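(* Let $M^7=S^1\times X^6$, where $X^6$ is a compact complex threefold admitting a holomorphic volume form $\Omega$ and a hermitian metric $\omega_0$ such that $d(|\Omega|_{\omega_0}\,\omega_0^2)=0$. Let $\omega_t$ be a solution, with initial data $\omega_0$, of the $\alpha'=0$ anomaly flow of hermitian metrics $\partial_t(|\Omega|_{\omega_t}\,\omega_t^2)=4i\,\partial\bar\partial\omega_t$. Let $$\psi=-dr\wedge\frac{1}{|\Omega|_{\omega_t}}\operatorname{Im}\Omega-\frac12\omega_t^2,$$ where $r$ denotes the angle coordinate on $S^1$. Then, for an arbitrary constant $C\in\mathbb{R}$, the evolving family of $G_2$-structures $(M^7,\psi)$ solves $$\partial_t(e^{-2f}\psi)=d\big(e^{2f}d^*(e^{-2f}\psi)\big)+(C-2)\,d\big((\operatorname{tr}T)\varphi\big),\qquad d(e^{-2f}\psi)=0,$$ where $e^{4f}=\mathrm{vol}_\psi/\mathrm{vol}_R$ with fixed reference volume form $\mathrm{vol}_R=\frac{1}{2\sqrt2}\,dr\wedge(i\,\Omega\wedge\bar\Omega)$.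
   Context: Hermitian metrics are identified with their fundamental $(1,1)$-forms $\omega$, and the norm $|\Omega|_\omega$ is defined by $|\Omega|_\omega^2\,\frac{\omega^3}{3!}=i\,\Omega\wedge\bar\Omega$. A $G_2$-structure on an oriented $7$-manifold is a $3$-form $\varphi$ determining a metric $g_\varphi$ and volume form $\mathrm{vol}_\varphi$ by $(X\lrcorner\varphi)\wedge(Y\lrcorner\varphi)\wedge\varphi=-6\,g_\varphi(X,Y)\,\mathrm{vol}_\varphi$; its dual $4$-form is $\psi=\star_\varphi\varphi$, and, given the orientation, $\psi$ determines $\varphi$, $g_\varphi$ and $\mathrm{vol}_\psi:=\mathrm{vol}_\varphi$. Here $S^1\times X$ is oriented by $dr\wedge(i\,\Omega\wedge\bar\Omega)$, and the $3$-form corresponding to $\psi$ is $\varphi=2\sqrt2\operatorname{Re}\big(\tfrac{1}{|\Omega|_\omega}\Omega\big)-\tfrac{1}{2\sqrt2}\,dr\wedge\omega$. $d^*$ is the formal adjoint of $d$ with respect to $g_\varphi$. The torsion of $\varphi$ is the $2$-tensor $T$ defined in a local orthonormal frame by $\nabla_m\varphi_{ijk}=T_{mp}\psi_{pijk}$ (Levi-Civita connection, repeated indices summed), and $\operatorname{tr}T=T_{pp}$. *)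

(* Defs.v *)
From HB Require Import structures.
From mathcomp Require Import all_boot all_order all_algebra all_fingroup.
From mathcomp Require Import all_classical all_reals all_analysis.
From mathcomp Require Import complex.

Set Implicit Arguments.
Unset Strict Implicit.
Unset Printing Implicit Defensive.

Import Order.TTheory GRing.Theory Num.Theory.
Import numFieldNormedType.Exports.

Local Open Scope classical_set_scope.
Local Open Scope ring_scope.
Local Open Scope complex_scope.

(* Manifolds are given by atlases, and a tensor field is the family of its    *)
(* local expressions in the charts; local identities are required at every    *)
(* point of the image of every chart.  Values outside that image are          *)
(* irrelevant.                                                                *)

(** * Smooth functions on R^n *)

Section Smooth.
Context {R : realType} {n : nat}.

Definition pderiv (i : 'I_n) (f : 'rV[R]_n -> R) (x : 'rV[R]_n) : R :=
  'D_(delta_mx 0 i) f x.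

Fixpoint Ck (k : nat) (U : set 'rV[R]_n) (f : 'rV[R]_n -> R) : Prop :=
  if k is l.+1 then
    (forall x, U x -> differentiable f x) /\ (forall i, Ck l U (pderiv i f))
  else forall x, U x -> {for x, continuous f}.

(* On a set that need not be open, smooth means locally the restriction of a  *)
(* smooth function defined on an open set.                                    *)
Definition smooth_on (A : set 'rV[R]_n) (f : 'rV[R]_n -> R) : Prop :=
  forall x, A x -> exists (U : set 'rV[R]_n) (F : 'rV[R]_n -> R),
    [/\ open U, U x, forall k, Ck k U F & forall y, U y -> A y -> F y = f y].

Definition pderivC (i : 'I_n) (f : 'rV[R]_n -> R[i]) (x : 'rV[R]_n) : R[i] :=
  pderiv i (fun y => complex.Re (f y)) x
    +i* pderiv i (fun y => complex.Im (f y)) x.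

End Smooth.

(** * Alternating tensors on R^n *)

(* A k-covector is given by its components a I = a(e_(I 0), ..., e_(I (k-1))). *)
Definition covec (K : Type) (n k : nat) := {ffun 'I_k -> 'I_n} -> K.

Definition fcons n k (a : 'I_n) (I : {ffun 'I_k -> 'I_n}) :
    {ffun 'I_k.+1 -> 'I_n} :=
  [ffun b => if unlift ord0 b is Some c then I c else a].

Definition fid n : {ffun 'I_n -> 'I_n} := [ffun i => i].

Section Covectors.
Context {K : fieldType} {n : nat}.

Definition is_alternating k (a : covec K n k) : Prop :=
  forall (s : 'S_k) (I : {ffun 'I_k -> 'I_n}),
    a [ffun b => I (s b)] = (-1) ^+ s * a I.

(* Normalised so that (dx^1 /\ dx^2)(e_1, e_2) = 1.                           *)
Definition wedge p q (a : covec K n p) (b : covec K n q) : covec K n (p + q) :=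
  fun I => ((p`! * q`!)%N%:R)^-1 * \sum_(s : 'S_(p + q))
    (-1) ^+ s * a [ffun c => I (s (lshift q c))]
              * b [ffun c => I (s (rshift p c))].

Definition interior_product k (u : 'rV[K]_n) (a : covec K n k.+1) :
    covec K n k :=
  fun I => \sum_(c < n) u 0 c * a (fcons c I).

End Covectors.

Section Metric_algebra.
Context {R : realType} {n : nat}.

(* Volume covector of the metric g, for the orientation in which the top      *)
(* covector o is positive; the determinant is the Levi-Civita symbol.         *)
Definition volcov (g : 'M[R]_n) (o : covec R n n) : covec R n n :=
  fun I => Num.sg (o (fid n)) * Num.sqrt (\det g)
           * \det (\matrix_(a < n, b < n) ((I a == b)%:R : R)).

Definition inner k (g : 'M[R]_n) (a b : covec R n k) : R :=
  (k`!%:R)^-1 * \sum_(I : {ffun 'I_k -> 'I_n}) \sum_(J : {ffun 'I_k -> 'I_n})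
    a I * b J * \prod_(c < k) invmx g (I c) (J c).

(* So that a /\ *b = <a, b> vol.                                              *)
Definition hodge p q (g : 'M[R]_n) (vol : covec R n (p + q)) (a : covec R n p) :
    covec R n q :=
  fun J => (p`!%:R)^-1 *
    \sum_(I : {ffun 'I_p -> 'I_n}) \sum_(I' : {ffun 'I_p -> 'I_n})
      a I * (\prod_(c < p) invmx g (I c) (I' c))
      * vol [ffun c => match fintype.split c with
                       | inl c1 => I' c1 | inr c2 => J c2 end].

End Metric_algebra.

(** * Differential calculus in a chart *)

Section Local_calculus.
Context {R : realType}.

Definition extd n k (a : 'rV[R]_n -> covec R n k) :
    'rV[R]_n -> covec R n k.+1 :=
  fun x I => \sum_(j < k.+1) (-1) ^+ j *
    pderiv (I j) (fun y => a y [ffun c => I (lift j c)]) x.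

Definition pullback m n k (F : 'rV[R]_m -> 'rV[R]_n)
    (a : 'rV[R]_n -> covec R n k) : 'rV[R]_m -> covec R m k :=
  fun x I => \sum_(J : {ffun 'I_k -> 'I_n})
    a (F x) J * \prod_(c < k) (jacobian F x) (I c) (J c).

(* Gamma^l_(ij)                                                               *)
Definition christoffel n (g : 'rV[R]_n -> 'M[R]_n) (x : 'rV[R]_n)
    (l i j : 'I_n) : R :=
  2^-1 * \sum_(s < n) invmx (g x) l s *
    (pderiv i (fun y => g y j s) x + pderiv j (fun y => g y i s) x
     - pderiv s (fun y => g y i j) x).

(* Components (nabla_m a)_I of the Levi-Civita covariant derivative.          *)
Definition nabla n k (g : 'rV[R]_n -> 'M[R]_n) (a : 'rV[R]_n -> covec R n k)
    (x : 'rV[R]_n) (m : 'I_n) : covec R n k :=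
  fun I => pderiv m (fun y => a y I) x
    - \sum_(b < k) \sum_(l < n) christoffel g x l m (I b)
        * a x [ffun c => if c == b then l else I c].

(* On R^(n+n) = C^n the complex coordinates are z_j = x_j + i x_(n+j).        *)
Definition dz n (j : 'I_n) : covec R[i] (n + n) 1 :=
  fun I => if I ord0 == lshift n j then 1
           else if I ord0 == rshift n j then 0 +i* 1 else 0.

Definition dzbar n (j : 'I_n) : covec R[i] (n + n) 1 := fun I => (dz j I)^*.

Definition dbyz n (j : 'I_n) (h : 'rV[R]_(n + n) -> R[i]) x : R[i] :=
  (pderivC (lshift n j) h x - (0 +i* 1) * pderivC (rshift n j) h x) / 2.

Definition dbyzbar n (j : 'I_n) (h : 'rV[R]_(n + n) -> R[i]) x : R[i] :=
  (pderivC (lshift n j) h x + (0 +i* 1) * pderivC (rshift n j) h x) / 2.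

(* The coframe dx^a has constant coefficients in the coframe dz^j, dzbar^j,   *)
(* so del a = sum_j dz^j /\ (d a / d z_j) holds componentwise in either.      *)
Definition ldel n k (a : 'rV[R]_(n + n) -> covec R[i] (n + n) k) :
    'rV[R]_(n + n) -> covec R[i] (n + n) (1 + k) :=
  fun x I => \sum_(j < n)
    wedge (dz j) (fun L => dbyz j (fun y => a y L) x) I.

Definition ldelbar n k (a : 'rV[R]_(n + n) -> covec R[i] (n + n) k) :
    'rV[R]_(n + n) -> covec R[i] (n + n) (1 + k) :=
  fun x I => \sum_(j < n)
    wedge (dzbar j) (fun L => dbyzbar j (fun y => a y L) x) I.

(* Multiplication by i on C^n.                                                *)
Definition Jmul n (u : 'rV[R]_(n + n)) : 'rV[R]_(n + n) :=
  row_mx (- rsubmx u) (lsubmx u).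

(* Integral over R^n of a compactly supported smooth function.                *)
Fixpoint integral_Rn n : ('rV[R]_n -> R) -> R :=
  match n return ('rV[R]_n -> R) -> R with
  | 0 => fun h => h 0
  | m.+1 => fun h => Rintegral lebesgue_measure setT (fun s : R =>
      integral_Rn (fun v : 'rV[R]_m => h (row_mx (const_mx s : 'rV_1) v)))
  end.

End Local_calculus.

(** * Manifolds *)

Record atlas (R : realType) (n : nat) := Atlas {
  carrier :> topologicalType;
  chart : Type;
  chart_dom : chart -> set carrier;
  chart_map : chart -> carrier -> 'rV[R]_n;
  (* inverse of chart_map on its image *)
  chart_inv : chart -> 'rV[R]_n -> carrier
}.

Section Manifold.
Context {R : realType} {n : nat} (M : atlas R n).

Definition chart_img (i : chart M) : set 'rV[R]_n := chart_map i @` chart_dom i.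
Definition overlap (i j : chart M) : set 'rV[R]_n :=
  chart_map i @` (chart_dom i `&` chart_dom j).
Definition transition (i j : chart M) (x : 'rV[R]_n) : 'rV[R]_n :=
  chart_map j (chart_inv i x).

(* Second countability is not listed: it follows from compactness, which the  *)
(* manifolds considered here satisfy.                                         *)
Record smooth_manifold : Prop := {
  sm_hausdorff : hausdorff_space M;
  sm_cover : forall p : M, exists i : chart M, chart_dom i p;
  sm_dom_open : forall i : chart M, open (chart_dom i);
  sm_img_open : forall i : chart M, open (chart_img i);
  sm_cancel : forall (i : chart M) p, chart_dom i p ->
    chart_inv i (chart_map i p) = p;
  sm_coord_continuous :
    forall (i : chart M) p, chart_dom i p -> {for p, continuous (chart_map i)};
  sm_param_continuous :
    forall (i : chart M) x, chart_img i x -> {for x, continuous (chart_inv i)};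
  sm_transition : forall (i j : chart M) (l : 'I_n),
    smooth_on (overlap i j) (fun x => transition i j x 0 l)
}.

Definition diff_form (K : Type) (k : nat) := chart M -> 'rV[R]_n -> covec K n k.
Definition scalar_field := chart M -> 'rV[R]_n -> R.
Definition tensor2 := chart M -> 'rV[R]_n -> 'M[R]_n.

Definition form_eq (K : Type) k (a b : diff_form K k) : Prop :=
  forall i x, chart_img i x -> forall I, a i x I = b i x I.

Definition is_form k (a : diff_form R k) : Prop :=
  [/\ forall i x, chart_img i x -> is_alternating (a i x),
      forall i I, smooth_on (chart_img i) (fun x => a i x I)
    & forall i j x, overlap i j x -> forall I,
        a i x I = pullback (transition i j) (a j) x I].

Definition complexify k (a : diff_form R k) : diff_form R[i] k :=
  fun i x I => (a i x I)%:C.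
Definition formRe k (a : diff_form R[i] k) : diff_form R k :=
  fun i x I => complex.Re (a i x I).
Definition formIm k (a : diff_form R[i] k) : diff_form R k :=
  fun i x I => complex.Im (a i x I).
Definition formconj k (a : diff_form R[i] k) : diff_form R[i] k :=
  fun i x I => (a i x I)^*.

Definition is_formC k (a : diff_form R[i] k) : Prop :=
  is_form (formRe a) /\ is_form (formIm a).

Definition zero_form k : diff_form R k := fun _ _ _ => 0.
Definition fadd (K : fieldType) k (a b : diff_form K k) : diff_form K k :=
  fun i x I => a i x I + b i x I.
Definition fscale (K : fieldType) k (c : K) (a : diff_form K k) :
    diff_form K k :=
  fun i x I => c * a i x I.
Definition fmul k (h : scalar_field) (a : diff_form R k) : diff_form R k :=
  fun i x I => h i x * a i x I.
Definition fwedge (K : fieldType) p q (a : diff_form K p) (b : diff_form K q) :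
    diff_form K (p + q) := fun i x => wedge (a i x) (b i x).
Definition extder k (a : diff_form R k) : diff_form R k.+1 :=
  fun i => extd (a i).

(* Ratio a / b of two top-degree forms, b nowhere zero.                       *)
Definition top_ratio (a b : diff_form R n) : scalar_field :=
  fun i x => a i x (fid n) / b i x (fid n).

Definition riemannian_metric (g : tensor2) : Prop :=
  [/\ forall i x, chart_img i x -> (g i x)^T = g i x,
      forall i x, chart_img i x -> forall u : 'rV[R]_n, u != 0 ->
        0 < (u *m g i x *m u^T) 0 0,
      forall i a b, smooth_on (chart_img i) (fun x => g i x a b)
    & forall i j x, overlap i j x ->
        let A := jacobian (transition i j) x in
        g i x = A *m g j (transition i j x) *m A^T].

Definition vol_form (g : tensor2) (o : diff_form R n) : diff_form R n :=
  fun i x => volcov (g i x) (o i x).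

(* delta = d^* b for the formal adjoint d^* of d: k-forms -> (k+1)-forms with *)
(* respect to g; by partitions of unity the test forms may be taken with      *)
(* compact support in the domain of a chart.                                  *)
Definition is_codiff (g : tensor2) k (b : diff_form R k.+1)
    (delta : diff_form R k) : Prop :=
  is_form delta /\
  forall (i : chart M) (a : 'rV[R]_n -> covec R n k),
    (forall x, is_alternating (a x)) ->
    (forall I, smooth_on setT (fun x => a x I)) ->
    (exists S : set 'rV[R]_n, [/\ compact S, S `<=` chart_img i
      & forall x, ~ S x -> forall I, a x I = 0]) ->
    integral_Rn (fun x =>
      inner (g i x) (extd a x) (b i x) * Num.sqrt (\det (g i x)))
    = integral_Rn (fun x =>
      inner (g i x) (a x) (delta i x) * Num.sqrt (\det (g i x))).

Definition has_dt k (J : set R) (a : R -> diff_form R k) (t : R)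
    (b : diff_form R k) : Prop :=
  forall i x, chart_img i x -> forall I,
    (fun s : R => (s - t)^-1 * (a s i x I - a t i x I)) @ within J t^'
      --> b i x I.

(* The family (a t), t in J, is smooth jointly in t and in the point.         *)
Definition smooth_family k (J : set R) (a : R -> diff_form R k) : Prop :=
  forall i I, smooth_on
    [set v : 'rV[R]_(1 + n) | J (lsubmx v 0 0) /\ chart_img i (rsubmx v)]
    (fun v => a (lsubmx v 0 0) i (rsubmx v) I).

End Manifold.

Arguments zero_form {R n M k}.

Notation "a '\wedge' b" := (fwedge a b)
  (at level 40, left associativity) : ring_scope.

(** * Complex manifolds *)

Section Complex.
Context {R : realType} {n : nat} (X : atlas R (n + n)).

(* A holomorphic transition map is a smooth one with complex-linear           *)
(* differential.                                                              *)
Definition complex_manifold : Prop :=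
  smooth_manifold X /\
  forall (i j : chart X) x, overlap i j x -> forall u : 'rV[R]_(n + n),
    Jmul u *m jacobian (transition i j) x
    = Jmul (u *m jacobian (transition i j) x).

Definition del k (a : diff_form X R[i] k) : diff_form X R[i] (1 + k) :=
  fun i => ldel (a i).
Definition delbar k (a : diff_form X R[i] k) : diff_form X R[i] (1 + k) :=
  fun i => ldelbar (a i).

Definition eval2 (a : covec R (n + n) 2) (u v : 'rV[R]_(n + n)) : R :=
  interior_product v (interior_product u a) (ffun0 (card_ord 0)).

(* Fundamental forms of hermitian metrics: real positive (1,1)-forms.         *)
Definition hermitian_metric (w : diff_form X R 2) : Prop :=
  [/\ is_form w,
      forall i x, chart_img i x -> forall u v,
        eval2 (w i x) (Jmul u) (Jmul v) = eval2 (w i x) u v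
    & forall i x, chart_img i x -> forall u, u != 0 ->
        0 < eval2 (w i x) u (Jmul u)].

End Complex.

Section Threefold.
Context {R : realType} (X : atlas R (3 + 3)).

Definition dz123 : covec R[i] (3 + 3) 3 :=
  wedge (wedge (dz (inord 0 : 'I_3)) (dz (inord 1 : 'I_3)))
        (dz (inord 2 : 'I_3)).

Definition holomorphic_volume_form (Omega : diff_form X R[i] 3) : Prop :=
  is_formC Omega /\
  forall i : chart X, exists h : 'rV[R]_(3 + 3) -> R[i],
    [/\ smooth_on (chart_img i) (fun x => complex.Re (h x)),
        smooth_on (chart_img i) (fun x => complex.Im (h x)),
        forall x, chart_img i x -> forall j : 'I_3, dbyzbar j h x = 0,
        forall x, chart_img i x -> h x != 0
      & forall x, chart_img i x -> forall I, Omega i x I = h x * dz123 I].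

(* The real form i Omega /\ conj Omega.                                       *)
Definition iOmegabar (Omega : diff_form X R[i] 3) : diff_form X R (3 + 3) :=
  formRe (fscale (0 +i* 1) (Omega \wedge formconj Omega)).

(* |Omega|_w, defined by |Omega|_w^2 w^3 / 3! = i Omega /\ conj Omega.        *)
Definition norm_form (Omega : diff_form X R[i] 3) (w : diff_form X R 2) :
    scalar_field X :=
  fun i x => Num.sqrt
    (top_ratio (iOmegabar Omega)
       (fscale (3`!%:R^-1) (w \wedge w \wedge w)) i x).

(* w is a solution of d/dt (|Omega|_w w^2) = 4 i del delbar w.                *)
Definition anomaly_flow (J : set R) (Omega : diff_form X R[i] 3)
    (w : R -> diff_form X R 2) : Prop :=
  forall t, J t -> exists b : diff_form X R (2 + 2),
    has_dt J (fun s => fmul (norm_form Omega (w s)) (w s \wedge w s)) t b /\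
    form_eq (complexify b) (fscale (0 +i* 4) (del (delbar (complexify (w t))))).

End Threefold.

(** * The circle and products *)

Section Circle.
Variable R : realType.

Definition circle_pt : Type := {p : R * R | p.1 ^+ 2 + p.2 ^+ 2 == 1}.
Definition circle_top : topologicalType :=
  initial_topology (fun p : circle_pt => \val p : R * R).

Lemma cis_subproof (r : R) : (cos r, sin r).1 ^+ 2 + (cos r, sin r).2 ^+ 2 == 1.
Proof. by rewrite /= cos2Dsin2. Qed.

Definition cis (r : R) : circle_top := exist _ (cos r, sin r) (cis_subproof r).

(* The chart indexed by a is the angle coordinate with values in              *)
(* ]a - pi, a + pi[, defined outside the point of angle a + pi.               *)
Definition circle : atlas R 1 :=
  @Atlas R 1 circle_top R
    (fun a => [set p | p <> cis (a + pi)])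
    (fun a p => get [set r : 'rV[R]_1 |
       [/\ a - pi < r 0 0, r 0 0 < a + pi & cis (r 0 0) = p]])
    (fun a r => cis (r 0 0)).

(* dr, for the angle coordinate r                                             *)
Definition dr_circle : diff_form circle R 1 := fun _ _ _ => 1.

End Circle.

Section Product.
Context {R : realType} {m n : nat}.

Definition prod_atlas (A : atlas R m) (B : atlas R n) : atlas R (m + n) :=
  @Atlas R (m + n) (A * B)%type (chart A * chart B)%type
    (fun c => chart_dom c.1 `*` chart_dom c.2)
    (fun c p => row_mx (chart_map c.1 p.1) (chart_map c.2 p.2))
    (fun c x => (chart_inv c.1 (lsubmx x), chart_inv c.2 (rsubmx x))).

Variables (A : atlas R m) (B : atlas R n).

(* Pullbacks by the two projections of the product.                           *)
Definition pr1_form k (a : diff_form A R k) : diff_form (prod_atlas A B) R k :=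
  fun c => pullback (@lsubmx R 1 m n) (a c.1).
Definition pr2_form k (a : diff_form B R k) : diff_form (prod_atlas A B) R k :=
  fun c => pullback (@rsubmx R 1 m n) (a c.2).

End Product.

(** * G2-structures *)

Section G2.
Context {R : realType} (M : atlas R 7).

(* phi is a G2-structure on M, oriented by o, with metric g and dual          *)
(* 4-form psi.                                                                *)
Definition G2_structure (o : diff_form M R 7) (phi : diff_form M R 3)
    (g : tensor2 M) (psi : diff_form M R 4) : Prop :=
  [/\ is_form phi, riemannian_metric g,
      forall i x, chart_img i x -> forall (u v : 'rV[R]_7) I,
        wedge (wedge (interior_product u (phi i x))
                     (interior_product v (phi i x))) (phi i x) I
        = - 6 * (u *m g i x *m v^T) 0 0 * vol_form g o i x I
    & form_eq psi
        (fun i x => @hodge R 7 3 4 (g i x) (vol_form g o i x) (phi i x))].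

(* nabla_m phi_ijk = T_mp psi_pijk, the index p being raised with the inverse *)
(* metric since coordinate frames need not be orthonormal.                    *)
Definition is_torsion (g : tensor2 M) (phi : diff_form M R 3)
    (psi : diff_form M R 4) (T : tensor2 M) : Prop :=
  forall i x, chart_img i x -> forall (m : 'I_7) I,
    nabla (g i) (phi i) x m I
    = \sum_(p < 7) \sum_(q < 7)
        T i x m p * invmx (g i x) p q * psi i x (fcons q I).

Definition trace_g (g T : tensor2 M) : scalar_field M :=
  fun i x => \sum_(p < 7) \sum_(q < 7) invmx (g i x) p q * T i x p q.

End G2.

Section Ansatz.
Context {R : realType} (X : atlas R (3 + 3)).

Definition S1_times : atlas R (1 + (3 + 3)) := prod_atlas (circle R) X.

Definition dr : diff_form S1_times R 1 := pr1_form (B := X) (@dr_circle R).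

(* dr /\ (i Omega /\ conj Omega)                                              *)
Definition orientation (Omega : diff_form X R[i] 3) : diff_form S1_times R 7 :=
  dr \wedge pr2_form (A := circle R) (iOmegabar Omega).

Definition vol_R (Omega : diff_form X R[i] 3) : diff_form S1_times R 7 :=
  fscale (2 * Num.sqrt 2)^-1 (orientation Omega).

Definition inv_norm (Omega : diff_form X R[i] 3) (w : diff_form X R 2) :
    scalar_field X :=
  fun i x => (norm_form Omega w i x)^-1.

Definition G2_psi (Omega : diff_form X R[i] 3) (w : diff_form X R 2) :
    diff_form S1_times R 4 :=
  fadd (fscale (-1)
         (dr \wedge
            pr2_form (A := circle R) (fmul (inv_norm Omega w) (formIm Omega))))
       (fscale (- 2^-1) (pr2_form (A := circle R) (w \wedge w))).

Definition G2_phi (Omega : diff_form X R[i] 3) (w : diff_form X R 2) :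
    diff_form S1_times R 3 :=
  fadd (fscale (2 * Num.sqrt 2)
         (pr2_form (A := circle R) (fmul (inv_norm Omega w) (formRe Omega))))
       (fscale (- (2 * Num.sqrt 2)^-1) (dr \wedge pr2_form (A := circle R) w)).

(* f with e^(4f) = vol_psi / vol_R                                            *)
Definition conf_factor (Omega : diff_form X R[i] 3) (g : tensor2 S1_times) :
    scalar_field S1_times :=
  fun i x =>
    ln (top_ratio (vol_form g (orientation Omega)) (vol_R Omega) i x) / 4.

Definition exp_mul k (c : R) (f : scalar_field S1_times)
    (a : diff_form S1_times R k) : diff_form S1_times R k :=
  fmul (fun i x => expR (c * f i x)) a.

End Ansatz.

(* Main.v *)
Require Import Defs.
From HB Require Import structures.
From mathcomp Require Import all_boot all_order all_algebra all_fingroup.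
From mathcomp Require Import all_classical all_reals all_analysis.
From mathcomp Require Import complex ring lra zify.

Set Implicit Arguments.
Unset Strict Implicit.
Unset Printing Implicit Defensive.

Import Order.TTheory GRing.Theory Num.Theory.
Import numFieldNormedType.Exports.

Local Open Scope classical_set_scope.
Local Open Scope ring_scope.

(** Write N for |Omega|_w. At every point of X there is a complex linear frame
    in which w is the standard hermitian form of C^3 and Omega is a positive
    multiple of dz^0 /\ dz^1 /\ dz^2 (su3_frame): a unitary frame is found by
    Gram-Schmidt, and rotating one of its vectors corrects the phase of Omega.
    Completing this frame by 2 sqrt 2 times the circle direction turns phi,
    psi, the metric dr^2 / 8 + g_w and the orientation into constant model
    tensors on R^7. All pointwise assertions thereby become identities between
    forms with integer coefficients, which are decided by evaluation: the G2
    identity (phi0_G2), psi = * phi (hodge_phi0), and the values of the star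
    and inner product that follow.

    The volume of the metric gives e^(4 f) = N^-2, hence e^(-2 f) psi = - dr /\
    Im Omega - N w^2 / 2 (exp_psiE). Since Im Omega is closed, this form is
    closed exactly when w is balanced, d (N w^2) = 0. It is also the star of N
    phi, so its codifferential is * d (N phi) by integration by parts
    (integral_by_parts). As Re Omega is closed, d (N phi) is a multiple of dr
    /\ d (N w), and for balanced w the star of the latter is N J dw
    (hodge_balanced, star_dPhi). Therefore e^(2 f) d^*(e^(-2 f) psi) = J dw,
    which is i (del - delbar) w because w is of type (1,1).

    The exterior derivative of i (del - delbar) w is -2 i del delbar w. The
    flow gives the time derivative 4 i del delbar w for N w^2, hence -2 i del
    delbar w for e^(-2 f) psi, in which only - N w^2 / 2 varies (ddbar,
    flow_psi, extd_dual). The balanced condition holds at all times because the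
    time derivative of N w^2 is exact (flow_balanced).

    The term with the constant C vanishes: 4 tr T is the inner product of d phi
    with psi (trace_at), since the Levi-Civita connection is torsion free, and
    d phi is a combination of dr /\ dw and d(1/N) /\ Re Omega. The product of
    the first with psi is that of dw with Im Omega, which vanishes because dw
    /\ Re Omega = 0 by types; the second has type (3,1) + (1,3) and is
    orthogonal to w^2 (dphi_psi). *)

(** * Multi-indices, alternating tensors and the exterior product *)

Section Indices.
Context {n : nat}.

(** Insertion of a at position j; fcons is the case j = 0. *)
Definition fins k (j : 'I_k.+1) (a : 'I_n) (I : {ffun 'I_k -> 'I_n}) :
    {ffun 'I_k.+1 -> 'I_n} :=
  [ffun b => if unlift j b is Some c then I c else a].

Definition fcat p q (I : {ffun 'I_p -> 'I_n}) (J : {ffun 'I_q -> 'I_n}) :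
    {ffun 'I_(p + q) -> 'I_n} :=
  [ffun c => match fintype.split c with inl c1 => I c1 | inr c2 => J c2 end].

Lemma fins_at k (j : 'I_k.+1) a I : fins j a I j = a.
Proof. by rewrite ffunE unlift_none. Qed.

Lemma fins_lift k (j : 'I_k.+1) a I c : fins j a I (lift j c) = I c.
Proof. by rewrite ffunE liftK. Qed.

Lemma del_fins k (j : 'I_k.+1) a I : [ffun c => fins j a I (lift j c)] = I.
Proof. by apply/ffunP => c; rewrite ffunE fins_lift. Qed.

Lemma fins_del k (j : 'I_k.+1) (I : {ffun 'I_k.+1 -> 'I_n}) :
  fins j (I j) [ffun c => I (lift j c)] = I.
Proof. by apply/ffunP => b; rewrite ffunE; case: unliftP => [c|] ->; rewrite ?ffunE. Qed.

Lemma fcons_at k a (I : {ffun 'I_k -> 'I_n}) : fcons a I ord0 = a.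
Proof. exact: fins_at. Qed.

Lemma fcons_lift k a (I : {ffun 'I_k -> 'I_n}) c : fcons a I (lift ord0 c) = I c.
Proof. exact: fins_lift. Qed.

Lemma fcat_l p q (I : {ffun 'I_p -> 'I_n}) (J : {ffun 'I_q -> 'I_n}) c :
  fcat I J (lshift q c) = I c.
Proof. by rewrite ffunE; case: split_ordP => d /eqP; rewrite ?eq_lshift ?eq_lrshift // => /eqP->. Qed.

Lemma fcat_r p q (I : {ffun 'I_p -> 'I_n}) (J : {ffun 'I_q -> 'I_n}) c :
  fcat I J (rshift p c) = J c.
Proof. by rewrite ffunE; case: split_ordP => d /eqP; rewrite ?eq_rshift ?eq_rlshift // => /eqP->. Qed.

Lemma sum_fins (V : nmodType) k (j : 'I_k.+1) (F : {ffun 'I_k.+1 -> 'I_n} -> V) :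
  \sum_I F I = \sum_a \sum_K F (fins j a K).
Proof.
rewrite pair_bigA /= (reindex (fun p => fins j p.1 p.2)) //=.
exists (fun I => (I j, [ffun c => I (lift j c)])) => [[a K] _ | I _] /=.
  by rewrite fins_at del_fins.
exact: fins_del.
Qed.

Lemma sum_fcat (V : nmodType) p q (F : {ffun 'I_(p + q) -> 'I_n} -> V) :
  \sum_I F I = \sum_I1 \sum_I2 F (fcat I1 I2).
Proof.
rewrite pair_bigA /= (reindex (fun u => fcat u.1 u.2)) //=.
exists (fun I => ([ffun c => I (lshift q c)], [ffun c => I (rshift p c)])).
  by case=> [a b] _ /=; congr pair; apply/ffunP => c; rewrite ffunE ?fcat_l ?fcat_r.
move=> I _ /=; apply/ffunP => c; rewrite ffunE.
by case: split_ordP => d ->; rewrite ffunE.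
Qed.

End Indices.

(** A permutation of k + 1 indices is its value at 0 together with the induced
    bijection of the remaining ones. *)
Lemma sum_perm_lift (V : nmodType) k (F : 'S_k.+1 -> V) :
  \sum_s F s = \sum_j \sum_(s : 'S_k) F (lift_perm ord0 j s).
Proof.
rewrite pair_bigA /= (reindex (fun p => lift_perm ord0 p.1 p.2)) //=.
apply: onW_bij; apply: inj_card_bij => [[i s] [j t] /= e|]; last first.
  by rewrite card_prod !card_ord !card_Sn.
have eij : i = j by move/permP/(_ ord0): e; rewrite !lift_perm_id.
rewrite -eij in e *; congr pair; apply/permP => c.
by move/permP/(_ (lift ord0 c)): e; rewrite !lift_perm_lift => /lift_inj.
Qed.

Section Covec.
Context {K : numFieldType} {n : nat}.
Implicit Types (k p q : nat).

Lemma covecP k (a b : covec K n k) : (forall I, a I = b I) -> a = b.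
Proof. exact: funext. Qed.

Lemma covecD k (a b : covec K n k) I : (a + b) I = a I + b I. Proof. by []. Qed.
Lemma covecN k (a : covec K n k) I : (- a) I = - a I. Proof. by []. Qed.
Lemma covecZ k c (a : covec K n k) I : (c *: a) I = c * a I. Proof. by []. Qed.
Lemma covec_sum (T : Type) (s : seq T) (P : pred T) k (F : T -> covec K n k) I :
  (\sum_(t <- s | P t) F t) I = \sum_(t <- s | P t) F t I.
Proof. by rewrite fct_sumE. Qed.

(** The shuffle expansion of the product of a one-form with b: k + 1 terms
    instead of a sum over all permutations. *)
Definition wedge1 k (alpha : 'I_n -> K) (b : covec K n k) : covec K n k.+1 :=
  fun I => \sum_(j < k.+1) (-1) ^+ j * alpha (I j) * b [ffun c => I (lift j c)].

Lemma signr_odd_perm k (s : 'S_k) : ((-1) ^+ s : K) * (-1) ^+ s = 1.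
Proof. by rewrite -signr_addb addbb. Qed.

Lemma sign_lift_perm k (j : 'I_k.+1) (s : 'S_k) :
  (-1) ^+ lift_perm ord0 j s = (-1) ^+ j * (-1) ^+ s :> K.
Proof. by rewrite odd_lift_perm /= signr_addb signr_odd. Qed.

Lemma alt_wedge p q (a : covec K n p) (b : covec K n q) :
  is_alternating (wedge a b).
Proof.
move=> s I; rewrite /wedge mulrCA; congr (_ * _).
rewrite big_distrr /= (reindex_inj (mulIg s^-1%g)) /=; apply: eq_bigr => t _.
rewrite odd_permM odd_permV signr_addb; rewrite -!mulrA; rewrite mulrCA.
congr (_ * (_ * (_ * _))); congr (_ _); apply/ffunP => c; by rewrite !ffunE !permE /= permKV.
Qed.

(** Antisymmetrising over the indices of the first factor before
    antisymmetrising over all of them changes nothing: splitting off the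
    position occupied by alpha reduces both sides to the same sum over
    permutations of p + q + 1 indices. *)
Lemma wedge_wedge1 p q alpha (b : covec K n p) (c : covec K n q) :
  wedge (wedge1 alpha b) c = wedge1 alpha (wedge b c).
Proof.
apply: covecP => I; rewrite /wedge /wedge1.
pose T (L : {ffun 'I_(p + q).+1 -> 'I_n}) := alpha (L ord0) *
  b [ffun c => L (lift ord0 (lshift q c))] * c [ffun c => L (lift ord0 (rshift p c))].
transitivity ((p`! * q`!)%:R^-1 *
  \sum_(s : 'S_(p + q).+1) (-1) ^+ s * T [ffun x => I (s x)]); last first.
  rewrite sum_perm_lift big_distrr; apply: eq_bigr => j _.
  rewrite /= !big_distrr /=; apply: eq_bigr => s _.
  rewrite sign_lift_perm /T !ffunE lift_perm_id.
  have -> : [ffun c0 => [ffun x => I (lift_perm ord0 j s x)] (lift ord0 (lshift q c0))]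
     = [ffun c0 => [ffun c1 => I (lift j c1)] (s (lshift q c0))].
    by apply/ffunP => x; rewrite !ffunE lift_perm_lift.
  have -> : [ffun c0 => [ffun x => I (lift_perm ord0 j s x)] (lift ord0 (rshift p c0))]
     = [ffun c0 => [ffun c1 => I (lift j c1)] (s (rshift p c0))].
    by apply/ffunP => x; rewrite !ffunE lift_perm_lift.
  move: (b _) (c _) (alpha _) ((-1) ^+ j) ((-1) ^+ s) => B D A e1 e2; ring.
have -> : \sum_(s : 'S_(p.+1 + q)) (-1) ^+ s *
    (\sum_(j < p.+1) (-1) ^+ j *
      alpha ([ffun c0 => I (s (lshift q c0))] j) *
      b [ffun c0 => [ffun c1 => I (s (lshift q c1))] (lift j c0)]) *
    c [ffun c0 => I (s (rshift p.+1 c0))]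
  = \sum_(j < p.+1) \sum_(s : 'S_(p + q).+1) (-1) ^+ s * T [ffun x => I (s x)].
  under eq_bigr => s _ do rewrite big_distrr big_distrl /=.
  rewrite exchange_big /=; apply: eq_bigr => j _.
  pose u : 'S_(p + q).+1 := lift_perm ord0 (lshift q j : 'I_(p.+1 + q)) 1%g.
  rewrite [RHS](reindex_inj (mulgI u)) /=; apply: eq_bigr => s _.
  have -> : (-1) ^+ (u * s)%g = (-1) ^+ j * (-1) ^+ s :> K.
    by rewrite odd_permM signr_addb sign_lift_perm odd_perm1 mulr1.
  rewrite /T !ffunE permM lift_perm_id.
  have e1 (x : 'I_(p + q)) : (u * s)%g (lift ord0 x) = s (lift (lshift q j : 'I_(p + q).+1) x).
    by rewrite permM lift_perm_lift perm1.
  have -> : [ffun c0 => [ffun x => I ((u * s)%g x)] (lift ord0 (lshift q c0))]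
     = [ffun c0 => [ffun c1 => I (s (lshift q c1))] (lift j c0)].
    apply/ffunP => x; rewrite !ffunE e1; congr (I (s _)); by apply: val_inj.
  have -> : [ffun c0 => [ffun x => I ((u * s)%g x)] (lift ord0 (rshift p c0))]
     = [ffun c0 => I (s (rshift p.+1 c0))].
    apply/ffunP => x; rewrite !ffunE e1; congr (I (s _)); apply: val_inj => /=.
    by have := ltn_ord j; rewrite ltnS /bump => h; rewrite (leq_trans h (leq_addr _ _)).
  move: (b _) (c _) (alpha _) ((-1) ^+ j) ((-1) ^+ s) => B D A x1 x2; ring.
rewrite sumr_const card_ord -[X in _ * X]mulr_natl mulrA; congr (_ * _).
by rewrite factS -mulnA natrM invfM mulrAC mulVf ?mul1r ?pnatr_eq0.
Qed.
End Covec.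

Section Covec2.
Context {K : numFieldType} {n : nat}.
Implicit Types (k p q : nat).

Definition one0 : covec K n 0 := fun _ => 1.
Definition covec1 (alpha : 'I_n -> K) : covec K n 1 := fun I => alpha (I ord0).

Lemma alt_one0 : is_alternating one0.
Proof. by move=> s I; rewrite /one0 mulr1 (_ : s = 1%g) ?odd_perm1 //; apply/permP => -[]. Qed.

Lemma altD k (a b : covec K n k) :
  is_alternating a -> is_alternating b -> is_alternating (a + b).
Proof. by move=> ha hb s I; rewrite !covecD ha hb mulrDr. Qed.

Lemma altZ k c (a : covec K n k) : is_alternating a -> is_alternating (c *: a).
Proof. by move=> ha s I; rewrite !covecZ ha mulrCA. Qed.

Lemma alt_sum (T : Type) (s : seq T) (P : pred T) k (F : T -> covec K n k) :
  (forall t, P t -> is_alternating (F t)) -> is_alternating (\sum_(t <- s | P t) F t).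
Proof.
move=> h u I; rewrite !covec_sum big_distrr /=.
by apply: eq_bigr => t Pt; exact: h.
Qed.

Lemma wedge_one0 q (b : covec K n q) : is_alternating b -> wedge one0 b = b.
Proof.
move=> hb; apply: covecP => I; rewrite /wedge /one0 mul1n.
rewrite (eq_bigr (fun=> b I)) => [|s _].
  by rewrite sumr_const card_Sn -[X in _ * X]mulr_natl mulrA mulVf ?mul1r // pnatr_eq0 -lt0n fact_gt0.
rewrite mulr1 (_ : [ffun _ => _] = [ffun c => I (s c)]) ?hb; last first.
  by apply/ffunP => c; rewrite !ffunE; congr (I (s _)); exact: val_inj.
by rewrite mulrA signr_odd_perm mul1r.
Qed.

Lemma wedge1_one0 alpha : wedge1 alpha one0 = covec1 alpha.
Proof. by apply: covecP => I; rewrite /wedge1 big_ord1 /one0 mulr1 expr0 mul1r. Qed.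

Lemma wedge_covec1 k alpha (b : covec K n k) : is_alternating b ->
  wedge (covec1 alpha) b = wedge1 alpha b.
Proof. by move=> hb; rewrite -wedge1_one0 wedge_wedge1 wedge_one0. Qed.

Lemma alt_wedge1 k alpha (b : covec K n k) :
  is_alternating b -> is_alternating (wedge1 alpha b).
Proof. by move=> hb; rewrite -wedge_covec1 //; exact: (@alt_wedge _ _ 1 k). Qed.

Lemma wedge1_anti k alpha beta (c : covec K n k) : is_alternating c ->
  wedge1 alpha (wedge1 beta c) = - wedge1 beta (wedge1 alpha c).
Proof.
move=> hc; have E a b : wedge1 a (wedge1 b c) = wedge (wedge1 a (covec1 b)) c.
  by rewrite wedge_wedge1 wedge_covec1.
rewrite !E; apply: covecP => I; rewrite covecN /wedge -mulrN; congr (_ * _).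
rewrite -sumrN; apply: eq_bigr => s _; rewrite -mulNr -mulrN; congr (_ * _ * _).
rewrite /wedge1 !big_ord_recr !big_ord0 /= /covec1 !ffunE.
rewrite (_ : lift ord_max ord0 = widen_ord (leqnSn 1) ord_max :> 'I_2); last exact: val_inj.
rewrite (_ : lift (widen_ord (leqnSn 1) ord_max) ord0 = ord_max :> 'I_2); last exact: val_inj.
by ring.
Qed.

Lemma wedge1Dl k a a' (b : covec K n k) :
  wedge1 (a + a') b = wedge1 a b + wedge1 a' b.
Proof.
apply: covecP => I; rewrite covecD /wedge1 -big_split; apply: eq_bigr => j _ /=.
by rewrite mulrDr mulrDl.
Qed.

Lemma wedge1Zl k c a (b : covec K n k) : wedge1 (c *: a) b = c *: wedge1 a b.
Proof.
apply: covecP => I; rewrite covecZ /wedge1 big_distrr; apply: eq_bigr => j _ /=.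
by rewrite mulrCA !mulrA.
Qed.

Lemma wedge1_suml (T : Type) (s : seq T) (P : pred T) k (F : T -> 'I_n -> K)
    (b : covec K n k) :
  wedge1 (\sum_(t <- s | P t) F t) b = \sum_(t <- s | P t) wedge1 (F t) b.
Proof.
apply: covecP => I; rewrite covec_sum /wedge1 exchange_big; apply: eq_bigr => j _ /=.
by rewrite fct_sumE big_distrr big_distrl.
Qed.

Lemma wedge1Dr k a (b b' : covec K n k) :
  wedge1 a (b + b') = wedge1 a b + wedge1 a b'.
Proof.
apply: covecP => I; rewrite covecD /wedge1 -big_split; apply: eq_bigr => j _ /=.
by rewrite mulrDr.
Qed.

Lemma wedge1Zr k c a (b : covec K n k) : wedge1 a (c *: b) = c *: wedge1 a b.
Proof.
apply: covecP => I; rewrite covecZ /wedge1 big_distrr; apply: eq_bigr => j _ /=.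
by rewrite mulrCA.
Qed.

Lemma wedge1_sumr (T : Type) (s : seq T) (P : pred T) k a (F : T -> covec K n k) :
  wedge1 a (\sum_(t <- s | P t) F t) = \sum_(t <- s | P t) wedge1 a (F t).
Proof.
apply: covecP => I; rewrite covec_sum /wedge1 exchange_big; apply: eq_bigr => j _ /=.
by rewrite covec_sum big_distrr.
Qed.

Lemma wedgeDl p q (a a' : covec K n p) (b : covec K n q) :
  wedge (a + a') b = wedge a b + wedge a' b.
Proof.
apply: covecP => I; rewrite covecD /wedge -mulrDr -big_split; congr (_ * _).
by apply: eq_bigr => s _ /=; rewrite covecD mulrDr mulrDl.
Qed.

Lemma wedgeDr p q (a : covec K n p) (b b' : covec K n q) :
  wedge a (b + b') = wedge a b + wedge a b'.
Proof.
apply: covecP => I; rewrite covecD /wedge -mulrDr -big_split; congr (_ * _).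
by apply: eq_bigr => s _ /=; rewrite covecD mulrDr.
Qed.

Lemma wedgeZl p q c (a : covec K n p) (b : covec K n q) :
  wedge (c *: a) b = c *: wedge a b.
Proof.
apply: covecP => I; rewrite covecZ /wedge mulrCA; congr (_ * _).
by rewrite big_distrr; apply: eq_bigr => s _ /=; rewrite covecZ (mulrCA _ c) !mulrA.
Qed.

Lemma wedgeZr p q c (a : covec K n p) (b : covec K n q) :
  wedge a (c *: b) = c *: wedge a b.
Proof.
apply: covecP => I; rewrite covecZ /wedge mulrCA; congr (_ * _).
by rewrite big_distrr; apply: eq_bigr => s _ /=; rewrite covecZ (mulrCA _ c) !mulrA.
Qed.

Lemma wedge_suml (T : Type) (s : seq T) (P : pred T) p q (F : T -> covec K n p)
    (b : covec K n q) :
  wedge (\sum_(t <- s | P t) F t) b = \sum_(t <- s | P t) wedge (F t) b.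
Proof.
apply: covecP => I; rewrite covec_sum /wedge -big_distrr; congr (_ * _) => /=.
rewrite exchange_big; apply: eq_bigr => u _ /=.
by rewrite covec_sum big_distrr big_distrl.
Qed.

Lemma wedge_sumr (T : Type) (s : seq T) (P : pred T) p q (a : covec K n p)
    (F : T -> covec K n q) :
  wedge a (\sum_(t <- s | P t) F t) = \sum_(t <- s | P t) wedge a (F t).
Proof.
apply: covecP => I; rewrite covec_sum /wedge -big_distrr; congr (_ * _) => /=.
rewrite exchange_big; apply: eq_bigr => u _ /=.
by rewrite covec_sum big_distrr.
Qed.

(** The permutation that exchanges the two pairs of indices is even. *)
Lemma wedgeC2 (a b : covec K n 2) : wedge a b = wedge b a.
Proof.
pose i0 := lshift 2 (ord0 : 'I_2); pose i1 := lshift 2 (ord_max : 'I_2).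
pose i2 := rshift 2 (ord0 : 'I_2); pose i3 := rshift 2 (ord_max : 'I_2).
pose u : 'S_(2 + 2) := (tperm i0 i2 * tperm i1 i3)%g.
have e (c : 'I_2) : u (lshift 2 c) = rshift 2 c /\ u (rshift 2 c) = lshift 2 c.
  have [->|->] : c = ord0 \/ c = ord_max.
    case: c => m hm; have [m0|m0] := posnP m; [left|right]; apply: val_inj => //=.
    by move: hm; rewrite ltnS; case: m m0 => [|[|]].
    by rewrite /u !permM -/i0 -/i2 tpermL tpermR !tpermD.
  by rewrite /u !permM -/i1 -/i3 !(@tpermD _ i0) // tpermL tpermR.
apply: covecP => I; rewrite /wedge; congr (_ * _).
rewrite (reindex_inj (mulgI u)) /=; apply: eq_bigr => s _.
have -> : (-1) ^+ (u * s)%g = (-1) ^+ s :> K by rewrite !odd_permM !odd_tperm.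
rewrite -!mulrA; congr (_ * _); rewrite mulrC; congr (b _ * a _);
  by apply/ffunP => c; rewrite !ffunE permM; have [e1 e2] := e c; rewrite ?e1 ?e2.
Qed.

Lemma alt_fins k (a : covec K n k.+1) (j : 'I_k.+1) x I :
  is_alternating a -> a (fins j x I) = (-1) ^+ j * a (fcons x I).
Proof.
move=> ha; pose u : 'S_k.+1 := lift_perm ord0 j 1%g.
have -> : fcons x I = [ffun b => fins j x I (u b)].
  apply/ffunP => b; rewrite [RHS]ffunE; case: (unliftP ord0 b) => [c|] ->.
    by rewrite fcons_lift lift_perm_lift perm1 fins_lift.
  by rewrite fcons_at lift_perm_id fins_at.
by rewrite ha sign_lift_perm odd_perm1 mulr1 mulrA -expr2 sqrr_sign mul1r.
Qed.

Lemma alt_dup k (a : covec K n k) (I : {ffun 'I_k -> 'I_n}) i j :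
  is_alternating a -> i != j -> I i = I j -> a I = 0.
Proof.
move=> ha ij Iij; have := ha (tperm i j) I.
rewrite odd_tperm ij mulN1r (_ : [ffun b => _] = I).
  by move/eqP; rewrite -subr_eq0 opprK -mulr2n mulrn_eq0 /= => /eqP.
by apply/ffunP => b; rewrite ffunE; case: tpermP => [->|->|].
Qed.

(** For alternating tensors this is k! times the standard inner product. *)
Definition pairing k (a b : covec K n k) : K := \sum_I a I * b I.

(** Exterior multiplication is adjoint to contraction; by alternation each of
    the k + 1 positions of alpha contributes equally. *)
Lemma pairing_wedge1 k alpha (b : covec K n k) (c : covec K n k.+1) :
  is_alternating c ->
  pairing (wedge1 alpha b) c =
  k.+1%:R * pairing b (interior_product (\row_i alpha i) c).
Proof.
move=> hc; rewrite /pairing /wedge1.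
under eq_bigr do rewrite big_distrl /=.
rewrite exchange_big /= mulr_natl -[in RHS](card_ord k.+1) -sumr_const.
apply: eq_bigr => j _; rewrite (sum_fins j) exchange_big /=; apply: eq_bigr => I _.
rewrite /interior_product big_distrr /=; apply: eq_bigr => i _.
rewrite del_fins fins_at alt_fins // mxE.
move: (sqrr_sign K j) (alpha i) (b I) (c _); move: ((-1) ^+ j) => e he A B C.
by transitivity (e ^+ 2 * (B * (A * C))); [ring | rewrite he mul1r].
Qed.

Lemma alt_interior k u (a : covec K n k.+1) :
  is_alternating a -> is_alternating (interior_product u a).
Proof.
move=> ha s I; rewrite /interior_product big_distrr; apply: eq_bigr => c _ /=.
rewrite mulrCA; congr (_ * _).
have -> : (-1) ^+ s = (-1) ^+ lift_perm ord0 ord0 s :> K by rewrite sign_lift_perm mul1r.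
rewrite -ha; congr (a _); apply/ffunP => b; rewrite [RHS]ffunE.
case: (unliftP ord0 b) => [d|] ->; first by rewrite lift_perm_lift !fcons_lift ffunE.
by rewrite lift_perm_id !fcons_at.
Qed.

(** The Levi-Civita symbol. *)
Definition eps : covec K n n := fun I => \det (\matrix_(a, b) (I a == b)%:R).

Lemma epsE I : eps I = \sum_(s : 'S_n) (-1) ^+ s * (I == [ffun i => s i])%:R.
Proof.
apply: eq_bigr => s _; congr (_ * _).
under eq_bigr do rewrite mxE.
case: eqP => [->|ne]; first by rewrite big1 // => i _; rewrite ffunE eqxx.
have [i hi] : exists i, I i != s i.
  by apply/existsP; rewrite -negb_forall; apply/forallP => h; apply: ne;
    apply/ffunP => i; rewrite ffunE; exact/eqP.
by rewrite (bigD1 i) //= (negbTE hi) mul0r.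
Qed.

Lemma eps_fid : eps (fid n) = 1.
Proof.
rewrite /eps (_ : \matrix_(_, _) _ = 1%:M) ?det1 //.
by apply/matrixP => i j; rewrite !mxE ffunE.
Qed.

(** An alternating tensor of top degree vanishes on repeated indices and is
    determined on permutations by its value on the identity. *)
Lemma top_alt (a : covec K n n) : is_alternating a -> a = a (fid n) *: eps.
Proof.
move=> ha; apply: covecP => I; rewrite covecZ epsE.
case: (boolP (injectiveb I)) => [/injectiveP injI|/injectivePn[i [j ij eij]]].
  have [s eI] : exists s : 'S_n, I = [ffun i => s i].
    by exists (perm injI); apply/ffunP => i; rewrite ffunE permE.
  rewrite eI (bigD1 s) //= big1 => [|t ne].
    rewrite eqxx mulr1 addr0 mulrC -ha; congr (a _).
    by apply/ffunP => i; rewrite !ffunE.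
  case: eqP => [e|]; last by rewrite mulr0.
  by case/eqP: ne; apply/permP => i; move/ffunP/(_ i): e; rewrite !ffunE.
rewrite (alt_dup ha ij eij) big1 ?mulr0 // => s _.
case: eqP => [e|]; last by rewrite mulr0.
by case/eqP: ij; move: eij; rewrite e !ffunE => /perm_inj.
Qed.

Lemma alt_eps : is_alternating eps.
Proof.
move=> s I; rewrite !epsE big_distrr /= (reindex_inj (mulgI s)) /=.
apply: eq_bigr => t _; rewrite odd_permM signr_addb -mulrA; congr (_ * (_ * _)).
congr (nat_of_bool _)%:R; apply/eqP/eqP => [e|->]; apply/ffunP => i; rewrite !ffunE ?permM //.
by move/ffunP/(_ (s^-1%g i)): e; rewrite !ffunE permM permKV.
Qed.

End Covec2.
Arguments one0 {K n}.
Arguments eps {K n}.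

(** * Pullback by a matrix *)

Section Pull.
Context {K : numFieldType}.
Implicit Types (k p q m n : nat).

(** With vectors as rows, (pull P a)(u, v, ...) = a(u P, v P, ...). *)
Definition pull m n k (P : 'M[K]_(m, n)) (a : covec K n k) : covec K m k :=
  fun I => \sum_J a J * \prod_(c < k) P (I c) (J c).

Lemma pull1 n k (a : covec K n k) : pull 1%:M a = a.
Proof.
apply: covecP => I; rewrite /pull (bigD1 I) //= [X in _ + X]big1 => [|J ne].
  by rewrite big1 ?mulr1 ?addr0 // => c _; rewrite mxE eqxx.
have [c hc] : exists c, I c != J c.
  apply/existsP; rewrite -negb_forall; apply: contraNN ne => /forallP h.
  by apply/eqP/ffunP => c; apply/esym/eqP.
by rewrite (bigD1 c) //= mxE (negbTE hc) mul0r mulr0.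
Qed.

Lemma pull_mul m n l k (P : 'M[K]_(m, n)) (Q : 'M[K]_(n, l)) (a : covec K l k) :
  pull (P *m Q) a = pull P (pull Q a).
Proof.
apply: covecP => I; rewrite /pull.
under [RHS]eq_bigr do rewrite big_distrl /=.
rewrite exchange_big /=; apply: eq_bigr => J _.
under eq_bigr do rewrite mxE.
rewrite bigA_distr_bigA big_distrr /=; apply: eq_bigr => L _.
by rewrite big_split /= -!mulrA; congr (_ * _); rewrite mulrC.
Qed.

Lemma pullD m n k (P : 'M[K]_(m, n)) (a b : covec K n k) :
  pull P (a + b) = pull P a + pull P b.
Proof. by apply: covecP => I; rewrite covecD /pull -big_split; apply: eq_bigr => J _ /=; rewrite -mulrDl. Qed.

Lemma pullZ m n k c (P : 'M[K]_(m, n)) (a : covec K n k) :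
  pull P (c *: a) = c *: pull P a.
Proof. by apply: covecP => I; rewrite covecZ /pull big_distrr; apply: eq_bigr => J _ /=; rewrite mulrA. Qed.

Lemma pull_sum (T : Type) (s : seq T) (Q : pred T) m n k (P : 'M[K]_(m, n))
    (F : T -> covec K n k) :
  pull P (\sum_(t <- s | Q t) F t) = \sum_(t <- s | Q t) pull P (F t).
Proof.
apply: covecP => I; rewrite covec_sum /pull exchange_big; apply: eq_bigr => J _ /=.
by rewrite covec_sum big_distrl.
Qed.

Lemma reindex_ffun_perm (T : finType) k (s : 'S_k) (F : {ffun 'I_k -> T} -> K) :
  \sum_J F J = \sum_(J : {ffun 'I_k -> T}) F [ffun c => J (s c)].
Proof.
rewrite (reindex (fun J : {ffun 'I_k -> T} => [ffun c => J (s c)])) //.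
exists (fun J : {ffun 'I_k -> T} => [ffun c => J (s^-1%g c)]) => J _; apply/ffunP => c;
  by rewrite !ffunE ?permK ?permKV.
Qed.

Lemma pull_perm m n k (P : 'M[K]_(m, n)) (s : 'S_k) (a : covec K n k)
    (I : {ffun 'I_k -> 'I_m}) :
  pull P a [ffun b => I (s b)] = pull P (fun J => a [ffun b => J (s b)]) I.
Proof.
rewrite /pull (reindex_ffun_perm s); apply: eq_bigr => J _; congr (_ * _).
rewrite [RHS](reindex_inj (@perm_inj _ s)); apply: eq_bigr => c _.
by rewrite !ffunE.
Qed.

Lemma alt_pull m n k (P : 'M[K]_(m, n)) (a : covec K n k) :
  is_alternating a -> is_alternating (pull P a).
Proof.
move=> ha s I; rewrite pull_perm /pull big_distrr; apply: eq_bigr => J _ /=.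
by rewrite ha mulrA.
Qed.

Lemma pull_fcat m n p q (P : 'M[K]_(m, n)) (a : covec K n (p + q)) I1 I2 :
  pull P a (fcat I1 I2) =
  \sum_J1 \sum_J2 a (fcat J1 J2) * (\prod_(c < p) P (I1 c) (J1 c))
                                 * (\prod_(c < q) P (I2 c) (J2 c)).
Proof.
rewrite /pull sum_fcat; apply: eq_bigr => J1 _; apply: eq_bigr => J2 _.
rewrite big_split_ord /= -mulrA; congr (_ * (_ * _)); apply: eq_bigr => c _;
  by rewrite ?fcat_l ?fcat_r.
Qed.

Lemma pull_fins m n k (j : 'I_k.+1) (P : 'M[K]_(m, n)) (a : covec K n k.+1) x I :
  pull P a (fins j x I) =
  \sum_y P x y * pull P (fun J => a (fins j y J)) I.
Proof.
rewrite /pull (sum_fins j); apply: eq_bigr => y _.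
rewrite big_distrr; apply: eq_bigr => J _ /=.
rewrite mulrCA; congr (_ * _).
rewrite (bigD1_ord j) //= !fins_at; congr (_ * _).
by apply: eq_bigr => c _; rewrite !fins_lift.
Qed.

Lemma pull_fcons m n k (P : 'M[K]_(m, n)) (a : covec K n k.+1) x I :
  pull P a (fcons x I) = \sum_y P x y * pull P (fun J => a (fcons y J)) I.
Proof. exact: (pull_fins ord0). Qed.

Lemma pull_wedge1 m n k (P : 'M[K]_(m, n)) alpha (b : covec K n k) :
  pull P (wedge1 alpha b) = wedge1 (fun i => \sum_j P i j * alpha j) (pull P b).
Proof.
apply: covecP => I; rewrite {1}/pull /wedge1.
under eq_bigr do rewrite big_distrl /=.
rewrite exchange_big /=; apply: eq_bigr => j _.
rewrite (sum_fins j) /= -mulrA big_distrl /= big_distrr /=; apply: eq_bigr => y _.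
rewrite /pull !big_distrr /=; apply: eq_bigr => J _.
rewrite (bigD1_ord j) //= !fins_at del_fins.
under eq_bigr do rewrite fins_lift.
under [in RHS]eq_bigr do rewrite ffunE.
ring.
Qed.

(** The sum over multi-indices may be permuted along with the arguments, so
    pullback commutes with antisymmetrisation. *)
Lemma pull_wedge m n p q (P : 'M[K]_(m, n)) (a : covec K n p) (b : covec K n q) :
  pull P (wedge a b) = wedge (pull P a) (pull P b).
Proof.
apply: covecP => I; rewrite {1}/pull /wedge.
under eq_bigr do rewrite -mulrA big_distrl /=.
rewrite -big_distrr /=; congr (_ * _); rewrite exchange_big /=; apply: eq_bigr => s _.
rewrite (reindex_ffun_perm s^-1%g) sum_fcat /pull -[RHS]mulrA big_distrl big_distrr /=.
apply: eq_bigr => J1 _; rewrite mulrA !big_distrr /=; apply: eq_bigr => J2 _.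
have -> : [ffun c => [ffun c0 => fcat J1 J2 (s^-1%g c0)] (s (lshift q c))] = J1.
  by apply/ffunP => c; rewrite 2!ffunE permK fcat_l.
have -> : [ffun c => [ffun c0 => fcat J1 J2 (s^-1%g c0)] (s (rshift p c))] = J2.
  by apply/ffunP => c; rewrite 2!ffunE permK fcat_r.
rewrite (reindex_inj (@perm_inj _ s)) /= big_split_ord /=.
under eq_bigr do rewrite ffunE permK fcat_l.
under [X in _ * (_ * X)]eq_bigr do rewrite ffunE permK fcat_r.
under [in RHS]eq_bigr do rewrite ffunE.
under [X in _ = _ * (_ * X)]eq_bigr do rewrite ffunE.
by rewrite -!mulrA; congr (_ * (_ * _)); rewrite mulrCA.
Qed.

Lemma pull_interior m n k (P : 'M[K]_(m, n)) (u : 'rV[K]_m) (a : covec K n k.+1) :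
  interior_product u (pull P a) = pull P (interior_product (u *m P) a).
Proof.
apply: covecP => I; rewrite /interior_product.
under eq_bigr do rewrite pull_fcons big_distrr /=.
rewrite exchange_big /= [RHS]/pull.
under [RHS]eq_bigr do rewrite big_distrl /=.
rewrite [RHS]exchange_big /=; apply: eq_bigr => y _.
rewrite /pull mxE; under eq_bigr do rewrite mulrA.
rewrite -big_distrl big_distrr /=; apply: eq_bigr => J _; ring.
Qed.

Lemma pairing_pull m n k (P : 'M[K]_(m, n)) (a : covec K n k) (b : covec K m k) :
  pairing (pull P a) b = pairing a (pull P^T b).
Proof.
rewrite /pairing /pull.
under eq_bigr do rewrite big_distrl /=.
rewrite exchange_big; apply: eq_bigr => J _ /=.
rewrite big_distrr; apply: eq_bigr => I _ /=.
under [in RHS]eq_bigr do rewrite mxE.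
ring.
Qed.

Lemma pull_eps n (P : 'M[K]_n) : pull P eps = \det P *: eps.
Proof.
rewrite (top_alt (alt_pull P (@alt_eps K n))); congr (_ *: _).
rewrite /pull; under eq_bigr do rewrite epsE big_distrl /=.
rewrite exchange_big; apply: eq_bigr => s _ /=.
rewrite (bigD1 [ffun i => s i]) //= [X in _ + X]big1 => [|J /negbTE->]; last by rewrite mulr0 mul0r.
rewrite eqxx mulr1 addr0; congr (_ * _); apply: eq_bigr => c _.
by rewrite !ffunE.
Qed.

End Pull.

Section Interior.
Context {K : numFieldType} {n : nat}.

Lemma interior_sum (T : Type) (s : seq T) k (u : T -> 'rV[K]_n) (a : covec K n k.+1) :
  interior_product (\sum_(t <- s) u t) a = \sum_(t <- s) interior_product (u t) a.
Proof.
apply: covecP => I; rewrite covec_sum /interior_product exchange_big.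
by apply: eq_bigr => c _ /=; rewrite summxE big_distrl.
Qed.

Lemma interiorZ k c (u : 'rV[K]_n) (a : covec K n k.+1) :
  interior_product (c *: u) a = c *: interior_product u a.
Proof.
apply: covecP => I; rewrite covecZ /interior_product big_distrr.
by apply: eq_bigr => d _ /=; rewrite mxE mulrA.
Qed.

Lemma interior_delta k (c : 'I_n) (a : covec K n k.+1) I :
  interior_product (delta_mx 0 c) a I = a (fcons c I).
Proof.
rewrite /interior_product (bigD1 c) //= big1 => [|d /negbTE ne]; rewrite mxE eqxx ?eqxx ?ne /=.
  by rewrite mul1r addr0.
by rewrite mul0r.
Qed.

End Interior.

(** * The Hodge star under a change of frame *)

Section MetricAlgebra.
Context {R : realType} {n : nat}.
Implicit Types (g : 'M[R]_n) (k p q : nat).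

Lemma innerE k g (a b : covec R n k) :
  inner g a b = (k`!%:R)^-1 * pairing a (pull (invmx g) b).
Proof.
rewrite /inner /pairing; congr (_ * _); apply: eq_bigr => I _.
by rewrite /pull big_distrr; apply: eq_bigr => J _ /=; rewrite mulrA.
Qed.

Lemma hodgeE p q g (vol : covec R n (p + q)) (a : covec R n p) J :
  hodge g vol a J =
  (p`!%:R)^-1 * pairing (pull (invmx g)^T a) (fun I => vol (fcat I J)).
Proof.
rewrite /hodge /pairing exchange_big /=; congr (_ * _); apply: eq_bigr => I' _.
rewrite /pull big_distrl; apply: eq_bigr => I _ /=.
by under [in RHS]eq_bigr do rewrite mxE.
Qed.

Lemma volcovE g o : volcov g o = (Num.sg (o (fid n)) * Num.sqrt (\det g)) *: eps.
Proof. by []. Qed.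

Lemma pull_inj m k (P : 'M[R]_m) (a b : covec R m k) : P \in unitmx ->
  pull P a = pull P b -> a = b.
Proof.
by move=> hP e; rewrite -(pull1 a) -(pull1 b) -(mulVmx hP) !pull_mul e.
Qed.

(** Changing the frame by P turns g into P g P^T; the inverse metrics cancel
    the factors P in the contracted indices. *)
Lemma pull_hodge p q (P : 'M[R]_n) g (vol : covec R n (p + q)) (a : covec R n p) :
  P \in unitmx -> g \in unitmx ->
  pull P (hodge g vol a) = hodge (P *m g *m P^T) (pull P vol) (pull P a).
Proof.
move=> hP hg; apply: covecP => J; rewrite hodgeE /pairing.
under eq_bigr do rewrite pull_fcat.
rewrite [LHS]/pull; under [LHS]eq_bigr do rewrite hodgeE /pairing big_distrr big_distrl /=.
set h := P *m g *m P^T.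
have e : P^T *m (invmx h)^T *m P = (invmx g)^T.
  apply: trmx_inj; rewrite !trmx_mul !trmxK; apply: (can_inj (mulmxK hg)); rewrite mulVmx //.
  have hh : h \in unitmx by rewrite /h !unitmx_mul hP hg unitmx_tr hP.
  have hPT : P^T \in unitmx by rewrite unitmx_tr.
  rewrite -mulmxA; apply: (can_inj (mulmxK hPT)); rewrite mul1mx -!mulmxA.
  by rewrite (mulmxA P g) -/h mulVmx ?mulmx1.
have key : forall J2 : {ffun 'I_q -> 'I_n},
    \sum_I pull (invmx h)^T (pull P a) I *
      \sum_J1 vol (fcat J1 J2) * \prod_(c < p) P (I c) (J1 c)
    = \sum_I1 pull (invmx g)^T a I1 * vol (fcat I1 J2).
  move=> J2; rewrite -e !pull_mul.
  rewrite -/(pairing _ (fun I1 => vol (fcat I1 J2))) pairing_pull trmxK.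
  by rewrite /pairing.
transitivity (\sum_J2 (p`!%:R)^-1 *
   (\sum_I1 pull (invmx g)^T a I1 * vol (fcat I1 J2)) * \prod_(c < q) P (J c) (J2 c)).
  apply: eq_bigr => J2 _; rewrite !big_distrr !big_distrl /=.
  by apply: eq_bigr => I _; rewrite !mulrA.
under [LHS]eq_bigr do rewrite -mulrA.
rewrite -big_distrr /=; congr (_ * _).
under [LHS]eq_bigr do rewrite -key big_distrl /=.
rewrite exchange_big /=; apply: eq_bigr => I _.
under [LHS]eq_bigr do rewrite -mulrA.
rewrite -big_distrr /=; congr (_ * _); rewrite [RHS]exchange_big /=.
by apply: eq_bigr => J2 _; rewrite big_distrl.
Qed.

(** The factor sgn (det P) coming from the orientation and the factor |det P|
    coming from sqrt (det g) combine to det P. *)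
Lemma pull_volcov (P : 'M[R]_n) g o : P \in unitmx -> is_alternating o ->
  pull P (volcov g o) = volcov (P *m g *m P^T) (pull P o).
Proof.
move=> hP ho; rewrite !volcovE pullZ pull_eps scalerA; congr (_ *: _).
rewrite {2}(top_alt ho) pullZ pull_eps covecZ covecZ eps_fid mulr1 sgrM.
rewrite !det_mulmx det_tr (mulrAC (\det P)) -expr2 sqrtrM ?sqr_ge0 // sqrtr_sqr.
rewrite -!mulrA; congr (_ * _); rewrite [LHS]mulrC mulrA; congr (_ * _).
exact: numEsg.
Qed.

Lemma inner_pull k (P : 'M[R]_n) g (a b : covec R n k) :
  P \in unitmx -> g \in unitmx ->
  inner (P *m g *m P^T) (pull P a) (pull P b) = inner g a b.
Proof.
move=> hP hg; rewrite !innerE pairing_pull -!pull_mul; congr (_ * pairing _ (pull _ _)).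
set h := P *m g *m P^T; apply: (can_inj (mulmxK hg)); rewrite mulVmx //.
have hh : h \in unitmx by rewrite /h !unitmx_mul hP hg unitmx_tr hP.
have hPT : P^T \in unitmx by rewrite unitmx_tr.
rewrite -mulmxA; apply: (can_inj (mulmxK hPT)); rewrite mul1mx -!mulmxA.
by rewrite (mulmxA P g) -/h mulVmx ?mulmx1.
Qed.

Lemma inner_wedge1 k g alpha (b : covec R n k) (c : covec R n k.+1) :
  is_alternating c ->
  inner g (wedge1 alpha b) c =
  inner g b (interior_product ((\row_i alpha i) *m invmx g) c).
Proof.
move=> hc; rewrite !innerE pairing_wedge1; last exact: alt_pull.
rewrite pull_interior mulrA; congr (_ * _).
by rewrite factS natrM invfM mulrAC mulVf ?mul1r // pnatr_eq0.
Qed.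

(** Raising all indices with the inverse metric is the change of frame P =
    g^-1, so pull_hodge turns the Hodge star into a contraction with the raised
    volume form. *)
Lemma raise_hodge p q g (vol : covec R n (p + q)) (a : covec R n p) J :
  g \in unitmx -> g^T = g ->
  pull (invmx g) (hodge g vol a) J =
  (p`!%:R)^-1 * pairing a (fun I => pull (invmx g) vol (fcat I J)).
Proof.
move=> hg sg; rewrite pull_hodge ?unitmx_inv //.
have sgi : (invmx g)^T = invmx g by rewrite trmx_inv sg.
rewrite sgi mulVmx // mul1mx hodgeE invmxK sg -pull_mul.
by rewrite mulmxV // pull1.
Qed.

Lemma innerDl k g (a a' b : covec R n k) :
  inner g (a + a') b = inner g a b + inner g a' b.
Proof.
rewrite !innerE -mulrDr -big_split; congr (_ * _); apply: eq_bigr => I _ /=.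
by rewrite covecD mulrDl.
Qed.

Lemma innerZl k g c (a b : covec R n k) : inner g (c *: a) b = c * inner g a b.
Proof.
rewrite !innerE mulrCA; congr (_ * _); rewrite /pairing big_distrr.
by apply: eq_bigr => I _ /=; rewrite covecZ mulrA.
Qed.

Lemma innerZr k g c (a b : covec R n k) : inner g a (c *: b) = c * inner g a b.
Proof.
rewrite !innerE mulrCA pullZ; congr (_ * _); rewrite /pairing big_distrr.
by apply: eq_bigr => I _ /=; rewrite covecZ mulrCA.
Qed.

Lemma inner_suml (T : Type) (s : seq T) k g (F : T -> covec R n k) b :
  inner g (\sum_(t <- s) F t) b = \sum_(t <- s) inner g (F t) b.
Proof.
rewrite innerE /pairing; under eq_bigr do rewrite covec_sum big_distrl /=.
rewrite exchange_big big_distrr; apply: eq_bigr => t _ /=.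
by rewrite innerE.
Qed.

Lemma inner_sumr (T : Type) (s : seq T) k g a (F : T -> covec R n k) :
  inner g a (\sum_(t <- s) F t) = \sum_(t <- s) inner g a (F t).
Proof.
rewrite innerE /pairing pull_sum; under eq_bigr do rewrite covec_sum big_distrr /=.
rewrite exchange_big big_distrr; apply: eq_bigr => t _ /=.
by rewrite innerE.
Qed.

End MetricAlgebra.

(** * Forms with integer coefficients *)

Section IteratedForms.
Context {K : numFieldType} {n : nat}.
Implicit Types (k p q : nat) (l m : seq nat).

Fixpoint iform k (alpha : nat -> 'I_n -> K) : covec K n k :=
  match k with
  | 0 => one0
  | k'.+1 => wedge1 (alpha 0%N) (@iform k' (fun b => alpha b.+1))
  end.
Arguments iform k alpha : clear implicits.

Lemma alt_iform k alpha : is_alternating (iform k alpha).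
Proof.
elim: k alpha => [|k IH] alpha; first exact: alt_one0.
exact/alt_wedge1/IH.
Qed.

Lemma iform_det k alpha I :
  iform k alpha I = \det (\matrix_(a < k, b < k) alpha b (I a)).
Proof.
elim: k alpha I => [|k IH] alpha I; first by rewrite det_mx00.
rewrite (expand_det_col _ ord0) /= /wedge1; apply: eq_bigr => j _.
rewrite mxE /cofactor addn0 mulrA (mulrC (alpha _ _)) IH; congr (_ * \det _).
by apply/matrixP => a b; rewrite !mxE ffunE.
Qed.

Lemma eq_iform k alpha beta :
  (forall b, (b < k)%N -> alpha b = beta b) -> iform k alpha = iform k beta.
Proof.
elim: k alpha beta => //= k IH alpha beta h; rewrite h //; congr wedge1.
by apply: IH => b hb; apply: h.
Qed.

Lemma eps_iform : eps = iform n (fun b i => (val i == b)%:R).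
Proof. by apply: covecP => I; rewrite iform_det. Qed.

Lemma wedge_iform p q alpha beta :
  wedge (iform p alpha) (iform q beta) =
  iform (p + q) (fun b => if (b < p)%N then alpha b else beta (b - p)%N).
Proof.
elim: p alpha => [|p IH] alpha /=.
  rewrite wedge_one0; last exact: alt_iform.
  by apply: eq_iform => b _; rewrite subn0.
by rewrite wedge_wedge1 IH.
Qed.

(** The product dx^(l_0) /\ dx^(l_1) /\ ... of coordinate one-forms. The
    default value n of nth makes the factors beyond the end of l vanish. *)
Definition bform k l : covec K n k := iform k (fun b i => (val i == nth n l b)%:R).
Arguments bform k l : clear implicits.

Definition dxi (x : nat) : 'I_n -> K := fun i => (val i == x)%:R.

Lemma bform_cons k x l : bform k.+1 (x :: l) = wedge1 (dxi x) (bform k l).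
Proof. by []. Qed.

Lemma alt_bform k l : is_alternating (bform k l).
Proof. exact: alt_iform. Qed.

Lemma wedge_bform p q l m : size l = p ->
  wedge (bform p l) (bform q m) = bform (p + q) (l ++ m).
Proof.
move=> sl; rewrite wedge_iform; apply: eq_iform => b hb.
by apply: funext => i; rewrite nth_cat sl; case: ifP.
Qed.

(** Multi-indices as lists of naturals, on which coefficients can be computed.
    *)
Definition vals k (I : {ffun 'I_k -> 'I_n}) : seq nat := [seq val (I c) | c <- enum 'I_k].

Lemma size_vals k (I : {ffun 'I_k -> 'I_n}) : size (vals I) = k.
Proof. by rewrite size_map size_enum_ord. Qed.

Lemma nth_vals x0 k (I : {ffun 'I_k -> 'I_n}) (c : 'I_k) : nth x0 (vals I) c = I c.
Proof. by rewrite (nth_map c) ?size_enum_ord // nth_ord_enum. Qed.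

Lemma vals_fcons k a (I : {ffun 'I_k -> 'I_n}) : vals (fcons a I) = val a :: vals I.
Proof.
rewrite /vals enum_ordSl /= fcons_at -map_comp; congr cons.
by apply: eq_map => c /=; rewrite fcons_lift.
Qed.

Lemma vals_fcat p q (I : {ffun 'I_p -> 'I_n}) (J : {ffun 'I_q -> 'I_n}) :
  vals (fcat I J) = vals I ++ vals J.
Proof.
apply: (@eq_from_nth _ 0%N); first by rewrite size_cat !size_vals.
move=> i; rewrite size_vals => hi; rewrite nth_cat size_vals.
rewrite (nth_vals 0 (fcat I J) (Ordinal hi)).
case: (split_ordP (Ordinal hi)) => c e; rewrite e; have /= -> := congr1 val e.
  by rewrite fcat_l nth_vals.
by rewrite fcat_r addKn nth_vals.
Qed.

(** Deletion of the entry at position j. *)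
Definition rm (j : nat) (m : seq nat) : seq nat := take j m ++ drop j.+1 m.

Lemma vals_del k (I : {ffun 'I_k.+1 -> 'I_n}) j :
  vals [ffun c => I (lift j c)] = rm j (vals I).
Proof.
have hj : (j < size (vals I))%N by rewrite size_vals.
apply: (@eq_from_nth _ 0%N).
  by rewrite size_vals size_cat size_takel ?(ltnW hj) // size_drop size_vals
    subSS subnKC // -ltnS.
move=> i; rewrite size_vals => hi; rewrite nth_cat size_takel ?(ltnW hj) //.
rewrite (nth_vals 0 _ (Ordinal hi)) ffunE -(nth_vals 0).
rewrite /= /bump; case: ltnP => h; first by rewrite nth_take.
by rewrite add1n nth_drop addSn subnKC.
Qed.

(** The value of dx^(l_0) /\ dx^(l_1) /\ ... on the multi-index m: the sign of
    the permutation taking l to m, or 0. It is the shuffle expansion of wedge1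
    on lists. *)
Fixpoint sgl l m : int :=
  if l is x :: l' then
    foldr (fun j acc =>
      (if nth 0%N m j == x then
         (if odd j then - sgl l' (rm j m) else sgl l' (rm j m)) else 0) + acc)
      0 (iota 0 (size m))
  else 1.

Lemma foldr_iota (F : nat -> int) k :
  foldr (fun j acc => F j + acc) 0 (iota 0 k) = \sum_(j < k) F j.
Proof. by rewrite -(big_mkord xpredT) unlock /reducebig /index_iota subn0. Qed.

Lemma bformE k l I : size l = k -> bform k l I = (sgl l (vals I))%:~R.
Proof.
elim: k l I => [|k IH] [|x l] I // [sl].
rewrite bform_cons [sgl _ _]/= foldr_iota size_vals rmorph_sum /=; apply: eq_bigr => j _.
rewrite IH // vals_del nth_vals /dxi.
rewrite -signr_odd; case: ifP => _; last by rewrite mulr0 mul0r rmorph0.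
by case: odd; rewrite ?expr1 ?expr0 ?mulr1 ?mul1r ?mulN1r ?rmorphN.
Qed.

(** All lists of length k with entries below d, that is, all multi-indices. *)
Fixpoint lists (d k : nat) : seq (seq nat) :=
  if k is k'.+1 then flatten [seq [seq x :: l | l <- lists d k'] | x <- iota 0 d]
  else [:: [::]].

Lemma vals_lists k (I : {ffun 'I_k -> 'I_n}) : vals I \in lists n k.
Proof.
elim: k I => [|k IH] I.
  by rewrite /vals enum_ord0.
rewrite -(fins_del ord0 I) -/(fcons _ _) vals_fcons.
apply/flattenP; exists [seq val (I ord0) :: l | l <- lists n k].
  by apply: (map_f (fun x => [seq x :: l | l <- lists n k])); rewrite mem_iota /= add0n.
by rewrite map_f.
Qed.

(** Forms with constant integer coefficients are stored as lists of pairs of a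
    coefficient and a list of indices, so that identities between them are
    decided by evaluation. *)
Definition zform k (s : seq (int * seq nat)) : covec K n k :=
  \sum_(t <- s) t.1%:~R *: bform k t.2.
Arguments zform k s : clear implicits.

Definition zsum (F : seq nat -> int) (s : seq (int * seq nat)) : int :=
  foldr (fun t acc => t.1 * F t.2 + acc) 0 s.

Lemma zsumE F s : (zsum F s)%:~R = \sum_(t <- s) t.1%:~R * (F t.2)%:~R :> K.
Proof.
elim: s => [|t s IH] /=; first by rewrite big_nil.
by rewrite big_cons -IH rmorphD rmorphM.
Qed.

Definition zval (s : seq (int * seq nat)) (m : seq nat) : int :=
  zsum (fun l => sgl l m) s.

Definition zwf k (s : seq (int * seq nat)) := all (fun t => size t.2 == k) s.

Lemma zformE k s I : zwf k s -> zform k s I = (zval s (vals I))%:~R.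
Proof.
move=> /allP ws; rewrite /zform covec_sum zsumE.
rewrite big_seq [RHS]big_seq; apply: eq_bigr => t /ws /eqP st.
by rewrite covecZ bformE.
Qed.

Lemma alt_zform k s : is_alternating (zform k s).
Proof. by apply: alt_sum => t _; apply/altZ/alt_bform. Qed.

(** Equality of two integral forms is a finite check over all multi-indices. *)
Lemma zform_eq k s t : zwf k s -> zwf k t ->
  all (fun m => zval s m == zval t m) (lists n k) -> zform k s = zform k t.
Proof.
move=> ws wt /allP h; apply: covecP => I; rewrite !zformE //.
by rewrite (eqP (h _ (vals_lists I))).
Qed.

Lemma zformZ k (c : int) s : c%:~R *: zform k s = zform k [seq (c * t.1, t.2) | t <- s].
Proof.
rewrite /zform big_map scaler_sumr; apply: eq_bigr => t _.
by rewrite scalerA rmorphM.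
Qed.

Lemma zformD k s t : zform k s + zform k t = zform k (s ++ t).
Proof. by rewrite /zform big_cat. Qed.

Definition zmul (s t : seq (int * seq nat)) : seq (int * seq nat) :=
  flatten [seq [seq (a.1 * b.1, a.2 ++ b.2) | b <- t] | a <- s].

Lemma wedge_zform p q s t : zwf p s ->
  wedge (zform p s) (zform q t) = zform (p + q) (zmul s t).
Proof.
move=> /allP ws; rewrite /zform /zmul wedge_suml big_flatten big_map.
rewrite big_seq [RHS]big_seq; apply: eq_bigr => a /ws /eqP sa.
rewrite wedge_sumr big_map; apply: eq_bigr => b _ /=.
by rewrite wedgeZl wedgeZr scalerA wedge_bform // rmorphM.
Qed.

Lemma wedge1_zform k x s :
  wedge1 (dxi x) (zform k s) = zform k.+1 [seq (t.1, x :: t.2) | t <- s].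
Proof.
rewrite /zform wedge1_sumr big_map; apply: eq_bigr => t _ /=.
by rewrite wedge1Zr bform_cons.
Qed.

Lemma eps_bform : eps = bform n (iota 0 n).
Proof.
rewrite eps_iform; apply: eq_iform => b hb; apply: funext => i.
by rewrite nth_iota // add0n.
Qed.

(** Each contraction of c with a coordinate vector extracts one index. *)
Lemma pairing_bform k (L : {ffun 'I_k -> 'I_n}) (c : covec K n k) :
  is_alternating c -> pairing (bform k (vals L)) c = k`!%:R * c L.
Proof.
elim: k L c => [|k IH] L c hc.
  rewrite /pairing (eq_bigr (fun=> c L)) => [|I _].
    rewrite sumr_const card_ffun !card_ord expn0 mulr1n fact0 mul1r //.
  by rewrite /= /one0 mul1r; congr c; apply/ffunP => -[].
rewrite -(fins_del ord0 L) -/(fcons _ _) vals_fcons bform_cons pairing_wedge1 //.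
rewrite IH; last exact: alt_interior.
rewrite mulrA -natrM -factS; congr (_ * _).
rewrite /interior_product (bigD1 (L ord0)) //= big1 => [|i ne]; rewrite mxE /dxi.
  by rewrite eqxx mul1r addr0.
by rewrite (negbTE (_ : val i != val (L ord0))) ?mul0r // val_eqE.
Qed.

(** A multi-index without repetition can be sorted, at the cost of a sign. *)
Lemma alt_ext k (a b : covec K n k) : is_alternating a -> is_alternating b ->
  (forall I, sorted ltn (vals I) -> a I = b I) -> a = b.
Proof.
move=> ha hb h; apply: covecP => I.
case: (boolP (injectiveb I)) => [/injectiveP injI|/injectivePn[i [j ij eij]]]; last first.
  by rewrite (alt_dup ha ij eij) (alt_dup hb ij eij).
pose t := [tuple I c | c < k].
have /tuple_permP[u eu] : perm_eq (sort (fun x y : 'I_n => (x <= y)%N) t) t by rewrite perm_sort.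
pose I' := [ffun c => I (u c)].
have eI' : vals I' = map val (sort (fun x y : 'I_n => (x <= y)%N) t).
  rewrite eu -map_comp; apply: eq_map => c /=.
  by rewrite ffunE tnth_mktuple.
have hI' : sorted ltn (vals I').
  rewrite ltn_sorted_uniq_leq; apply/andP; split.
    rewrite map_inj_uniq ?enum_uniq // => c d; rewrite !ffunE => /val_inj/injI.
    exact: perm_inj.
  rewrite eI' sorted_map; apply: sort_sorted => x y; exact: leq_total.
have := h _ hI'; rewrite ha hb => e.
have := congr1 (fun z => (-1) ^+ u * z) e.
by rewrite !mulrA !signr_odd_perm !mul1r.
Qed.

Definition slists (d k : nat) := [seq l <- lists d k | sorted ltn l].

(** The coordinate forms with increasing indices are dual to the increasing
    multi-indices. *)
Definition sgl_dual (d k : nat) :=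
  uniq (slists d k) &&
  all (fun l => all (fun m => sgl l m == (l == m)%:R) (slists d k)) (slists d k).

End IteratedForms.
Arguments iform {K n} k alpha.
Arguments bform {K n} k l.
Arguments zform {K n} k s.

Section Decomposition.
Context {K : numFieldType} {n' : nat}.
Local Notation n := n'.+1.

Definition flist k (l : seq nat) : {ffun 'I_k -> 'I_n} := [ffun c : 'I_k => inord (nth 0%N l c)].
Arguments flist k l : clear implicits.

Lemma flist_vals k (I : {ffun 'I_k -> 'I_n}) : flist k (vals I) = I.
Proof. by apply/ffunP => c; rewrite ffunE nth_vals inord_val. Qed.

Lemma size_lists d k l : l \in lists d k -> size l = k.
Proof.
elim: k l => [|k IH] l /=; first by rewrite inE => /eqP->.
by move=> /flattenP[s /mapP[x _ ->] /mapP[l' /IH <- ->]].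
Qed.

(** Both sides are alternating, hence determined by their values on increasing
    multi-indices. *)
Lemma alt_decomp k (a : covec K n k) : is_alternating a -> sgl_dual n k ->
  a = \sum_(l <- slists n k) a (flist k l) *: bform k l.
Proof.
move=> ha /andP[us /allP hs]; apply: alt_ext => // [|I hI].
  by apply: alt_sum => t _; apply/altZ/alt_bform.
have mI : vals I \in slists n k by rewrite mem_filter hI vals_lists.
rewrite covec_sum (bigD1_seq (vals I)) //= covecZ flist_vals.
have sz l : l \in slists n k -> size l = k by rewrite mem_filter => /andP[_ /size_lists].
have val l : l \in slists n k -> bform k l I = (l == vals I)%:R :> K.
  move=> ml; rewrite bformE ?sz //.
  by move/allP/(_ _ mI)/eqP: (hs _ ml) => ->; case: eqP.
rewrite val // eqxx mulr1 big_seq_cond big1 ?addr0 // => l /andP[ml ne].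
by rewrite covecZ val // (negbTE ne) mulr0.
Qed.

Lemma dxi_decomp (alpha : 'I_n -> K) : alpha = \sum_(c < n) alpha c *: dxi c.
Proof.
apply: funext => i; rewrite fct_sumE (bigD1 i) //= big1 => [|c ne].
  by rewrite addr0 -[RHS]/(alpha i * dxi i i) /dxi eqxx mulr1.
by rewrite -[LHS]/(alpha c * dxi c i) /dxi val_eqE eq_sym (negbTE ne) mulr0.
Qed.

End Decomposition.
Arguments flist {n'} k l.
Section MoreForms.
Context {K : numFieldType}.

Lemma pull_iform m n k (P : 'M[K]_(m, n)) alpha :
  pull P (iform k alpha) = iform k (fun b i => \sum_j P i j * alpha b j).
Proof.
elim: k alpha => [|k IH] alpha; last by rewrite /= pull_wedge1 IH.
apply: covecP => I; rewrite /pull /= /one0 (eq_bigr (fun=> 1)) => [|J _].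
  by rewrite sumr_const card_ffun !card_ord expn0.
by rewrite big_ord0 mul1r.
Qed.

(** Pullback by Emx is pullback by the projection R^(m + n) -> R^n. *)
Definition Emx m n : 'M[K]_(m + n, n) := col_mx 0 1%:M.

Lemma pull_Emx_bform m n k l :
  pull (Emx m n) (bform k l) = bform k [seq (m + x)%N | x <- l].
Proof.
rewrite pull_iform; apply: eq_iform => b hb; apply: funext => i.
have -> : nth (m + n)%N [seq (m + x)%N | x <- l] b = (m + nth n l b)%N.
  case: (ltnP b (size l)) => h; first by rewrite (nth_map n).
  by rewrite !nth_default ?size_map.
rewrite /Emx; case: (split_ordP i) => j -> /=.
  rewrite big1 => [|c _]; last by rewrite col_mxEu mxE mul0r.
  case: eqP => // e; have := ltn_ord j.
  by rewrite e ltnNge leq_addr.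
rewrite (bigD1 j) //= col_mxEd mxE eqxx mul1r big1 ?addr0 => [|c ne].
  by rewrite eqn_add2l.
by rewrite col_mxEd mxE eq_sym (negbTE ne) mul0r.
Qed.

Lemma pull_Emx_zform m n k s :
  pull (Emx m n) (zform k s) = zform k [seq (t.1, [seq (m + x)%N | x <- t.2]) | t <- s].
Proof.
rewrite /zform pull_sum big_map; apply: eq_bigr => t _.
by rewrite pullZ pull_Emx_bform.
Qed.

(** The matrix of Jmul: Jmul u = u Jmx. *)
Definition Jmx n : 'M[K]_(n + n) := block_mx 0 1%:M (- 1%:M) 0.

(** The one-form dx^x composed with J is, up to the sign jsgn, the coordinate
    form with index jidx n x. *)
Definition jidx n x := if (x < n)%N then (n + x)%N else (x - n)%N.
Definition jsgn n (l : seq nat) : int := foldr (fun x s => if (x < n)%N then - s else s) 1 l.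

Lemma pull_Jmx_dxi n x : (x < n + n)%N ->
  (fun i => \sum_j Jmx n i j * dxi x j) = (jsgn n [:: x])%:~R *: dxi (jidx n x).
Proof.
move=> hx; apply: funext => i; rewrite -[RHS]/((jsgn n [:: x])%:~R * dxi (jidx n x) i).
rewrite (bigD1 (Ordinal hx)) //= big1 => [|c ne]; last first.
  by rewrite /dxi (negbTE (_ : val c != x)) ?mulr0.
rewrite addr0 /dxi eqxx mulr1 /Jmx /jidx /=.
case: (split_ordP (Ordinal hx)) => j e; rewrite e; have /= -> := congr1 val e.
  rewrite rmorphN1 mulN1r; case: (split_ordP i) => a ->.
    by rewrite block_mxEul mxE /= [_ == _](_ : _ = false) ?oppr0 //; apply/eqP => h;
      have := ltn_ord a; rewrite h ltnNge leq_addr.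
  by rewrite block_mxEdl !mxE /= eqn_add2l val_eqE.
rewrite addKn mul1r; case: (split_ordP i) => a ->.
  by rewrite block_mxEur mxE /= val_eqE.
by rewrite block_mxEdr mxE /= [_ == _](_ : _ = false) //; apply/eqP => h;
  have := ltn_ord j; rewrite -h ltnNge leq_addr.
Qed.

Lemma pull_Jmx_bform n k l : size l = k -> all (fun x => (x < n + n)%N) l ->
  pull (Jmx n) (bform k l) = zform k [:: (jsgn n l, [seq jidx n x | x <- l])].
Proof.
rewrite /zform big_seq1; elim: k l => [|k IH] [|x l] //= sl.
  by move=> _; rewrite scale1r /bform pull_iform.
case: sl => sl /andP[hx hl]; rewrite !bform_cons pull_wedge1 pull_Jmx_dxi // IH //.
rewrite wedge1Zl wedge1Zr scalerA /jsgn /=; congr (_ *: _).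
by case: ifP => _; rewrite ?rmorphN1 ?mulN1r ?mul1r ?rmorphN.
Qed.

Lemma JmxE n (u : 'rV[K]_(n + n)) : u *m Jmx n = row_mx (- rsubmx u) (lsubmx u).
Proof.
rewrite -[in LHS](hsubmxK u) /Jmx mul_row_block !mulmx0 !mulmx1 add0r addr0.
by rewrite mulmxN mulmx1.
Qed.

Lemma Jmx_sq n : Jmx n *m Jmx n = - 1%:M.
Proof.
rewrite /Jmx mulmx_block !mul0mx !mulmx0 !mulmx1 !mul1mx !add0r !addr0.
by rewrite scalar_mx_block opp_block_mx oppr0.
Qed.

Lemma vals_fid n : vals (fid n) = iota 0 n.
Proof.
rewrite /vals -[RHS](val_enum_ord n); apply: eq_map => c; by rewrite ffunE.
Qed.

Lemma zform_top n s : zwf n s -> zform n s = (zval s (iota 0 n))%:~R *: (eps : covec K n n).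
Proof.
move=> ws; rewrite (top_alt (alt_zform (K := K) (n := n) (k := n) s)) zformE //.
by rewrite vals_fid.
Qed.

(** A permutation of the first p of p + q indices. *)
Definition bperm p q (s : 'S_p) : {ffun 'I_(p + q) -> 'I_(p + q)} :=
  [ffun c => match fintype.split c with inl c1 => lshift q (s c1) | inr c2 => rshift p c2 end].

Lemma bperm_l p q (s : 'S_p) c : @bperm p q s (lshift q c) = lshift q (s c).
Proof. by rewrite ffunE; case: split_ordP => d /eqP; rewrite ?eq_lshift ?eq_lrshift // => /eqP->. Qed.

Lemma bperm_r p q (s : 'S_p) c : @bperm p q s (rshift p c) = rshift p c.
Proof. by rewrite ffunE; case: split_ordP => d /eqP; rewrite ?eq_rshift ?eq_rlshift // => /eqP->. Qed.

Lemma bperm_inj p q (s : 'S_p) : injective (@bperm p q s).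
Proof.
move=> c d; rewrite !ffunE; case: split_ordP => c' ->; case: split_ordP => d' -> /eqP;
  rewrite ?eq_lshift ?eq_rshift ?eq_lrshift ?eq_rlshift //.
  by move=> /eqP/perm_inj->.
by move=> /eqP->.
Qed.

Lemma sign_bperm p q (s : 'S_p) : (-1) ^+ perm (@bperm_inj p q s) = (-1) ^+ s :> K.
Proof.
rewrite -!det_perm; have -> : perm_mx (perm (@bperm_inj p q s)) = block_mx (perm_mx s) 0 0 1%:M :> 'M[K]_(p + q).
  apply/matrixP => i j; rewrite !mxE permE ffunE.
  case: (split_ordP i) => a _; rewrite !mxE; case: (split_ordP j) => b ->;
    by rewrite ?mxE ?eq_lshift ?eq_rshift ?eq_lrshift ?eq_rlshift.
by rewrite det_lblock det1 mulr1.
Qed.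

Lemma alt_fcat n p q (a : covec K n (p + q)) (J : {ffun 'I_q -> 'I_n}) :
  is_alternating a -> is_alternating (fun I : {ffun 'I_p -> 'I_n} => a (fcat I J)).
Proof.
move=> ha s I; rewrite -(sign_bperm q s) -ha; congr (a _).
apply/ffunP => c; rewrite [RHS]ffunE permE.
case: (split_ordP c) => d ->; first by rewrite bperm_l !fcat_l ffunE.
by rewrite bperm_r !fcat_r.
Qed.

Lemma vals_flist n' k l : l \in lists n'.+1 k -> vals (flist k l : {ffun 'I_k -> 'I_n'.+1}) = l.
Proof.
move=> hl; have sl := size_lists hl.
apply: (@eq_from_nth _ 0%N); first by rewrite size_vals.
move=> i; rewrite size_vals => hi; rewrite (nth_vals 0 _ (Ordinal hi)) ffunE /=.
apply: inordK; have : nth 0%N l i \in l by rewrite mem_nth ?sl.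
move: (nth _ _ _) => y; clear sl hi; move: hl; move: (n'.+1) => d.
elim: k l => [|k IH] l /=; first by rewrite inE => /eqP->.
move=> /flattenP[t /mapP[x hx ->] /mapP[l' /IH h ->]]; rewrite inE => /orP[/eqP->|/h//].
by move: hx; rewrite mem_iota.
Qed.

Lemma pairing_list n' k l (c : covec K n'.+1 k) : is_alternating c ->
  l \in lists n'.+1 k -> pairing (bform k l) c = k`!%:R * c (flist k l).
Proof. by move=> hc hl; rewrite -{1}(vals_flist hl) pairing_bform. Qed.

End MoreForms.

Section Euclidean.
Context {R : realType} {n' : nat}.
Local Notation n := n'.+1.

Lemma inner1_list k l (c : covec R n k) : is_alternating c -> l \in lists n k ->
  inner 1%:M (bform k l) c = c (flist k l).
Proof.
move=> hc hl; by rewrite innerE invmx1 pull1 pairing_list // mulrA mulVf ?mul1r // pnatr_eq0 -lt0n fact_gt0.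
Qed.

Lemma inner1_zform k s t : all (fun u => u.2 \in lists n k) s -> zwf k t ->
  inner 1%:M (zform k s) (zform k t : covec R n k) =
  (zsum (zval t) s)%:~R.
Proof.
move=> /allP hs wt; rewrite {1}/zform inner_suml zsumE.
rewrite big_seq [RHS]big_seq; apply: eq_bigr => u /hs hu.
rewrite innerZl inner1_list //; last exact: alt_zform.
by rewrite zformE // vals_flist.
Qed.

Lemma hodgeD p q g (vol : covec R n (p + q)) (a b : covec R n p) :
  hodge g vol (a + b) = hodge g vol a + hodge g vol b.
Proof.
apply: covecP => J; rewrite covecD /hodge -mulrDr -big_split; congr (_ * _).
apply: eq_bigr => I _ /=; rewrite -big_split; apply: eq_bigr => I' _ /=.
by rewrite covecD !mulrDl.
Qed.

Lemma hodgeZ p q g (vol : covec R n (p + q)) c (a : covec R n p) :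
  hodge g vol (c *: a) = c *: hodge g vol a.
Proof.
apply: covecP => J; rewrite covecZ /hodge mulrCA; congr (_ * _).
rewrite big_distrr; apply: eq_bigr => I _ /=; rewrite big_distrr; apply: eq_bigr => I' _ /=.
by rewrite covecZ -!mulrA.
Qed.

Lemma hodge_sum p q g (vol : covec R n (p + q)) (T : Type) (s : seq T)
    (F : T -> covec R n p) :
  hodge g vol (\sum_(t <- s) F t) = \sum_(t <- s) hodge g vol (F t).
Proof.
elim: s => [|t s IH]; last by rewrite !big_cons hodgeD IH.
rewrite !big_nil; have := hodgeZ g vol 0 0; by rewrite !scale0r.
Qed.

End Euclidean.

(** The Euclidean Hodge star for the orientation opposite to that of the
    coordinates, which is the one induced by dr /\ (i Omega /\ conj Omega). *)
Lemma hodge1_zform (R : realType) p q (s : seq (int * seq nat)) J :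
  all (fun u => u.2 \in lists (p + q).+1 p.+1) s ->
  @hodge R (p + q).+1 p.+1 q 1%:M (- eps) (zform p.+1 s) J =
  (zsum (fun l => - sgl (iota 0 (p + q).+1) (l ++ vals J)) s)%:~R.
Proof.
move=> /allP hs; rewrite /zform hodge_sum covec_sum zsumE.
rewrite big_seq [RHS]big_seq; apply: eq_bigr => u /hs hu.
rewrite hodgeZ covecZ hodgeE invmx1 trmx1 pull1 pairing_list //; last first.
  apply: (@alt_fcat R (p + q).+1 p.+1 q) => s' I'.
  by rewrite !covecN alt_eps mulrN.
rewrite mulKf ?pnatr_eq0 -?lt0n ?fact_gt0 // covecN eps_bform bformE ?size_iota //.
by rewrite vals_fcat vals_flist // rmorphN.
Qed.
(** * The standard SU(3)- and G2-structures *)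

(** The real part rho_l and the imaginary part iota_l of dz^0 /\ dz^1 /\ dz^2,
    and the standard hermitian form om_l, on C^3 with coordinates z_j = x_j + i
    x_(3+j). *)
Definition rho_l : seq (int * seq nat) :=
  [:: (1, [:: 0; 1; 2]%N); (-1, [:: 0; 4; 5]%N); (-1, [:: 3; 1; 5]%N); (-1, [:: 3; 4; 2]%N)].
Definition iota_l : seq (int * seq nat) :=
  [:: (1, [:: 3; 1; 2]%N); (1, [:: 0; 4; 2]%N); (1, [:: 0; 1; 5]%N); (-1, [:: 3; 4; 5]%N)].
Definition om_l : seq (int * seq nat) :=
  [:: (1, [:: 0; 3]%N); (1, [:: 1; 4]%N); (1, [:: 2; 5]%N)].

(** Pullback to R^7, whose coordinate 0 is the circle coordinate. *)
Definition lshiftl (s : seq (int * seq nat)) : seq (int * seq nat) :=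
  [seq (t.1, [seq (1 + x)%N | x <- t.2]) | t <- s].
Definition zscale (c : int) (s : seq (int * seq nat)) : seq (int * seq nat) :=
  [seq (c * t.1, t.2) | t <- s].
Definition zcons (x : nat) (s : seq (int * seq nat)) : seq (int * seq nat) :=
  [seq (t.1, x :: t.2) | t <- s].
(** Contraction with the coordinate vector of index c. *)
Definition zcontr (c : nat) (s : seq (int * seq nat)) : seq (int * seq nat) :=
  flatten [seq [seq ((if odd j then - t.1 else t.1), rm j t.2)
    | j <- iota 0 (size t.2) & nth 0%N t.2 j == c] | t <- s].

Definition phi_l := lshiftl rho_l ++ zscale (-1) (zcons 0 (lshiftl om_l)).
(** Half of the square of om_l. *)
Definition om2_l : seq (int * seq nat) :=
  [:: (1, [:: 0; 3; 1; 4]%N); (1, [:: 0; 3; 2; 5]%N); (1, [:: 1; 4; 2; 5]%N)].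
Definition psi_l := zscale (-1) (zcons 0 (lshiftl iota_l)) ++ zscale (-1) (lshiftl om2_l).

(** Twice the product of the basis form l with om_l. *)
Definition zsigma_b (l : seq nat) := zscale 2 (zmul [:: (1, l)] om_l).
(** The product of dx^a with the square of om_l. *)
Definition zsigma_l (a : nat) := zcons a (zmul om_l om_l).
(** The product with om_l of the one-form dual to the 5-form s, as in star5. *)
Definition zstar5w (s : seq (int * seq nat)) : seq (int * seq nat) :=
  flatten [seq zscale ((-1) ^+ a * zval s (rm a (iota 0 6))) (zcons a om_l) | a <- iota 0 6].

(** The identity of hodge_beta on the basis form l, with the degree conditions
    that make the list operations meaningful. *)
Definition check_beta (l : seq nat) :=
  [&& all (fun x => x < 3 + 3)%N l, zwf 5 (zsigma_b l),
     all (fun t => t.2 \in lists (3 + 3).+1 4) (zcons 0 (lshiftl [:: (1, l)])),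
     zwf 3 (lshiftl (zscale 2 [:: (jsgn 3 l, [seq jidx 3 x | x <- l])] ++ zstar5w (zsigma_b l))) &
     all (fun m => 2 * zsum (fun l => - sgl (iota 0 (3 + 3).+1) (l ++ m)) (zcons 0 (lshiftl [:: (1, l)]))
       == zval (lshiftl (zscale 2 [:: (jsgn 3 l, [seq jidx 3 x | x <- l])] ++ zstar5w (zsigma_b l))) m)
       (lists 7 3)].
Lemma check_betaT : all check_beta (slists 6 3). Proof. by vm_compute. Qed.

(** The identity of hodge_lam on the one-form dx^a. *)
Definition check_lam (a : nat) :=
  [&& zwf 5 (zsigma_l a),
     all (fun t => t.2 \in lists (3 + 3).+1 4) (zcons 0 (lshiftl (zcons a om_l))),
     zwf 3 (lshiftl (zstar5w (zsigma_l a))) &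
     all (fun m => 2 * zsum (fun l => - sgl (iota 0 (3 + 3).+1) (l ++ m)) (zcons 0 (lshiftl (zcons a om_l)))
       == zval (lshiftl (zstar5w (zsigma_l a))) m)
       (lists 7 3)].
Lemma check_lamT : all check_lam (iota 0 6). Proof. by vm_compute. Qed.

Definition check_inner_lam (a : nat) :=
  all (fun t => t.2 \in lists 7 4) (lshiftl (zcons a rho_l))
   && (zsum (zval psi_l) (lshiftl (zcons a rho_l)) == 0).
Lemma check_inner_lamT : all check_inner_lam (iota 0 6). Proof. by vm_compute. Qed.

Definition check_inner_beta (l : seq nat) :=
  [&& zwf 6 (zmul [:: (1, l)] rho_l),
     all (fun t => t.2 \in lists 7 4) (zcons 0 (lshiftl [:: (1, l)])) &
     zsum (zval psi_l) (zcons 0 (lshiftl [:: (1, l)])) == - zval (zmul [:: (1, l)] rho_l) (iota 0 6)].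
Lemma check_inner_betaT : all check_inner_beta (slists 6 3). Proof. by vm_compute. Qed.

Lemma dual63 : sgl_dual 6 3. Proof. by vm_compute. Qed.

Section Model.
Context {R : realType}.
Implicit Types (u v : 'rV[R]_7).

Definition rho0 : covec R 6 3 := zform 3 rho_l.
Definition iota0 : covec R 6 3 := zform 3 iota_l.
Definition om0 : covec R 6 2 := zform 2 om_l.
Definition phi0 : covec R 7 3 := zform 3 phi_l.
Definition psi0 : covec R 7 4 := zform 4 psi_l.
Definition vol0 : covec R 7 7 := - eps.

Lemma zform2 n k s : 2 *: zform k s = zform k (zscale 2 s) :> covec R n k.
Proof. by rewrite -zformZ. Qed.

(** Contractions of integral forms are computed on lists. *)
Lemma zcontrE k s (c : 'I_7) : zwf k.+1 s -> zwf k (zcontr c s) ->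
  all (fun m => zval s ((c : nat) :: m) == zval (zcontr c s) m) (lists 7 k) ->
  interior_product (delta_mx 0 c) (zform k.+1 s : covec R 7 k.+1) = zform k (zcontr c s).
Proof.
move=> ws wc /allP h; apply: covecP => I.
rewrite interior_delta !zformE // vals_fcons.
by rewrite (eqP (h _ (vals_lists I))).
Qed.

Lemma contr_phi0 (c : 'I_7) :
  interior_product (delta_mx 0 c) phi0 = zform 2 (zcontr c phi_l).
Proof.
have h : all (fun c : nat => [&& zwf 2 (zcontr c phi_l) &
   all (fun m => zval phi_l (c :: m) == zval (zcontr c phi_l) m) (lists 7 2)]) (iota 0 7).
  by vm_compute.
have mi : val c \in iota 0 7 by rewrite mem_iota /=.
by have /andP[h1 h2] := allP h _ mi; rewrite -zcontrE.
Qed.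

Lemma contr_psi0 (c : 'I_7) :
  interior_product (delta_mx 0 c) psi0 = zform 3 (zcontr c psi_l).
Proof.
have h : all (fun c : nat => [&& zwf 3 (zcontr c psi_l) &
   all (fun m => zval psi_l (c :: m) == zval (zcontr c psi_l) m) (lists 7 3)]) (iota 0 7).
  by vm_compute.
have mi : val c \in iota 0 7 by rewrite mem_iota /=.
by have /andP[h1 h2] := allP h _ mi; rewrite -zcontrE.
Qed.

Lemma interior_rV k (u : 'rV[R]_7) (a : covec R 7 k.+1) :
  interior_product u a = \sum_(c < 7) u 0 c *: interior_product (delta_mx 0 c) a.
Proof.
by rewrite {1}(row_sum_delta u) interior_sum; apply: eq_bigr => c _; rewrite interiorZ.
Qed.

Lemma dot_rV u v : (u *m v^T) 0 0 = \sum_(c < 7) u 0 c * v 0 c.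
Proof. by rewrite mxE; apply: eq_bigr => c _; rewrite mxE. Qed.

Lemma sum_delta u v (F : 'I_7 -> 'I_7 -> R) a :
  (forall c d, F c d = a * (c == d)%:R) ->
  \sum_(c < 7) \sum_(d < 7) u 0 c * v 0 d * F c d = a * (u *m v^T) 0 0.
Proof.
move=> h; rewrite dot_rV big_distrr; apply: eq_bigr => c _ /=.
rewrite (bigD1 c) //= big1 => [|d ne]; rewrite h.
  by rewrite eqxx mulr1 addr0 mulrC.
by rewrite eq_sym (negbTE ne) !mulr0.
Qed.

Lemma wedge3_bilin u v p q (A B : 'I_7 -> covec R 7 p) (f : covec R 7 q) :
  wedge (wedge (\sum_(c < 7) u 0 c *: A c) (\sum_(d < 7) v 0 d *: B d)) f
  = \sum_(c < 7) \sum_(d < 7) (u 0 c * v 0 d) *: wedge (wedge (A c) (B d)) f.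
Proof.
rewrite !wedge_suml; apply: eq_bigr => c _.
rewrite wedge_sumr wedge_suml; apply: eq_bigr => d _.
by rewrite (wedgeZl (u 0 c)) (wedgeZr (v 0 d)) 2!wedgeZl scalerA.
Qed.

(** The identity is bilinear in u and v, hence reduces to 49 products of
    integral forms. *)
Lemma phi0_G2 u v :
  wedge (wedge (interior_product u phi0) (interior_product v phi0)) phi0
  = (- 6 * (u *m v^T) 0 0) *: vol0.
Proof.
rewrite (interior_rV u) (interior_rV v).
have h : all (fun c => all (fun d =>
    zval (zmul (zmul (zcontr c phi_l) (zcontr d phi_l)) phi_l) (iota 0 7)
      == (if c == d then 6 else 0)) (iota 0 7)) (iota 0 7) by vm_compute.
have hw : all (fun c => zwf 2 (zcontr c phi_l)) (iota 0 7) by vm_compute.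
have hw4 : all (fun c => all (fun d => zwf 4 (zmul (zcontr c phi_l) (zcontr d phi_l))) (iota 0 7)) (iota 0 7) by vm_compute.
have hw7 : all (fun c => all (fun d => zwf 7 (zmul (zmul (zcontr c phi_l) (zcontr d phi_l)) phi_l)) (iota 0 7)) (iota 0 7) by vm_compute.
have mi (c : 'I_7) : val c \in iota 0 7 by rewrite mem_iota /=.
transitivity (\sum_(c < 7) \sum_(d < 7) (u 0 c * v 0 d * (6 * (c == d)%:R)) *: (eps : covec R 7 7)).
  rewrite wedge3_bilin; apply: eq_bigr => c _; apply: eq_bigr => d _.
  rewrite !contr_phi0 wedge_zform; last exact: (allP hw _ (mi c)).
  rewrite [wedge _ _](@wedge_zform R 7 4 3); last exact: (allP (allP hw4 _ (mi c)) _ (mi d)).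
  rewrite zform_top; last exact: (allP (allP hw7 _ (mi c)) _ (mi d)).
  rewrite (eqP (allP (allP h _ (mi c)) _ (mi d))) !scalerA; congr (_ *: _).
  by rewrite val_eqE; case: eqP; rewrite ?mulr1 ?mulr0.
under eq_bigr do rewrite -scaler_suml.
rewrite -scaler_suml; have -> := @sum_delta u v (fun c d => 6 * (c == d)%:R) 6 (fun c d => erefl).
by rewrite /vol0 scalerN -scaleNr mulNr opprK.
Qed.

(** Both sides are integral forms. *)
Lemma hodge_phi0 : @hodge R 7 3 4 1%:M vol0 phi0 = psi0.
Proof.
have h : all (fun m => zsum (fun l => - sgl (iota 0 7) (l ++ m)) phi_l == zval psi_l m) (lists 7 4).
  by vm_compute.
apply: covecP => J; rewrite (@hodge1_zform R 2 4); last by vm_compute.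
by rewrite (eqP (allP h _ (vals_lists J))) /psi0 zformE.
Qed.

(** The Euclidean products of the contractions of psi0 with coordinate vectors
    are 4 on the diagonal and 0 elsewhere. *)
Lemma inner_psi0 u v :
  inner 1%:M (interior_product u psi0) (interior_product v psi0) = 4 * (u *m v^T) 0 0.
Proof.
rewrite (interior_rV u) (interior_rV v) inner_suml.
have h : all (fun c => all (fun d =>
    zsum (zval (zcontr d psi_l)) (zcontr c psi_l) == (if c == d then 4 else 0)) (iota 0 7)) (iota 0 7) by vm_compute.
have hw : all (fun c => zwf 3 (zcontr c psi_l)) (iota 0 7) by vm_compute.
have hl : all (fun c => all (fun t => t.2 \in lists 7 3) (zcontr c psi_l)) (iota 0 7) by vm_compute.
have mi (c : 'I_7) : val c \in iota 0 7 by rewrite mem_iota /=.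
rewrite -(@sum_delta u v (fun c d => 4 * (c == d)%:R)) //.
apply: eq_bigr => c _; rewrite inner_sumr; apply: eq_bigr => d _.
rewrite innerZl innerZr mulrA !contr_psi0 inner1_zform; first last.
- exact: (allP hw _ (mi d)).
- exact: (allP hl _ (mi c)).
rewrite (eqP (allP (allP h _ (mi c)) _ (mi d))); congr (_ * _).
by rewrite val_eqE; case: eqP; rewrite ?mulr1 ?mulr0.
Qed.

Lemma om0_rho0 : wedge om0 rho0 = 0.
Proof.
rewrite wedge_zform // (_ : 0 = zform (2 + 3) [::]); last by rewrite /zform big_nil.
by apply: zform_eq; vm_compute.
Qed.

Lemma om0_cube : wedge (wedge om0 om0) om0 = - 6 *: eps.
Proof.
by rewrite wedge_zform // [LHS](@wedge_zform R 6 4 2) // (@zform_top R 6).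
Qed.

Lemma rho0_iota0 : wedge rho0 iota0 = - 4 *: eps.
Proof.
by rewrite wedge_zform // (@zform_top R 6).
Qed.

Lemma iota0_rho0 : wedge iota0 rho0 = 4 *: eps.
Proof.
by rewrite wedge_zform // (@zform_top R 6).
Qed.

Lemma phi0E : phi0 = pull (Emx 1 6) rho0 - wedge1 (dxi 0) (pull (Emx 1 6) om0).
Proof.
rewrite !pull_Emx_zform wedge1_zform -scaleN1r -[-1 in RHS](rmorphN1 (intmul (1 : R))) zformZ zformD.
by [].
Qed.

Lemma psi0E : psi0 = - wedge1 (dxi 0) (pull (Emx 1 6) iota0)
                     - 2^-1 *: pull (Emx 1 6) (wedge om0 om0).
Proof.
have -> : wedge om0 om0 = 2%:Z%:~R *: zform 4 om2_l.
  by rewrite wedge_zform // zformZ; apply: zform_eq; vm_compute.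
rewrite pullZ !pull_Emx_zform wedge1_zform scalerA mulVf ?pnatr_eq0 // scale1r.
rewrite -scaleN1r -[- zform 4 _]scaleN1r.
rewrite -(rmorphN1 (intmul (1 : R))) !zformZ zformD.
by [].
Qed.

(** Linear maps on alternating tensors that agree on the increasing coordinate
    forms are equal. *)
Lemma lin_ext (V : lmodType R) k (T T' : covec R 6 k -> V) :
  (forall c a b, T (c *: a + b) = c *: T a + T b) ->
  (forall c a b, T' (c *: a + b) = c *: T' a + T' b) ->
  sgl_dual 6 k ->
  (forall l, l \in slists 6 k -> T (bform k l) = T' (bform k l)) ->
  forall a, is_alternating a -> T a = T' a.
Proof.
move=> hT hT' hd h a ha; rewrite (alt_decomp ha hd).
have hs (U : covec R 6 k -> V) : (forall c a b, U (c *: a + b) = c *: U a + U b) ->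
    forall s, U (\sum_(l <- s) a (flist k l) *: bform k l)
      = \sum_(l <- s) a (flist k l) *: U (bform k l).
  move=> hU; elim=> [|l s IH]; last by rewrite !big_cons hU IH.
  by rewrite !big_nil; have := hU (-1) 0 0; rewrite scaler0 addr0 scaleN1r addNr.
rewrite !hs //; apply: eq_big_seq => l hl; by rewrite h.
Qed.

Lemma sum_iota (V : nmodType) d (F : nat -> V) :
  \sum_(a < d) F a = \sum_(a <- iota 0 d) F a.
Proof. by rewrite -(big_mkord xpredT) /index_iota subn0. Qed.

(** For lam = dN and beta = N dw this is d (N w^2). *)
Definition sigma5 (lam : 'I_6 -> R) (beta : covec R 6 3) : covec R 6 5 :=
  wedge1 lam (wedge om0 om0) + 2 *: wedge beta om0.

(** Its value at a is the coefficient of dx^a /\ s with respect to the volume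
    form of R^6. *)
Definition star5 (s : covec R 6 5) : 'I_6 -> R :=
  fun a => (-1) ^+ a * s (flist 5 (rm a (iota 0 6))).

Lemma star5_zform s : zwf 5 s ->
  wedge1 (star5 (zform 5 s)) om0 = zform 3 (zstar5w s).
Proof.
move=> ws; rewrite (dxi_decomp (star5 _)) wedge1_suml.
have hv : all (fun a => rm a (iota 0 6) \in lists 6 5) (iota 0 6) by vm_compute.
pose F a : covec R 6 3 := ((-1) ^+ a * zval s (rm a (iota 0 6)))%:~R *: wedge1 (dxi a) om0.
transitivity (\sum_(a < 6) F a).
  apply: eq_bigr => a _; rewrite wedge1Zl; congr (_ *: _).
  have mi : val a \in iota 0 6 by rewrite mem_iota /=.
  by rewrite /star5 zformE // vals_flist ?(allP hv _ mi) // rmorphM rmorph_sign.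
rewrite (sum_iota 6 F) /F /zstar5w /zform big_flatten big_map.
by apply: eq_bigr => a _; rewrite wedge1_zform zformZ.
Qed.

Lemma zsigma_bE l : size l = 3 -> 2 *: wedge (bform 3 l) om0 = zform 5 (zsigma_b l).
Proof.
move=> sl; have -> : bform 3 l = zform 3 [:: (1, l)] :> covec R 6 3.
  by rewrite /zform big_seq1 scale1r.
rewrite wedge_zform; last by rewrite /zwf /= sl.
by rewrite zform2.
Qed.

(** On R^7 the star of dr /\ beta is J beta for primitive beta; the second term
    on the right corrects the non-primitive part, which is read off from beta
    /\ om0. *)
Lemma hodge_beta (beta : covec R 6 3) : is_alternating beta ->
  2 *: @hodge R 7 4 3 1%:M vol0 (wedge1 (dxi 0) (pull (Emx 1 6) beta))
  = pull (Emx 1 6) (2 *: pull (Jmx 3) beta + wedge1 (star5 (2 *: wedge beta om0)) om0).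
Proof.
move: beta; apply: (lin_ext (V := covec R 7 3)); last first.
- move=> l hl; have sl : size l = 3 by apply: (@size_lists 6); move: hl; rewrite mem_filter => /andP[].
  have /and5P[h1 h2 h3 h4 h5] := allP check_betaT _ hl.
  rewrite (zsigma_bE sl) (star5_zform h2) (@pull_Jmx_bform R 3 3 l sl h1) zform2 zformD pull_Emx_zform.
  have -> : bform 3 l = zform 3 [:: (1, l)] :> covec R 6 3 by rewrite /zform big_seq1 scale1r.
  rewrite pull_Emx_zform [wedge1 _ _](@wedge1_zform R 7 3).
  apply: covecP => J; rewrite covecZ (@hodge1_zform R 3 3 _ J h3) (zformE J h4).
  by rewrite -(eqP (allP h5 _ (vals_lists J))) rmorphM.
- exact: dual63.
- move=> c a b.
  have -> : star5 (2 *: wedge (c *: a + b) om0)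
     = c *: star5 (2 *: wedge a om0) + star5 (2 *: wedge b om0).
    apply: funext => i; rewrite -[RHS]/(c * _ + _) /star5 wedgeDl wedgeZl !covecZ covecD covecZ; ring.
  have -> : 2 *: pull (Jmx 3) (c *: a + b) = c *: (2 *: pull (Jmx 3) a) + 2 *: pull (Jmx 3) b.
    by rewrite pullD pullZ scalerDr !scalerA mulrC.
  by rewrite wedge1Dl wedge1Zl addrACA -scalerDr pullD pullZ.
- move=> c a b; rewrite pullD pullZ wedge1Dr wedge1Zr hodgeD hodgeZ scalerDr; congr (_ + _).
  move: (hodge _ _ _) => X; by rewrite !scalerA mulrC.
Qed.

Lemma om0_sq : wedge om0 om0 = zform 4 (zmul om_l om_l).
Proof. exact: wedge_zform. Qed.

Lemma wedge1_om0 a : wedge1 (dxi a) om0 = zform 3 (zcons a om_l).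
Proof. exact: wedge1_zform. Qed.

(** The star of dr /\ lam /\ om0, written in terms of the 5-form lam /\ om0^2
    in order to cancel the correction in hodge_beta. *)
Lemma hodge_lam (lam : 'I_6 -> R) :
  2 *: @hodge R 7 4 3 1%:M vol0 (wedge1 (dxi 0) (pull (Emx 1 6) (wedge1 lam om0)))
  = pull (Emx 1 6) (wedge1 (star5 (wedge1 lam (wedge om0 om0))) om0).
Proof.
rewrite (dxi_decomp lam) !wedge1_suml.
have -> : star5 (\sum_(c < 6) wedge1 (lam c *: dxi c) (wedge om0 om0)) =
   \sum_(c < 6) lam c *: star5 (wedge1 (dxi c) (wedge om0 om0)).
  apply: funext => i; rewrite /star5 !fct_sumE big_distrr; apply: eq_bigr => c _.
  by rewrite wedge1Zl covecZ -[RHS]/(_ * _) mulrCA.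
rewrite wedge1_suml !pull_sum wedge1_sumr hodge_sum scaler_sumr; apply: eq_bigr => c _.
rewrite !wedge1Zl !pullZ wedge1Zr hodgeZ scalerA mulrC -scalerA; congr (_ *: _).
have mi : val c \in iota 0 6 by rewrite mem_iota /=.
rewrite om0_sq wedge1_om0 (@wedge1_zform R 6 4).
have /and4P[h2 h3 h4 h5] := allP check_lamT _ mi.
rewrite (star5_zform h2) !pull_Emx_zform [wedge1 _ _](@wedge1_zform R 7 3).
apply: covecP => J; rewrite covecZ (@hodge1_zform R 3 3 _ J h3) (zformE J h4).
by rewrite -(eqP (allP h5 _ (vals_lists J))) rmorphM.
Qed.

(** When sigma5 vanishes, the corrections in hodge_beta and hodge_lam cancel
    and only J beta remains. *)
Lemma hodge_balanced (lam : 'I_6 -> R) (beta : covec R 6 3) :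
  is_alternating beta -> sigma5 lam beta = 0 ->
  @hodge R 7 4 3 1%:M vol0 (wedge1 (dxi 0) (pull (Emx 1 6) (wedge1 lam om0 + beta)))
  = pull (Emx 1 6) (pull (Jmx 3) beta).
Proof.
move=> hb hs; have e2 : (2 : R) != 0 by rewrite pnatr_eq0.
have e : star5 (wedge1 lam (wedge om0 om0)) + star5 (2 *: wedge beta om0) = 0.
  apply: funext => i; rewrite -[LHS]/(_ * _ + _ * _) -mulrDr.
  have := congr1 (fun f : covec R 6 5 => f (flist 5 (rm i (iota 0 6)))) hs.
  by rewrite /sigma5 covecD => ->; rewrite mulr0.
apply: (scalerI e2).
rewrite pullD wedge1Dr hodgeD scalerDr hodge_lam hodge_beta // -pullD addrC -addrA.
by rewrite -wedge1Dl [_ + star5 _]addrC e -(scale0r (0 : 'I_6 -> R)) wedge1Zl scale0r addr0 pullZ.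
Qed.

(** The form lam /\ rho0 has no component along psi0: the terms of psi0 without
    dr lie in om0^2, which is orthogonal to it. *)
Lemma inner_lam_psi0 (lam : 'I_6 -> R) :
  inner 1%:M (pull (Emx 1 6) (wedge1 lam rho0)) psi0 = 0.
Proof.
rewrite (dxi_decomp lam) wedge1_suml pull_sum inner_suml big1 // => c _.
have mi : val c \in iota 0 6 by rewrite mem_iota /=.
have /andP[h1 h2] := allP check_inner_lamT _ mi.
rewrite wedge1Zl pullZ innerZl wedge1_zform pull_Emx_zform inner1_zform //.
by rewrite (eqP h2) mulr0.
Qed.

(** Only the component of psi0 along dr contributes, namely - dr /\ iota0;
    pairing beta with iota0 amounts to multiplying it by rho0. *)
Lemma inner_beta_psi0 (beta : covec R 6 3) : is_alternating beta ->
  inner 1%:M (wedge1 (dxi 0) (pull (Emx 1 6) beta)) psi0 = - wedge beta rho0 (fid 6).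
Proof.
move: beta; apply: (lin_ext (V := R^o)); last first.
- move=> l hl; have sl : size l = 3 by apply: (@size_lists 6); move: hl; rewrite mem_filter => /andP[].
  have /and3P[h1 h2 h3] := allP check_inner_betaT _ hl.
  have -> : bform 3 l = zform 3 [:: (1, l)] :> covec R 6 3 by rewrite /zform big_seq1 scale1r.
  rewrite pull_Emx_zform [wedge1 _ _](@wedge1_zform R 7 3) inner1_zform //.
  rewrite wedge_zform ?zformE //; last by rewrite /zwf /= sl.
  by rewrite vals_fid (eqP h3) rmorphN.
- exact: dual63.
- move=> c a b; rewrite wedgeDl wedgeZl covecD covecZ opprD -[c *: _]/(c * _); by rewrite mulrN.
- by move=> c a b; rewrite pullD pullZ wedge1Dr wedge1Zr innerDl innerZl.
Qed.

End Model.

(** * Unitary frames for hermitian forms *)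

Section Pull2.
Context {K : numFieldType}.

Definition e0 n : {ffun 'I_0 -> 'I_n} := ffun0 (card_ord 0).

Lemma pull0 m n (P : 'M[K]_(m, n)) (a : covec K n 0) I : pull P a I = a (e0 n).
Proof.
rewrite /pull (bigD1 (e0 n)) //= [X in _ + X]big1 => [|J /negP[]]; last by apply/eqP/ffunP => -[].
by rewrite big_ord0 mulr1 addr0.
Qed.

(** The bilinear form defined by a 2-covector; eval2 is the case of R^(n + n).
    *)
Definition bil n (a : covec K n 2) (u v : 'rV[K]_n) : K :=
  interior_product v (interior_product u a) (e0 n).

Lemma bil_pull m n (P : 'M[K]_(m, n)) a u v :
  bil (pull P a) u v = bil a (u *m P) (v *m P).
Proof. by rewrite /bil !pull_interior pull0. Qed.

Lemma bilE n (a : covec K n 2) u v :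
  bil a u v = \sum_i \sum_j u 0 i * v 0 j * bil a (delta_mx 0 i) (delta_mx 0 j).
Proof.
rewrite exchange_big; apply: eq_bigr => j _; rewrite /bil {1}/interior_product big_distrr.
apply: eq_bigr => i _ /=; rewrite /interior_product.
rewrite (bigD1 j) //= [X in _ = _ * (_ + X)]big1 => [|k /negbTE ne]; last first.
  by rewrite mxE eqxx ne mul0r.
rewrite mxE !eqxx mul1r addr0 (bigD1 i) //= big1 => [|k /negbTE ne]; last first.
  by rewrite mxE eqxx ne mul0r.
by rewrite mxE !eqxx mul1r addr0 mulrA (mulrC (v 0 j)).
Qed.

Lemma bil_inj n (a b : covec K n 2) : (forall u v, bil a u v = bil b u v) -> a = b.
Proof.
move=> h; apply: covecP => I.
have E (c : covec K n 2) : c I = bil c (delta_mx 0 (I ord0)) (delta_mx 0 (I (lift ord0 ord0))).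
  rewrite /bil !interior_delta; congr (c _); apply/ffunP => i.
  case: (unliftP ord0 i) => [j|] ->; last by rewrite fcons_at.
  by rewrite fcons_lift; case: (unliftP ord0 j) => [k|] ->; [case: k | rewrite fcons_at].
by rewrite !E h.
Qed.

End Pull2.

Section HermitianAlgebra.
Context {R : realType}.
Notation J := (@Jmx R 3).

(** The metric g(u, v) = w(u, J v) of a hermitian form w. *)
Definition Gmx (w : covec R (3 + 3) 2) : 'M[R]_(3 + 3) :=
  \matrix_(a, b) bil w (delta_mx 0 a) (delta_mx 0 b *m J).

Lemma bil_linr m (w : covec R m 2) u v v' c :
  bil w u (c *: v + v') = c * bil w u v + bil w u v'.
Proof.
rewrite /bil /interior_product big_distrr -big_split; apply: eq_bigr => d _ /=.
by rewrite !mxE mulrDl mulrA.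
Qed.

Lemma GmxE w u v : bil w u (v *m J) = (u *m Gmx w *m v^T) 0 0.
Proof.
have lin (F : 'rV[R]_(3 + 3) -> R) : (forall c v v', F (c *: v + v') = c * F v + F v') ->
    forall v, F v = \sum_j v 0 j * F (delta_mx 0 j).
  move=> hF v'; rewrite {1}(row_sum_delta v').
  have F0 : F 0 = 0 by have := hF (-1) 0 0; rewrite scaler0 addr0 mulN1r addNr.
  by elim: (index_enum _) => [|j s IH]; rewrite ?big_nil // !big_cons hF IH.
rewrite (lin (fun v => bil w u (v *m J))) => [|c x y]; last first.
  by rewrite mulmxDl -scalemxAl bil_linr.
rewrite mxE; apply: eq_bigr => j _; rewrite mxE [RHS]mulrC mxE; congr (_ * _).
rewrite (lin (fun u => bil w u (delta_mx 0 j *m J))) => [|c x y].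
  by apply: eq_bigr => i _; rewrite mxE.
rewrite /bil /interior_product big_distrr -big_split; apply: eq_bigr => d _ /=.
rewrite [c * _]mulrCA -mulrDr; congr (_ * _); rewrite big_distrr -big_split; apply: eq_bigr => e _ /=.
by rewrite !mxE mulrDl mulrA.
Qed.

Lemma Gmx_om0 : Gmx om0 = 1%:M.
Proof.
have h : all (fun i => all (fun j =>
    zval om_l [:: i; j] == (if (j < 3)%N then 0 else (i == j - 3)%N%:R) - (if (i < 3)%N then 0 else (j == i - 3)%N%:R))
   (iota 0 6)) (iota 0 6) by vm_compute.
have E (i j : 'I_(3 + 3)) : bil om0 (delta_mx 0 i) (delta_mx 0 j) = (zval om_l [:: val i; val j])%:~R.
  rewrite /bil !interior_delta /om0 zformE // !vals_fcons.
  by rewrite (_ : vals _ = [::]) // /vals enum_ord0.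
apply/matrixP => i j; rewrite !mxE JmxE.
have mi (k : 'I_(3 + 3)) : val k \in iota 0 6 by rewrite mem_iota; case: k.
case: (split_ordP j) => j' ej.
  have -> : row_mx (- rsubmx (delta_mx 0 j)) (lsubmx (delta_mx 0 j)) = delta_mx 0 (rshift 3 j') :> 'rV[R]_(3 + 3).
    apply/rowP => k; case: (split_ordP k) => k' ->; rewrite ?row_mxEl ?row_mxEr !mxE ej.
      by rewrite eq_rlshift eq_lrshift oppr0.
    by rewrite eq_lshift eq_rshift.
  rewrite E (eqP (allP (allP h _ (mi _)) _ (mi _))) ej /=.
  case: (split_ordP i) => i' ->.
    by rewrite subr0 eq_lshift -val_eqE addKn; case: eqP.
  rewrite eq_rlshift [(val (rshift 3 i') == _)%N](_ : _ = false).
    by rewrite [(_ == val (rshift 3 i') - 3)%N](_ : _ = false) // /=; apply/eqP;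
      have := ltn_ord i'; have := ltn_ord j'; lia.
  by rewrite /=; apply/eqP; have := ltn_ord i'; have := ltn_ord j'; lia.
have -> : row_mx (- rsubmx (delta_mx 0 j)) (lsubmx (delta_mx 0 j)) = - delta_mx 0 (lshift 3 j') :> 'rV[R]_(3 + 3).
  apply/rowP => k; case: (split_ordP k) => k' ->; rewrite ?row_mxEl ?row_mxEr !mxE ej.
    by rewrite eq_lshift eq_rshift.
  by rewrite eq_rlshift eq_lrshift oppr0.
rewrite -[- delta_mx _ _]addr0 -scaleN1r bil_linr E.
have -> : bil om0 (delta_mx 0 i) 0 = 0 :> R.
  by rewrite /bil /interior_product big1 // => d _; rewrite mxE mul0r.
rewrite addr0 mulN1r (eqP (allP (allP h _ (mi _)) _ (mi _))) ej /=.
have hj : (j' < 3)%N by exact: ltn_ord.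
rewrite hj sub0r rmorphN opprK; case: (split_ordP i) => i' ->.
  by rewrite eq_lrshift rmorph0.
rewrite eq_rshift -val_eqE eq_sym (_ : (val (rshift 3 i') - 3)%N = val i'); last by rewrite /= addKn.
by case: eqP.
Qed.

Lemma Gmx_pull (P : 'M[R]_(3 + 3)) w : P *m J = J *m P ->
  Gmx (pull P w) = P *m Gmx w *m P^T.
Proof.
move=> PJ; apply/matrixP => i j; rewrite mxE bil_pull -mulmxA -PJ mulmxA GmxE.
transitivity (((delta_mx 0 i : 'rV[R]_(3 + 3)) *m (P *m Gmx w *m P^T) *m (delta_mx j 0 : 'cV[R]_(3 + 3))) 0 0).
  by rewrite trmx_mul trmx_delta !mulmxA.
by rewrite -rowE -colE !mxE.
Qed.

(** Since J is invertible, w is recovered from g. *)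
Lemma Gmx_inj (w w' : covec R (3 + 3) 2) : Gmx w = Gmx w' -> w = w'.
Proof.
move=> h; apply: bil_inj => u v.
have -> : v = (- v *m J) *m J by rewrite -mulmxA Jmx_sq mulmxN mulmx1 opprK.
by rewrite !GmxE h.
Qed.

Lemma herm_anti (G : 'M[R]_(3 + 3)) : J *m G *m J^T = G -> G *m J^T = - (J *m G).
Proof. by move=> JG; rewrite -[in RHS]JG !mulmxA Jmx_sq !mulNmx mul1mx opprK. Qed.

(** Gram-Schmidt for complex subspaces: a vector orthogonal to the rows of Q
    and of Q J exists as long as 2 m < 6, and it is automatically orthogonal to
    its own image under J. *)
Lemma unitary_frame_rows (G : 'M[R]_(3 + 3)) m : (m <= 3)%N -> G^T = G ->
  (forall u : 'rV[R]_(3 + 3), u != 0 -> 0 < (u *m G *m u^T) 0 0) ->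
  J *m G *m J^T = G ->
  exists Q : 'M[R]_(m, 3 + 3), Q *m G *m Q^T = 1%:M /\ Q *m G *m (Q *m J)^T = 0.
Proof.
move=> hm sG pG JG; elim: m hm => [|m IH] hm.
  by exists 0; split; apply/matrixP => -[].
have [Q [Q1 Q2]] := IH (ltnW hm).
pose M := row_mx (G *m Q^T) (G *m (Q *m J)^T).
have /rowV0Pn[u /sub_kermxP uM u0] : kermx M != 0.
  rewrite kermx_eq0 /row_free.
  by apply/eqP => e; have := rank_leq_col M; rewrite e; lia.
have [uQ uJQ] : u *m (G *m Q^T) = 0 /\ u *m (G *m (Q *m J)^T) = 0.
  have : row_mx (u *m (G *m Q^T)) (u *m (G *m (Q *m J)^T)) = 0.
    by rewrite -mul_mx_row uM.
  by rewrite -row_mx0 => /eq_row_mx[-> ->].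
have GJ := herm_anti JG.
have uJu : u *m G *m (u *m J)^T = 0.
  have e : (u *m G *m (u *m J)^T)^T = - (u *m G *m (u *m J)^T).
    rewrite !trmx_mul !trmxK sG -!mulmxA (mulmxA G) GJ !(mulmxN, mulNmx).
    by rewrite opprK !mulmxA.
  have := congr1 (fun A : 'M[R]_1 => A 0 0) e; rewrite !mxE => /eqP.
  rewrite -subr_eq0 opprK -mulr2n mulrn_eq0 /= => /eqP h.
  by apply/matrixP => a b; rewrite !ord1 [RHS]mxE -h mxE.
pose c := Num.sqrt ((u *m G *m u^T) 0 0).
have c0 : c != 0 by rewrite gt_eqF // sqrtr_gt0 pG.
pose v := c^-1 *: u.
have vv : v *m G *m v^T = 1%:M.
  rewrite /v linearZ /= -scalemxAl -scalemxAl -scalemxAr scalerA -invfM -expr2.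
  have -> : c ^+ 2 = (u *m G *m u^T) 0 0 by rewrite sqr_sqrtr // ltW // pG.
  apply/matrixP => a b; rewrite !ord1 mxE [RHS]mxE mulVf // gt_eqF //; exact: pG.
suff [Q' [h1 h2]] : exists Q' : 'M[R]_(1 + m, 3 + 3),
  Q' *m G *m Q'^T = 1%:M /\ Q' *m G *m (Q' *m J)^T = 0 by exists Q'.
exists (col_mx v Q); split.
  rewrite tr_col_mx mul_col_mx mul_col_row vv Q1.
  have -> : v *m G *m Q^T = 0 by rewrite -!scalemxAl -mulmxA uQ scaler0.
  have -> : Q *m G *m v^T = 0.
    apply: trmx_inj; rewrite trmx0 !trmx_mul trmxK sG mulmxA.
    by rewrite -!scalemxAl -mulmxA uQ scaler0.
  by rewrite -scalar_mx_block.
rewrite [col_mx v Q *m J]mul_col_mx tr_col_mx mul_col_mx mul_col_row Q2.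
have -> : v *m G *m (v *m J)^T = 0.
  by rewrite -!scalemxAl linearZ /= -scalemxAr uJu !scaler0.
have -> : v *m G *m (Q *m J)^T = 0 by rewrite -!scalemxAl -mulmxA uJQ scaler0.
have -> : Q *m G *m (v *m J)^T = 0.
  rewrite trmx_mul -mulmxA (mulmxA G) GJ mulNmx mulmxN.
  apply/eqP; rewrite oppr_eq0; apply/eqP; apply: trmx_inj.
  rewrite trmx0 !trmx_mul trmxK sG -!mulmxA -trmx_mul.
  by rewrite -!scalemxAl uJQ scaler0.
exact: block_mx0.
Qed.

(** The frame consists of three unitary vectors and their images under J. *)
Lemma unitary_frame (G : 'M[R]_(3 + 3)) : G^T = G ->
  (forall u : 'rV[R]_(3 + 3), u != 0 -> 0 < (u *m G *m u^T) 0 0) ->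
  J *m G *m J^T = G ->
  exists P : 'M[R]_(3 + 3), P *m G *m P^T = 1%:M /\ P *m J = J *m P.
Proof.
move=> sG pG JG; have [Q [Q1 Q2]] := unitary_frame_rows (leqnn 3) sG pG JG.
exists (col_mx Q (Q *m J)); split.
  rewrite tr_col_mx mul_col_mx mul_col_row Q1 Q2.
  have -> : Q *m J *m G *m Q^T = 0.
    apply: trmx_inj; rewrite trmx0 trmx_mul trmxK trmx_mul sG mulmxA; exact: Q2.
  have -> : Q *m J *m G *m (Q *m J)^T = 1%:M.
    by rewrite trmx_mul -Q1 !mulmxA -(mulmxA Q) -(mulmxA Q) JG.
  by rewrite -scalar_mx_block.
rewrite mul_col_mx /Jmx mul_block_col !mul0mx mul1mx add0r addr0 mulNmx mul1mx.
by rewrite -mulmxA -/(Jmx 3) Jmx_sq mulmxN mulmx1.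
Qed.

End HermitianAlgebra.

(** * Complex volume forms and complex linear frames *)

Section ComplexVolume.
Context {R : realType}.
Local Notation C := R[i].
Local Notation ii := (0 +i* 1 : C)%C.
Local Notation J := (@Jmx R 3).

Lemma ii2 : ii * ii = -1.
Proof. by apply/eqP; rewrite eq_complex /=; apply/andP; split; apply/eqP; rewrite /=; ring. Qed.

(** The complex one-form dz^j = dx^j + i dx^(3+j). *)
Definition zdz (j : 'I_3) : 'I_(3 + 3) -> C := dxi j + ii *: dxi (3 + j).

Lemma dzE j : dz j = covec1 (zdz j) :> covec C (3 + 3) 1.
Proof.
apply: covecP => I; rewrite /dz /covec1 -[RHS]/(_ + _ * _) /dxi.
case: (split_ordP (I ord0)) => a -> /=.
  rewrite eq_lshift eq_lrshift -val_eqE [(val a == 3 + j)%N](_ : _ = false); last first.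
    by rewrite ltn_eqF // (leq_trans (ltn_ord a)) // leq_addr.
  by rewrite mulr0 addr0; case: eqP.
rewrite eq_rshift eq_rlshift eqn_add2l -val_eqE [(3 + a == val j)%N](_ : _ = false); last first.
  by rewrite gtn_eqF // (leq_trans (ltn_ord j)) // leq_addr.
by rewrite add0r; case: eqP; rewrite ?mulr1 ?mulr0.
Qed.

Lemma dz123_iform : dz123 = iform 3 (fun b => zdz (inord b)) :> covec C (3 + 3) 3.
Proof.
rewrite /dz123 !dzE -wedge1_one0 wedge_wedge1 wedge_one0; last first.
  by rewrite -wedge1_one0; apply/alt_wedge1/alt_one0.
rewrite [LHS]wedge_wedge1; congr wedge1; rewrite -!wedge1_one0 wedge_wedge1 wedge_one0 //.
exact/alt_wedge1/alt_one0.
Qed.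

Lemma dz123E : dz123 = zform 3 rho_l + ii *: zform 3 iota_l :> covec C (3 + 3) 3.
Proof.
rewrite dz123_iform /= /zdz !inordK //.
rewrite /zform /rho_l /iota_l !big_cons !big_nil !bform_cons.
have -> : bform 0 [::] = one0 :> covec C (3 + 3) 0 by [].
rewrite !(wedge1Dl, wedge1Zl, wedge1Dr, wedge1Zr).
have b3 x y z : bform 3 [:: x; y; z] = wedge1 (dxi x) (wedge1 (dxi y) (wedge1 (dxi z) one0)) :> covec C (3 + 3) 3 by [].
apply: covecP => I; rewrite !(covecD, covecZ).
pose F x y z : C := wedge1 (dxi x) (wedge1 (dxi y) (wedge1 (dxi z) one0)) I.
rewrite /= -!/(F _ _ _) [(0 : covec C (3 + 3) 3) I](_ : _ = 0) // !(mulrA ii ii) ii2 !rmorphN1 !rmorph1.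
move: F; move: ii => i F.
ring.
Qed.

Lemma Re_realM (z : C) (x : R) : complex.Re (x%:C%C * z) = x * complex.Re z.
Proof. by case: z => a b /=; rewrite mul0r subr0. Qed.
Lemma Im_realM (z : C) (x : R) : complex.Im (x%:C%C * z) = x * complex.Im z.
Proof. by case: z => a b /=; rewrite mul0r addr0. Qed.

Lemma Re_sum (T : Type) (s : seq T) (P : pred T) (F : T -> C) :
  complex.Re (\sum_(t <- s | P t) F t) = \sum_(t <- s | P t) complex.Re (F t).
Proof. by apply: (big_morph (@complex.Re R)) => // -[? ?] [? ?]. Qed.
Lemma Im_sum (T : Type) (s : seq T) (P : pred T) (F : T -> C) :
  complex.Im (\sum_(t <- s | P t) F t) = \sum_(t <- s | P t) complex.Im (F t).
Proof. by apply: (big_morph (@complex.Im R)) => // -[? ?] [? ?]. Qed.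

Lemma int_complex (z : int) : z%:~R = ((z%:~R : R)%:C)%C :> C.
Proof. by rewrite rmorph_int. Qed.

Lemma Re_ab (a b : R) : complex.Re (a%:C%C + ii * b%:C%C) = a.
Proof. by rewrite /=; ring. Qed.
Lemma Im_ab (a b : R) : complex.Im (a%:C%C + ii * b%:C%C) = b.
Proof. by rewrite /=; ring. Qed.

Definition reC n k (a : covec C n k) : covec R n k := fun I => complex.Re (a I).
Definition imC n k (a : covec C n k) : covec R n k := fun I => complex.Im (a I).

Lemma re_dz123 : reC dz123 = rho0.
Proof.
apply: covecP => I; rewrite /reC dz123E covecD covecZ /rho0 !zformE // !int_complex.
by rewrite Re_ab.
Qed.

Lemma im_dz123 : imC dz123 = iota0.
Proof.
apply: covecP => I; rewrite /imC dz123E covecD covecZ /iota0 !zformE // !int_complex.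
by rewrite Im_ab.
Qed.

Lemma reC_pull m n k (P : 'M[R]_(m, n)) (a : covec C n k) :
  reC (pull (map_mx (real_complex R) P) a) = pull P (reC a).
Proof.
apply: covecP => I; rewrite /reC /pull Re_sum; apply: eq_bigr => J _.
under eq_bigr do rewrite mxE; by rewrite -rmorph_prod mulrC Re_realM mulrC.
Qed.

Lemma imC_pull m n k (P : 'M[R]_(m, n)) (a : covec C n k) :
  imC (pull (map_mx (real_complex R) P) a) = pull P (imC a).
Proof.
apply: covecP => I; rewrite /imC /pull Im_sum; apply: eq_bigr => J _.
under eq_bigr do rewrite mxE; by rewrite -rmorph_prod mulrC Im_realM mulrC.
Qed.

(** The complex 3 x 3 matrix of a real matrix commuting with J. *)
Definition cmx (P : 'M[R]_(3 + 3)) : 'M[C]_3 :=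
  \matrix_(k, j) (P (lshift 3 k) (lshift 3 j) +i* P (lshift 3 k) (rshift 3 j))%C.

Lemma commJ (P : 'M[R]_(3 + 3)) : P *m J = J *m P ->
  P = block_mx (ulsubmx P) (ursubmx P) (- ursubmx P) (ulsubmx P).
Proof.
rewrite -{1 2}[P]submxK /Jmx !mulmx_block !mulmx0 !mul0mx !mulmx1 !mul1mx !add0r !addr0.
rewrite !mulmxN !mulNmx !mulmx1 !mul1mx => /eq_block_mx[e1 e2 _ _].
by rewrite -[LHS]submxK -e2 -e1.
Qed.

Lemma zdz_l j a : zdz j (lshift 3 a) = (a == j)%:R.
Proof.
rewrite /zdz -[LHS]/(_ + _ * _) /dxi /= [(val a == 3 + j)%N](_ : _ = false); last first.
  by rewrite ltn_eqF // (leq_trans (ltn_ord a)) // leq_addr.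
by rewrite mulr0 addr0 val_eqE.
Qed.

Lemma zdz_r j a : zdz j (rshift 3 a) = ii * (a == j)%:R.
Proof.
rewrite /zdz -[LHS]/(_ + _ * _) /dxi /= eqn_add2l val_eqE [(3 + a == val j)%N](_ : _ = false).
  by rewrite add0r.
by rewrite gtn_eqF // (leq_trans (ltn_ord j)) // leq_addr.
Qed.

Lemma pull_zdz (P : 'M[R]_(3 + 3)) j i : P *m J = J *m P ->
  \sum_a map_mx (real_complex R) P i a * zdz j a = \sum_k zdz k i * cmx P k j.
Proof.
move=> /commJ eP; rewrite big_split_ord /= (bigD1 j) //= [X in _ + X + _]big1 ?addr0 => [|k ne]; last first.
  by rewrite zdz_l (negbTE ne) mulr0.
rewrite [X in _ + X](bigD1 j) //= [X in _ + (_ + X)]big1 ?addr0 => [|k ne]; last first.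
  by rewrite zdz_r (negbTE ne) !mulr0.
rewrite zdz_l zdz_r eqxx !mulr1; case: (split_ordP i) => k ->.
  rewrite (bigD1 k) //= big1 => [|l ne]; last by rewrite zdz_l eq_sym (negbTE ne) mul0r.
  rewrite zdz_l eqxx mul1r addr0 !mxE; apply/eqP; rewrite eq_complex /=.
  by apply/andP; split; apply/eqP; ring.
rewrite (bigD1 k) //= big1 => [|l ne]; last by rewrite zdz_r eq_sym (negbTE ne) mulr0 mul0r.
rewrite zdz_r eqxx mulr1 addr0 !mxE.
have -> : P (rshift 3 k) (lshift 3 j) = - P (lshift 3 k) (rshift 3 j).
  by rewrite {1}eP block_mxEdl !mxE.
have -> : P (rshift 3 k) (rshift 3 j) = P (lshift 3 k) (lshift 3 j).
  by rewrite {1}eP block_mxEdr !mxE.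
apply/eqP; rewrite eq_complex /=.
by apply/andP; split; apply/eqP; ring.
Qed.

(** The form dz^0 /\ dz^1 /\ dz^2 is the complex determinant in the coordinates
    z, so a complex linear map multiplies it by its determinant. *)
Lemma pull_dz123 (P : 'M[R]_(3 + 3)) : P *m J = J *m P ->
  pull (map_mx (real_complex R) P) dz123 = \det (cmx P) *: dz123.
Proof.
move=> PJ; rewrite dz123_iform pull_iform; apply: covecP => I.
rewrite covecZ !iform_det mulrC -det_mulmx; congr (\det _).
apply/matrixP => a b; rewrite !mxE pull_zdz // inord_val.
by apply: eq_bigr => k _; rewrite !mxE inord_val.
Qed.

Lemma pull_rho0 (P : 'M[R]_(3 + 3)) : P *m J = J *m P ->
  pull P rho0 = complex.Re (\det (cmx P)) *: rho0 - complex.Im (\det (cmx P)) *: iota0.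
Proof.
move=> PJ; rewrite -re_dz123 -im_dz123 -reC_pull pull_dz123 //.
by apply: covecP => I; rewrite /reC /imC !(covecD, covecN, covecZ); case: (\det _) (dz123 I) => [? ?] [? ?].
Qed.

Lemma pull_iota0 (P : 'M[R]_(3 + 3)) : P *m J = J *m P ->
  pull P iota0 = complex.Im (\det (cmx P)) *: rho0 + complex.Re (\det (cmx P)) *: iota0.
Proof.
move=> PJ; rewrite -re_dz123 -im_dz123 -imC_pull pull_dz123 //.
apply: covecP => I; rewrite /reC /imC !(covecD, covecN, covecZ); case: (\det _) (dz123 I) => [? ?] [? ?] /=.
by rewrite addrC.
Qed.

Lemma rho0_val : rho0 (flist 3 [:: 0; 1; 2]%N) = 1 :> R /\ rho0 (flist 3 [:: 3; 4; 5]%N) = 0 :> R.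
Proof. by split; rewrite /rho0 zformE // vals_flist. Qed.
Lemma iota0_val : iota0 (flist 3 [:: 0; 1; 2]%N) = 0 :> R /\ iota0 (flist 3 [:: 3; 4; 5]%N) = - 1 :> R.
Proof. by split; rewrite /iota0 zformE // vals_flist. Qed.

Lemma rho_iota_indep (a b : R) : a *: rho0 + b *: iota0 = 0 -> a = 0 /\ b = 0.
Proof.
move=> h; have [r1 r2] := rho0_val; have [i1 i2] := iota0_val.
have h1 := congr1 (fun f : covec R 6 3 => f (flist 3 [:: 0; 1; 2]%N)) h.
have h2 := congr1 (fun f : covec R 6 3 => f (flist 3 [:: 3; 4; 5]%N)) h.
move: h1 h2; rewrite !covecD !covecZ r1 r2 i1 i2 !mulr0 mulr1 mulrN1 addr0 add0r.
by rewrite -[(0 : covec R 6 3) _]/0 => -> /eqP; rewrite oppr_eq0 => /eqP ->.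
Qed.

(** For c^2 + s^2 = 1 this rotates the first complex coordinate; its complex
    determinant is c + i s. *)
Definition rotmx (c s : R) : 'M[R]_(3 + 3) :=
  let d := fun x y => diag_mx (\row_(j < 3) if j == 0 then x else y) in
  block_mx (d c 1) (d s 0) (- d s 0) (d c 1).

Lemma rotmx_J c s : rotmx c s *m J = J *m rotmx c s.
Proof.
rewrite /rotmx /Jmx !mulmx_block !mulmx0 !mul0mx !mulmx1 !mul1mx !add0r !addr0.
by rewrite !mulmxN !mulNmx !mulmx1 !mul1mx.
Qed.

Lemma rotmx_orth c s : c ^+ 2 + s ^+ 2 = 1 -> rotmx c s *m (rotmx c s)^T = 1%:M.
Proof.
move=> h; rewrite /rotmx tr_block_mx mulmx_block linearN /= !tr_diag_mx.
rewrite !(mulNmx, mulmxN) opprK !mulmx_diag.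
rewrite [X in block_mx X _ _ _](_ : _ = 1%:M); last first.
  rewrite -linearD /= -diag_const_mx; congr diag_mx; apply/rowP => j; rewrite !mxE.
  by case: ifP => _; rewrite ?mulr0 ?mulr1 ?addr0 // -!expr2.
rewrite [X in block_mx _ X _ _](_ : _ = 0); last first.
  rewrite -linearN -linearD /= -(linear0 (@diag_mx R 3)); congr diag_mx; apply/rowP => j; rewrite !mxE.
  by case: ifP => _; rewrite ?mulr0 ?mul0r ?subr0 ?oppr0 ?addr0 // mulrC addNr.
rewrite [X in block_mx _ _ X _](_ : _ = 0); last first.
  rewrite -linearN -linearD /= -(linear0 (@diag_mx R 3)); congr diag_mx; apply/rowP => j; rewrite !mxE.
  by case: ifP => _; rewrite ?mulr0 ?mul0r ?subr0 ?oppr0 ?addr0 // mulrC addNr.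
rewrite [X in block_mx _ _ _ X](_ : _ = 1%:M); last first.
  rewrite -linearD /= -diag_const_mx; congr diag_mx; apply/rowP => j; rewrite !mxE.
  by case: ifP => _; rewrite ?mulr0 ?mulr1 ?add0r // -!expr2 addrC.
by rewrite -scalar_mx_block.
Qed.

Lemma det_rotmx c s : \det (cmx (rotmx c s)) = (c +i* s)%C.
Proof.
have -> : cmx (rotmx c s) = diag_mx (\row_(j < 3) if j == 0 then (c +i* s)%C else 1).
  apply/matrixP => i j; rewrite mxE /rotmx block_mxEul block_mxEur !mxE.
  by case: (i == j); rewrite ?mulr0n ?mulr1n //; case: (i == 0).
rewrite det_diag !big_ord_recl big_ord0 !mxE /= !mulr1.
by [].
Qed.

End ComplexVolume.

Section Frame.
Context {R : realType}.
Local Notation J := (@Jmx R 3).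

(** Choose a unitary frame for w; the complex volume form becomes a nonzero
    multiple of dz^0 /\ dz^1 /\ dz^2, and rotating one vector of the frame
    makes the factor positive. *)
Lemma su3_frame (w : covec R (3 + 3) 2) (hr hi : R) :
  (Gmx w)^T = Gmx w ->
  (forall u : 'rV[R]_(3 + 3), u != 0 -> 0 < (u *m Gmx w *m u^T) 0 0) ->
  J *m Gmx w *m J^T = Gmx w -> (hr != 0) || (hi != 0) ->
  exists (P : 'M[R]_(3 + 3)) (kappa : R),
    [/\ P *m J = J *m P, P \in unitmx, P *m Gmx w *m P^T = 1%:M /\ pull P w = om0, 0 < kappa &
      pull P (hr *: rho0 - hi *: iota0) = kappa *: rho0 /\
      pull P (hi *: rho0 + hr *: iota0) = kappa *: iota0].
Proof.
move=> sG pG JG h0; have [P [P1 PJ]] := unitary_frame sG pG JG.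
have uP : P \in unitmx.
  by have := mulmx1_unit P1; rewrite unitmx_mul => -[/andP[]].
pose d := \det (cmx P); pose al := hr * complex.Re d - hi * complex.Im d.
pose be := hi * complex.Re d + hr * complex.Im d.
have e1 : pull P (hr *: rho0 - hi *: iota0) = al *: rho0 - be *: iota0.
  rewrite -scaleNr pullD !pullZ pull_rho0 // pull_iota0 // -/d.
  by apply: covecP => I; rewrite !(covecD, covecN, covecZ) /al /be; ring.
have e2 : pull P (hi *: rho0 + hr *: iota0) = be *: rho0 + al *: iota0.
  rewrite pullD !pullZ pull_rho0 // pull_iota0 // -/d.
  by apply: covecP => I; rewrite !(covecD, covecN, covecZ) /al /be; ring.
pose k := Num.sqrt (al ^+ 2 + be ^+ 2).
have k0 : 0 < k.
  rewrite sqrtr_gt0 lt_neqAle addr_ge0 ?sqr_ge0 // andbT eq_sym.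
  rewrite paddr_eq0 ?sqr_ge0 // !sqrf_eq0; apply/negP => /andP[/eqP a0 /eqP b0].
  have z : hr *: rho0 - hi *: iota0 = 0 :> covec R 6 3.
    apply: (pull_inj uP); rewrite e1 a0 b0 !scale0r subr0.
    by rewrite -[in RHS](scale0r (0 : covec R 6 3)) pullZ scale0r.
  have [] := rho_iota_indep (a := hr) (b := - hi); first by rewrite scaleNr.
  by move=> hr0 /eqP; rewrite oppr_eq0 => /eqP hi0; rewrite hr0 hi0 eqxx in h0.
have k2 : k ^+ 2 = al ^+ 2 + be ^+ 2 by rewrite sqr_sqrtr // addr_ge0 ?sqr_ge0.
have kn : k != 0 by rewrite gt_eqF.
pose c := al / k; pose s := - be / k.
have cs : c ^+ 2 + s ^+ 2 = 1.
  by rewrite /c /s !expr_div_n sqrrN -mulrDl -k2 divff // expf_neq0.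
pose D := rotmx c s; have DJ : D *m J = J *m D := rotmx_J c s.
have DP : D *m P *m J = J *m (D *m P) by rewrite -mulmxA PJ mulmxA DJ mulmxA.
have DG : D *m P *m Gmx w *m (D *m P)^T = 1%:M.
  rewrite trmx_mul -!mulmxA (mulmxA P) (mulmxA (P *m _)) P1 mul1mx.
  exact: rotmx_orth.
exists (D *m P), k; split => //.
- by have := mulmx1_unit DG; rewrite unitmx_mul => -[/andP[]].
- by split=> //; apply: Gmx_inj; rewrite Gmx_pull // DG Gmx_om0.
split; rewrite pull_mul ?e1 ?e2 -?scaleNr pullD !pullZ pull_rho0 // pull_iota0 // det_rotmx /=.
  apply: covecP => I; rewrite !(covecD, covecN, covecZ).
  have -> : al = k * c by rewrite /c mulrC divfK.
  have -> : be = - (k * s) by rewrite /s mulrC divfK // opprK.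
  transitivity (k * (c ^+ 2 + s ^+ 2) * rho0 I); last by rewrite cs mulr1.
  ring.
apply: covecP => I; rewrite !(covecD, covecN, covecZ).
have -> : al = k * c by rewrite /c mulrC divfK.
have -> : be = - (k * s) by rewrite /s mulrC divfK // opprK.
transitivity (k * (c ^+ 2 + s ^+ 2) * iota0 I); last by rewrite cs mulr1.
ring.
Qed.

End Frame.

(** * Smooth functions *)

Section Pderiv.
Context {R : realType} {n : nat}.
Implicit Types (f g : 'rV[R]_n -> R) (x : 'rV[R]_n) (U V : set 'rV[R]_n).

Lemma pderiv_near i f g x : (\near x, f x = g x) -> pderiv i f x = pderiv i g x.
Proof. exact: near_eq_derive. Qed.

Lemma pderiv_eq_on i f g x U : open U -> U x -> (forall y, U y -> f y = g y) ->
  pderiv i f x = pderiv i g x.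
Proof.
move=> oU Ux h; apply: pderiv_near; apply: filterS (open_nbhs_nbhs (conj oU Ux)).
exact: h.
Qed.

Lemma differentiable_near0 f x : (\near x, f x = 0) -> differentiable f x.
Proof.
move=> h; have f0 : f x = 0 by exact: (nbhs_singleton h).
have h0 : \forall y \near (0 : 'rV[R]_n), f (y + x) = 0.
  by move: h; rewrite (near_shift 0 x) subr0.
have key : f \o shift x = cst (f x) + 0 +o_ (0 : 'rV[R]_n) id.
  apply/eqaddoP => _ /posnumP[e]; near=> y.
  rewrite !fctE /= f0 addr0 subr0 (_ : f (y + x) = 0) ?normr0 ?mulr_ge0 //.
  by near: y.
have c0 : continuous (0 : 'rV[R]_n -> R) by move=> ?; exact: cst_continuous.
have d0 : 'd f x = 0 :> ('rV[R]_n -> R) by apply: diff_unique.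
by apply/diff_locallyP; rewrite d0.
Unshelve. all: by end_near. Qed.

Lemma differentiable_eq_on f g x U : open U -> U x -> (forall y, U y -> f y = g y) ->
  differentiable f x -> differentiable g x.
Proof.
move=> oU Ux h df; have -> : g = f + (g - f) by apply: funext => y; rewrite !fctE; ring.
apply: differentiableD => //; apply: differentiable_near0.
apply: filterS (open_nbhs_nbhs (conj oU Ux)) => y Uy.
by rewrite !fctE h // subrr.
Qed.

Lemma pderiv_cst i (c : R) x : pderiv i (fun _ => c) x = 0.
Proof. exact: derive_cst. Qed.

Lemma pderivD i f g x : differentiable f x -> differentiable g x ->
  pderiv i (fun y => f y + g y) x = pderiv i f x + pderiv i g x.
Proof. by move=> df dg; apply: deriveD; apply: diff_derivable. Qed.

Lemma pderivM i f g x : differentiable f x -> differentiable g x ->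
  pderiv i (fun y => f y * g y) x = pderiv i f x * g x + f x * pderiv i g x.
Proof.
move=> df dg; have df' := @diff_derivable _ _ _ f x (delta_mx 0 i) df.
have dg' := @diff_derivable _ _ _ g x (delta_mx 0 i) dg.
by rewrite /pderiv [LHS](deriveM df' dg') addrC [X in X + _ = _]mulrC.
Qed.

Lemma differentiableD' f g x : differentiable f x -> differentiable g x ->
  differentiable (fun y => f y + g y) x.
Proof. exact: differentiableD. Qed.

Lemma differentiableM' f g x : differentiable f x -> differentiable g x ->
  differentiable (fun y => f y * g y) x.
Proof. exact: differentiableM. Qed.

Lemma pderivZ i c f x : differentiable f x -> pderiv i (fun y => c * f y) x = c * pderiv i f x.
Proof. by move=> df; rewrite pderivM // pderiv_cst mul0r add0r. Qed.

Lemma differentiable_sum' (T : Type) (s : seq T) (P : pred T) (F : T -> 'rV[R]_n -> R) x :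
  (forall t, P t -> differentiable (F t) x) ->
  differentiable (fun y => \sum_(t <- s | P t) F t y) x.
Proof.
move=> h; elim: s => [|t s IH].
  by under eq_fun do rewrite big_nil.
have -> : (fun y => \sum_(t <- t :: s | P t) F t y) =
   fun y => if P t then F t y + \sum_(t <- s | P t) F t y else \sum_(t <- s | P t) F t y.
  by apply: funext => y; rewrite big_cons.
by case Pt: (P t) => //; apply: differentiableD' => //; apply: h.
Qed.

Lemma pderiv_sum (T : Type) (s : seq T) (P : pred T) i (F : T -> 'rV[R]_n -> R) x :
  (forall t, P t -> differentiable (F t) x) ->
  pderiv i (fun y => \sum_(t <- s | P t) F t y) x = \sum_(t <- s | P t) pderiv i (F t) x.
Proof.
move=> h; elim: s => [|t s IH].
  rewrite big_nil (_ : (fun _ => _) = fun=> 0) ?pderiv_cst //.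
  by apply: funext => y; rewrite big_nil.
rewrite big_cons; have -> : (fun y => \sum_(t <- t :: s | P t) F t y) =
   fun y => if P t then F t y + \sum_(t <- s | P t) F t y else \sum_(t <- s | P t) F t y.
  by apply: funext => y; rewrite big_cons.
case Pt: (P t) => //; rewrite pderivD ?IH //; first exact: h.
exact: differentiable_sum'.
Qed.

Lemma pderivV i f x : differentiable f x -> f x != 0 ->
  pderiv i (fun y => (f y)^-1) x = - (f x)^-1 * (f x)^-1 * pderiv i f x.
Proof.
move=> df f0; have df' := @diff_derivable _ _ _ f x (delta_mx 0 i) df.
rewrite /pderiv [LHS](deriveV f0 df').
by rewrite -[LHS]/(_ * _) expr2 invfM !mulNr.
Qed.

Lemma differentiable_sqrt f x : differentiable f x -> 0 < f x ->
  differentiable (fun y => Num.sqrt (f y)) x.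
Proof.
move=> df f0; apply: (differentiable_comp (g := Num.sqrt) df).
by apply/derivable1_diffP; have [] := is_derive1_sqrt f0.
Qed.

Lemma pderiv_sqrt i f x : differentiable f x -> 0 < f x ->
  pderiv i (fun y => Num.sqrt (f y)) x = 2^-1 * (Num.sqrt (f x))^-1 * pderiv i f x.
Proof.
move=> df f0; have h := is_derive1_sqrt f0.
have ds : differentiable (Num.sqrt : R -> R) (f x).
  by apply/derivable1_diffP; have [] := h.
rewrite /pderiv !deriveE //; last exact: differentiable_sqrt.
have /(congr1 (fun F => F (delta_mx 0 i))) := @diff_comp _ _ _ _ f Num.sqrt x df ds.
rewrite /= => e; rewrite [LHS]e.
rewrite diff1E // -[LHS]/(_ * _) derive1E (@derive_val _ _ _ _ _ _ _ h) mulrC.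
by rewrite invfM.
Qed.

(** Ck k U f is a condition on the points of U one at a time, hence monotone in
    U. *)
Lemma Ck_point k U f : Ck k U f <-> forall x, U x -> Ck k [set x] f.
Proof.
elim: k f => [|k IH] f /=.
  by split=> [h x Ux y -> //|h x Ux]; [exact: h | exact: (h x Ux)].
split=> [[h1 h2] x Ux|h].
  split=> [y ->|i]; first exact: h1.
  by move/IH: (h2 i); apply.
split=> [x Ux|i]; first by have [+ _] := h x Ux; apply.
by apply/IH => x Ux; have [_] := h x Ux; apply.
Qed.

Lemma Ck_sub k U V f : (V `<=` U) -> Ck k U f -> Ck k V f.
Proof. by move=> VU /Ck_point h; apply/Ck_point => x /VU; apply: h. Qed.

Lemma CkW k U f : Ck k.+1 U f -> Ck k U f.
Proof.
elim: k f => [|k IH] f /=; first by move=> [h _] x /h; exact: differentiable_continuous.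
move=> [h1 h2]; split=> // i; exact: IH.
Qed.

Lemma Ck_diff k U f x : Ck k.+1 U f -> U x -> differentiable f x.
Proof. by move=> [h _]; apply: h. Qed.

Lemma Ck_eq k U f g : open U -> (forall x, U x -> f x = g x) -> Ck k U f -> Ck k U g.
Proof.
move=> oU; elim: k f g => [|k IH] f g h /=.
  move=> cf x Ux; rewrite /prop_for /continuous_at -(h _ Ux).
  have hn : \near x, f x = g x.
    apply: filterS (open_nbhs_nbhs (conj oU Ux)) => y Uy; exact: h.
  exact: cvg_trans (@near_eq_cvg _ _ (nbhs x) _ _ _ hn) (cf x Ux).
move=> [h1 h2]; split=> [x Ux|i].
  exact: (differentiable_eq_on oU Ux h (h1 x Ux)).
by apply: IH (h2 i) => x Ux; exact: (pderiv_eq_on _ oU Ux h).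
Qed.

Lemma Ck_cst k U (c : R) : Ck k U (fun _ => c).
Proof.
elim: k c => [|k IH] c /=; first by move=> x _; exact: cst_continuous.
split=> [x _|i]; first exact: differentiable_cst.
by rewrite (_ : pderiv i _ = fun=> 0) //; apply: funext => x; rewrite pderiv_cst.
Qed.

Lemma CkD k U f g : open U -> Ck k U f -> Ck k U g -> Ck k U (fun y => f y + g y).
Proof.
move=> oU; elim: k f g => [|k IH] f g /=.
  by move=> hf hg x Ux; apply: continuousD; [exact: hf | exact: hg].
move=> [f1 f2] [g1 g2]; split=> [x Ux|i]; first by apply: differentiableD'; auto.
apply: Ck_eq (IH _ _ (f2 i) (g2 i)) => // x Ux; rewrite pderivD //; auto.
Qed.

Lemma CkM k U f g : open U -> Ck k U f -> Ck k U g -> Ck k U (fun y => f y * g y).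
Proof.
move=> oU; elim: k f g => [|k IH] f g /=.
  by move=> hf hg x Ux; apply: continuousM; [exact: hf | exact: hg].
move=> hf hg; have [f1 f2] := hf; have [g1 g2] := hg.
split=> [x Ux|i]; first by apply: differentiableM'; auto.
have hf' : Ck k U f by exact: CkW.
have hg' : Ck k U g by exact: CkW.
apply: Ck_eq (CkD oU (IH _ _ (f2 i) hg') (IH _ _ hf' (g2 i))) => // x Ux.
by rewrite pderivM //; auto.
Qed.

Lemma CkV k U f : open U -> (forall x, U x -> f x != 0) -> Ck k U f ->
  Ck k U (fun y => (f y)^-1).
Proof.
move=> oU f0; elim: k => [|k IH] /=.
  by move=> hf x Ux; apply: continuousV; [exact: f0 | exact: hf].
move=> hf; have [f1 f2] := hf; split=> [x Ux|i]; first by apply: differentiableV; auto.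
have hi := IH (CkW hf).
apply: Ck_eq (CkM oU (CkM oU (CkM oU (Ck_cst k U (-1)) hi) hi) (f2 i)) => // x Ux.
by rewrite pderivV ?mulN1r //; auto.
Qed.

Lemma Ck_sqrt k U f : open U -> (forall x, U x -> 0 < f x) -> Ck k U f ->
  Ck k U (fun y => Num.sqrt (f y)).
Proof.
move=> oU f0; elim: k => [|k IH] /=.
  move=> hf x Ux; apply: (continuous_comp (f := f) (g := Num.sqrt)); first exact: hf.
  exact: sqrt_continuous.
move=> hf; have [f1 f2] := hf; split=> [x Ux|i]; first by apply: differentiable_sqrt; auto.
have hs := IH (CkW hf).
have hv : Ck k U (fun y => (Num.sqrt (f y))^-1).
  by apply: CkV => // x Ux; rewrite gt_eqF // sqrtr_gt0 f0.
apply: Ck_eq (CkM oU (CkM oU (Ck_cst k U 2^-1) hv) (f2 i)) => // x Ux.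
by rewrite pderiv_sqrt //; auto.
Qed.

(** On an open set the local extension agrees with f near each point, so both
    have the same derivatives there. *)
Lemma smooth_on_Ck A f k : open A -> smooth_on A f -> Ck k A f.
Proof.
move=> oA h; apply/Ck_point => x Ax; have [U [F [oU Ux hF e]]] := h x Ax.
apply: (@Ck_sub k (U `&` A)); first by move=> y ->.
apply: (@Ck_eq k (U `&` A) F); first exact: openI.
  by move=> y [Uy Ay]; apply: e.
by apply: (@Ck_sub k U) => // y [].
Qed.

Lemma Ck_smooth_on A f : open A -> (forall k, Ck k A f) -> smooth_on A f.
Proof. by move=> oA h x Ax; exists A, f; split. Qed.

Lemma smooth_on_sub A B f : A `<=` B -> smooth_on B f -> smooth_on A f.
Proof.
move=> AB h x /AB /h[U [F [oU Ux hF e]]]; exists U, F; split=> // y Uy /AB; exact: e.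
Qed.

Lemma smooth_on_eq A f g : (forall x, A x -> f x = g x) -> smooth_on A f -> smooth_on A g.
Proof.
move=> fg h x Ax; have [U [F [oU Ux hF e]]] := h x Ax; exists U, F; split=> // y Uy Ay.
by rewrite e // fg.
Qed.

Lemma smooth_on_cst (A : set 'rV[R]_n) (c : R) : smooth_on A (fun _ => c).
Proof.
move=> x _; exists setT, (fun _ => c); split=> //; first exact: openT.
by move=> k; exact: Ck_cst.
Qed.

Lemma smooth_onD A f g : smooth_on A f -> smooth_on A g -> smooth_on A (fun y => f y + g y).
Proof.
move=> hf hg x Ax; have [U [F [oU Ux hF eF]]] := hf x Ax.
have [V [G [oV Vx hG eG]]] := hg x Ax.
have oUV := openI oU oV.
exists (U `&` V), (fun y => F y + G y); split=> // [k|y [Uy Vy] Ay].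
  by apply: CkD => //; [apply: Ck_sub (hF k) => y [] | apply: Ck_sub (hG k) => y []].
by rewrite eF // eG.
Qed.

Lemma smooth_onM A f g : smooth_on A f -> smooth_on A g -> smooth_on A (fun y => f y * g y).
Proof.
move=> hf hg x Ax; have [U [F [oU Ux hF eF]]] := hf x Ax.
have [V [G [oV Vx hG eG]]] := hg x Ax.
have oUV := openI oU oV.
exists (U `&` V), (fun y => F y * G y); split=> // [k|y [Uy Vy] Ay].
  by apply: CkM => //; [apply: Ck_sub (hF k) => y [] | apply: Ck_sub (hG k) => y []].
by rewrite eF // eG.
Qed.

Lemma smooth_on_sum A (T : Type) (s : seq T) (P : pred T) (F : T -> 'rV[R]_n -> R) :
  (forall t, P t -> smooth_on A (F t)) -> smooth_on A (fun y => \sum_(t <- s | P t) F t y).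
Proof.
move=> h; elim: s => [|t s IH].
  by apply: (@smooth_on_eq A (fun _ => 0)) => [x _|]; [rewrite big_nil | exact: smooth_on_cst].
case Pt : (P t); last by apply: (smooth_on_eq _ IH) => x _; rewrite big_cons Pt.
by apply: (smooth_on_eq _ (smooth_onD (h t Pt) IH)) => x _; rewrite big_cons Pt.
Qed.

(** The extension of f may vanish away from A, so its domain is shrunk. *)
Lemma smooth_onV A f : (forall x, A x -> f x != 0) -> smooth_on A f ->
  smooth_on A (fun y => (f y)^-1).
Proof.
move=> f0 hf x Ax; have [U [F [oU Ux hF eF]]] := hf x Ax.
have oV : open (U `&` [set y | F y != 0]).
  rewrite openE => y [Uy Fy]; apply: filterI; first exact: open_nbhs_nbhs.
  have cF : {for y, continuous F} := hF 0%N y Uy.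
  by apply: (cF [set z | z != 0]); apply: open_nbhs_nbhs; split=> //; exact: open_neq.
exists (U `&` [set y | F y != 0]), (fun y => (F y)^-1); split=> //.
- by split=> //; rewrite /= eF // f0.
- move=> k; apply: CkV => // [y []//|]; by apply: Ck_sub (hF k) => y [].
- by move=> y [Uy _] Ay; rewrite eF.
Qed.

Lemma smooth_on_sqrt A f : (forall x, A x -> 0 < f x) -> smooth_on A f ->
  smooth_on A (fun y => Num.sqrt (f y)).
Proof.
move=> f0 hf x Ax; have [U [F [oU Ux hF eF]]] := hf x Ax.
have oV : open (U `&` [set y | 0 < F y]).
  rewrite openE => y [Uy Fy]; apply: filterI; first exact: open_nbhs_nbhs.
  have cF : {for y, continuous F} := hF 0%N y Uy.
  by apply: (cF [set z | 0 < z]); apply: open_nbhs_nbhs; split=> //; exact: open_gt.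
exists (U `&` [set y | 0 < F y]), (fun y => Num.sqrt (F y)); split=> //.
- by split=> //; rewrite /= eF // f0.
- move=> k; apply: Ck_sqrt => // [y []//|]; by apply: Ck_sub (hF k) => y [].
- by move=> y [Uy _] Ay; rewrite eF.
Qed.

Lemma smooth_on_diff A f x : open A -> smooth_on A f -> A x -> differentiable f x.
Proof. by move=> oA h Ax; have [+ _] := smooth_on_Ck 1 oA h; apply. Qed.

Lemma smooth_on_continuous A f x : open A -> smooth_on A f -> A x -> {for x, continuous f}.
Proof. by move=> oA h Ax; apply: (smooth_on_Ck 0 oA h). Qed.

Lemma smooth_on_pderiv A f i : open A -> smooth_on A f -> smooth_on A (pderiv i f).
Proof.
by move=> oA h; apply: Ck_smooth_on => // k; have [_] := smooth_on_Ck k.+1 oA h; apply.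
Qed.

End Pderiv.

Section Lines.
Context {R : realType} {n : nat}.
Implicit Types (f : 'rV[R]_n -> R) (x a v : 'rV[R]_n).

Lemma is_derive_line f a v (s : R) : derivable f (s *: v + a) v ->
  is_derive s 1 (fun r : R => f (r *: v + a)) ('D_v f (s *: v + a)).
Proof.
move=> h.
have e : (fun h => h^-1 *: (((fun r : R => f (r *: v + a)) \o shift s) (h *: 1) - f (s *: v + a)))
   = (fun h => h^-1 *: ((f \o shift (s *: v + a)) (h *: v) - f (s *: v + a))).
  apply: funext => r /=; congr (_ *: (f _ - _)).
  by rewrite -[r *: 1]/(r * 1) mulr1 scalerDl addrA.
by split; rewrite /derivable /derive e.
Qed.

Lemma mvt_line f a v (h : R) (U : set 'rV[R]_n) : 0 < h ->
  (forall s, 0 <= s <= h -> U (s *: v + a)) ->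
  (forall y, U y -> differentiable f y) ->
  exists2 c, 0 < c < h & f (h *: v + a) - f a = 'D_v f (c *: v + a) * h.
Proof.
move=> h0 hU df.
have dl s : 0 <= s <= h -> is_derive s 1 (fun r : R => f (r *: v + a)) ('D_v f (s *: v + a)).
  by move=> /hU/df d; apply/is_derive_line/diff_derivable.
have [|s|c cab e] := @MVT R (fun r : R => f (r *: v + a)) (fun s => 'D_v f (s *: v + a)) 0 h h0.
- by move=> s; rewrite in_itv /= => /andP[/ltW s0 /ltW sh]; apply: dl; rewrite s0.
- apply: derivable_within_continuous => r; rewrite in_itv /= => hr.
  by have [] := dl r hr.
- exists c; first by move: cab; rewrite in_itv.
  by move: e; rewrite scale0r add0r subr0.
Qed.

Lemma norm_delta m : `|delta_mx 0 m : 'rV[R]_n| <= 1.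
Proof.
rewrite -[leLHS]/(mx_norm _); case: (eqVneq (mx_norm (delta_mx 0 m : 'rV[R]_n)) 0) => [->//|].
by move=> /mx_norm_neq0[ij ->]; rewrite mxE; case: (_ && _); rewrite ?normr1 ?normr0.
Qed.

(** The second difference of f in two directions equals each mixed derivative
    at some nearby point, by the mean value theorem applied twice; the step is
    then sent to 0. *)
Lemma schwarz (U : set 'rV[R]_n) f x i j : open U -> Ck 2 U f -> U x ->
  pderiv i (pderiv j f) x = pderiv j (pderiv i f) x.
Proof.
move=> oU Cf Ux.
(* The second difference, with the direction k treated first. *)
have second (k l : 'I_n) (h : R) : 0 < h ->
    (forall s t, 0 <= s <= h -> 0 <= t <= h ->
       U (s *: delta_mx 0 k + t *: delta_mx 0 l + x)) ->
    exists s t, [/\ 0 < s < h, 0 < t < h &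
      f (h *: delta_mx 0 k + h *: delta_mx 0 l + x) - f (h *: delta_mx 0 k + x)
      - f (h *: delta_mx 0 l + x) + f x
      = pderiv l (pderiv k f) (s *: delta_mx 0 k + t *: delta_mx 0 l + x) * (h * h)].
  move=> h0 hU; pose g y := f (h *: delta_mx 0 l + y) - f y.
  have [Cf1 Cf2] := Cf.
  have hh : 0 <= h <= h by rewrite ltW /=.
  have h00 : 0 <= (0 : R) <= h by rewrite lexx ltW.
  have dsh y : U (h *: delta_mx 0 l + y) ->
      is_derive y (delta_mx 0 k) (fun z => f (h *: delta_mx 0 l + z))
        (pderiv k f (h *: delta_mx 0 l + y)).
    move=> Uy; have d := @diff_derivable _ _ _ f _ (delta_mx 0 k) (Cf1 _ Uy).
    have e : (fun r => r^-1 *: (((fun z => f (h *: delta_mx 0 l + z)) \o shift y) (r *: delta_mx 0 k)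
           - f (h *: delta_mx 0 l + y)))
       = (fun r : R => r^-1 *: ((f \o shift (h *: delta_mx 0 l + y)) (r *: delta_mx 0 k)
           - f (h *: delta_mx 0 l + y))).
      by apply: funext => r /=; congr (_ *: (f _ - _)); rewrite addrCA.
    by split; rewrite /pderiv /derivable /derive e.
  pose V := [set y | U y /\ U (h *: delta_mx 0 l + y)].
  have dg s : 0 <= s <= h -> is_derive s 1 (fun r : R => g (r *: delta_mx 0 k + x))
      (pderiv k f (h *: delta_mx 0 l + (s *: delta_mx 0 k + x)) - pderiv k f (s *: delta_mx 0 k + x)).
    move=> hs; have U1 : U (s *: delta_mx 0 k + x).
      by have := hU s 0 hs h00; rewrite scale0r addr0.
    have U2 : U (h *: delta_mx 0 l + (s *: delta_mx 0 k + x)).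
      by have := hU s h hs hh; rewrite addrCA addrA.
    have d1 := dsh _ U2.
    have d2 := @diff_derivable _ _ _ f _ (delta_mx 0 k) (Cf1 _ U1).
    apply: is_deriveB.
      apply: is_derive_eq (is_derive_line (f := fun z => f (h *: delta_mx 0 l + z)) _) _.
        by have [] := d1.
      by rewrite derive_val.
    exact: is_derive_line.
  have [|s|s /[!in_itv]/= sb e] := @MVT R (fun r : R => g (r *: delta_mx 0 k + x))
    (fun s => pderiv k f (h *: delta_mx 0 l + (s *: delta_mx 0 k + x)) - pderiv k f (s *: delta_mx 0 k + x)) 0 h h0.
  - by move=> s; rewrite in_itv /= => /andP[/ltW s0 /ltW sh]; apply: dg; rewrite s0.
  - by apply: derivable_within_continuous => r; rewrite in_itv /= => hr; have [] := dg r hr.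
  have sb' : 0 <= s <= h by case/andP: sb => /ltW-> /ltW->.
  have [|y|t tb e2] := @mvt_line (pderiv k f) (s *: delta_mx 0 k + x) (delta_mx 0 l) h U h0.
  - by move=> t ht; have := hU s t sb' ht; rewrite addrCA addrA.
  - by have [+ _] := Cf2 k; apply.
  exists s, t; split => //.
  move: e; rewrite e2 subr0 scale0r add0r /g => e.
  have -> : h *: delta_mx 0 k + h *: delta_mx 0 l + x = h *: delta_mx 0 l + (h *: delta_mx 0 k + x).
    by rewrite addrCA addrA.
  have -> : s *: delta_mx 0 k + t *: delta_mx 0 l + x = t *: delta_mx 0 l + (s *: delta_mx 0 k + x).
    by rewrite addrCA addrA.
  by rewrite mulrA -[pderiv l _ _ * h]/('D_(delta_mx 0 l) (pderiv k f) _ * h) -e; ring.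
have [Cf1 Cf2] := Cf.
have cA : {for x, continuous (pderiv i (pderiv j f))} by have [_] := Cf2 j; apply.
have cB : {for x, continuous (pderiv j (pderiv i f))} by have [_] := Cf2 i; apply.
apply/eqP; rewrite -subr_eq0 -normr_le0; apply/ler_addgt0Pl => e e0; rewrite addr0.
have e20 : 0 < e / 2 by rewrite divr_gt0.
have nA : \forall y \near x, `|pderiv i (pderiv j f) x - pderiv i (pderiv j f) y| < e / 2.
  by have := cA; move/cvgrPdist_lt/(_ _ e20).
have nB : \forall y \near x, `|pderiv j (pderiv i f) x - pderiv j (pderiv i f) y| < e / 2.
  by have := cB; move/cvgrPdist_lt/(_ _ e20).
have nU : \forall y \near x, U y by exact: open_nbhs_nbhs.
have [d /= d0 hd] : nbhs_ball x ([set y | [/\ U y, `|pderiv i (pderiv j f) x - pderiv i (pderiv j f) y| < e / 2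
    & `|pderiv j (pderiv i f) x - pderiv j (pderiv i f) y| < e / 2]]).
  apply/nbhs_ballP; apply: filterS3 nU nA nB => y a b c; split; [exact: a|exact: b|exact: c].
(* Any factor larger than 2 keeps both intermediate points in the ball of
   radius d. *)
have [h h0 h4] : exists2 h : R, 0 < h & 4 * h = d.
  by exists (d / 4); [rewrite divr_gt0 | rewrite mulrC divfK].
have inb (k l : 'I_n) s t : 0 <= s <= h -> 0 <= t <= h ->
    ball x d (s *: delta_mx 0 k + t *: delta_mx 0 l + x).
  move=> /andP[s0 sh] /andP[t0 th]; rewrite -ball_normE /= opprD addrCA subrr addr0 normrN.
  have nd (m : 'I_n) : `|delta_mx 0 m : 'rV[R]_n| <= 1.
    exact: norm_delta.
  apply: le_lt_trans (ler_normD _ _) _; rewrite !normrZ !ger0_norm //.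
  have := ler_pM s0 (normr_ge0 _) sh (nd k); have := ler_pM t0 (normr_ge0 _) th (nd l).
  move: h4; move: (s * _) (t * _) => p q; lra.
have [s [t [hs ht e1]]] := second j i h h0 (fun s t hs ht => let: And3 u _ _ := hd _ (inb j i s t hs ht) in u).
have [s' [t' [hs' ht' e2]]] := second i j h h0 (fun s t hs ht => let: And3 u _ _ := hd _ (inb i j s t hs ht) in u).
have w u : 0 < u < h -> 0 <= u <= h by case/andP => /ltW-> /ltW->.
have [_ a1 _] := hd _ (inb j i s t (w _ hs) (w _ ht)).
have [_ _ b1] := hd _ (inb i j s' t' (w _ hs') (w _ ht')).
have hh : h * h != 0 by rewrite mulf_neq0 ?gt_eqF.
have eAB : pderiv i (pderiv j f) (s *: delta_mx 0 j + t *: delta_mx 0 i + x)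
   = pderiv j (pderiv i f) (s' *: delta_mx 0 i + t' *: delta_mx 0 j + x).
  have ec : h *: delta_mx 0 j + h *: delta_mx 0 i + x = h *: delta_mx 0 i + h *: delta_mx 0 j + x.
    by congr (_ + _); exact: addrC.
  apply: (mulIf hh); apply: etrans (esym e1) _; apply: etrans _ e2; rewrite ec.
  move: (f (h *: delta_mx 0 i + h *: delta_mx 0 j + x)) (f (h *: delta_mx 0 j + x))
    (f (h *: delta_mx 0 i + x)) (f x) => p q r r'; ring.
move: a1 b1; rewrite eAB; move: (pderiv j (pderiv i f) (s' *: _ + _ + _)) => z a1 b1.
move: (pderiv i (pderiv j f) x) (pderiv j (pderiv i f) x) a1 b1 => p q a1 b1.
have -> : p - q = (p - z) + - (q - z) by ring.
apply: le_trans (ler_normD _ _) _; rewrite normrN (splitr e).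
exact/ltW/ltrD.
Qed.

End Lines.

(** * The exterior derivative *)

Section ExteriorDerivative.
Context {R : realType}.

Definition pd n k (c : 'I_n) (a : 'rV[R]_n -> covec R n k) x : covec R n k :=
  fun I => pderiv c (fun y => a y I) x.

(** The coordinate formula d a = sum_c dx^c /\ (d a / d x^c), from which the
    calculus of d follows. *)
Lemma extdE n k (a : 'rV[R]_n -> covec R n k) x :
  extd a x = \sum_(c < n) wedge1 (dxi c) (pd c a x).
Proof.
apply: covecP => I; rewrite covec_sum /wedge1 exchange_big; apply: eq_bigr => j _ /=.
rewrite (bigD1 (I j)) //= big1 => [|c ne].
  by rewrite /dxi eqxx mulr1 addr0.
by rewrite /dxi val_eqE eq_sym (negbTE ne) mulr0 mul0r.
Qed.

Lemma alt_pd n k c (a : 'rV[R]_n -> covec R n k) x (U : set 'rV[R]_n) :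
  open U -> U x -> (forall y, U y -> is_alternating (a y)) ->
  (forall I, differentiable (fun y => a y I) x) -> is_alternating (pd c a x).
Proof.
move=> oU Ux ha da s I; rewrite /pd.
rewrite (@pderiv_eq_on _ _ _ _ (fun y => (-1) ^+ s * a y I) _ _ oU Ux) ?pderivZ //.
by move=> y Uy; apply: ha.
Qed.

Lemma alt_extd n k (a : 'rV[R]_n -> covec R n k) x (U : set 'rV[R]_n) :
  open U -> U x -> (forall y, U y -> is_alternating (a y)) ->
  (forall I, differentiable (fun y => a y I) x) -> is_alternating (extd a x).
Proof.
move=> oU Ux ha da; rewrite extdE; apply: alt_sum => c _; apply: alt_wedge1.
exact: (alt_pd _ oU).
Qed.

Lemma extd_eq_on n k (a b : 'rV[R]_n -> covec R n k) x (U : set 'rV[R]_n) :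
  open U -> U x -> (forall y, U y -> a y = b y) -> extd a x = extd b x.
Proof.
move=> oU Ux h; rewrite !extdE; apply: eq_bigr => c _; congr wedge1.
by apply: covecP => I; apply: (pderiv_eq_on _ oU Ux) => y /h ->.
Qed.

(** The product dx^m /\ dx^i is antisymmetric in m and i, while the Hessian is
    symmetric. *)
Lemma hess_kill n k (H : 'I_n -> 'I_n -> R) (c : covec R n k) :
  (forall i j, H i j = H j i) -> is_alternating c ->
  \sum_(m < n) wedge1 (dxi m) (wedge1 (H m) c) = 0.
Proof.
move=> sH hc; pose w (m i : 'I_n) := wedge1 (dxi m) (wedge1 (dxi i) c).
have e : \sum_(m < n) wedge1 (dxi m) (wedge1 (H m) c) = \sum_m \sum_i H m i *: w m i.
  apply: eq_bigr => m _.
  rewrite {1}(_ : H m = \sum_(i < n) H m i *: dxi i); last first.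
    apply: funext => i; rewrite fct_sumE (bigD1 i) //= big1 => [|j ne].
      by rewrite addr0 -[RHS]/(H m i * dxi i i) /dxi eqxx mulr1.
    by rewrite -[LHS]/(H m j * dxi j i) /dxi val_eqE eq_sym (negbTE ne) mulr0.
  by rewrite wedge1_suml wedge1_sumr; apply: eq_bigr => i _; rewrite wedge1Zl wedge1Zr.
apply: covecP => I; have : (\sum_m \sum_i H m i *: w m i) = - (\sum_m \sum_i H m i *: w m i).
  rewrite {1}exchange_big -sumrN; apply: eq_bigr => m _; rewrite -sumrN.
  by apply: eq_bigr => i _; rewrite /w sH wedge1_anti // scalerN.
move=> /(congr1 (fun f : covec R n _ => f I)); rewrite e covecN => /eqP.
by rewrite -subr_eq0 opprK -mulr2n mulrn_eq0 /= => /eqP.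
Qed.

Definition two n (p q : 'I_n) : {ffun 'I_2 -> 'I_n} := fcons p (fcons q (e0 n)).

Lemma two0 n (p q : 'I_n) : two p q ord0 = p.
Proof. exact: fcons_at. Qed.
Lemma two1 n (p q : 'I_n) : two p q (lift ord0 ord0) = q.
Proof. by rewrite fcons_lift fcons_at. Qed.

Lemma sum_two n (F : {ffun 'I_2 -> 'I_n} -> R) : \sum_J F J = \sum_p \sum_q F (two p q).
Proof.
rewrite (sum_fins ord0); apply: eq_bigr => p _; rewrite (sum_fins ord0); apply: eq_bigr => q _.
rewrite (bigD1 (e0 n)) //= big1 ?addr0 // => J /negP[]; by apply/eqP/ffunP => -[].
Qed.

Lemma alt_two n (a : covec R n 2) p q : is_alternating a -> a (two q p) = - a (two p q).
Proof.
move=> ha; have := ha (tperm ord0 (lift ord0 ord0)) (two p q).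
rewrite odd_tperm expr1 mulN1r => <-; congr (a _).
apply/ffunP => b; rewrite [RHS]ffunE; case: (unliftP ord0 b) => [j|] ->; last first.
  by rewrite tpermL two0 two1.
have -> : j = ord0 by apply: val_inj; case: j => -[].
by rewrite tpermR two0 two1.
Qed.

Lemma prod2 (f : 'I_2 -> R) : \prod_(c < 2) f c = f ord0 * f (lift ord0 ord0).
Proof. by rewrite !big_ord_recl big_ord0 mulr1. Qed.

Section Chain.
Context {m n : nat}.
Implicit Types (F : 'rV[R]_m -> 'rV[R]_n) (x : 'rV[R]_m).

Lemma differentiable_rV F x : (forall l, differentiable (fun y => F y 0 l) x) -> differentiable F x.
Proof.
move=> h; have -> : F = \sum_(l < n) (fun y => F y 0 l *: delta_mx 0 l).
  by apply: funext => y; rewrite fct_sumE {1}(row_sum_delta (F y)).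
by apply: differentiable_sum => l; apply: differentiableZl.
Qed.

Lemma jacobianE F x c l : (forall l, differentiable (fun y => F y 0 l) x) ->
  jacobian F x c l = pderiv c (fun y => F y 0 l) x.
Proof.
move=> h; have dF := differentiable_rV h.
have e := deriveEjacobian (delta_mx 0 c) dF.
have -> : jacobian F x c l = ((delta_mx 0 c : 'rV[R]_m) *m jacobian F x) 0 l.
  by rewrite -rowE [RHS]mxE.
rewrite -e derive_mx ?mxE //; exact: diff_derivable.
Qed.

Lemma pderiv_comp F x c (g : 'rV[R]_n -> R) : (forall l, differentiable (fun y => F y 0 l) x) ->
  differentiable g (F x) ->
  pderiv c (fun y => g (F y)) x = \sum_l jacobian F x c l * pderiv l g (F x).
Proof.
move=> h dg; have dF := differentiable_rV h.
rewrite /pderiv deriveE; last exact: (differentiable_comp dF dg).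
have /(congr1 (fun f => f (delta_mx 0 c))) := diff_comp dF dg.
rewrite /= => e; rewrite [LHS]e.
have -> : 'd F x (delta_mx 0 c) = delta_mx 0 c *m jacobian F x.
  by rewrite -deriveE // deriveEjacobian.
rewrite [_ *m _]row_sum_delta linear_sum; apply: eq_bigr => l _.
by rewrite linearZ /= -rowE mxE deriveE.
Qed.

(** Differentiating the components of F^* a gives the pullback of da and terms
    with second derivatives of F; the latter form a symmetric Hessian and are
    removed by hess_kill. *)
Lemma extd_pull2 F x (U : set 'rV[R]_m) (V : set 'rV[R]_n) (a : 'rV[R]_n -> covec R n 2) :
  open U -> U x -> (forall l k, Ck k U (fun y => F y 0 l)) ->
  (forall y, U y -> V (F y)) -> (forall y, V y -> is_alternating (a y)) ->
  (forall I, differentiable (fun y => a y I) (F x)) ->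
  extd (pullback F a) x = pull (jacobian F x) (extd a (F x)).
Proof.
move=> oU Ux sF UV altA dA.
have dF y l : U y -> differentiable (fun y => F y 0 l) y by move=> Uy; exact: (Ck_diff (sF l 1%N)).
have d2F l i : differentiable (pderiv i (fun y => F y 0 l)) x.
  by have [_] := sF l 2 => /(_ i) [+ _]; apply.
have altx : is_alternating (a (F x)) by apply/altA/UV.
pose Ja := jacobian F x.
have JE y i l : U y -> jacobian F y i l = pderiv i (fun y => F y 0 l) y.
  by move=> Uy; apply: jacobianE => l'; exact: dF.
have JaE i l : Ja i l = pderiv i (fun y => F y 0 l) x by exact: JE.
pose H p c i := pderiv c (pderiv i (fun y => F y 0 p)) x.
pose u p : 'I_m -> R := fun i => \sum_q a (F x) (two p q) * Ja i q.
(* The partial derivatives of F^* a, with the Hessian of F collected in H. *)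
have key c : pd c (pullback F a) x = \sum_l Ja c l *: pull Ja (pd l a (F x))
    + \sum_p wedge1 (H p c) (covec1 (u p)).
  apply: covecP => I; rewrite covecD !covec_sum /pd.
  pose G J y := a (F y) J * (pderiv (I ord0) (fun y => F y 0 (J ord0)) y *
                      pderiv (I (lift ord0 ord0)) (fun y => F y 0 (J (lift ord0 ord0))) y).
  rewrite (@pderiv_eq_on _ _ _ _ (fun y => \sum_J G J y) _ _ oU Ux); last first.
    move=> y Uy; rewrite /pullback; apply: eq_bigr => J _; congr (_ * _).
    by rewrite prod2 !(JE y).
  have dG0 J : differentiable (fun y => a (F y) J) x.
    by apply: (differentiable_comp (f := F) (g := fun z => a z J)) => //;
      apply: differentiable_rV => l; exact: dF.
  rewrite pderiv_sum => [|J _]; last by do 2!apply: differentiableM' => //.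
  under eq_bigr => J _.
    rewrite /G pderivM // ?pderivM //; last exact: differentiableM'.
    rewrite (pderiv_comp _ (g := fun z => a z J)) // => [|l]; last exact: dF.
    rewrite -!JaE -!/(H _ _ _).
    over.
  rewrite big_split /=; congr (_ + _).
    under eq_bigr do rewrite big_distrl /=.
    rewrite exchange_big; apply: eq_bigr => l _ /=.
    rewrite covecZ /pull big_distrr; apply: eq_bigr => J _ /=.
    by rewrite prod2 -!mulrA.
  rewrite sum_two; transitivity (\sum_p \sum_q
     (a (F x) (two p q) * (H p c (I ord0) * Ja (I (lift ord0 ord0)) q)
      + a (F x) (two p q) * (Ja (I ord0) p * H q c (I (lift ord0 ord0))))).
    by apply: eq_bigr => p _; apply: eq_bigr => q _; rewrite two0 two1 mulrDr.
  under [LHS]eq_bigr do rewrite big_split /=.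
  rewrite big_split /= [X in _ + X]exchange_big -big_split; apply: eq_bigr => p _ /=.
  rewrite /wedge1 big_ord_recl big_ord1 expr0 mul1r expr1 mulN1r mulNr /covec1 !ffunE.
  have -> : lift (lift ord0 ord0) ord0 = ord0 :> 'I_2 by apply: val_inj.
  congr (_ + _); rewrite /u big_distrr /= -?sumrN; apply: eq_bigr => q _; first by rewrite mulrCA.
  by rewrite (alt_two p q altx) mulNr; congr (- _); rewrite [RHS]mulrC mulrA.
rewrite extdE; under eq_bigr do rewrite key wedge1Dr.
rewrite big_split /= [X in _ + X](_ : _ = 0) ?addr0.
  under eq_bigr do rewrite wedge1_sumr.
  rewrite exchange_big extdE pull_sum; apply: eq_bigr => l _ /=.
  rewrite pull_wedge1.
  have -> : (fun i => \sum_j jacobian F x i j * dxi l j) = \sum_c Ja c l *: dxi c.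
    apply: funext => i; rewrite fct_sumE (bigD1 l) //= big1 => [|j ne]; last first.
      by rewrite /dxi val_eqE (negbTE ne) mulr0.
    rewrite /dxi eqxx mulr1 addr0 (bigD1 i) //= big1 => [|j ne]; last first.
      by rewrite -[LHS]/(_ * _) val_eqE eq_sym (negbTE ne) mulr0.
    by rewrite addr0 -[RHS]/(_ * _) eqxx mulr1.
  by rewrite wedge1_suml; apply: eq_bigr => c _; rewrite wedge1Zl wedge1Zr.
under eq_bigr do rewrite wedge1_sumr.
rewrite exchange_big big1 // => p _; apply: hess_kill; last first.
  by rewrite -wedge1_one0; apply/alt_wedge1/alt_one0.
by move=> i j; apply: (schwarz _ _ oU (sF p 2) Ux).
Qed.

End Chain.

End ExteriorDerivative.

Section FormCalculus.
Context {R : realType}.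

Lemma jacobian_rsubmx m n x : jacobian (@rsubmx R 1 m n) x = Emx m n.
Proof.
apply/matrixP => c l; rewrite /jacobian mxE diff_lin; last exact: continuous_rsubmx.
rewrite !mxE; case: (split_ordP c) => d ->; rewrite ?col_mxEu ?col_mxEd !mxE.
  by rewrite eq_rlshift.
by rewrite eq_rshift eq_sym.
Qed.

Lemma jacobian_lsubmx m n x : jacobian (@lsubmx R 1 m n) x = col_mx 1%:M 0.
Proof.
apply/matrixP => c l; rewrite /jacobian mxE diff_lin; last exact: continuous_lsubmx.
rewrite !mxE; case: (split_ordP c) => d ->; rewrite ?col_mxEu ?col_mxEd !mxE.
  by rewrite eq_lshift eq_sym.
by rewrite eq_lrshift.
Qed.

Section OneSpace.
Context {n : nat}.
Implicit Types (k : nat) (x : 'rV[R]_n) (U : set 'rV[R]_n).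

(** A linear map with constant coefficients commutes with partial derivatives.
    *)
Lemma pd_lin k l (T : covec R n k -> covec R n l) (M : {ffun 'I_l -> 'I_n} -> {ffun 'I_k -> 'I_n} -> R)
    c (a : 'rV[R]_n -> covec R n k) x :
  (forall b I, T b I = \sum_J M I J * b J) ->
  (forall J, differentiable (fun y => a y J) x) ->
  pd c (fun y => T (a y)) x = T (pd c a x).
Proof.
move=> hT da; apply: covecP => I; rewrite hT /pd.
have -> : (fun y => T (a y) I) = fun y => \sum_J M I J * a y J by apply: funext => y; rewrite hT.
rewrite pderiv_sum => [|J _]; last by apply: differentiableM' => //; exact: differentiable_cst.
by apply: eq_bigr => J _; rewrite pderivZ.
Qed.

Lemma pd_pull k c (P : 'M[R]_n) (a : 'rV[R]_n -> covec R n k) x :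
  (forall J, differentiable (fun y => a y J) x) ->
  pd c (fun y => pull P (a y)) x = pull P (pd c a x).
Proof.
apply: (pd_lin (M := fun I J => \prod_(d < k) P (I d) (J d))) => b I.
by apply: eq_bigr => J _; rewrite mulrC.
Qed.

Lemma pd_wedge1 k c alpha (a : 'rV[R]_n -> covec R n k) x :
  (forall J, differentiable (fun y => a y J) x) ->
  pd c (fun y => wedge1 alpha (a y)) x = wedge1 alpha (pd c a x).
Proof.
move=> da; apply: covecP => I; rewrite /pd /wedge1 pderiv_sum => [|j _].
  by apply: eq_bigr => j _; rewrite pderivZ.
by apply: differentiableM' => //; exact: differentiable_cst.
Qed.

Lemma pd_fmul k c (f : 'rV[R]_n -> R) (a : 'rV[R]_n -> covec R n k) x :
  differentiable f x -> (forall J, differentiable (fun y => a y J) x) ->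
  pd c (fun y => f y *: a y) x = pderiv c f x *: a x + f x *: pd c a x.
Proof.
by move=> df da; apply: covecP => I; rewrite covecD !covecZ /pd -pderivM.
Qed.

Lemma pd_sum k (T : Type) (s : seq T) c (a : T -> 'rV[R]_n -> covec R n k) x :
  (forall t J, differentiable (fun y => a t y J) x) ->
  pd c (fun y => \sum_(t <- s) a t y) x = \sum_(t <- s) pd c (a t) x.
Proof.
move=> da; apply: covecP => I; rewrite covec_sum /pd -pderiv_sum //.
by congr (pderiv c _ x); apply: funext => y; rewrite covec_sum.
Qed.

Lemma pdD k c (a b : 'rV[R]_n -> covec R n k) x :
  (forall J, differentiable (fun y => a y J) x) -> (forall J, differentiable (fun y => b y J) x) ->
  pd c (fun y => a y + b y) x = pd c a x + pd c b x.
Proof. by move=> da db; apply: covecP => I; rewrite covecD /pd -pderivD. Qed.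

Lemma pdZ k c (r : R) (a : 'rV[R]_n -> covec R n k) x :
  (forall J, differentiable (fun y => a y J) x) ->
  pd c (fun y => r *: a y) x = r *: pd c a x.
Proof. by move=> da; apply: covecP => I; rewrite covecZ /pd -pderivZ. Qed.

Lemma extdD k (a b : 'rV[R]_n -> covec R n k) x :
  (forall J, differentiable (fun y => a y J) x) -> (forall J, differentiable (fun y => b y J) x) ->
  extd (fun y => a y + b y) x = extd a x + extd b x.
Proof.
move=> da db; rewrite !extdE -big_split; apply: eq_bigr => c _ /=.
by rewrite pdD // wedge1Dr.
Qed.

Lemma extdZ k (r : R) (a : 'rV[R]_n -> covec R n k) x :
  (forall J, differentiable (fun y => a y J) x) ->
  extd (fun y => r *: a y) x = r *: extd a x.
Proof.
by move=> da; rewrite !extdE scaler_sumr; apply: eq_bigr => c _; rewrite pdZ // wedge1Zr.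
Qed.

Lemma extd_fmul k (f : 'rV[R]_n -> R) (a : 'rV[R]_n -> covec R n k) x :
  differentiable f x -> (forall J, differentiable (fun y => a y J) x) ->
  extd (fun y => f y *: a y) x = wedge1 (fun c => pderiv c f x) (a x) + f x *: extd a x.
Proof.
move=> df da; rewrite !extdE scaler_sumr [in RHS](_ : (fun c => _) = \sum_(c < n) pderiv c f x *: dxi c).
  rewrite wedge1_suml -big_split; apply: eq_bigr => c _ /=.
  by rewrite pd_fmul // wedge1Dr !wedge1Zr wedge1Zl.
apply: funext => i; rewrite fct_sumE (bigD1 i) //= big1 => [|j ne].
  by rewrite addr0 -[RHS]/(_ * _) /dxi eqxx mulr1.
by rewrite -[LHS]/(_ * _) /dxi val_eqE eq_sym (negbTE ne) mulr0.
Qed.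

Lemma extd_cst k (c : covec R n k) x : extd (fun _ : 'rV[R]_n => c) x = 0.
Proof.
rewrite extdE big1 // => i _; have -> : pd i (fun _ : 'rV[R]_n => c) x = 0.
  by apply: covecP => I; exact: pderiv_cst.
by rewrite -(scale0r (0 : covec R n k)) wedge1Zr scale0r.
Qed.

Lemma diff_wedge1 k alpha (a : 'rV[R]_n -> covec R n k) x I :
  (forall J, differentiable (fun y => a y J) x) ->
  differentiable (fun y => wedge1 alpha (a y) I) x.
Proof.
by move=> da; apply: differentiable_sum' => j _; apply: differentiableM'.
Qed.

Lemma extd_wedge1 k alpha (a : 'rV[R]_n -> covec R n k) x U :
  open U -> U x -> (forall y, U y -> is_alternating (a y)) ->
  (forall J, differentiable (fun y => a y J) x) ->
  extd (fun y => wedge1 alpha (a y)) x = - wedge1 alpha (extd a x).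
Proof.
move=> oU Ux alta da; rewrite !extdE wedge1_sumr -sumrN; apply: eq_bigr => c _.
by rewrite pd_wedge1 // wedge1_anti //; exact: (alt_pd _ oU).
Qed.

Lemma diff_wedge p q (a : 'rV[R]_n -> covec R n p) (b : 'rV[R]_n -> covec R n q) x I :
  (forall J, differentiable (fun y => a y J) x) -> (forall J, differentiable (fun y => b y J) x) ->
  differentiable (fun y => wedge (a y) (b y) I) x.
Proof.
move=> da db; apply: differentiableM'; first exact: differentiable_cst.
by apply: differentiable_sum' => s _; apply: differentiableM' => //; apply: differentiableM'.
Qed.

Lemma pd_wedge p q c (a : 'rV[R]_n -> covec R n p) (b : 'rV[R]_n -> covec R n q) x :
  (forall J, differentiable (fun y => a y J) x) -> (forall J, differentiable (fun y => b y J) x) ->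
  pd c (fun y => wedge (a y) (b y)) x = wedge (pd c a x) (b x) + wedge (a x) (pd c b x).
Proof.
move=> da db; apply: covecP => I; rewrite covecD /pd /wedge -mulrDr.
have dc (r : R) : differentiable (fun _ : 'rV[R]_n => r) x by exact: differentiable_cst.
have d1 (s : 'S_(p + q)) : differentiable (fun y => (-1) ^+ s * a y [ffun c0 => I (s (lshift q c0))]) x.
  exact: differentiableM'.
rewrite pderivZ; last by apply: differentiable_sum' => s _; apply: differentiableM'.
congr (_ * _); rewrite pderiv_sum => [|s _]; last exact: differentiableM'.
by rewrite -big_split; apply: eq_bigr => s _ /=; rewrite pderivM // pderivZ.
Qed.

Lemma extd_wedge_sq (a : 'rV[R]_n -> covec R n 2) x :
  (forall J, differentiable (fun y => a y J) x) ->
  extd (fun y => wedge (a y) (a y)) x = 2 *: wedge (extd a x) (a x).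
Proof.
move=> da; rewrite extdE -[extd a x]/(extd a x) extdE wedge_suml scaler_sumr.
apply: eq_bigr => c _; rewrite pd_wedge // (wedgeC2 (a x)) wedge_wedge1.
by rewrite -[X in X + _]scale1r -[X in _ + X]scale1r -scalerDl wedge1Zr.
Qed.

(** d with each dx^c replaced by its composition with A. For A = 1 this is d,
    and for A = J it is i (del - delbar). *)
Definition dtwist (A : 'M[R]_n) k (a : 'rV[R]_n -> covec R n k) x : covec R n k.+1 :=
  \sum_(c < n) wedge1 (fun i => A i c) (pd c a x).

Lemma dtwist1 k (a : 'rV[R]_n -> covec R n k) x : dtwist 1%:M a x = extd a x.
Proof.
rewrite extdE; apply: eq_bigr => c _; congr wedge1; apply: funext => i.
by rewrite mxE /dxi val_eqE.
Qed.

Lemma dtwist_eq_on A k (a b : 'rV[R]_n -> covec R n k) x U :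
  open U -> U x -> (forall y, U y -> a y = b y) -> dtwist A a x = dtwist A b x.
Proof.
move=> oU Ux h; apply: eq_bigr => c _; congr wedge1.
by apply: covecP => I; apply: (pderiv_eq_on _ oU Ux) => y /h ->.
Qed.

Lemma alt_dtwist A k (a : 'rV[R]_n -> covec R n k) x U :
  open U -> U x -> (forall y, U y -> is_alternating (a y)) ->
  (forall J, differentiable (fun y => a y J) x) -> is_alternating (dtwist A a x).
Proof.
by move=> oU Ux ha da; apply: alt_sum => c _; apply: alt_wedge1; exact: (alt_pd _ oU).
Qed.

Lemma dtwistZ A k (r : R) (a : 'rV[R]_n -> covec R n k) x :
  (forall J, differentiable (fun y => a y J) x) ->
  dtwist A (fun y => r *: a y) x = r *: dtwist A a x.
Proof.
by move=> da; rewrite /dtwist scaler_sumr; apply: eq_bigr => c _; rewrite pdZ // wedge1Zr.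
Qed.

Lemma smooth_pd k c (a : 'rV[R]_n -> covec R n k) U : open U ->
  (forall I, smooth_on U (fun y => a y I)) -> forall I, smooth_on U (fun y => pd c a y I).
Proof. by move=> oU h I; exact: smooth_on_pderiv. Qed.

Lemma smooth_wedge1 k alpha (a : 'rV[R]_n -> covec R n k) U :
  (forall I, smooth_on U (fun y => a y I)) -> forall I, smooth_on U (fun y => wedge1 alpha (a y) I).
Proof.
move=> h I; apply: smooth_on_sum => j _; apply: smooth_onM; [exact: smooth_on_cst | exact: h].
Qed.

Lemma smooth_dtwist A k (a : 'rV[R]_n -> covec R n k) U : open U ->
  (forall I, smooth_on U (fun y => a y I)) -> forall I, smooth_on U (fun y => dtwist A a y I).
Proof.
move=> oU h I; apply: (smooth_on_eq (f := fun y => \sum_(c < n) wedge1 (fun i => A i c) (pd c a y) I)).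
  by move=> y _; rewrite /dtwist covec_sum.
by apply: smooth_on_sum => c _; apply: smooth_wedge1; exact: smooth_pd.
Qed.

Lemma dtwist_comp A B k (a : 'rV[R]_n -> covec R n k) x U :
  open U -> U x -> (forall I, smooth_on U (fun y => a y I)) ->
  dtwist A (dtwist B a) x =
  \sum_(b < n) \sum_(c < n) wedge1 (fun i => A i b) (wedge1 (fun i => B i c) (pd b (pd c a) x)).
Proof.
move=> oU Ux sa; apply: eq_bigr => b _.
have dpd c J : differentiable (fun y => pd c a y J) x.
  by apply: (smooth_on_diff oU _ Ux); exact: smooth_pd.
rewrite pd_sum => [|c J]; last exact: diff_wedge1.
by rewrite wedge1_sumr; apply: eq_bigr => c _; rewrite pd_wedge1.
Qed.

Lemma pd_sym k b c (a : 'rV[R]_n -> covec R n k) x U : open U -> U x ->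
  (forall I, smooth_on U (fun y => a y I)) -> pd b (pd c a) x = pd c (pd b a) x.
Proof.
move=> oU Ux sa; apply: covecP => I; apply: (schwarz _ _ oU _ Ux).
exact: (smooth_on_Ck 2 oU (sa I)).
Qed.

(** Both sides are sums of (A dx^b) /\ (B dx^c) /\ (d^2 a / d x^b d x^c);
    one-forms anticommute and partial derivatives commute. *)
Lemma dtwist_anti A B k (a : 'rV[R]_n -> covec R n k) x U :
  open U -> U x -> (forall y, U y -> is_alternating (a y)) ->
  (forall I, smooth_on U (fun y => a y I)) ->
  dtwist A (dtwist B a) x = - dtwist B (dtwist A a) x.
Proof.
move=> oU Ux alta sa; rewrite !(dtwist_comp _ _ oU) // exchange_big -sumrN.
apply: eq_bigr => c _; rewrite -sumrN; apply: eq_bigr => b _.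
rewrite (pd_sym _ _ oU) // wedge1_anti //; apply: (alt_pd _ oU) => // [y Uy|I].
  by apply: (alt_pd _ oU) => // I; apply: (smooth_on_diff oU).
by apply: (smooth_on_diff oU _ Ux); exact: smooth_pd.
Qed.

End OneSpace.

(** The forms pulled back from the second factor have constant coefficients
    along the first one. *)
Lemma extd_pr2 m n k (a : 'rV[R]_n -> covec R n k) (x : 'rV[R]_(m + n)) :
  (forall J, differentiable (fun y => a y J) (rsubmx x)) ->
  extd (fun y => pull (Emx m n) (a (rsubmx y))) x = pull (Emx m n) (extd a (rsubmx x)).
Proof.
move=> da; have dr l : differentiable (fun y : 'rV[R]_(m + n) => rsubmx y 0 l) x.
  apply: (differentiable_comp (f := rsubmx) (g := fun z : 'rV[R]_n => z 0 l)).
    exact: differentiable_rsubmx.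
  exact: differentiable_coord.
have dc J : differentiable (fun y : 'rV[R]_(m + n) => a (rsubmx y) J) x.
  apply: (differentiable_comp (f := rsubmx) (g := fun z => a z J)) => //.
  exact: differentiable_rsubmx.
have key c : pd c (fun y => pull (Emx m n) (a (rsubmx y))) x
    = \sum_l Emx m n c l *: pull (Emx m n) (pd l a (rsubmx x)).
  apply: covecP => I; rewrite covec_sum /pd /pull.
  rewrite pderiv_sum => [|J _]; last by apply: differentiableM' => //; exact: differentiable_cst.
  under [RHS]eq_bigr do rewrite covecZ big_distrr /=.
  rewrite exchange_big; apply: eq_bigr => J _ /=.
  have -> : (fun y : 'rV[R]_(m + n) => a (rsubmx y) J * \prod_(c0 < k) Emx m n (I c0) (J c0))
     = fun y => \prod_(c0 < k) Emx m n (I c0) (J c0) * a (rsubmx y) J.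
    by apply: funext => y; rewrite mulrC.
  rewrite pderivZ // (@pderiv_comp R (m + n) n rsubmx x c (fun z => a z J) dr (da J)) // jacobian_rsubmx.
  by rewrite mulrC big_distrl; apply: eq_bigr => l _ /=; rewrite mulrA.
rewrite !extdE; under eq_bigr do rewrite key wedge1_sumr.
rewrite exchange_big pull_sum; apply: eq_bigr => l _ /=.
rewrite pull_wedge1 [in RHS](_ : (fun i => _) = \sum_(c < m + n) Emx m n c l *: dxi c).
  by rewrite wedge1_suml; apply: eq_bigr => c _; rewrite wedge1Zl wedge1Zr.
apply: funext => i; rewrite fct_sumE (bigD1 l) //= big1 => [|j ne]; last first.
  by rewrite /dxi val_eqE (negbTE ne) mulr0.
rewrite {1}/dxi eqxx mulr1 addr0 (bigD1 i) //= big1 => [|j ne].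
  by rewrite addr0 -[RHS]/(_ * _) /dxi eqxx mulr1.
by rewrite -[LHS]/(_ * _) /dxi val_eqE eq_sym (negbTE ne) mulr0.
Qed.

Section LeviCivita.
Context {n : nat} (g : 'rV[R]_n -> 'M[R]_n) (x : 'rV[R]_n) (U : set 'rV[R]_n).
Hypotheses (oU : open U) (Ux : U x) (sg : forall y, U y -> (g y)^T = g y).

Lemma christoffel_sym l i j : christoffel g x l i j = christoffel g x l j i.
Proof.
rewrite /christoffel; congr (_ * _); apply: eq_bigr => s _; congr (_ * _).
rewrite [X in X - _]addrC; congr (_ - _); apply: (pderiv_eq_on _ oU Ux) => y /sg e.
by rewrite -[in LHS]e mxE.
Qed.

(** The Christoffel symbols are symmetric in their lower indices, so they
    disappear when the covariant derivative is antisymmetrised. *)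
Lemma extd_nabla k (a : 'rV[R]_n -> covec R n k.+1) : is_alternating (a x) ->
  \sum_(m < n) wedge1 (dxi m) (nabla g a x m) = extd a x.
Proof.
move=> alta; pose G l m i := christoffel g x l m i.
have e m : nabla g a x m = pd m a x - \sum_l wedge1 (G l m) (interior_product (delta_mx 0 l) (a x)).
  apply: covecP => I; rewrite covecD covecN covec_sum /nabla; congr (_ - _).
  rewrite exchange_big; apply: eq_bigr => l _; apply: eq_bigr => b _ /=.
  rewrite interior_delta -mulrA mulrCA; congr (_ * _).
  rewrite -(alt_fins _ _ _ alta); congr (a x _); apply/ffunP => c; rewrite !ffunE.
  by case: unliftP => [d|] ->; rewrite ?eqxx // ffunE eq_sym (negbTE (neq_lift _ _)).
rewrite extdE; under eq_bigr do rewrite e -scaleN1r wedge1Dr wedge1Zr.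
rewrite big_split /= -scaler_sumr [X in _ *: X](_ : _ = 0) ?scaler0 ?addr0 //.
under eq_bigr do rewrite wedge1_sumr.
rewrite exchange_big big1 // => l _; apply: hess_kill; first by move=> i j; exact: christoffel_sym.
exact: alt_interior.
Qed.

End LeviCivita.

End FormCalculus.

(** * The operators del and delbar *)

Section Dolbeault.
Context {R : realType}.
Local Notation C := (complex R).
Local Notation J := (@Jmx R 3).
Local Notation ii := (0 +i* 1 : C)%C.

Lemma sum_Jmx_l (a : 'I_3) (F : 'I_(3 + 3) -> R) : \sum_c J (lshift 3 a) c * F c = F (rshift 3 a).
Proof.
rewrite (bigD1 (rshift 3 a)) //= [X in _ + X]big1 ?addr0 => [|c ne]; last first.
  case: (split_ordP c) ne => d ->; rewrite /Jmx ?block_mxEul ?block_mxEur !mxE ?mul0r //.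
  by rewrite eq_rshift eq_sym => /negbTE ->; rewrite mul0r.
by rewrite /Jmx block_mxEur mxE eqxx mul1r.
Qed.

Lemma sum_Jmx_r (a : 'I_3) (F : 'I_(3 + 3) -> R) : \sum_c J (rshift 3 a) c * F c = - F (lshift 3 a).
Proof.
rewrite (bigD1 (lshift 3 a)) //= [X in _ + X]big1 ?addr0 => [|c ne]; last first.
  case: (split_ordP c) ne => d ->; rewrite /Jmx ?block_mxEdl ?block_mxEdr !mxE ?mul0r //.
  by rewrite eq_lshift eq_sym => /negbTE ->; rewrite oppr0 mul0r.
by rewrite /Jmx block_mxEdl !mxE eqxx mulN1r.
Qed.

Lemma half_re (z : C) : complex.Re (z / 2) = 2^-1 * complex.Re z.
Proof. by rewrite [z / 2](_ : _ = (2^-1)%:C%C * z) ?Re_realM // mulrC fmorphV rmorph_nat. Qed.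
Lemma half_im (z : C) : complex.Im (z / 2) = 2^-1 * complex.Im z.
Proof. by rewrite [z / 2](_ : _ = (2^-1)%:C%C * z) ?Im_realM // mulrC fmorphV rmorph_nat. Qed.

Section Function.
Variables (f : 'rV[R]_(3 + 3) -> C) (x : 'rV[R]_(3 + 3)).
Let p y := complex.Re (f y).
Let q y := complex.Im (f y).

(** The component in direction i of del f, that is, of (d f - i (d f) J) / 2.
    *)
Lemma sum_zdz_dbyz i : \sum_j zdz j i * dbyz j f x =
  ((2^-1 * (pderiv i p x + \sum_c J i c * pderiv c q x)) +i*
   (2^-1 * (pderiv i q x - \sum_c J i c * pderiv c p x)))%C.
Proof.
have [a ->|a ->] := split_ordP i; rewrite (bigD1 a) //= [X in _ + X]big1 ?addr0; last first.
- by move=> b ne; rewrite zdz_r eq_sym (negbTE ne) ?mulr0 ?conjc0 mul0r.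
- rewrite zdz_r eqxx mulr1 !sum_Jmx_r; apply/eqP.
  rewrite eq_complex /dbyz mulrA half_re half_im /pderivC /=.
  rewrite -/p -/q; move: (pderiv (lshift 3 a) p x) (pderiv (rshift 3 a) p x) (pderiv (lshift 3 a) q x)
    (pderiv (rshift 3 a) q x) => u v w z; apply/andP; split; apply/eqP; ring.
- by move=> b ne; rewrite zdz_l eq_sym (negbTE ne) ?conjc0 mul0r.
- rewrite zdz_l eqxx mul1r !sum_Jmx_l; apply/eqP; rewrite eq_complex half_re half_im /=.
  rewrite -/p -/q; move: (pderiv (lshift 3 a) p x) (pderiv (rshift 3 a) p x) (pderiv (lshift 3 a) q x)
    (pderiv (rshift 3 a) q x) => u v w z; apply/andP; split; apply/eqP; ring.
Qed.

(** The component in direction i of delbar f, that is, of (d f + i (d f) J) /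
    2. *)
Lemma sum_zdz_dbyzbar i : \sum_j (zdz j i)^*%C * dbyzbar j f x =
  ((2^-1 * (pderiv i p x - \sum_c J i c * pderiv c q x)) +i*
   (2^-1 * (pderiv i q x + \sum_c J i c * pderiv c p x)))%C.
Proof.
have [a ->|a ->] := split_ordP i; rewrite (bigD1 a) //= [X in _ + X]big1 ?addr0; last first.
- by move=> b ne; rewrite zdz_r eq_sym (negbTE ne) ?mulr0 ?conjc0 mul0r.
- rewrite zdz_r eqxx mulr1 !sum_Jmx_r; apply/eqP.
  rewrite eq_complex /dbyzbar mulrA half_re half_im /pderivC /=.
  rewrite -/p -/q; move: (pderiv (lshift 3 a) p x) (pderiv (rshift 3 a) p x) (pderiv (lshift 3 a) q x)
    (pderiv (rshift 3 a) q x) => u v w z; apply/andP; split; apply/eqP; ring.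
- by move=> b ne; rewrite zdz_l eq_sym (negbTE ne) ?conjc0 mul0r.
- rewrite zdz_l eqxx conjc1 mul1r !sum_Jmx_l; apply/eqP; rewrite eq_complex half_re half_im /=.
  rewrite -/p -/q; move: (pderiv (lshift 3 a) p x) (pderiv (rshift 3 a) p x) (pderiv (lshift 3 a) q x)
    (pderiv (rshift 3 a) q x) => u v w z; apply/andP; split; apply/eqP; ring.
Qed.

End Function.

Section Forms.
Variables (k : nat) (b : 'rV[R]_(3 + 3) -> covec C (3 + 3) k) (U : set 'rV[R]_(3 + 3)).
Local Notation p := (fun y => reC (b y)).
Local Notation q := (fun y => imC (b y)).
Variable x : 'rV[R]_(3 + 3).
Hypotheses (oU : open U) (Ux : U x) (altb : forall y, U y -> is_alternating (b y)).
Hypotheses (dp : forall L, differentiable (fun y => p y L) x)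
  (dq : forall L, differentiable (fun y => q y L) x).

Lemma pderivC_perm (s : 'S_k) (L : {ffun 'I_k -> 'I_(3 + 3)}) c :
  pderivC c (fun y => b y [ffun d => L (s d)]) x = (-1) ^+ s * pderivC c (fun y => b y L) x.
Proof.
have sR (z : C) : (-1) ^+ s * z = (((-1) ^+ s)%:C)%C * z by rewrite rmorphXn rmorphN1.
rewrite sR /pderivC; apply/eqP; rewrite eq_complex Re_realM Im_realM /=.
have e y : U y -> b y [ffun d => L (s d)] = (-1) ^+ s * b y L by move=> Uy; exact: altb.
rewrite -(pderivZ _ _ (dp L)) -(pderivZ _ _ (dq L)).
by apply/andP; split; apply/eqP; apply: (pderiv_eq_on _ oU Ux) => y /e ->; rewrite sR ?Re_realM ?Im_realM.
Qed.

Lemma ldelE I : ldel b x I = \sum_(d < k.+1) (-1) ^+ d *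
  \sum_j zdz j (I d) * dbyz j (fun y => b y [ffun c => I (lift d c)]) x.
Proof.
rewrite /ldel; transitivity (\sum_(j < 3) wedge1 (zdz j) (fun L => dbyz j (fun y => b y L) x) I).
  apply: eq_bigr => j _; rewrite dzE wedge_covec1 // => s L.
  by rewrite /dbyz !pderivC_perm mulrCA -mulrBr mulrA.
rewrite /wedge1 exchange_big; apply: eq_bigr => d _ /=.
by rewrite big_distrr; apply: eq_bigr => j _ /=; rewrite -mulrA.
Qed.

Lemma ldelbarE I : ldelbar b x I = \sum_(d < k.+1) (-1) ^+ d *
  \sum_j (zdz j (I d))^*%C * dbyzbar j (fun y => b y [ffun c => I (lift d c)]) x.
Proof.
rewrite /ldelbar; transitivity (\sum_(j < 3)
   wedge1 (fun i => (zdz j i)^*%C) (fun L => dbyzbar j (fun y => b y L) x) I).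
  apply: eq_bigr => j _; have -> : dzbar j = covec1 (fun i => (zdz j i)^*%C) :> covec C (3 + 3) 1.
    by apply: covecP => L; rewrite /dzbar dzE.
  rewrite wedge_covec1 // => s L.
  by rewrite /dbyzbar !pderivC_perm mulrCA -mulrDr mulrA.
rewrite /wedge1 exchange_big; apply: eq_bigr => d _ /=.
by rewrite big_distrr; apply: eq_bigr => j _ /=; rewrite -mulrA.
Qed.

Lemma dtwistE (a : 'rV[R]_(3 + 3) -> covec R (3 + 3) k) (A : 'M[R]_(3 + 3)) I :
  dtwist A a x I = \sum_(d < k.+1) (-1) ^+ d *
    \sum_c A (I d) c * pderiv c (fun y => a y [ffun e => I (lift d e)]) x.
Proof.
rewrite /dtwist covec_sum /wedge1 exchange_big; apply: eq_bigr => d _ /=.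
by rewrite big_distrr; apply: eq_bigr => j _ /=; rewrite -mulrA.
Qed.

Lemma Re_signC (m : nat) (z : C) : complex.Re ((-1) ^+ m * z) = (-1) ^+ m * complex.Re z.
Proof. by rewrite -Re_realM rmorphXn rmorphN1. Qed.
Lemma Im_signC (m : nat) (z : C) : complex.Im ((-1) ^+ m * z) = (-1) ^+ m * complex.Im z.
Proof. by rewrite -Im_realM rmorphXn rmorphN1. Qed.

Lemma comb_sum (r : R) (u v w : 'I_k.+1 -> R) : (forall d, u d = 2^-1 * (v d + r * w d)) ->
  \sum_(d < k.+1) (-1) ^+ d * u d
  = 2^-1 * (\sum_(d < k.+1) (-1) ^+ d * v d + r * \sum_(d < k.+1) (-1) ^+ d * w d).
Proof.
move=> h; rewrite [X in _ * (_ + X)]big_distrr -big_split big_distrr; apply: eq_bigr => d _ /=.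
by rewrite h; move: (v d) (w d) ((-1) ^+ d) => v' w' s; ring.
Qed.

(** On a form p + i q, del is (d - i dtwist J) / 2. *)
Lemma Im_ldel : imC (ldel b x) = 2^-1 *: (extd q x + (-1) *: dtwist J p x).
Proof.
apply: covecP => I; rewrite /imC ldelE Im_sum !(covecZ, covecD) dtwistE -(comb_sum (r := -1) (fun=> erefl)).
by apply: eq_bigr => d _; rewrite Im_signC sum_zdz_dbyz /= mulN1r.
Qed.

(** On a form p + i q, delbar is (d + i dtwist J) / 2. *)
Lemma Re_ldelbar : reC (ldelbar b x) = 2^-1 *: (extd p x + (-1) *: dtwist J q x).
Proof.
apply: covecP => I; rewrite /reC ldelbarE Re_sum !(covecZ, covecD) dtwistE -(comb_sum (r := -1) (fun=> erefl)).
by apply: eq_bigr => d _; rewrite Re_signC sum_zdz_dbyzbar /= mulN1r.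
Qed.

Lemma Im_ldelbar : imC (ldelbar b x) = 2^-1 *: (extd q x + dtwist J p x).
Proof.
apply: covecP => I; rewrite /imC ldelbarE Im_sum !(covecZ, covecD) dtwistE -[X in _ + X]mul1r.
rewrite -(comb_sum (r := 1) (fun=> erefl)).
by apply: eq_bigr => d _; rewrite Im_signC sum_zdz_dbyzbar /= mul1r.
Qed.

Lemma alt_ldelbar : is_alternating (ldelbar b x).
Proof.
have -> : ldelbar b x = \sum_j
   wedge (dzbar j) (fun L => dbyzbar j (fun y => b y L) x).
  by apply: covecP => I; rewrite covec_sum.
by apply: alt_sum => j _; exact: alt_wedge.
Qed.

End Forms.

(** By the formulas for del and delbar, 4 i del delbar a = - d (dtwist J a) +
    dtwist J (d a) up to an imaginary part, and the two operators anticommute.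
    *)
Lemma ddbar k (a : 'rV[R]_(3 + 3) -> covec R (3 + 3) k) U x I : open U -> U x ->
  (forall y, U y -> is_alternating (a y)) -> (forall L, smooth_on U (fun y => a y L)) ->
  complex.Re ((0 +i* 4)%C * ldel (ldelbar (fun y L => (a y L)%:C%C)) x I)
    = -2 * extd (dtwist J a) x I.
Proof.
move=> oU Ux alta sa; pose b y L := (a y L)%:C%C.
have altb y : U y -> is_alternating (b y).
  by move=> Uy s L; rewrite /b alta // rmorphM rmorphXn rmorphN1.
have pd0 c y : pd c (fun y => imC (b y)) y = 0.
  by apply: covecP => L; rewrite /pd /imC /= pderiv_cst.
have wedge10 al : wedge1 al 0 = 0 :> covec R (3 + 3) k.+1.
  by rewrite -[X in wedge1 _ X](scale0r (0 : covec R (3 + 3) k)) wedge1Zr scale0r.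
have q0 y : extd (fun y => imC (b y)) y = 0.
  by rewrite extdE big1 // => c _; rewrite pd0 wedge10.
have t0 y : dtwist J (fun y => imC (b y)) y = 0.
  by rewrite /dtwist big1 // => c _; rewrite pd0 wedge10.
have d0 y L : U y -> differentiable (fun y => reC (b y) L) y.
  by move=> Uy; exact: (smooth_on_diff oU (sa L) Uy).
have d1 y L : differentiable (fun y => imC (b y) L) y by exact: differentiable_cst.
have alt2 y : U y -> is_alternating (ldelbar b y) by move=> Uy; exact: (alt_ldelbar b y).
rewrite (_ : complex.Re _ = -4 * imC (ldel (ldelbar b) x) I); last first.
  by rewrite /imC -/b; case: (ldel _ _ _) => u v /=; ring.
have dt J' : differentiable (fun y => dtwist J a y J') x.
  by apply: (smooth_on_diff oU _ Ux); exact: smooth_dtwist.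
have de J' : differentiable (fun y => extd a y J') x.
  apply: (differentiable_eq_on oU Ux (f := fun y => dtwist 1%:M a y J')) => [y _|].
    by rewrite dtwist1.
  by apply: (smooth_on_diff oU _ Ux); exact: smooth_dtwist.
have e1 y : U y -> imC (ldelbar b y) = 2^-1 *: dtwist J a y.
  by move=> Uy; rewrite (Im_ldelbar oU Uy altb) ?q0 ?add0r // => L; exact: d0.
have e2 y : U y -> reC (ldelbar b y) = 2^-1 *: extd a y.
  by move=> Uy; rewrite (Re_ldelbar oU Uy altb) ?t0 ?scaler0 ?addr0 // => L; exact: d0.
rewrite (Im_ldel oU Ux alt2); first last.
- move=> L; apply: (differentiable_eq_on oU Ux (f := fun y => 2^-1 * dtwist J a y L)).
    by move=> y Uy; rewrite e1.
  exact: differentiableM'.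
- move=> L; apply: (differentiable_eq_on oU Ux (f := fun y => 2^-1 * extd a y L)).
    by move=> y Uy; rewrite e2.
  exact: differentiableM'.
rewrite (extd_eq_on oU Ux e1) (dtwist_eq_on J oU Ux e2).
rewrite extdZ // dtwistZ //.
rewrite (dtwist_eq_on (b := dtwist 1%:M a) J oU Ux); last by move=> y _; rewrite dtwist1.
rewrite (dtwist_anti _ _ oU Ux) // dtwist1 !(covecZ, covecD, covecN).
by move: (extd _ _ _) => z; lra.
Qed.

(** If J a = a then J also fixes the partial derivatives of a, so J d a only
    twists the one-forms dx^c. *)
Lemma dtwist_pull k (a : 'rV[R]_(3 + 3) -> covec R (3 + 3) k) U x : open U -> U x ->
  (forall L, smooth_on U (fun y => a y L)) -> (forall y, U y -> pull J (a y) = a y) ->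
  pull J (extd a x) = dtwist J a x.
Proof.
move=> oU Ux sa h; rewrite extdE pull_sum; apply: eq_bigr => c _.
rewrite pull_wedge1 -pd_pull => [|L]; last exact: (smooth_on_diff oU (sa L) Ux).
congr wedge1.
  apply: funext => i; rewrite (bigD1 c) //= [X in _ + X]big1 ?addr0 => [|j ne].
    by rewrite /dxi eqxx mulr1.
  by rewrite /dxi val_eqE (negbTE ne) mulr0.
apply: covecP => L; apply: (pderiv_eq_on _ oU Ux) => y /h -> //.
Qed.

End Dolbeault.

(** * The divergence theorem *)

Section IteratedIntegral.
Context {R : realType}.
Local Notation leb := (@lebesgue_measure R).

(** The points of the slices over which integral_Rn iterates. *)
Definition rcons1 n (s : R) (v : 'rV[R]_n) : 'rV[R]_(1 + n) := row_mx (const_mx s) v.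

Lemma rcons1_0 n s (v : 'rV[R]_n) : rcons1 s v 0 (lshift n ord0) = s.
Proof. by rewrite row_mxEl mxE. Qed.

Lemma rcons1_r n s (v : 'rV[R]_n) i : rcons1 s v 0 (rshift 1 i) = v 0 i.
Proof. by rewrite row_mxEr. Qed.

Lemma ball_rcons1 n s s' (v v' : 'rV[R]_n) e :
  ball s e s' -> ball v e v' -> ball (rcons1 s v) e (rcons1 s' v').
Proof.
move=> bs [e0 bv]; split=> // i j; rewrite ord1; case: (split_ordP j) => d ->.
  by rewrite ord1 !rcons1_0.
by rewrite !rcons1_r.
Qed.

Lemma near_rcons1 n (f : 'rV[R]_(1 + n) -> R) s (v : 'rV[R]_n) (P : set R) :
  {for rcons1 s v, continuous f} -> nbhs (f (rcons1 s v)) P ->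
  \forall v' \near v & s' \near s, P (f (rcons1 s' v')).
Proof.
move=> cf /cf /nbhs_ballP[e /= e0 h].
exists (ball v e, ball s e); first by split; exact: nbhsx_ballx.
by move=> [v' s'] [/= bv bs]; apply: h; exact: ball_rcons1.
Qed.

Definition supp n (B : R) (f : 'rV[R]_n -> R) := forall (x : 'rV[R]_n) i, B < `|x 0 i| -> f x = 0.

Lemma compact_cube n (B : R) : compact [set v : 'rV[R]_n | forall i, `|v 0 i| <= B].
Proof.
have := @rV_compact R n (fun=> `[- B, B]%classic) (fun=> @segment_compact _ _ _).
by congr compact; apply/seteqP; split=> v h i; have := h i; rewrite /= in_itv /= ler_norml.
Qed.

Lemma cubeP n (B : R) (v : 'rV[R]_n) : (forall i, `|v 0 i| <= B) \/ exists i, B < `|v 0 i|.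
Proof.
have [h|/existsNP[i /negP]] := pselect (forall i, `|v 0 i| <= B); [by left | right].
by exists i; rewrite ltNge.
Qed.

(** A continuous function with compact support is uniformly continuous. *)
Lemma slice_unif n B (f : 'rV[R]_(1 + n) -> R) s (e : R) : continuous f -> supp B f -> 0 < e ->
  \forall s' \near s, forall v, `|f (rcons1 s' v) - f (rcons1 s v)| <= e.
Proof.
move=> cf sf e0; have e20 : 0 < e / 2 by rewrite divr_gt0.
have tri (x y z : R) : `|x - y| < e / 2 -> `|x - z| < e / 2 -> `|y - z| <= e.
  move=> p1 p2; have -> : y - z = (x - z) - (x - y) by ring.
  by apply: le_trans (ler_normB _ _) _; rewrite (splitr e); apply/ltW/ltrD.
have /compact_near_coveringP h := @compact_cube n B.
have := h R (nbhs s) (fun s' v => `|f (rcons1 s' v) - f (rcons1 s v)| <= e) _.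
case=> [v _|d /= d0 hd].
  pose P : set R := [set y | `|f (rcons1 s v) - y| < e / 2].
  have nP : nbhs (f (rcons1 s v)) P by apply/nbhs_ballP; exists (e / 2).
  have [[/= A1 A2] [n1 n2] h1] := near_rcons1 (cf _) nP.
  exists (A1, A2) => // -[v' s'] [/= a1 a2].
  have p1 := h1 (v', s') (conj a1 a2); have p2 := h1 (v', s) (conj a1 (nbhs_singleton n2)).
  exact: tri p1 p2.
exists d => // s' /hd h' v; case: (cubeP B v) => [|[i hi]]; first exact: h'.
have si t : B < `|rcons1 t v 0 (rshift 1 i)| by rewrite rcons1_r.
by rewrite !(sf _ (rshift 1 i)) // subrr normr0 ltW.
Qed.

Lemma cont_slice n (f : 'rV[R]_(1 + n) -> R) s : continuous f -> continuous (fun v => f (rcons1 s v)).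
Proof.
move=> cf v P /= nP; have [[/= A1 A2] [n1 n2] h1] := near_rcons1 (cf _) nP.
by apply: filterS n1 => v' a1; exact: (h1 (v', s) (conj a1 (nbhs_singleton n2))).
Qed.

Lemma supp_slice n B (f : 'rV[R]_(1 + n) -> R) s : supp B f -> supp B (fun v => f (rcons1 s v)).
Proof. by move=> sf v i hi; apply: (sf _ (rshift 1 i)); rewrite rcons1_r. Qed.

Lemma cont_comb n c (f g : 'rV[R]_n -> R) : continuous f -> continuous g ->
  continuous (fun v => c * f v + g v).
Proof.
move=> cf cg v; rewrite -/({for v, continuous (fun v => c * f v + g v)}).
apply: continuousD; last exact: cg.
by apply: continuousM; [exact: cst_continuous | exact: cf].
Qed.

Section Line.
Variables (B : R) (B0 : 0 <= B).
Implicit Types h k : R -> R.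
Definition supp1 h := forall s, B < `|s| -> h s = 0.

Lemma Rint_seg h : supp1 h -> Rintegral leb setT h = Rintegral leb `[- B, B]%classic h.
Proof.
move=> sh; rewrite [RHS]Rintegral_mkcond; congr (Rintegral _ _ _); apply: funext => s.
rewrite /patch; case: ifPn => // /negP ns; apply: sh.
by rewrite ltNge; apply/negP => hs; apply: ns; rewrite inE /= in_itv /= -ler_norml.
Qed.

Lemma int_seg h : continuous h -> leb.-integrable `[- B, B]%classic (EFin \o h).
Proof.
move=> ch; apply: continuous_compact_integrable; first exact: segment_compact.
exact: continuous_subspaceT.
Qed.

Lemma Rint_lin c h k : continuous h -> continuous k -> supp1 h -> supp1 k ->
  Rintegral leb setT (fun s => c * h s + k s) = c * Rintegral leb setT h + Rintegral leb setT k.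
Proof.
move=> ch ck sh sk; rewrite !Rint_seg //; last by move=> s hs; rewrite sh // sk // mulr0 addr0.
rewrite RintegralD //; [|apply: int_seg|exact: int_seg].
  by rewrite RintegralZl //; exact: int_seg.
by move=> s; apply: continuousM; [exact: cst_continuous | exact: ch].
Qed.

Lemma Rint_bound e h : continuous h -> supp1 h -> (forall s, `|h s| <= e) ->
  `|Rintegral leb setT h| <= 2 * B * e.
Proof.
move=> ch sh he; rewrite Rint_seg //.
have mD : measurable (`[- B, B]%classic : set (measurableTypeR R)) by exact: measurable_itv.
apply: le_trans (le_normr_Rintegral mD (int_seg ch)) _.
have ic : leb.-integrable `[- B, B]%classic (EFin \o (fun=> e)) by apply: int_seg; exact: cst_continuous.
apply: le_trans (le_Rintegral mD _ ic _) _; rewrite /=.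
- by apply: (int_seg (h := fun s => `|h s|)) => s; apply: continuous_comp; [exact: ch | exact: norm_continuous].
- by move=> s _.
rewrite Rintegral_cst // mulrC; apply: ler_wpM2r; first exact: le_trans (he 0).
have E : fine (lebesgue_measure (`[- B, B]%classic : set R)) <= 2 * B.
  by rewrite lebesgue_measure_itv /= lte_fin; case: ifP => _ /=; [lra | rewrite mulr_ge0].
exact: E.
Qed.

End Line.

(** The fundamental theorem of calculus on a segment that contains the support
    in its interior. *)
Lemma Rint_deriv B h k : 0 <= B -> continuous k -> supp1 B h -> supp1 B k ->
  (forall s : R, is_derive s 1 h (k s)) -> Rintegral leb setT k = 0.
Proof.
move=> B0 ck sh sk dh; have B1 : 0 <= B + 1 by lra.
have sk1 : supp1 (B + 1) k by move=> s hs; apply: sk; apply: lt_trans hs; lra.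
have ch : continuous h.
  by move=> s; apply/differentiable_continuous/derivable1_diffP; have [] := dh s.
rewrite (Rint_seg sk1) /Rintegral (@continuous_FTC2 _ k h).
- by rewrite /= !sh ?subrr // ?normrN ger0_norm //; lra.
- lra.
- exact: continuous_subspaceT.
- split=> [s _||]; first by have [] := dh s.
    by apply: cvg_at_right_filter; exact: ch.
  by apply: cvg_at_left_filter; exact: ch.
- by move=> s _; rewrite derive1E derive_val.
Qed.

Lemma norm_step (a b z : R) : 0 < a -> a < - b -> `|b| < z -> `|a + b| < z.
Proof. by move=> a0 ab; rewrite !ltr0_norm; lra. Qed.

Section Iterated.
Variables (B : R) (B0 : 0 <= B).

(** Both properties in dimension n give the continuity of the inner integral in
    dimension n + 1, which in turn gives both properties there; hence the joint
    induction of integral_lin_bound. *)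
Let lin_at n := forall c (f g : 'rV[R]_n -> R), continuous f -> continuous g -> supp B f ->
  supp B g -> integral_Rn (fun x => c * f x + g x) = c * integral_Rn f + integral_Rn g.
Let bound_at n := forall (e : R) (f : 'rV[R]_n -> R), continuous f -> supp B f ->
  (forall x, `|f x| <= e) -> `|integral_Rn f| <= (2 * B) ^+ n * e.

Let cont_aux n (f : 'rV[R]_n.+1 -> R) : lin_at n -> bound_at n -> continuous f -> supp B f ->
  continuous (fun s => integral_Rn (fun v : 'rV[R]_n => f (rcons1 s v))).
Proof.
move=> IHl IHb cf sf s; apply/cvgrPdist_le => e e0.
pose M := (2 * B) ^+ n; have M0 : 0 <= M by rewrite exprn_ge0 // mulr_ge0.
have d0 : 0 < e / (M + 1) by rewrite divr_gt0 //; lra.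
apply: filterS (slice_unif s cf sf d0) => s' h.
have cs t : continuous (fun v => f (rcons1 t v)) by exact: cont_slice.
have ss t : supp B (fun v => f (rcons1 t v)) by exact: supp_slice.
rewrite distrC -[X in _ - X]mul1r -mulNr addrC -IHl //.
apply: le_trans (IHb (e / (M + 1)) _ _ _ _) _.
- exact: cont_comb.
- by move=> v i hi; rewrite !(ss _ _ _ hi) mulr0 addr0.
- by move=> v; rewrite mulN1r addrC.
rewrite -/M mulrA ler_pdivrMr; last by lra.
by rewrite mulrC; apply: ler_wpM2l; [exact: ltW | lra].
Qed.

Let supp_aux n (f : 'rV[R]_n.+1 -> R) : bound_at n -> supp B f ->
  supp1 B (fun s => integral_Rn (fun v : 'rV[R]_n => f (rcons1 s v))).
Proof.
move=> IHb sf s hs.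
have z (v : 'rV[R]_n) : f (rcons1 s v) = 0.
  by have := sf (rcons1 s v) (lshift n (ord0 : 'I_1)); rewrite rcons1_0 => /(_ hs).
have c0 : continuous (fun _ : 'rV[R]_n => 0 : R) by move=> ?; exact: cst_continuous.
rewrite (_ : (fun v => f (rcons1 s v)) = fun=> 0); last by apply: funext.
apply/eqP; rewrite -normr_le0; apply: le_trans (IHb 0 _ c0 (fun _ _ _ => erefl) _) _.
  by move=> x; rewrite normr0.
by rewrite mulr0.
Qed.

Lemma integral_lin_bound n : lin_at n /\ bound_at n.
Proof.
elim: n => [|n [IHl IHb]]; first by split=> // e f _ _ h /=; rewrite expr0 mul1r.
split=> [c f g cf cg sf sg|e f cf sf he] /=.
  rewrite -(@Rint_lin B); [|exact: cont_aux|exact: cont_aux|exact: supp_aux|exact: supp_aux].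
  congr (Rintegral _ _ _); apply: funext => s; rewrite -IHl //; try exact: cont_slice; exact: supp_slice.
rewrite exprS -mulrA; apply: (Rint_bound B0); [exact: cont_aux | exact: supp_aux | move=> s].
apply: IHb; [exact: cont_slice | exact: supp_slice | by move=> v].
Qed.

Lemma integral_lin n c (f g : 'rV[R]_n -> R) : continuous f -> continuous g -> supp B f -> supp B g ->
  integral_Rn (fun x => c * f x + g x) = c * integral_Rn f + integral_Rn g.
Proof. by have [+ _] := integral_lin_bound n; apply. Qed.

Lemma integral_bound n (e : R) (f : 'rV[R]_n -> R) : continuous f -> supp B f ->
  (forall x, `|f x| <= e) -> `|integral_Rn f| <= (2 * B) ^+ n * e.
Proof. by have [_] := integral_lin_bound n; apply. Qed.

Lemma cont_integral n (f : 'rV[R]_n.+1 -> R) : continuous f -> supp B f ->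
  continuous (fun s => integral_Rn (fun v : 'rV[R]_n => f (rcons1 s v))).
Proof. by have [l b] := integral_lin_bound n; exact: cont_aux. Qed.

Lemma supp_integral n (f : 'rV[R]_n.+1 -> R) : supp B f ->
  supp1 B (fun s => integral_Rn (fun v : 'rV[R]_n => f (rcons1 s v))).
Proof. by have [_ b] := integral_lin_bound n; exact: supp_aux. Qed.

Lemma integral0 n : integral_Rn (fun _ : 'rV[R]_n => 0) = 0.
Proof.
have c0 : continuous (fun _ : 'rV[R]_n => 0 : R) by move=> ?; exact: cst_continuous.
have := integral_lin (-1) c0 c0 (fun _ _ _ => erefl) (fun _ _ _ => erefl).
by under eq_fun do rewrite mulr0 addr0; rewrite mulN1r addNr.
Qed.

Definition C1c n (F : 'rV[R]_n -> R) := [/\ forall x, differentiable F x,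
  forall i, continuous (pderiv i F) & supp B F].

Lemma supp_pderiv n i (F : 'rV[R]_n -> R) : supp B F -> supp B (pderiv i F).
Proof.
move=> sF x j hj; rewrite (@pderiv_eq_on _ _ i F (fun=> 0) x [set y | B < `|y 0 j|]) ?pderiv_cst //.
  apply: (@open_comp _ _ (fun y : 'rV[R]_n => `|y 0 j|) [set r | B < r]); last exact: open_gt.
  move=> y _; apply: (continuous_comp (f := fun z : 'rV[R]_n => z 0 j)); last exact: norm_continuous.
  exact: coord_continuous.
by move=> y; exact: sF.
Qed.

Lemma rcons1_shift n s (v : 'rV[R]_n) i (r : R) :
  rcons1 s (r *: delta_mx 0 i + v) = r *: delta_mx 0 (rshift 1 i) + rcons1 s v.
Proof.
apply/rowP => j; rewrite !mxE; case: (split_ordP j) => d e.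
  by rewrite !mxE e eq_lrshift /= mulr0 add0r.
by rewrite !mxE e eq_rshift.
Qed.

Lemma rcons1_add n s (v : 'rV[R]_n) (r : R) :
  rcons1 (r + s) v = r *: delta_mx 0 (lshift n ord0) + rcons1 s v.
Proof.
apply/rowP => j; rewrite !mxE; case: (split_ordP j) => d e.
  by rewrite !mxE e ord1 eqxx mulr1.
by rewrite e eq_rlshift /= mulr0 add0r.
Qed.

Lemma diff_slice n (F : 'rV[R]_(1 + n) -> R) s v : differentiable F (rcons1 s v) ->
  differentiable (fun v => F (rcons1 s v)) v.
Proof.
move=> dF; apply: (differentiable_comp (f := @rcons1 n s) (g := F)) => //.
apply: differentiable_rV => j; case: (split_ordP j) => d ->.
  by under eq_fun do rewrite ord1 rcons1_0.
by under eq_fun do rewrite rcons1_r; exact: differentiable_coord.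
Qed.

Lemma pderiv_slice n (F : 'rV[R]_(1 + n) -> R) s i v :
  pderiv i (fun v => F (rcons1 s v)) v = pderiv (rshift 1 i) F (rcons1 s v).
Proof.
have e : (fun r => r^-1 *: (((fun v => F (rcons1 s v)) \o shift v) (r *: delta_mx 0 i) - F (rcons1 s v)))
  = (fun r : R => r^-1 *: ((F \o shift (rcons1 s v)) (r *: delta_mx 0 (rshift 1 i)) - F (rcons1 s v))).
  by apply: funext => r /=; rewrite rcons1_shift.
by rewrite /pderiv /derive e.
Qed.

(** In the first coordinate one differentiates under the integral sign and
    applies Rint_deriv; in the other coordinates the inner integral vanishes by
    induction. *)
Lemma integral_pderiv n i (F : 'rV[R]_n -> R) : C1c F -> integral_Rn (pderiv i F) = 0.
Proof.
elim: n i F => [[]//|n IH] i F [dF cF sF].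
have CF : continuous F by move=> x; apply: differentiable_continuous.
case: (split_ordP (i : 'I_(1 + n))) => j ->; last first.
  rewrite [LHS]/= (_ : (fun s => _) = fun=> 0) ?Rintegral_cst ?mul0r //.
  apply: funext => s; rewrite -[RHS](IH j (fun v => F (rcons1 s v))).
    by congr integral_Rn; apply: funext => v; rewrite pderiv_slice.
  split=> [v|k|]; [exact: diff_slice | | exact: supp_slice].
  rewrite (_ : pderiv k _ = fun v => pderiv (rshift 1 k) F (rcons1 s v)).
    by apply: cont_slice; exact: cF.
  by apply: funext => v; exact: pderiv_slice.
rewrite ord1; set D := pderiv _ F; have cD : continuous D by exact: cF.
have sD : supp B D by exact: supp_pderiv.
rewrite [LHS]/=; pose h s := integral_Rn (fun v : 'rV[R]_n => F (rcons1 s v)).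
apply: (@Rint_deriv B h) => //; [exact: cont_integral|exact: supp_integral|exact: supp_integral|].
move=> s; rewrite -/(rcons1 s).
(* The difference quotients of F in the first coordinate converge to D
   uniformly in v. *)
have claim d : 0 < d -> \forall r \near (0 : R), forall v,
    `|(- r) * D (rcons1 s v) + (-1 * F (rcons1 s v) + F (rcons1 (r + s) v))| <= `|r| * d.
  move=> d0; have /nbhs_ballP[/= rho rho0 hrho] := slice_unif s cD sD d0.
  apply/nbhs_ballP; exists rho => // r; rewrite -ball_normE /= sub0r normrN => hr v.
  have hD c : `|c| < rho -> `|D (rcons1 (c + s) v) - D (rcons1 s v)| <= d.
    by move=> hc; apply: hrho; rewrite -ball_normE /= opprD addrC subrK normrN.
  have dFT y : setT y -> differentiable F y by move=> _; exact: dF.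
  have key z (p q : R) : `|z - q| <= d -> p = z * r -> `|- r * q + p| <= `|r| * d.
    move=> hz ->; rewrite (_ : _ + _ = r * (z - q)); last by ring.
    by rewrite normrM; apply: ler_wpM2l.
  have [r0|r0|->] := ltgtP r 0; last first.
  - by rewrite oppr0 mul0r add0r add0r mulN1r addNr !normr0 mul0r.
  - have [|c /andP[c0 cr] e] := mvt_line (a := rcons1 s v) (v := delta_mx 0 (lshift n ord0)) r0 _ dFT; first by [].
    apply: (key (D (rcons1 (c + s) v))).
      by apply: hD; rewrite gtr0_norm //; apply: lt_trans cr _; rewrite -(gtr0_norm r0).
    by rewrite mulN1r addrC !rcons1_add e.
  - have r0' : 0 < - r by rewrite oppr_gt0.
    have [|c /andP[c0 cr] e] := mvt_line (a := rcons1 (r + s) v) (v := delta_mx 0 (lshift n ord0)) r0' _ dFT; first by [].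
    apply: (key (D (rcons1 (c + r + s) v))).
      by apply: hD; exact: norm_step.
    move: e; rewrite -!rcons1_add addrA addNr add0r mulrN => e.
    by rewrite mulN1r -[RHS]opprK -addrA -[in RHS]/(pderiv _ F _) -e opprB addrC.
have cvgh : (fun r : R => r^-1 *: ((h \o shift s) (r *: 1) - h s)) @ 0^' -->
    integral_Rn (fun v => D (rcons1 s v)).
  apply/cvgrPdist_le => e e0.
  pose M := (2 * B) ^+ n; have M0 : 0 <= M by rewrite exprn_ge0 // mulr_ge0.
  have d0 : 0 < e / (M + 1) by rewrite divr_gt0 //; lra.
  have nr : \forall r \near 0^', r != 0 :> R by exact: nbhs_dnbhs_neq.
  have nc : \forall r \near 0^', forall v,
      `|(- r) * D (rcons1 s v) + (-1 * F (rcons1 s v) + F (rcons1 (r + s) v))| <= `|r| * (e / (M + 1)).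
    by apply: cvg_within; exact: claim.
  near=> r; have r0 : r != 0 by near: r.
  have hr : forall v, `|(- r) * D (rcons1 s v) + (-1 * F (rcons1 s v) + F (rcons1 (r + s) v))|
     <= `|r| * (e / (M + 1)) by near: r.
  have cs (f : 'rV[R]_n.+1 -> R) t : continuous f -> continuous (fun v => f (rcons1 t v)) by exact: cont_slice.
  have ss (f : 'rV[R]_n.+1 -> R) t : supp B f -> supp B (fun v => f (rcons1 t v)) by exact: supp_slice.
  have s1 t : supp B (fun v => -1 * F (rcons1 s v) + F (rcons1 t v)).
    by move=> v k hk; rewrite !(ss F _ sF _ _ hk) mulr0 addr0.
  have c1 t : continuous (fun v => -1 * F (rcons1 s v) + F (rcons1 t v)).
    by apply: cont_comb; exact: cs.
  have s2 : supp B (fun v => (- r) * D (rcons1 s v) + (-1 * F (rcons1 s v) + F (rcons1 (r + s) v))).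
    by move=> v k hk; rewrite (s1 _ _ _ hk) (ss D _ sD _ _ hk) mulr0 addr0.
  have : `|integral_Rn (fun v : 'rV[R]_n => (- r) * D (rcons1 s v)
      + (-1 * F (rcons1 s v) + F (rcons1 (r + s) v)))| <= M * (`|r| * (e / (M + 1))).
    by apply: integral_bound => //; apply: cont_comb; [exact: cs | exact: c1].
  rewrite integral_lin; [|exact: cs|exact: c1|exact: ss|exact: s1].
  rewrite integral_lin; [|exact: cs|exact: cs|exact: ss|exact: ss].
  rewrite -/(h s) -/(h (r + s)) => hb.
  set k := integral_Rn _ in hb *.
  rewrite /= [r%:A]mulr1 -[_ *: _]/(_ * _).
  have -> : k - r^-1 * (h (r + s) - h s) = - (r^-1 * (- r * k + (-1 * h s + h (r + s)))) by field.
  rewrite normrN normrM normfV ler_pdivrMl ?normr_gt0 //; apply: le_trans hb _.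
  rewrite mulrCA ler_pM2l ?normr_gt0 // mulrA ler_pdivrMr; last by lra.
  by rewrite mulrC; apply: ler_wpM2l; [exact: ltW | lra].
by split; [exact: cvgP cvgh | exact/cvg_lim].
Unshelve. all: by end_near. Qed.

Lemma integral_sum_pderiv n (T : Type) (r : seq T) (d : T -> 'I_n) (F : T -> 'rV[R]_n -> R) :
  (forall t, C1c (F t)) ->
  [/\ continuous (fun x => \sum_(t <- r) pderiv (d t) (F t) x),
      supp B (fun x => \sum_(t <- r) pderiv (d t) (F t) x)
    & integral_Rn (fun x => \sum_(t <- r) pderiv (d t) (F t) x) = 0].
Proof.
move=> hF; elim: r => [|t r [IHc IHs IHi]].
  split=> [|x k _|]; rewrite ?big_nil //.
    by under eq_fun do rewrite big_nil; move=> x; exact: cst_continuous.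
  by under eq_fun do rewrite big_nil; exact: integral0.
have [dF cF sF] := hF t; have sp := @supp_pderiv n (d t) _ sF.
have e : (fun x => \sum_(t <- t :: r) pderiv (d t) (F t) x) =
   fun x => 1 * pderiv (d t) (F t) x + \sum_(t <- r) pderiv (d t) (F t) x.
  by apply: funext => x; rewrite big_cons mul1r.
rewrite e; split; first exact: cont_comb.
  by move=> x k hk; rewrite (sp _ _ hk) (IHs _ _ hk) mulr0 addr0.
by rewrite integral_lin // integral_pderiv // mulr0 add0r.
Qed.

End Iterated.

Lemma open_setC_compact n (S : set 'rV[R]_n) : compact S -> open (~` S).
Proof. by move=> cS; apply: closed_openC; apply: compact_closed cS; exact: norm_hausdorff. Qed.

(** Extension by 0 outside a compact subset of V keeps a smooth function C^1.
    *)
Lemma smooth_ext n (V S : set 'rV[R]_n) (u : 'rV[R]_n -> R) B : open V -> compact S ->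
  S `<=` V -> S `<=` [set x | forall i, `|x 0 i| <= B] -> smooth_on V u ->
  (forall x, ~ S x -> u x = 0) -> C1c B u.
Proof.
move=> oV cS SV SB su u0; have oS : open (~` S).
  by exact: open_setC_compact.
split=> [x|i x|x i hi].
- have [Vx|nVx] := pselect (V x); first exact: (smooth_on_diff oV su Vx).
  apply: (differentiable_eq_on (f := fun=> 0) oS) => [| y /u0 -> //|]; last exact: differentiable_cst.
  by move=> /SV.
- have [Vx|nVx] := pselect (V x).
    by apply: (smooth_on_continuous oV _ Vx); exact: smooth_on_pderiv.
  have Sx : (~` S) x by move=> /SV.
  have eS y : (~` S) y -> 0 = pderiv i u y.
    by move=> Sy; rewrite (@pderiv_eq_on _ _ i u (fun=> 0) y (~` S) oS Sy) ?pderiv_cst.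
  by have /(_ x Sx) := Ck_eq oS eS (Ck_cst 0 (~` S) 0).
- by apply: u0 => /SB /(_ i); rewrite leNgt hi.
Qed.

(** Functions that differ by the divergence of a compactly supported field have
    the same integral. *)
Lemma integral_divergence n (V S : set 'rV[R]_n) (f1 f2 : 'rV[R]_n -> R)
    (u : 'I_n -> 'rV[R]_n -> R) : open V -> compact S -> S `<=` V ->
  smooth_on V f1 -> smooth_on V f2 -> (forall i, smooth_on V (u i)) ->
  (forall x, ~ S x -> [/\ f1 x = 0, f2 x = 0 & forall i, u i x = 0]) ->
  (forall x, V x -> f1 x = f2 x + \sum_i pderiv i (u i) x) ->
  integral_Rn f1 = integral_Rn f2.
Proof.
move=> oV cS SV s1 s2 su z e.
have [B B0 SB] : exists2 B, 0 <= B & S `<=` [set x | forall i, `|x 0 i| <= B].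
  have [M [_ hM]] := compact_bounded cS; exists (`|M| + 1); first by rewrite addr_ge0.
  move=> x Sx i; have hx : `|x| <= `|M| + 1.
    by apply: hM => //; apply: le_lt_trans (ler_norm M) _; rewrite ltrDl.
  apply: le_trans hx; rewrite [leRHS]/Num.norm /= mx_normrE.
  by apply: (le_bigmax _ (fun ij : 'I_1 * 'I_n => `|x ij.1 ij.2|) (0, i)).
have C f : smooth_on V f -> (forall x, ~ S x -> f x = 0) -> C1c B f by exact: smooth_ext.
have z1 x : ~ S x -> f1 x = 0 by move=> /z[].
have z2 x : ~ S x -> f2 x = 0 by move=> /z[].
have zu i x : ~ S x -> u i x = 0 by move=> /z[].
have [dF1 _ sF1] := C _ s1 z1; have [dF2 _ sF2] := C _ s2 z2.
have [cs ss is0] := @integral_sum_pderiv B B0 n _ (index_enum 'I_n) id u (fun i => C _ (su i) (zu i)).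
have -> : f1 = fun x => 1 * (\sum_i pderiv i (u i) x) + f2 x.
  apply: funext => x; rewrite mul1r addrC; have [/e//|nVx] := pselect (V x).
  have oS : open (~` S) by exact: open_setC_compact.
  have Sx : (~` S) x by move=> /SV.
  rewrite z1 // z2 // add0r big1 // => i _.
  by rewrite (@pderiv_eq_on _ _ i (u i) (fun=> 0) x (~` S)) ?pderiv_cst // => y; exact: zu.
have c2 : continuous f2 by move=> x; exact: differentiable_continuous.
by rewrite (@integral_lin B) // is0 mulr0 add0r.
Qed.

End IteratedIntegral.

(** * The circle, overlaps of charts and products *)

Section Circle.
Context {R : realType}.
Implicit Types (a r s u v : R).

(** Two angles with the same cosine and sine differ by a multiple of 2 pi. *)
Lemma cis_inj r s : cos r = cos s -> sin r = sin s -> `|r - s| < 2 * pi -> r = s.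
Proof.
move=> ec es h; apply/eqP; rewrite -subr_eq0; apply/eqP.
have : cos (r - s) = 1 by rewrite cosB ec es -!expr2 cos2Dsin2.
move: (r - s) h => z h.
move=> e; have s0 : sin (z / 2) = 0.
  apply/eqP; rewrite -sqrf_eq0; apply/eqP; move: e; rewrite [z in cos z]splitr cosD -!expr2 cos2sin2.
  by move: (sin _ ^+ 2) => q; lra.
have [z0|z0|z0] := ltgtP (z / 2) 0; last by apply/eqP; move: z0; move/eqP; rewrite mulf_eq0 invr_eq0 pnatr_eq0 orbF.
  have : 0 < sin (- (z / 2)) by apply: sin_gt0_pi; move: h; rewrite ltr0_norm; lra.
  by rewrite sinN s0 oppr0 ltxx.
have : 0 < sin (z / 2) by apply: sin_gt0_pi; move: h; rewrite gtr0_norm; lra.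
by rewrite s0 ltxx.
Qed.

Lemma periodicz (f : R -> R) T (k : int) r : periodic f T -> f (r + T *~ k) = f r.
Proof.
move=> pf; case: k => n; first by rewrite -pmulrn periodicn.
by rewrite NegzE mulrNz -[LHS](periodicn pf n.+1) subrK.
Qed.

(** The angle is plus or minus the arc cosine, up to a multiple of 2 pi. *)
Lemma angle_exists a u v : u ^+ 2 + v ^+ 2 = 1 ->
  exists2 r, a - pi <= r < a + pi & cos r = u /\ sin r = v.
Proof.
move=> uv; have u1 : -1 <= u <= 1.
  by rewrite -ler_norml -(ler_pXn2r (n := 2)) ?nnegrE // real_normK ?num_real // expr1n -uv lerDl sqr_ge0.
have [r0 [cr sr]] : exists r0, cos r0 = u /\ sin r0 = v.
  have cu : cos (acos u) = u by apply: acosK; rewrite in_itv.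
  have su : sin (acos u) = `|v| by rewrite sin_acos // -uv addrC addKr sqrtr_sqr.
  have [v0|v0] := leP 0 v; first by exists (acos u); rewrite su ger0_norm.
  by exists (- acos u); rewrite cosN sinN su ltr0_norm // opprK.
have p0 : 0 < 2 * pi :> R by rewrite mulr_gt0 // pi_gt0.
pose k := Num.floor ((r0 - a + pi) / (2 * pi)).
have /andP[k1 k2] : k%:~R <= (r0 - a + pi) / (2 * pi) < (k + 1)%:~R by exact: floor_itv.
exists (r0 + (pi *+ 2) *~ (- k)); last first.
  by rewrite !periodicz //; [exact: sinD2pi | exact: cosD2pi].
have -> : (pi *+ 2) *~ (- k) = - (k%:~R * (2 * pi)) :> R.
  by rewrite mulrNz -mulrzl mulr_natl.
move: k1 k2; rewrite ler_pdivlMr // ltr_pdivrMr // intrD mulr1z [X in _ < X]mulrDl mul1r.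
by move: (k%:~R * _) => q k1 k2; apply/andP; split; lra.
Qed.

Lemma circle_mapP a (p : circle_pt R) : p <> cis (a + pi) ->
  let r := @chart_map R 1 (circle R) a p in
  [/\ a - pi < r 0 0, r 0 0 < a + pi & cis (r 0 0) = p].
Proof.
move=> hp; apply: (@getPex _ [set r : 'rV[R]_1 | [/\ a - pi < r 0 0, r 0 0 < a + pi & cis (r 0 0) = p]]).
case: p hp => -[u v] puv hp; have [r /andP[r1 r2] [cr sr]] := angle_exists a (eqP puv).
have er : cis r = exist _ (u, v) puv by apply: val_inj; rewrite /= cr sr.
exists (const_mx r); rewrite /= !mxE; split=> //.
rewrite lt_neqAle r1 andbT; apply/eqP => e; apply: hp; rewrite -er -e.
have -> : a + pi = a - pi + pi *+ 2 by rewrite -addrA; congr (_ + _); rewrite mulr2n addKr.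
by apply: val_inj; rewrite /= cosD2pi sinD2pi.
Qed.

Lemma circle_mapK a r : a - pi < r -> r < a + pi ->
  (cis r : circle_pt R) <> cis (a + pi) /\ @chart_map R 1 (circle R) a (cis r) = const_mx r.
Proof.
move=> r1 r2; have inj s : cis r = cis s -> `|r - s| < 2 * pi -> r = s.
  by move=> /(congr1 val) [ec es]; exact: cis_inj.
have ne : (cis r : circle_pt R) <> cis (a + pi).
  move=> /inj e; have : r = a + pi by apply: e; rewrite ltr_norml; apply/andP; split; lra.
  by move=> e'; move: r2; rewrite -e' ltxx.
split=> //; have [m1 m2 em] := circle_mapP ne.
apply/rowP => k; rewrite ord1 mxE; apply/esym/inj => //.
by move: m1 m2; move: (chart_map _ _ 0 0) => z m1 m2; rewrite ltr_norml; apply/andP; split; lra.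
Qed.

Lemma circle_imgE a (r : 'rV[R]_1) :
  @chart_img R 1 (circle R) a r <-> a - pi < r 0 0 < a + pi.
Proof.
split=> [[p /= hp <-]|/andP[r1 r2]]; first by have [-> ->] := circle_mapP hp.
have [ne e] := circle_mapK r1 r2; exists (cis (r 0 0)) => //; rewrite e.
by apply/rowP => k; rewrite ord1 mxE.
Qed.

Lemma open_itv1 (a b : R) : open [set r : 'rV[R]_1 | a < r 0 0 < b].
Proof.
have -> : [set r : 'rV[R]_1 | a < r 0 0 < b] = (fun r : 'rV[R]_1 => r 0 0) @^-1` `]a, b[%classic.
  by apply/seteqP; split=> r /=; rewrite in_itv.
apply: open_comp; last exact: interval_open.
by move=> r _; exact: coord_continuous.
Qed.

(** Near a given point the two angle coordinates differ by a constant whose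
    cosine is 1 and whose sine is 0. *)
Lemma circle_transition (a b : chart (circle R)) (x : 'rV[R]_1) : overlap a b x ->
  exists (c : R) (U : set 'rV[R]_1), [/\ open U, U x &
    forall y, U y -> @transition R 1 (circle R) a b y = y + const_mx c].
Proof.
move=> [p [pa pb] ex]; have [a1 a2 ea] := circle_mapP pa; have [b1 b2 eb] := circle_mapP pb.
move: a1 a2 ea b1 b2 eb; rewrite {}ex => a1 a2 ea; set z := chart_map b p => b1 b2 eb.
pose c := z 0 0 - x 0 0; have [cc cs] : cos (x 0 0 + c) = cos (x 0 0) /\ sin (x 0 0 + c) = sin (x 0 0).
  have -> : x 0 0 + c = z 0 0 by rewrite addrC subrK.
  by have := etrans ea (esym eb) => /(congr1 val) [-> ->].
have e1 : cos c = 1 /\ sin c = 0.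
  have -> : c = (x 0 0 + c) - x 0 0 by rewrite addrC addKr.
  by rewrite cosB sinB cc cs -!expr2 cos2Dsin2 mulrC subrr.
exists c, [set y : 'rV[R]_1 | b - pi - c < y 0 0 < b + pi - c]; split; first exact: open_itv1.
  by rewrite /= ltrBlDr ltrBrDr [x 0 0 + c]addrC subrK b1.
move=> y /andP[y1 y2]; rewrite /transition /=.
have -> : cis (y 0 0) = cis (y 0 0 + c).
  by apply: val_inj; rewrite /= cosD sinD e1.1 e1.2 !mulr0 !mulr1 subr0 addr0.
have y1' : b - pi < y 0 0 + c by rewrite -ltrBlDr.
have y2' : y 0 0 + c < b + pi by rewrite -ltrBrDr.
have [_ e] := circle_mapK y1' y2'; apply: etrans e _.
by apply/rowP => k; rewrite ord1 !mxE.
Qed.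

End Circle.

Section Overlap.
Context {R : realType} {n : nat} (M : atlas R n).
Implicit Types (i j : chart M) (x : 'rV[R]_n).

Lemma overlap_img i j x : overlap i j x -> chart_img i x.
Proof. by move=> [p [pi _] <-]; exists p. Qed.

Lemma form_pull k (a : diff_form M R k) i j x : is_form a -> overlap i j x ->
  a i x = pull (jacobian (transition i j) x) (a j (transition i j x)).
Proof. by move=> [_ _ h] o; apply: covecP; exact: h. Qed.

Hypothesis sm : smooth_manifold M.

Lemma open_overlap i j : open (overlap i j).
Proof.
rewrite openE => x [p [pi pj] ex]; have cx : chart_img i x by exists p.
have n1 : nbhs x (chart_img i) by apply: open_nbhs_nbhs; split=> //; exact: (sm_img_open sm).
have ei : chart_inv i x = p by rewrite -ex (sm_cancel sm).
have n2 : nbhs x (chart_inv i @^-1` chart_dom j).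
  apply: (sm_param_continuous sm cx); apply: open_nbhs_nbhs; split; first exact: (sm_dom_open sm).
  by rewrite ei.
apply: filterS2 n1 n2 => y [q qi ey] /=; rewrite -ey (sm_cancel sm) // => qj.
by exists q.
Qed.

Lemma overlap_transition i j x : overlap i j x -> chart_img j (transition i j x).
Proof. by move=> [p [pi pj] <-]; exists p => //; rewrite /transition (sm_cancel sm). Qed.

Lemma Ck_transition i j k l : Ck k (overlap i j) (fun x => transition i j x 0 l).
Proof. by apply: smooth_on_Ck; [exact: open_overlap | exact: (sm_transition sm)]. Qed.

Lemma diff_transition i j x l : overlap i j x ->
  differentiable (fun y => transition i j y 0 l) x.
Proof. by apply: Ck_diff; exact: (Ck_transition i j 1). Qed.

End Overlap.

Section FormClosure.
Context {R : realType} {n : nat} (M : atlas R n).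

Lemma is_form_add k (a b : diff_form M R k) : is_form a -> is_form b -> is_form (fadd a b).
Proof.
move=> fa fb; have [a1 a2 _] := fa; have [b1 b2 _] := fb; split=> [i x hx|i I|i j x o].
- by apply: altD; auto.
- by apply: smooth_onD; auto.
- by move=> I; rewrite /fadd (form_pull fa o) (form_pull fb o) -covecD -pullD.
Qed.

Lemma is_form_scale k c (a : diff_form M R k) : is_form a -> is_form (fscale c a).
Proof.
move=> fa; have [a1 a2 _] := fa; split=> [i x hx|i I|i j x o].
- by apply: altZ; auto.
- by apply: smooth_onM; [exact: smooth_on_cst | exact: a2].
- by move=> I; rewrite /fscale (form_pull fa o) -covecZ -pullZ.
Qed.

Lemma is_form_fmul k (h : scalar_field M) (a : diff_form M R k) :
  (forall i, smooth_on (chart_img i) (h i)) ->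
  (forall i j x, overlap i j x -> h i x = h j (transition i j x)) ->
  is_form a -> is_form (fmul h a).
Proof.
move=> sh ih fa; have [a1 a2 _] := fa; split=> [i x hx|i I|i j x o].
- by apply: altZ; auto.
- by apply: smooth_onM; [exact: sh | exact: a2].
- by move=> I; rewrite /fmul (form_pull fa o) (ih _ _ _ o) -covecZ -pullZ.
Qed.

Lemma smooth_wedge m p q (a : 'rV[R]_m -> covec R n p) (b : 'rV[R]_m -> covec R n q) A :
  (forall I, smooth_on A (fun y => a y I)) -> (forall I, smooth_on A (fun y => b y I)) ->
  forall I, smooth_on A (fun y => wedge (a y) (b y) I).
Proof.
move=> sa sb I; apply: smooth_onM; first exact: smooth_on_cst.
apply: smooth_on_sum => s _; apply: smooth_onM; last exact: sb.
by apply: smooth_onM; [exact: smooth_on_cst | exact: sa].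
Qed.

Lemma is_form_wedge p q (a : diff_form M R p) (b : diff_form M R q) :
  is_form a -> is_form b -> is_form (fwedge a b).
Proof.
move=> fa fb; have [a1 a2 _] := fa; have [b1 b2 _] := fb; split=> [i x hx|i I|i j x o I].
- exact: alt_wedge.
- by apply: smooth_wedge.
- by rewrite /fwedge (form_pull fa o) (form_pull fb o) -pull_wedge.
Qed.

End FormClosure.

Section ProductCircle.
Context {R : realType} {n : nat} (X : atlas R n).
Hypothesis sm : smooth_manifold X.
Local Notation M := (prod_atlas (circle R) X).
Implicit Types (c d : chart M) (x : 'rV[R]_(1 + n)).

Lemma prod_imgE c x : chart_img c x <-> chart_img c.1 (lsubmx x) /\ chart_img c.2 (rsubmx x).
Proof.
split=> [[[p q] /= [hp hq] <-]|[[p hp ep] [q hq eq]]].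
  by rewrite row_mxKl row_mxKr; split; [exists p | exists q].
by exists (p, q); [split | rewrite -[LHS]/(row_mx (chart_map c.1 p) (chart_map c.2 q)) ep eq hsubmxK].
Qed.

Lemma prod_overlap c d x : overlap c d x ->
  overlap c.1 d.1 (lsubmx x) /\ overlap c.2 d.2 (rsubmx x).
Proof.
move=> [[p q] [/= [p1 q1] [p2 q2]] <-]; rewrite row_mxKl row_mxKr.
by split; [exists p | exists q].
Qed.

Lemma open_prod_img c : open (chart_img c).
Proof.
have -> : chart_img c = (lsubmx @^-1` [set r : 'rV[R]_1 | c.1 - pi < r 0 0 < c.1 + pi])
   `&` (rsubmx @^-1` chart_img c.2).
  by apply/seteqP; split=> x; [move=> /prod_imgE[/circle_imgE ? ?] | move=> [/circle_imgE ? ?]; exact/prod_imgE].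
apply: openI; apply: open_comp.
- by move=> y _; exact: continuous_lsubmx.
- exact: open_itv1.
- by move=> y _; exact: continuous_rsubmx.
- exact: (sm_img_open sm).
Qed.

(** The angle coordinate only changes by translations. *)
Lemma jac_prod c d x : overlap c d x -> jacobian (transition c d) x =
  block_mx 1%:M 0 0 (jacobian (transition c.2 d.2) (rsubmx x)).
Proof.
move=> /prod_overlap[ov1 ov2]; have [r [U [oU Ux hU]]] := circle_transition ov1.
have oV : open (lsubmx @^-1` U : set 'rV[R]_(1 + n)).
  by apply: open_comp => // y _; exact: continuous_lsubmx.
pose T y := transition c d y.
have eT y : T y = row_mx (transition c.1 d.1 (lsubmx y)) (transition c.2 d.2 (rsubmx y)) by [].
have eL y k : (lsubmx @^-1` U) y -> y 0 (lshift n k) + r = T y 0 (lshift n k).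
  by move=> Uy; rewrite eT row_mxEl hU // !mxE.
have eR l : (fun y => T y 0 (rshift 1 l)) = fun y => transition c.2 d.2 (rsubmx y) 0 l.
  by apply: funext => y; rewrite eT row_mxEr.
have dr l : differentiable (fun y : 'rV[R]_(1 + n) => rsubmx y 0 l) x.
  apply: (differentiable_comp (f := rsubmx) (g := fun z : 'rV[R]_n => z 0 l)).
    exact: differentiable_rsubmx.
  exact: differentiable_coord.
have d2 l : differentiable (fun y => transition c.2 d.2 y 0 l) (rsubmx x).
  exact: diff_transition.
have dL k : differentiable (fun y : 'rV[R]_(1 + n) => y 0 (lshift n k) + r) x.
  by apply: differentiableD' => //; exact: differentiable_coord.
have dT l : differentiable (fun y => T y 0 l) x.
  case: (split_ordP l) => k ->; first exact: (differentiable_eq_on oV Ux (eL ^~ k)).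
  rewrite eR; apply: (differentiable_comp (f := rsubmx) (g := fun z => transition c.2 d.2 z 0 k)) => //.
  exact: differentiable_rsubmx.
apply/matrixP => a b; rewrite jacobianE //.
case: (split_ordP b) => k ->.
  rewrite -(pderiv_eq_on a oV Ux (eL ^~ k)) pderivD //; last exact: differentiable_coord.
  rewrite pderiv_cst addr0 /pderiv.
  have -> : (fun y : 'rV[R]_(1 + n) => y 0 (lshift n k)) = (fun y => lsubmx y 0 k).
    by apply: funext => y; rewrite mxE.
  have dl l : differentiable (fun y : 'rV[R]_(1 + n) => lsubmx y 0 l) x.
    apply: (differentiable_comp (f := lsubmx) (g := fun z : 'rV[R]_1 => z 0 l)).
      exact: differentiable_lsubmx.
    exact: differentiable_coord.
  rewrite -/(pderiv a _ x) -jacobianE // jacobian_lsubmx.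
  by case: (split_ordP a) => e ->; rewrite ?block_mxEul ?block_mxEdl ?col_mxEu ?col_mxEd.
rewrite -/(T) eR (@pderiv_comp R (1 + n) n rsubmx x a (fun z => transition c.2 d.2 z 0 k) dr (d2 k)).
under eq_bigr do rewrite jacobian_rsubmx -(jacobianE _ _ d2).
case: (split_ordP a) => e ->.
  by rewrite block_mxEur big1 ?mxE // => l _; rewrite col_mxEu mxE mul0r.
rewrite block_mxEdr (bigD1 e) //= big1 => [|l ne]; rewrite col_mxEd mxE.
  by rewrite eqxx mul1r addr0.
by rewrite eq_sym (negbTE ne) mul0r.
Qed.

Lemma pr2E k (a : diff_form X R k) c x :
  pr2_form (A := circle R) a c x = pull (Emx 1 n) (a c.2 (rsubmx x)).
Proof. by rewrite -(jacobian_rsubmx x). Qed.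

Lemma dr_covec c x : pr1_form (B := X) (@dr_circle R) c x = covec1 (dxi 0).
Proof.
apply: covecP => I; rewrite /pr1_form /pullback jacobian_lsubmx /covec1.
rewrite (bigD1 [ffun=> ord0]) //= [X in _ + X]big1 => [|J /negP[]]; last first.
  by apply/eqP/ffunP => k; rewrite ffunE; apply: val_inj; case: (J k) => -[].
rewrite addr0 big_ord1 mul1r ffunE; case: (split_ordP (I ord0)) => a ->.
  by rewrite col_mxEu ord1 mxE /dxi.
by rewrite col_mxEd mxE /dxi.
Qed.

Lemma Emx_jac (B : 'M[R]_n) : block_mx 1%:M 0 0 B *m Emx 1 n = Emx 1 n *m B.
Proof. by rewrite /Emx mul_block_col mul_col_mx !mulmx0 !mul0mx mulmx1 mul1mx !add0r. Qed.

Lemma Ck_rsubmx k U (f : 'rV[R]_n -> R) : open U -> Ck k U f ->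
  Ck k (rsubmx @^-1` U) (fun y : 'rV[R]_(1 + n) => f (rsubmx y)).
Proof.
move=> oU; have oV : open (rsubmx @^-1` U : set 'rV[R]_(1 + n)).
  by apply: open_comp => // y _; exact: continuous_rsubmx.
elim: k f => [|k IH] f /=.
  move=> cf x Ux; apply: (continuous_comp (f := rsubmx) (g := f)); last exact: cf.
  exact: continuous_rsubmx.
move=> [f1 f2]; split=> [x Ux|i].
  apply: (differentiable_comp (f := rsubmx) (g := f)); last exact: f1.
  exact: differentiable_rsubmx.
have dr l (x : 'rV[R]_(1 + n)) : differentiable (fun y : 'rV[R]_(1 + n) => rsubmx y 0 l) x.
  apply: (differentiable_comp (f := rsubmx) (g := fun z : 'rV[R]_n => z 0 l)).
    exact: differentiable_rsubmx.
  exact: differentiable_coord.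
case: (split_ordP i) => j ->; [apply: Ck_eq oV _ (Ck_cst k _ 0) | apply: Ck_eq oV _ (IH _ (f2 j))] => x Ux;
  rewrite (@pderiv_comp R (1 + n) n rsubmx x _ f (fun l => dr l x) (f1 _ Ux)) jacobian_rsubmx.
  by rewrite big1 // => l _; rewrite col_mxEu mxE mul0r.
rewrite (bigD1 j) //= big1 => [|l ne]; rewrite col_mxEd mxE.
  by rewrite eqxx mul1r addr0.
by rewrite eq_sym (negbTE ne) mul0r.
Qed.

Lemma smooth_rsubmx A (f : 'rV[R]_n -> R) : smooth_on A f ->
  smooth_on (rsubmx @^-1` A) (fun y : 'rV[R]_(1 + n) => f (rsubmx y)).
Proof.
move=> h x Ax; have [U [F [oU Ux hF eF]]] := h _ Ax.
exists (rsubmx @^-1` U), (fun y => F (rsubmx y)); split=> //.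
- by apply: open_comp => // y _; exact: continuous_rsubmx.
- by move=> k; exact: Ck_rsubmx.
- by move=> y Uy Ay; exact: eF.
Qed.

Lemma smooth_pull m l k (P : 'M[R]_(m, n)) (a : 'rV[R]_l -> covec R n k) A :
  (forall I, smooth_on A (fun y => a y I)) -> forall I, smooth_on A (fun y => pull P (a y) I).
Proof.
move=> sa I; apply: smooth_on_sum => J _; apply: smooth_onM; first exact: sa.
exact: smooth_on_cst.
Qed.

Lemma is_form_pr2 k (a : diff_form X R k) : is_form a -> is_form (pr2_form (A := circle R) a).
Proof.
move=> fa; have [a1 a2 _] := fa; split=> [c x /prod_imgE[_ hx]|c I|c d x o I].
- by rewrite pr2E; apply: alt_pull; exact: a1.
- apply: (@smooth_on_sub _ _ _ (rsubmx @^-1` chart_img c.2)); first by move=> x /prod_imgE[].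
  apply: (smooth_on_eq (f := fun y => pull (Emx 1 n) (a c.2 (rsubmx y)) I)).
    by move=> y _; rewrite pr2E.
  by apply: smooth_pull => J; exact: (smooth_rsubmx (a2 c.2 J)).
- rewrite -[RHS]/(pull _ _ _) (jac_prod o) !pr2E; have [ov1 ov2] := prod_overlap o.
  by rewrite -pull_mul Emx_jac pull_mul (form_pull fa ov2) /transition /= row_mxKr.
Qed.

Lemma is_form_dr : is_form (pr1_form (B := X) (@dr_circle R)).
Proof.
split=> [c x _|c I|c d x o I].
- by rewrite dr_covec -wedge1_one0; apply/alt_wedge1/alt_one0.
- by apply: (smooth_on_eq (f := fun _ => covec1 (dxi 0) I)) => [y _|]; [rewrite dr_covec | exact: smooth_on_cst].
rewrite -[RHS]/(pull _ _ _) (jac_prod o) !dr_covec -wedge1_one0 pull_wedge1.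
have e1 (B : 'M[R]_(1 + n)) : pull B (one0 : covec R (1 + n) 0) = one0.
  by apply: covecP => L; rewrite pull0.
rewrite e1.
congr (wedge1 _ _ I); apply: funext => k; rewrite (bigD1 (lshift n ord0)) //= big1 => [|l ne]; last first.
  case: (split_ordP l) ne => e ->; first by rewrite ord1 eqxx.
  by rewrite /dxi /= mulr0.
rewrite {2}/dxi /= mulr1 addr0; case: (split_ordP k) => e ->.
  by rewrite block_mxEul ord1 mxE /dxi.
by rewrite block_mxEdl mxE /dxi.
Qed.

End ProductCircle.

(** * The G2-structure at a point *)

Section Pointwise.
Context {R : realType}.
Local Notation J := (@Jmx R 3).
Local Notation E := (@Emx R 1 6).
Local Notation c0 := (2 * Num.sqrt 2 : R).
Implicit Types (w : covec R 6 2) (r s beta : covec R 6 3) (P : 'M[R]_6).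

Lemma c0_gt0 : 0 < c0. Proof. by rewrite mulr_gt0 // sqrtr_gt0. Qed.
Lemma c0_neq0 : c0 != 0. Proof. by rewrite gt_eqF // c0_gt0. Qed.
Lemma inv_cancel (c k : R) : c != 0 -> k != 0 -> c * (c * k)^-1 * k = 1.
Proof. by move=> c1 k1; field; rewrite k1 c1. Qed.
Lemma c0_sq : c0 * c0 = 8.
Proof. by rewrite mulrACA -expr2 -[Num.sqrt 2 * _]expr2 sqr_sqrtr //; ring. Qed.

(** The real form i Omega /\ conj Omega, for Omega = r + i s. *)
Definition iOb r s : covec R 6 (3 + 3) := wedge r s - wedge s r.
(** The norm of r + i s with respect to w. *)
Definition normN w r s : R :=
  Num.sqrt (iOb r s (fid 6) / (6%:R^-1 * wedge (wedge w w) w (fid 6))).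
Definition phiN w r (N : R) : covec R 7 3 :=
  c0 *: pull E (N^-1 *: r) + (- c0^-1) *: wedge1 (dxi 0) (pull E w).
Definition psiN w s (N : R) : covec R 7 4 :=
  (-1) *: wedge1 (dxi 0) (pull E (N^-1 *: s)) + (- 2^-1) *: @pull R 7 6 (2 + 2) E (wedge w w).
(** The metric dr^2 / 8 + g_w: the length of the circle direction is fixed by
    the factor 2 sqrt 2 in phi. *)
Definition g7 w : 'M[R]_(1 + 6) := block_mx (8^-1)%:M 0 0 (Gmx w).
Definition ori7 r s : covec R 7 7 := wedge1 (dxi 0) (pull E (iOb r s)).

(** In the frame P the hermitian form is standard and r + i s is kappa times
    the standard complex volume form. *)
Definition su3 w r s P kappa := [/\ P *m J = J *m P, P \in unitmx,
  P *m Gmx w *m P^T = 1%:M /\ pull P w = om0, 0 < kappa &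
  pull P r = kappa *: rho0 /\ pull P s = kappa *: iota0].

(** The frame P completed by 2 sqrt 2 times the circle direction, which makes
    it orthonormal for g7. *)
Definition Q7 P : 'M[R]_(1 + 6) := block_mx c0%:M 0 0 P.

Lemma Q7_E P : Q7 P *m E = E *m P.
Proof. by rewrite /Q7 /Emx mul_block_col mul_col_mx !mulmx0 !mul0mx mulmx1 mul1mx !add0r. Qed.

Lemma pull_Q7_E P k (a : covec R 6 k) : pull (Q7 P) (pull E a) = pull E (pull P a).
Proof. by rewrite -!pull_mul Q7_E. Qed.

Lemma pull_Q7_dr P k (a : covec R 7 k) :
  pull (Q7 P) (wedge1 (dxi 0) a) = c0 *: wedge1 (dxi 0) (pull (Q7 P) a).
Proof.
rewrite pull_wedge1 -wedge1Zl; congr wedge1; apply: funext => i.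
rewrite (bigD1 (lshift 6 (ord0 : 'I_1))) //= big1 => [|l ne]; last first.
  case: (split_ordP (l : 'I_(1 + 6))) ne => d ->; first by rewrite ord1 eqxx.
  by rewrite /dxi /= mulr0.
rewrite {1}/dxi /= mulr1 addr0 -[RHS]/(_ * _); case: (split_ordP (i : 'I_(1 + 6))) => d ->.
  by rewrite /Q7 block_mxEul ord1 !mxE eqxx /dxi /= mulr1.
by rewrite /Q7 block_mxEdl mxE /dxi /= mulr0.
Qed.

Lemma pull00 m n k (P : 'M[R]_(m, n)) : pull P (0 : covec R n k) = 0.
Proof. by rewrite -(scale0r (0 : covec R n k)) pullZ scale0r. Qed.

Section InFrame.
Variables (w : covec R 6 2) (r s : covec R 6 3) (P : 'M[R]_6) (kappa : R).
Hypothesis fr : su3 w r s P kappa.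
Local Notation N := (normN w r s).
Local Notation Q := (Q7 P).

Let PJ : P *m J = J *m P. Proof. by have [] := fr. Qed.
Let uP : P \in unitmx. Proof. by have [] := fr. Qed.
Let PG : P *m Gmx w *m P^T = 1%:M. Proof. by have [_ _ []] := fr. Qed.
Let Pw : pull P w = om0. Proof. by have [_ _ []] := fr. Qed.
Let k0 : 0 < kappa. Proof. by have [] := fr. Qed.
Let Pr : pull P r = kappa *: rho0. Proof. by have [_ _ _ _ []] := fr. Qed.
Let Ps : pull P s = kappa *: iota0. Proof. by have [_ _ _ _ []] := fr. Qed.

(** A tensor is alternating as soon as its components in some frame are. *)
Lemma alt_inv k (a : covec R 6 k) : is_alternating (pull P a) -> is_alternating a.
Proof. by move=> h; rewrite -(pull1 a) -(mulVmx uP) pull_mul; exact: alt_pull. Qed.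

Lemma alt_w : is_alternating w.
Proof. by apply: alt_inv; rewrite Pw; exact: alt_zform. Qed.
Lemma alt_r : is_alternating r.
Proof. by apply: alt_inv; rewrite Pr; apply: altZ; exact: alt_zform. Qed.
Lemma alt_s : is_alternating s.
Proof. by apply: alt_inv; rewrite Ps; apply: altZ; exact: alt_zform. Qed.

Lemma pull_iOb : pull P (iOb r s) = (- 8 * kappa ^+ 2) *: eps.
Proof.
rewrite /iOb -scaleN1r pullD (pullZ (-1)) !pull_wedge Pr Ps !wedgeZl !wedgeZr rho0_iota0 iota0_rho0.
by rewrite !scalerA -scalerDl; congr (_ *: _); ring.
Qed.

Lemma alt_iOb : is_alternating (iOb r s).
Proof. by apply: alt_inv; rewrite pull_iOb; apply: altZ; exact: alt_eps. Qed.

Lemma top_pull (a : covec R 6 6) c : is_alternating a -> pull P a = c *: eps ->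
  \det P * a (fid 6) = c.
Proof.
move=> ha; rewrite {1}(top_alt ha) pullZ pull_eps scalerA.
by move=> /(congr1 (fun f : covec R 6 6 => f (fid 6))); rewrite !covecZ eps_fid !mulr1 mulrC.
Qed.

Let dP : \det P != 0. Proof. by move: uP; rewrite unitmxE unitfE. Qed.

Lemma iOb_fid : \det P * iOb r s (fid 6) = - 8 * kappa ^+ 2.
Proof. exact: top_pull alt_iOb pull_iOb. Qed.

Lemma w3_fid : \det P * wedge (wedge w w) w (fid 6) = - 6.
Proof.
apply: (top_pull (a := wedge (wedge w w) w)); first exact: (@alt_wedge R 6 (2 + 2) 2).
have h := @pull_wedge R 6 6 (2 + 2) 2 P (wedge w w) w.
by rewrite (@pull_wedge R 6 6 2 2) Pw om0_cube in h; exact: h.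
Qed.

(** Both top-degree forms acquire the factor det P, which cancels. *)
Lemma norm_ratio : iOb r s (fid 6) / (6%:R^-1 * wedge (wedge w w) w (fid 6)) = 8 * kappa ^+ 2.
Proof.
have -> : iOb r s (fid 6) = - 8 * kappa ^+ 2 / \det P by rewrite -iOb_fid mulrC mulKf.
have -> : wedge (wedge w w) w (fid 6) = - 6 / \det P by rewrite -w3_fid mulrC mulKf.
by field; rewrite dP.
Qed.

Lemma normE : N = c0 * kappa.
Proof.
rewrite /normN norm_ratio -c0_sq -expr2 -exprMn sqrtr_sqr ger0_norm //.
by rewrite mulr_ge0 // ltW // c0_gt0.
Qed.

Lemma norm_gt0 : 0 < N.
Proof. by rewrite normE mulr_gt0 // c0_gt0. Qed.

Lemma Q_unit : Q \in unitmx.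
Proof.
rewrite unitmxE /Q7 det_ublock unitrM det_scalar1 unitfE c0_neq0 /=.
by move: uP; rewrite unitmxE.
Qed.

Lemma Qg : Q *m g7 w *m Q^T = 1%:M.
Proof.
rewrite /Q7 /g7 tr_block_mx !trmx0 !mulmx_block !mulmx0 !mul0mx !addr0 !add0r PG.
rewrite tr_scalar_mx -!scalar_mxM !mul0mx mulrAC c0_sq divff ?pnatr_eq0 //.
by rewrite -scalar_mx_block.
Qed.

Lemma g_eq : g7 w = invmx Q *m (invmx Q)^T.
Proof.
have := congr1 (fun A => invmx Q *m A *m (invmx Q)^T) Qg.
rewrite mulmx1 => <-; rewrite !mulmxA mulVmx ?Q_unit // mul1mx -mulmxA -trmx_mul.
by rewrite mulVmx ?Q_unit // trmx1 mulmx1.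
Qed.

Lemma g_unit : g7 w \in unitmx.
Proof. by rewrite g_eq unitmx_mul unitmx_tr unitmx_inv Q_unit. Qed.

Lemma g_sym : (g7 w)^T = g7 w.
Proof. by rewrite g_eq trmx_mul trmxK. Qed.

Lemma dot_pos n (v : 'rV[R]_n) : v != 0 -> 0 < (v *m v^T) 0 0.
Proof.
move=> v0; have e : (v *m v^T) 0 0 = \sum_j v 0 j ^+ 2.
  by rewrite mxE; apply: eq_bigr => j _; rewrite mxE expr2.
rewrite e lt_neqAle sumr_ge0 ?andbT => [|j _]; last exact: sqr_ge0.
rewrite eq_sym; apply: contraNneq v0 => /eqP; rewrite psumr_eq0 => [/allP h|j _]; last exact: sqr_ge0.
apply/eqP/rowP => j; rewrite mxE; apply/eqP; rewrite -sqrf_eq0.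
by apply: h; rewrite mem_index_enum.
Qed.

Lemma g_pos (u : 'rV[R]_7) : u != 0 -> 0 < (u *m g7 w *m u^T) 0 0.
Proof.
move=> u0; rewrite g_eq mulmxA -mulmxA -trmx_mul; apply: dot_pos.
by apply: contra u0 => /eqP h; rewrite -(mulmx1 u) -(mulVmx Q_unit) mulmxA h mul0mx.
Qed.

(** In the frame Q, phi and psi are the model forms: the powers of kappa and of
    2 sqrt 2 cancel because N = 2 sqrt 2 kappa. *)
Lemma pull_phi : pull Q (phiN w r N) = phi0.
Proof.
rewrite /phiN pullD !pullZ pull_Q7_E pull_Q7_dr pull_Q7_E Pw Pr normE phi0E.
have e1 : c0 * (c0 * kappa)^-1 * kappa = 1 by rewrite inv_cancel ?c0_neq0 // gt_eqF.
have e2 : - c0^-1 * c0 = -1 by rewrite mulNr mulVf ?c0_neq0.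
by rewrite (pullZ kappa) !scalerA e1 e2 scale1r scaleN1r.
Qed.

Lemma pull_psi : pull Q (psiN w s N) = psi0.
Proof.
have e1 : -1 * c0 * (c0 * kappa)^-1 * kappa = -1.
  by rewrite -mulrA mulN1r mulNr mulrA inv_cancel ?c0_neq0 // gt_eqF.
have h : pull E (pull P (wedge w w)) = pull E (wedge om0 om0) by rewrite pull_wedge Pw.
rewrite /psiN pullD (pullZ (-1)) (pullZ (- 2^-1)) pull_Q7_dr !pull_Q7_E (pullZ _^-1) Ps normE psi0E.
by rewrite (pullZ (c0 * kappa)^-1) (pullZ kappa) 2!wedge1Zr !scalerA mulrA e1 scaleN1r scaleNr; congr (_ - _ *: _); exact: h.
Qed.

Lemma dr_eps6 : wedge1 (dxi 0) (pull E (eps : covec R 6 6)) = eps :> covec R 7 7.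
Proof.
rewrite eps_bform pull_Emx_bform -bform_cons eps_bform //.
Qed.

Lemma pull_ori : pull Q (ori7 r s) = (- (c0 * (8 * kappa ^+ 2))) *: eps.
Proof.
rewrite /ori7 pull_Q7_dr pull_Q7_E pull_iOb pullZ wedge1Zr dr_eps6 scalerA.
by congr (_ *: _); ring.
Qed.

Lemma alt_ori : is_alternating (ori7 r s).
Proof. by apply: alt_wedge1; apply: alt_pull; exact: alt_iOb. Qed.

Lemma pull_vol : pull Q (volcov (g7 w) (ori7 r s)) = vol0.
Proof.
rewrite pull_volcov ?Q_unit //; last exact: alt_ori.
rewrite Qg pull_ori volcovE covecZ eps_fid mulr1 det1 sqrtr1 mulr1 ltr0_sg ?scaleN1r //.
by rewrite oppr_lt0 !mulr_gt0 // ?c0_gt0 // exprn_gt0.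
Qed.

(** This quotient of volume forms is e^(4 f), so e^(-2 f) = N. *)
Lemma vol_ratio : volcov (g7 w) (ori7 r s) (fid 7) / (c0^-1 * ori7 r s (fid 7)) = (N ^+ 2)^-1.
Proof.
have top7 (a : covec R 7 7) c : is_alternating a -> pull Q a = c *: eps -> a (fid 7) = c / \det Q.
  move=> ha; rewrite {1}(top_alt ha) pullZ pull_eps scalerA.
  move=> /(congr1 (fun f : covec R 7 7 => f (fid 7))); rewrite !covecZ eps_fid !mulr1 => <-.
  by rewrite mulfK //; have := Q_unit; rewrite unitmxE unitfE.
have dQ : \det Q != 0 by have := Q_unit; rewrite unitmxE unitfE.
have alt_vol : is_alternating (volcov (g7 w) (ori7 r s)).
  by have := @altZ R 7 7 (Num.sg (ori7 r s (fid 7)) * Num.sqrt (\det (g7 w))) eps alt_eps; apply.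
rewrite (top7 _ _ alt_ori pull_ori) (top7 _ (-1) alt_vol); last by rewrite pull_vol scaleN1r.
rewrite normE; move: dQ c0_neq0 (lt0r_neq0 k0) c0_sq; move: (\det Q) c0 kappa => d c k dn cn kn cc.
have -> : (c * k) ^+ 2 = 8 * k ^+ 2 by rewrite exprMn expr2 cc.
by field; rewrite dn cn kn.
Qed.

Lemma G2_at (u v : 'rV[R]_7) :
  wedge (wedge (interior_product u (phiN w r N)) (interior_product v (phiN w r N))) (phiN w r N)
  = (- 6 * (u *m g7 w *m v^T) 0 0) *: volcov (g7 w) (ori7 r s).
Proof.
apply: (pull_inj Q_unit).
pose iQ := invmx Q; have eu (x : 'rV[R]_7) : x = x *m iQ *m Q by rewrite -mulmxA mulVmx ?Q_unit // mulmx1.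
rewrite [in RHS]pullZ !pull_wedge pull_phi pull_vol {1}(eu u) {1}(eu v) -!(@pull_interior R 7 7 2) pull_phi phi0_G2.
by rewrite g_eq trmx_mul !mulmxA.
Qed.

Lemma hodge_at : @hodge R 7 3 4 (g7 w) (volcov (g7 w) (ori7 r s)) (phiN w r N) = psiN w s N.
Proof.
apply: (pull_inj Q_unit).
by rewrite pull_hodge ?Q_unit ?g_unit // Qg pull_vol pull_phi pull_psi hodge_phi0.
Qed.

Lemma alt_phi : is_alternating (phiN w r N).
Proof.
apply: altD; apply: altZ; first by apply: alt_pull; apply: altZ; exact: alt_r.
by apply: alt_wedge1; apply: alt_pull; exact: alt_w.
Qed.

Lemma alt_psi : is_alternating (psiN w s N).
Proof.
apply: altD; apply: altZ; last by apply: alt_pull; exact: (@alt_wedge R 6 2 2).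
by apply: alt_wedge1; apply: alt_pull; apply: altZ; exact: alt_s.
Qed.

(** The hypothesis says that d (N w^2) vanishes when lam = dN and beta = N dw;
    in the frame Q it is the one of hodge_balanced. *)
Lemma hodge_balanced_at (lam : 'I_6 -> R) beta : is_alternating beta ->
  wedge1 lam (wedge w w) + 2 *: wedge beta w = 0 ->
  @hodge R 7 4 3 (g7 w) (volcov (g7 w) (ori7 r s))
    (c0^-1 *: wedge1 (dxi 0) (pull E (wedge1 lam w + beta))) = pull E (pull J beta).
Proof.
move=> hb hs; apply: (pull_inj Q_unit).
rewrite pull_hodge ?Q_unit ?g_unit // Qg pull_vol pullZ pull_Q7_dr scalerA mulVf ?c0_neq0 //.
rewrite scale1r !pull_Q7_E pullD pull_wedge1 Pw hodge_balanced.
- by congr pull; rewrite -!pull_mul; congr pull; exact: esym.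
- exact: alt_pull.
by rewrite /sigma5 -[in LHS]Pw -!pull_wedge -pull_wedge1 -pullZ -pullD hs pull00.
Qed.

Lemma inner_lam_at (lam : 'I_6 -> R) :
  inner (g7 w) (pull E (wedge1 lam r)) (psiN w s N) = 0.
Proof.
rewrite -(inner_pull _ _ Q_unit g_unit) Qg pull_psi pull_Q7_E pull_wedge1 Pr wedge1Zr pullZ innerZl.
by rewrite inner_lam_psi0 mulr0.
Qed.

Lemma inner_beta_at beta : is_alternating beta -> wedge beta r = 0 ->
  inner (g7 w) (wedge1 (dxi 0) (pull E beta)) (psiN w s N) = 0.
Proof.
move=> hb h; rewrite -(inner_pull _ _ Q_unit g_unit) Qg pull_psi pull_Q7_dr pull_Q7_E innerZl.
rewrite inner_beta_psi0; last exact: alt_pull.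
have : kappa *: wedge (pull P beta) rho0 = 0.
  by rewrite -wedgeZr -Pr -(@pull_wedge R 6 6 3 3) h pull00.
move=> /(congr1 (fun f : covec R 6 6 => f (fid 6))); rewrite covecZ => /eqP.
by rewrite mulf_eq0 gt_eqF //= => /eqP ->; rewrite oppr0 mulr0.
Qed.

Lemma inner_psi_at (u v : 'rV[R]_7) :
  inner (g7 w) (interior_product u (psiN w s N)) (interior_product v (psiN w s N))
  = 4 * (u *m g7 w *m v^T) 0 0.
Proof.
pose iQ := invmx Q; have eu (x : 'rV[R]_7) : x = x *m iQ *m Q by rewrite -mulmxA mulVmx ?Q_unit // mulmx1.
rewrite -(inner_pull _ _ Q_unit g_unit) Qg {1}(eu u) {1}(eu v) -!(@pull_interior R 7 7 3) pull_psi inner_psi0.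
by rewrite g_eq trmx_mul !mulmxA.
Qed.

(** Contracting the antisymmetrised torsion equation with psi leaves the
    products of the contractions of psi with vectors, which are 4 times the
    metric by inner_psi_at. *)
Lemma trace_at (T : 'M[R]_7) (nab : 'I_7 -> covec R 7 3) :
  (forall m I, nab m I = \sum_(p < 7) \sum_(q < 7)
     T m p * invmx (g7 w) p q * psiN w s N (fcons q I)) ->
  inner (g7 w) (\sum_(m < 7) wedge1 (dxi m) (nab m)) (psiN w s N)
  = 4 * \sum_(p < 7) \sum_(q < 7) invmx (g7 w) p q * T p q.
Proof.
move=> h; pose V m : 'rV[R]_7 := row m (T *m invmx (g7 w)).
have e m : nab m = interior_product (V m) (psiN w s N).
  apply: covecP => I; rewrite h exchange_big; apply: eq_bigr => q _ /=.
  by rewrite !mxE big_distrl.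
rewrite inner_suml mulr_sumr; apply: eq_bigr => m _.
rewrite e inner_wedge1; last exact: alt_psi.
rewrite inner_psi_at trmx_mul trmx_inv g_sym !mulmxA; congr (_ * _).
rewrite -(mulmxA (V m)) mulmxV ?g_unit // mulmx1.
have -> : (V m *m (\row_i dxi m i)^T) 0 0 = V m 0 m.
  rewrite mxE (bigD1 m) //= big1 => [|j ne]; rewrite !mxE /dxi ?eqxx ?mulr1 ?addr0 //.
  by rewrite val_eqE (negbTE ne) mulr0.
rewrite !mxE; apply: eq_bigr => q _; rewrite mulrC; congr (_ * _).
by rewrite -[in LHS]g_sym -trmx_inv mxE.
Qed.

End InFrame.
End Pointwise.

(** * Holomorphic volume forms and hermitian metrics in a chart *)

Section HolomorphicVolume.
Context {R : realType}.
Local Notation C := R[i].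
Local Notation J := (@Jmx R 3).

Lemma om0_iota0 : wedge om0 iota0 = 0 :> covec R 6 5.
Proof.
rewrite wedge_zform //.
have -> : (0 : covec R 6 5) = zform 5 [::] by rewrite /zform big_nil.
by apply: zform_eq; vm_compute.
Qed.

(** The real part of i a /\ conj a, in terms of the real and imaginary parts of
    a. *)
Lemma Re_i_wedge n p (a : covec C n p) I :
  complex.Re ((0 +i* 1)%C * wedge a (fun L => (a L)^*%C) I) =
  (wedge (reC a) (imC a) - wedge (imC a) (reC a)) I.
Proof.
rewrite covecD covecN /wedge -mulrBr -sumrB.
have -> : (0 +i* 1)%C * ((p`! * p`!)%N%:R^-1 * \sum_(s : 'S_(p + p))
    (-1) ^+ s * a [ffun c => I (s (lshift p c))] * (a [ffun c => I (s (rshift p c))])^*%C)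
  = ((((p`! * p`!)%N%:R)^-1 : R)%:C)%C * \sum_(s : 'S_(p + p)) (((-1) ^+ s : R)%:C)%C *
     ((0 +i* 1)%C * (a [ffun c => I (s (lshift p c))] * (a [ffun c => I (s (rshift p c))])^*%C)).
  rewrite fmorphV rmorph_nat mulrCA; congr (_ * _); rewrite big_distrr; apply: eq_bigr => s _ /=.
  by rewrite rmorphXn rmorphN1 -!mulrA mulrCA.
rewrite Re_realM Re_sum; congr (_ * _); apply: eq_bigr => s _.
rewrite Re_realM -!mulrA -mulrBr; congr (_ * _); rewrite /reC /imC.
by case: (a _) (a _) => [u v] [u' v'] /=; ring.
Qed.

(** The identities of rho_iota_d on all multi-indices. *)
Definition check_rho_iota (a : nat) :=
  all (fun m => zval (zcons a rho_l) m == zval (zcons (3 + a) iota_l) m) (lists 6 4) &&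
  all (fun m => zval (zcons (3 + a) rho_l ++ zcons a iota_l) m == zval [::] m) (lists 6 4).

Lemma check_rho_iotaT : all check_rho_iota (iota 0 3). Proof. by vm_compute. Qed.

(** The real and imaginary parts of dz^a /\ dz^0 /\ dz^1 /\ dz^2 = 0. *)
Lemma rho_iota_d (a : 'I_3) :
  wedge1 (dxi a) rho0 = wedge1 (dxi (3 + a)) iota0 :> covec R 6 4 /\
  wedge1 (dxi (3 + a)) rho0 = - wedge1 (dxi a) iota0 :> covec R 6 4.
Proof.
have /andP[h1 h2] : check_rho_iota a by apply: (allP check_rho_iotaT); rewrite mem_iota; exact: ltn_ord.
split; first by rewrite !wedge1_zform; exact: zform_eq.
apply/eqP; rewrite -subr_eq0 opprK !wedge1_zform zformD.
have -> : (0 : covec R 6 4) = zform 4 [::] by rewrite /zform big_nil.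
by apply/eqP/zform_eq.
Qed.

Section Closed.
Variables (h : 'rV[R]_6 -> C) (x : 'rV[R]_6).
Local Notation hr := (fun y => complex.Re (h y)).
Local Notation hi := (fun y => complex.Im (h y)).
Hypotheses (dr : differentiable hr x) (di : differentiable hi x).
Hypothesis hol : forall j : 'I_3, @dbyzbar R 3 j h x = 0.

Lemma cauchy_riemann (a : 'I_3) :
  pderiv (lshift 3 a) hr x = pderiv (rshift 3 a) hi x /\
  pderiv (lshift 3 a) hi x = - pderiv (rshift 3 a) hr x.
Proof.
have := hol a; rewrite /dbyzbar /pderivC => /eqP; rewrite mulf_eq0 invr_eq0 pnatr_eq0 orbF.
rewrite eq_complex /= => /andP[/eqP e1 /eqP e2]; move: e1 e2.
move: (pderiv _ _ _) (pderiv _ _ _) (pderiv _ _ _) (pderiv _ _ _) => p q r s e1 e2; split; lra.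
Qed.

Lemma extd_fcst k (f : 'rV[R]_6 -> R) (c : covec R 6 k) : differentiable f x ->
  extd (fun y => f y *: c) x = \sum_(i < 6) pderiv i f x *: wedge1 (dxi i) c.
Proof.
move=> df; rewrite extd_fmul // extd_cst scaler0 addr0.
rewrite {1}(dxi_decomp (fun i => pderiv i f x)) wedge1_suml.
by apply: eq_bigr => i _; rewrite wedge1Zl.
Qed.

Let dc (f : 'rV[R]_6 -> R) (c : covec R 6 3) L : differentiable f x ->
  differentiable (fun y => (f y *: c) L) x.
Proof. by move=> df; apply: differentiableM'. Qed.

Lemma sum6 (V : nmodType) (F : 'I_6 -> V) :
  \sum_(i < 6) F i = \sum_(a < 3) (F (lshift 3 a) + F (rshift 3 a)).
Proof. by rewrite (@big_split_ord _ _ _ 3 3) big_split. Qed.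

(** By the Cauchy-Riemann equations dh is a combination of the dz^a, whose
    product with the complex volume form vanishes. *)
Lemma closed_re : extd (fun y => hr y *: rho0 - hi y *: iota0) x = 0.
Proof.
have -> : (fun y => hr y *: rho0 - hi y *: iota0) = (fun y => hr y *: rho0 + (- 1) *: (hi y *: iota0)).
  by apply: funext => y; rewrite scaleN1r.
rewrite extdD => [|L|L]; [|exact: dc|by apply: differentiableM' => //; exact: dc].
rewrite (extdZ (-1)) => [|L]; last exact: dc.
rewrite !extd_fcst // !sum6 scaler_sumr -big_split big1 // => a _ /=.
have [e1 e2] := cauchy_riemann a; have [f1 f2] := rho_iota_d a.
rewrite f1 f2 e1 e2.
move: (wedge1 _ iota0) (wedge1 _ iota0) (pderiv _ _ _) (pderiv _ _ _) => A B p q.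
by rewrite scaleN1r opprD scaleNr scalerN opprK addrACA -opprD [X in _ - X]addrC subrr.
Qed.

Lemma closed_im : extd (fun y => hi y *: rho0 + hr y *: iota0) x = 0.
Proof.
rewrite extdD => [|L|L]; [|exact: dc|exact: dc].
rewrite !extd_fcst // !sum6 -big_split big1 // => a _ /=.
have [e1 e2] := cauchy_riemann a; have [f1 f2] := rho_iota_d a.
rewrite f1 f2 e1 e2.
move: (wedge1 _ iota0) (wedge1 _ iota0) (pderiv _ _ _) (pderiv _ _ _) => A B p q.
by rewrite scaleNr scalerN -opprD [X in - X]addrC addNr.
Qed.

End Closed.
End HolomorphicVolume.

Section HermitianPoint.
Context {R : realType}.
Local Notation J := (@Jmx R 3).
Implicit Types (w : covec R (3 + 3) 2).

Lemma bil_anti n (w : covec R n 2) u v : is_alternating w -> bil w u v = - bil w v u.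
Proof.
move=> hw; rewrite (bilE w u v) (bilE w v u) exchange_big -sumrN; apply: eq_bigr => i _.
rewrite -sumrN; apply: eq_bigr => j _; rewrite [v 0 i * _]mulrC -mulrN; congr (_ * _).
have E (c : covec R n 2) a b : bil c (delta_mx 0 a) (delta_mx 0 b) = c (two a b).
  by rewrite /bil !interior_delta.
by rewrite !E (alt_two j i hw) opprK.
Qed.

Lemma bil_oppr n (w : covec R n 2) u v : bil w u (- v) = - bil w u v.
Proof. by rewrite /bil /interior_product -sumrN; apply: eq_bigr => d _; rewrite mxE mulNr. Qed.

Lemma pull_J_inv w : (forall u v, eval2 w (Jmul u) (Jmul v) = eval2 w u v) -> pull J w = w.
Proof. by move=> h; apply: bil_inj => u v; rewrite bil_pull !JmxE; exact: h. Qed.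

(** Symmetry and J-invariance of g both express that w is J-invariant. *)
Lemma Gmx_herm w : is_alternating w ->
  (forall u v, eval2 w (Jmul u) (Jmul v) = eval2 w u v) ->
  (forall u, u != 0 -> 0 < eval2 w u (Jmul u)) ->
  [/\ (Gmx w)^T = Gmx w, forall u : 'rV[R]_(3 + 3), u != 0 -> 0 < (u *m Gmx w *m u^T) 0 0 &
     J *m Gmx w *m J^T = Gmx w].
Proof.
move=> hw hJ hp; have hJ' u v : bil w (u *m J) (v *m J) = bil w u v.
  by rewrite !JmxE; exact: hJ.
split=> [|u u0|].
- apply/matrixP => a b; rewrite !mxE -hJ' -mulmxA Jmx_sq mulmxN mulmx1 bil_oppr.
  by rewrite bil_anti // opprK.
- by rewrite -GmxE JmxE; exact: hp.
- by rewrite -Gmx_pull // pull_J_inv.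
Qed.

Section Frames.
Variables (X : atlas R (3 + 3)) (Omega : diff_form X (complex R) 3) (w : diff_form X R 2).
Hypotheses (hO : holomorphic_volume_form Omega) (hw : hermitian_metric w).
Implicit Types (i j : chart X).
Local Notation r := (formRe Omega).
Local Notation s := (formIm Omega).

Lemma volume_parts i x (h : 'rV[R]_(3 + 3) -> complex R) : (forall I, Omega i x I = h x * dz123 I) ->
  r i x = complex.Re (h x) *: rho0 - complex.Im (h x) *: iota0 /\
  s i x = complex.Im (h x) *: rho0 + complex.Re (h x) *: iota0.
Proof.
move=> e; rewrite -re_dz123 -im_dz123; split; apply: covecP => I.
  by rewrite /formRe e covecD covecN !covecZ /reC /imC; case: (h x) (dz123 I) => [a b] [c d].
rewrite /formIm e covecD !covecZ /reC /imC; case: (h x) (dz123 I) => [a b] [c d] /=; ring.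
Qed.

(** su3_frame at a point of a chart, where Omega is a nonzero multiple of the
    standard complex volume form. *)
Lemma frame_exists i x : chart_img i x ->
  exists P kappa, su3 (w i x) (r i x) (s i x) P kappa.
Proof.
move=> hx; have [fw hJ hp] := hw; have [h [_ _ _ h0 eO]] := hO.2 i.
have [er es] := volume_parts (eO x hx).
have [g1 g2 g3] : [/\ (Gmx (w i x))^T = Gmx (w i x),
   forall u : 'rV[R]_(3 + 3), u != 0 -> 0 < (u *m Gmx (w i x) *m u^T) 0 0 &
   J *m Gmx (w i x) *m J^T = Gmx (w i x)].
  by apply: Gmx_herm; [have [+ _ _] := fw; exact | exact: hJ | exact: hp].
have hne : (complex.Re (h x) != 0) || (complex.Im (h x) != 0).
  by have := h0 x hx; rewrite eq_complex negb_and.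
have [P [k [PJ uP [PG Pw] k0 [Pr Ps]]]] := su3_frame g1 g2 g3 hne.
by exists P, k; rewrite /su3 er es.
Qed.

Lemma iOmegabarE i x : iOmegabar Omega i x = iOb (r i x) (s i x).
Proof. by apply: covecP => I; exact: (Re_i_wedge (Omega i x) I). Qed.

Lemma norm_formE i x : norm_form Omega w i x = normN (w i x) (r i x) (s i x).
Proof. by rewrite /norm_form /top_ratio iOmegabarE. Qed.

(** A (1,1)-form times a form of type (3,0) or (0,3) vanishes in dimension 3;
    this is checked in the frame, where both are standard. *)
Lemma w_rho_iota i x : chart_img i x -> wedge (w i x) rho0 = 0 /\ wedge (w i x) iota0 = 0.
Proof.
move=> hx; have [P [k [PJ uP [PG Pw] k0 _]]] := frame_exists hx.
split; apply: (pull_inj uP); rewrite pull_wedge Pw pull00 ?pull_rho0 ?pull_iota0 //.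
  by rewrite -scaleNr wedgeDr !wedgeZr om0_rho0 om0_iota0 !scaler0 addr0.
by rewrite wedgeDr !wedgeZr om0_rho0 om0_iota0 !scaler0 addr0.
Qed.

Lemma smooth_parts i : (forall I, smooth_on (chart_img i) (fun x => w i x I)) /\
  (forall I, smooth_on (chart_img i) (fun x => r i x I)) /\
  (forall I, smooth_on (chart_img i) (fun x => s i x I)).
Proof.
have [[_ + _] _ _] := hw; have [[[_ + _] [_ + _]] _] := hO.
by move=> a b c; do !split; auto.
Qed.

Lemma norm_ratio_gt0 i x : chart_img i x ->
  0 < iOb (r i x) (s i x) (fid 6) / (6%:R^-1 * wedge (wedge (w i x) (w i x)) (w i x) (fid 6)).
Proof.
move=> /frame_exists[P [k fr]]; rewrite (norm_ratio fr) mulr_gt0 // exprn_gt0 //.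
by have [_ _ _] := fr.
Qed.

End Frames.
End HermitianPoint.

Section NormSmooth.
Context {R : realType} {m : nat}.
Variables (A : set 'rV[R]_m) (w : 'rV[R]_m -> covec R 6 2) (r s : 'rV[R]_m -> covec R 6 3).
Hypotheses (sw : forall I, smooth_on A (fun x => w x I)).
Hypotheses (sr : forall I, smooth_on A (fun x => r x I)) (ss : forall I, smooth_on A (fun x => s x I)).
Hypothesis pos : forall x, A x ->
  0 < iOb (r x) (s x) (fid 6) / (6%:R^-1 * wedge (wedge (w x) (w x)) (w x) (fid 6)).

(** The domain is arbitrary so that the lemma also covers dependence on time.
    *)
Lemma smooth_norm : smooth_on A (fun x => normN (w x) (r x) (s x)).
Proof.
apply: smooth_on_sqrt => //; apply: smooth_onM.
  apply: (smooth_on_eq (f := fun y => wedge (r y) (s y) (fid 6) + (-1) * wedge (s y) (r y) (fid 6))).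
    by move=> y _; rewrite /iOb mulN1r.
  apply: smooth_onD; first exact: smooth_wedge.
  by apply: smooth_onM; [exact: smooth_on_cst | exact: smooth_wedge].
apply: smooth_onV => [x Ax|].
  by have := pos Ax; apply: contraTneq => ->; rewrite invr0 mulr0 ltxx.
apply: smooth_onM; first exact: smooth_on_cst.
by apply: smooth_wedge => // I; exact: smooth_wedge.
Qed.

End NormSmooth.

(** * The G2-structure on the product *)

Section Geometry.
Context {R : realType} (X : atlas R (3 + 3)).
Variables (Omega : diff_form X (complex R) 3).
Hypotheses (cX : complex_manifold X) (hO : holomorphic_volume_form Omega).
Local Notation J := (@Jmx R 3).
Local Notation E := (@Emx R 1 6).
Local Notation c0 := (2 * Num.sqrt 2 : R).
Local Notation r := (formRe Omega).
Local Notation s := (formIm Omega).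
Local Notation M := (S1_times X).
Implicit Types (i j : chart X) (c d : chart M).

Let sX : smooth_manifold X. Proof. by have [] := cX. Qed.
Let oV i : open (chart_img i). Proof. exact: (sm_img_open sX). Qed.
Arguments oV : clear implicits.

(** Transition maps are holomorphic. *)
Lemma jac_J i j x : overlap i j x ->
  jacobian (transition i j) x *m J = J *m jacobian (transition i j) x.
Proof.
move=> o; have [_ h] := cX; apply/row_matrixP => a; rewrite !row_mul.
by have := h i j x o (delta_mx 0 a); rewrite /Jmul -!JmxE !rowE.
Qed.

Lemma parts_closed i x : chart_img i x -> extd (r i) x = 0 /\ extd (s i) x = 0.
Proof.
move=> hx; have [h [sr si hol _ eO]] := hO.2 i.
have dr := smooth_on_diff (oV i) sr hx; have di := smooth_on_diff (oV i) si hx.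
have e y (hy : chart_img i y) := volume_parts (eO y hy).
rewrite (extd_eq_on (oV i) hx (fun y hy => (e y hy).1)) (extd_eq_on (oV i) hx (fun y hy => (e y hy).2)).
by rewrite (closed_re dr di (hol x hx)) (closed_im dr di (hol x hx)).
Qed.

Section OneTime.
Variable w : diff_form X R 2.
Hypothesis hw : hermitian_metric w.
Local Notation N i x := (normN (w i x) (r i x) (s i x)).

Lemma fw : is_form w. Proof. by have [] := hw. Qed.
Lemma fr : is_form r. Proof. by have [[]] := hO. Qed.
Lemma fs : is_form s. Proof. by have [[]] := hO. Qed.

Lemma N_gt0 i x : chart_img i x -> 0 < N i x.
Proof. by move=> /(frame_exists hO hw)[P [k f]]; exact: norm_gt0 f. Qed.

Lemma smooth_N i : smooth_on (chart_img i) (fun x => N i x).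
Proof.
have [a [b c]] := smooth_parts hO hw i.
by apply: smooth_norm => // x; exact: norm_ratio_gt0.
Qed.

Lemma ratio_scale (a b u : R) : u != 0 -> u * a / (6^-1 * (u * b)) = a / (6^-1 * b).
Proof. by move=> u0; rewrite [6^-1 * _]mulrCA invfM mulrACA divff // mul1r. Qed.

(** Both forms in the quotient have top degree and are multiplied by the same
    Jacobian determinant. *)
Lemma inv_N i j x : overlap i j x -> N i x = N j (transition i j x).
Proof.
move=> o; have oi := overlap_img o; have oj := overlap_transition sX o.
have [P [k f]] := frame_exists hO hw oi; have [P' [k' f']] := frame_exists hO hw oj.
rewrite /normN; set A := jacobian (transition i j) x.
have e1 : iOb (r i x) (s i x) = pull A (iOb (r j (transition i j x)) (s j (transition i j x))).
  rewrite /iOb (form_pull fr o) (form_pull fs o) -scaleN1r -[in RHS]scaleN1r pullD (pullZ (-1)).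
  by rewrite !pull_wedge.
have e2 : wedge (wedge (w i x) (w i x)) (w i x) =
    pull A (wedge (wedge (w j (transition i j x)) (w j (transition i j x))) (w j (transition i j x))).
  by rewrite (form_pull fw o) !pull_wedge.
have top (a : covec R 6 6) : is_alternating a -> pull A a (fid 6) = \det A * a (fid 6).
  by move=> ha; rewrite {1}(top_alt ha) pullZ pull_eps !covecZ eps_fid mulr1 mulrC.
have alt3 (a : covec R 6 2) : is_alternating (wedge (wedge a a) a) by exact: alt_wedge.
rewrite e1 e2 (top _ (alt_iOb f')) (top _ (alt3 _)).
have w0 : wedge (wedge (w i x) (w i x)) (w i x) (fid 6) != 0.
  by apply/eqP => z; have := w3_fid f; rewrite z mulr0 => /eqP; rewrite eq_sym oppr_eq0 pnatr_eq0.
have dA : \det A != 0.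
  by move: w0; rewrite e2 (top _ (alt3 _)) mulf_eq0 negb_or => /andP[].
congr (Num.sqrt _); exact: ratio_scale.
Qed.

Lemma is_form_invN (a : diff_form X R 3) : is_form a -> is_form (fmul (inv_norm Omega w) a).
Proof.
move=> fa; apply: is_form_fmul => // [i|i j x o].
  apply: (smooth_on_eq (f := fun x => (N i x)^-1)) => [x _|]; first by rewrite /inv_norm norm_formE.
  by apply: smooth_onV; [move=> x /N_gt0; exact: lt0r_neq0 | exact: smooth_N].
by rewrite /inv_norm !norm_formE (inv_N o).
Qed.

Definition metric7 : tensor2 M := fun c y => g7 (w c.2 (rsubmx y)).

Lemma imgX c y : chart_img c y -> chart_img c.2 (rsubmx y).
Proof. by move=> /prod_imgE[]. Qed.

Lemma wedge_dr k (a : diff_form X R k) c (y : 'rV[R]_(1 + (3 + 3))) :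
  is_alternating (a c.2 (rsubmx y)) ->
  wedge (@dr R X c y) (pr2_form (A := circle R) a c y) = wedge1 (dxi 0) (pull E (a c.2 (rsubmx y))).
Proof. by move=> h; rewrite [dr _ _]dr_covec pr2E wedge_covec1 //; exact: alt_pull. Qed.

Section AtPoint.
Variables (c : chart M) (y : 'rV[R]_(1 + (3 + 3))).
Hypothesis hy : chart_img c y.
Local Notation x := (rsubmx y).
Local Notation Nx := (N c.2 x).

Let hx : chart_img c.2 x. Proof. exact: imgX hy. Qed.
Let fx : exists P kappa, su3 (w c.2 x) (r c.2 x) (s c.2 x) P kappa.
Proof. by have [P [k f]] := frame_exists hO hw hx; exists P, k; exact: f. Qed.
Let aw : is_alternating (w c.2 x). Proof. by have [+ _ _] := fw; apply. Qed.
Let ar : is_alternating (r c.2 x). Proof. by have [+ _ _] := fr; apply. Qed.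
Let as_ : is_alternating (s c.2 x). Proof. by have [+ _ _] := fs; apply. Qed.

Lemma pr2_invN (a : diff_form X R 3) :
  pr2_form (A := circle R) (fmul (inv_norm Omega w) a) c y = pull E (Nx^-1 *: a c.2 x).
Proof. by rewrite pr2E; congr pull; apply: covecP => I; rewrite /fmul /inv_norm norm_formE. Qed.

Lemma phiE : G2_phi Omega w c y = phiN (w c.2 x) (r c.2 x) Nx.
Proof.
rewrite /phiN -wedge_dr //; apply: covecP => I.
by rewrite -[LHS]/(c0 * _ + - c0^-1 * _) pr2_invN.
Qed.

Lemma psiE : G2_psi Omega w c y = psiN (w c.2 x) (s c.2 x) Nx.
Proof.
rewrite /psiN; apply: covecP => I; rewrite -[LHS]/(-1 * _ + - 2^-1 * _) covecD !covecZ.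
congr (-1 * _ + - 2^-1 * _); last by rewrite pr2E.
rewrite /fwedge [dr _ _]dr_covec pr2_invN wedge_covec1 //.
by apply: alt_pull; exact: altZ.
Qed.

Lemma oriE : orientation Omega c y = ori7 (r c.2 x) (s c.2 x).
Proof.
have [P [k f]] := fx; rewrite /orientation /fwedge wedge_dr ?iOmegabarE //.
exact: alt_iOb f.
Qed.

Lemma vol_ratioE : top_ratio (vol_form metric7 (orientation Omega)) (vol_R Omega) c y = (Nx ^+ 2)^-1.
Proof.
have [P [k f]] := fx; rewrite -(vol_ratio f) /top_ratio /vol_form /vol_R /fscale.
by rewrite oriE.
Qed.

Let N0 : 0 < Nx. Proof. exact: N_gt0. Qed.

Lemma ln_ratio : conf_factor Omega metric7 c y = - (ln Nx / 2).
Proof.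
rewrite /conf_factor vol_ratioE lnV ?posrE ?exprn_gt0 // lnXn //.
by rewrite mulr2n; move: (ln _) => z; lra.
Qed.

Lemma expN k (a : diff_form M R k) : exp_mul (-2) (conf_factor Omega metric7) a c y = Nx *: a c y.
Proof.
apply: covecP => I; rewrite /exp_mul /fmul ln_ratio covecZ; congr (_ * _).
have -> : -2 * - (ln Nx / 2) = ln Nx by move: (ln _) => z; lra.
by rewrite lnK // posrE.
Qed.

Lemma expNV k (a : diff_form M R k) : exp_mul 2 (conf_factor Omega metric7) a c y = Nx^-1 *: a c y.
Proof.
apply: covecP => I; rewrite /exp_mul /fmul ln_ratio covecZ; congr (_ * _).
have -> : 2 * - (ln Nx / 2) = - ln Nx by move: (ln _) => z; lra.
by rewrite expRN lnK // posrE.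
Qed.

(** Since e^(-2 f) = N, the first term is Im Omega without its factor, and the
    second is N w^2. *)
Lemma exp_psiE : exp_mul (-2) (conf_factor Omega metric7) (G2_psi Omega w) c y =
  (-1) *: wedge1 (dxi 0) (pull E (s c.2 x)) + (- 2^-1) *: pull E (Nx *: wedge (w c.2 x) (w c.2 x)).
Proof.
rewrite expN psiE /psiN scalerDr (pullZ Nx^-1) (pullZ Nx) wedge1Zr !scalerA.
congr (_ *: _ + _ *: _); last by rewrite mulrC.
by rewrite mulrN1 mulNr divff // gt_eqF.
Qed.

End AtPoint.

Lemma riemannian : riemannian_metric metric7.
Proof.
split=> [c y hy|c y hy u u0|c a b|c d y o A].
- by have [P [k f]] := frame_exists hO hw (imgX hy); exact: g_sym f.
- by have [P [k f]] := frame_exists hO hw (imgX hy); exact: (g_pos f).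
- apply: (@smooth_on_sub _ _ _ (rsubmx @^-1` chart_img c.2)); first by move=> x /prod_imgE[].
  case: (split_ordP (a : 'I_(1 + 6))) => a' ->; case: (split_ordP (b : 'I_(1 + 6))) => b' ->.
  + apply: (smooth_on_eq (f := fun=> ((8^-1)%:M : 'M[R]_1) a' b')); last exact: smooth_on_cst.
    by move=> y _; rewrite /metric7 /g7 block_mxEul.
  + apply: (smooth_on_eq (f := fun=> 0)); last exact: smooth_on_cst.
    by move=> y _; rewrite /metric7 /g7 block_mxEur mxE.
  + apply: (smooth_on_eq (f := fun=> 0)); last exact: smooth_on_cst.
    by move=> y _; rewrite /metric7 /g7 block_mxEdl mxE.
  apply: (smooth_on_eq (f := fun y => Gmx (w c.2 (rsubmx y)) a' b')).
    by move=> y _; rewrite /metric7 /g7 block_mxEdr.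
  apply: (@smooth_rsubmx _ _ _ (fun x => Gmx (w c.2 x) a' b')).
  apply: (smooth_on_eq (f := fun x => bil (w c.2 x) (delta_mx 0 a') (delta_mx 0 b' *m J))).
    by move=> y _; rewrite mxE.
  apply: smooth_on_sum => e _; apply: smooth_onM; first exact: smooth_on_cst.
  apply: smooth_on_sum => e' _; apply: smooth_onM; first exact: smooth_on_cst.
  by have [_ + _] := fw; apply.
have [ov1 ov2] := prod_overlap o.
rewrite /A (jac_prod sX o) /metric7 /g7 (form_pull fw ov2) Gmx_pull ?jac_J //.
rewrite /transition /= row_mxKr tr_block_mx !trmx0 trmx1 !mulmx_block.
by rewrite !(mulmx0, mul0mx, addr0, add0r, mul1mx, mulmx1).
Qed.

Lemma is_form_phi : is_form (G2_phi Omega w).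
Proof.
apply: is_form_add; apply: is_form_scale.
  by apply: is_form_pr2 => //; apply: is_form_invN; exact: fr.
apply: (@is_form_wedge _ _ M 1 2); first exact: is_form_dr.
by apply: is_form_pr2 => //; exact: fw.
Qed.

Lemma G2_structureP : G2_structure (orientation Omega) (G2_phi Omega w) metric7 (G2_psi Omega w).
Proof.
split; [exact: is_form_phi | exact: riemannian | |].
  move=> c y hy u v I; have [P [k f]] := frame_exists hO hw (imgX hy).
  by rewrite phiE // /vol_form oriE // (G2_at f) covecZ.
move=> c y hy I; have [P [k f]] := frame_exists hO hw (imgX hy).
by rewrite psiE // -(hodge_at f) /vol_form oriE // phiE.
Qed.

End OneTime.
End Geometry.

(** * The formal adjoint of the exterior derivative *)

Section Density.
Context {R : realType} {n : nat}.

Lemma density_alg (t d z u v : R) : t * t = d -> d != 0 -> t * (u * (z * t / d * v)) = z * (u * v).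
Proof.
move=> sq d0; have -> : t * (u * (z * t / d * v)) = (t * t) * (z * (u * v)) / d by ring.
by rewrite sq; field.
Qed.

Lemma pairing_suml k (T : Type) (s : seq T) (F : T -> covec R n k) c :
  pairing (\sum_(t <- s) F t) c = \sum_(t <- s) pairing (F t) c.
Proof.
rewrite /pairing exchange_big; apply: eq_bigr => L _ /=; rewrite covec_sum.
by rewrite big_distrl.
Qed.

(** With raised indices the factors of det g coming from the volume form and
    from the density cancel, so the result depends on g only through the
    orientation. *)
Lemma raise_hodge_density p q (g : 'M[R]_(p + q)) (o : covec R (p + q) (p + q))
    (a : covec R (p + q) p) J :
  g \in unitmx -> g^T = g -> 0 < \det g ->
  Num.sqrt (\det g) * pull (invmx g) (@hodge R (p + q) p q g (volcov g o) a) J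
  = Num.sg (o (fid (p + q))) * ((p`!%:R)^-1 * pairing a (fun I => eps (fcat I J))).
Proof.
move=> ug sg dg; rewrite raise_hodge // volcovE pullZ pull_eps scalerA det_inv.
rewrite mulrCA [in RHS]mulrCA; congr (_ * _).
rewrite /pairing !big_distrr; apply: eq_bigr => I _ /=; rewrite covecZ.
have sq : Num.sqrt (\det g) * Num.sqrt (\det g) = \det g by rewrite -expr2 sqr_sqrtr // ltW.
have d0 : \det g != 0 by rewrite gt_eqF.
exact: density_alg.
Qed.

Lemma inner_hodge_density p q (g : 'M[R]_(p + q)) (o : covec R (p + q) (p + q))
    (A : covec R (p + q) q) (a : covec R (p + q) p) :
  g \in unitmx -> g^T = g -> 0 < \det g ->
  inner g A (@hodge R (p + q) p q g (volcov g o) a) * Num.sqrt (\det g)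
  = (q`!%:R)^-1 * \sum_J A J * (Num.sg (o (fid (p + q))) *
      ((p`!%:R)^-1 * pairing a (fun I => eps (fcat I J)))).
Proof.
move=> ug sg dg; rewrite innerE -mulrA; congr (_ * _); rewrite /pairing big_distrl.
apply: eq_bigr => J _ /=; rewrite -mulrA; congr (_ * _).
by rewrite mulrC raise_hodge_density.
Qed.

End Density.

Section Indices7.
Context {n : nat}.
Implicit Types (K I : {ffun 'I_3 -> 'I_n}).

Lemma fcat_fcons (c : 'I_n) K I :
  fcat (fcons c K) I = fcons c (fcat K I).
Proof.
apply/ffunP => b; case: (split_ordP (b : 'I_(4 + 3))) => e ->.
  rewrite fcat_l; case: (unliftP ord0 e) => [e'|] ->.
    have -> : lshift 3 (lift ord0 e') = lift ord0 (lshift 3 e') by exact: val_inj.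
    rewrite [LHS]fcons_lift.
    exact: (esym (etrans (fcons_lift c (fcat K I) (lshift 3 e')) (fcat_l K I e'))).
  have -> : lshift 3 (ord0 : 'I_4) = ord0 by exact: val_inj.
  by rewrite [LHS]fcons_at [RHS]fcons_at.
rewrite fcat_r; have -> : rshift 4 e = lift ord0 (rshift 3 e) by exact: val_inj.
exact: (esym (etrans (fcons_lift c (fcat K I) (rshift 3 e)) (fcat_r K I e))).
Qed.

Lemma fcat_fins (c : 'I_n) K I :
  fcat K (fcons c I) = fins (inord 3 : 'I_7) c (fcat K I).
Proof.
apply/ffunP => b; case: (split_ordP (b : 'I_(3 + 4))) => e ->.
  rewrite fcat_l; have -> : lshift 4 e = lift (inord 3 : 'I_7) (lshift 3 e).
    by apply: val_inj; rewrite /= inordK // /bump leqNgt ltn_ord.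
  exact: (esym (etrans (fins_lift (inord 3 : 'I_7) c (fcat K I) (lshift 3 e)) (fcat_l K I e))).
rewrite fcat_r; case: (unliftP ord0 e) => [e'|] ->.
  rewrite fcons_lift; have -> : rshift 3 (lift ord0 e') = lift (inord 3 : 'I_7) (rshift 3 e').
    by apply: val_inj; rewrite /= inordK // /bump leq_addr /= addnCA.
  exact: (esym (etrans (fins_lift (inord 3 : 'I_7) c (fcat K I) (rshift 3 e')) (fcat_r K I e'))).
have -> : rshift 3 (ord0 : 'I_4) = (inord 3 : 'I_7) by apply: val_inj; rewrite /= inordK.
by rewrite fcons_at; exact: esym (fins_at _ _ _).
Qed.

End Indices7.

(** The index c moves past the three indices of K. *)
Lemma eps_move {R : realType} (c : 'I_7) (K I : {ffun 'I_3 -> 'I_7}) :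
  eps (fcat (fcons c K) I) = - eps (fcat K (fcons c I)) :> R.
Proof.
have -> : fcat K (fcons c I) = fins (inord 3 : 'I_7) c (fcat K I) by exact: fcat_fins.
rewrite (alt_fins _ _ _ alt_eps) inordK // -signr_odd /= expr1 mulN1r opprK.
by congr eps; exact: fcat_fcons.
Qed.

Lemma fact43 {R : realType} : (4`!%:R)^-1 * 4%:R = (3`!%:R)^-1 :> R.
Proof. by rewrite (factS 3) natrM invfM mulrAC mulVf ?mul1r // pnatr_eq0. Qed.

Section Codifferential.
Context {R : realType}.
Variables (V : set 'rV[R]_7) (oV : open V).

(** The hypotheses say that f1 and f2 are the densities of the products of da
    with the dual of Phi and of a with the dual of d Phi. With raised indices
    these duals are Levi-Civita contractions, whose divergence involves no
    derivative of the metric, so the two densities differ by the divergence of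
    a field with compact support. *)
Lemma integral_by_parts (a : 'rV[R]_7 -> covec R 7 3) (Phi : 'rV[R]_7 -> covec R 7 3)
    (o : 'rV[R]_7 -> R) (S : set 'rV[R]_7) (f1 f2 : 'rV[R]_7 -> R) :
  compact S -> S `<=` V -> (forall x, ~ S x -> forall I, a x I = 0) ->
  (forall x, is_alternating (a x)) -> (forall I, smooth_on setT (fun x => a x I)) ->
  (forall I, smooth_on V (fun x => Phi x I)) ->
  smooth_on V o -> (forall x, V x -> o x != 0) ->
  (forall x, V x -> is_alternating (fun J : {ffun 'I_4 -> 'I_7} =>
     (3`!%:R)^-1 * pairing (Phi x) (fun I => eps (fcat I J)))) ->
  (forall x, V x -> f1 x = (4`!%:R)^-1 * \sum_J extd a x J *
     (Num.sg (o x) * ((3`!%:R)^-1 * pairing (Phi x) (fun I => eps (fcat I J))))) ->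
  (forall x, V x -> f2 x = (3`!%:R)^-1 * \sum_J a x J *
     (Num.sg (o x) * ((4`!%:R)^-1 * pairing (extd Phi x) (fun I => eps (fcat I J))))) ->
  (forall x, ~ S x -> f1 x = 0) -> (forall x, ~ S x -> f2 x = 0) ->
  integral_Rn f1 = integral_Rn f2.
Proof.
move=> cS SV a0 alta sa sPhi so o0 altP e1 e2 z1 z2.
(* The sign of o, written as a manifestly smooth function. *)
pose sg x := o x * (Num.sqrt (o x * o x))^-1.
have sgE x : V x -> Num.sg (o x) = sg x.
  move=> Vx; rewrite /sg -expr2 sqrtr_sqr.
  by rewrite [X in _ = X / _]numEsg mulfK // normr_eq0 o0.
have ssg : smooth_on V sg.
  have oo : smooth_on V (fun x => o x * o x) by exact: smooth_onM.
  have pos x : V x -> 0 < o x * o x by move=> Vx; rewrite -expr2 exprn_even_gt0 // o0.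
  apply: smooth_onM => //; apply: smooth_onV; first by move=> x /pos h; rewrite gt_eqF // sqrtr_gt0.
  exact: smooth_on_sqrt.
pose D x J := sg x * ((3`!%:R)^-1 * pairing (Phi x) (fun I => eps (fcat I J))).
have sD J : smooth_on V (fun x => D x J).
  apply: smooth_onM => //; apply: smooth_onM; first exact: smooth_on_cst.
  by apply: smooth_on_sum => I _; apply: smooth_onM; [exact: sPhi | exact: smooth_on_cst].
have saV I : smooth_on V (fun x => a x I) by apply: smooth_on_sub (sa I).
pose u c x := (3`!%:R)^-1 * \sum_I a x I * D x (fcons c I).
have su c : smooth_on V (u c).
  apply: smooth_onM; first exact: smooth_on_cst.
  by apply: smooth_on_sum => I _; apply: smooth_onM.
have altD x : V x -> is_alternating (D x) by move=> Vx; apply: altZ; exact: altP.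
have da x I : differentiable (fun x => a x I) x by exact: (smooth_on_diff openT (sa I)).
have dPhi x I : V x -> differentiable (fun x => Phi x I) x by move=> Vx; exact: (smooth_on_diff oV (sPhi I)).
have dD x J : V x -> differentiable (fun x => D x J) x by move=> Vx; exact: (smooth_on_diff oV (sD J)).
(* The sign is locally constant. *)
have sg0 x c : V x -> pderiv c sg x = 0.
  move=> Vx; pose W := V `&` [set y | 0 < o x * o y].
  have oW : open W.
    rewrite openE => y [Vy hy]; apply: filterI; first exact: open_nbhs_nbhs.
    have cy : {for y, continuous (fun z => o x * o z)}.
      by apply: continuousM; [exact: cst_continuous | exact: (smooth_on_continuous oV so)].
    by apply: (cy [set z | 0 < z]); apply: open_nbhs_nbhs; split=> //; exact: open_gt.
  rewrite (@pderiv_eq_on _ _ c sg (fun=> sg x) x W oW) ?pderiv_cst //.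
    by split=> //=; rewrite -expr2 exprn_even_gt0 // o0.
  move=> y [Vy hy]; rewrite -!sgE //.
  by move: hy; rewrite /= -sgr_cp0 sgrM; case: (sgrP (o x)); case: (sgrP (o y)); lra.
(* The divergence of the dual of Phi is minus the dual of d Phi. *)
have div_D x I : V x -> \sum_c pderiv c (fun y => D y (fcons c I)) x =
    - (sg x * ((4`!%:R)^-1 * pairing (extd Phi x) (fun L => eps (fcat L I)))).
  move=> Vx; have dsg : differentiable sg x by exact: (smooth_on_diff oV ssg).
  have dp J : differentiable (fun y => pairing (Phi y) (fun I => eps (fcat I J))) x.
    by apply: differentiable_sum' => K _; apply: differentiableM' => //; exact: dPhi.
  have step c : pderiv c (fun y => D y (fcons c I)) x =
      sg x * ((3`!%:R)^-1 * \sum_K pd c Phi x K * eps (fcat K (fcons c I))).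
    rewrite pderivM //; last by apply: differentiableM'.
    rewrite sg0 // mul0r add0r pderivZ //; congr (_ * (_ * _)).
    rewrite pderiv_sum => [|K _]; last by apply: differentiableM' => //; exact: dPhi.
    apply: eq_bigr => K _; rewrite [LHS]pderivM //; last exact: dPhi.
    by rewrite pderiv_cst mulr0 addr0.
  under eq_bigr do rewrite step.
  rewrite -big_distrr -mulrN /=; congr (_ * _); rewrite -big_distrr extdE /=.
  rewrite pairing_suml.
  rewrite [X in - (_ * X)](eq_bigr (fun c => 4%:R * - \sum_K pd c Phi x K * eps (fcat K (fcons c I)))) => [|c _].
    by rewrite -big_distrr sumrN /= mulrA fact43 mulrN opprK.
  rewrite pairing_wedge1; last by apply: alt_fcat; exact: alt_eps.
  congr (_ * _); rewrite /pairing -sumrN; apply: eq_bigr => K _; rewrite -mulrN; congr (_ * _).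
  have -> : (\row_(i < 7) dxi c i : 'rV[R]_7) = delta_mx 0 c.
    by apply/rowP => i; rewrite !mxE /dxi val_eqE.
  by rewrite interior_delta eps_move.
apply: (@integral_divergence R 7 V S f1 f2 u) => //.
- have sE J : smooth_on V (fun x => extd a x J).
    apply: (smooth_on_eq (f := fun y => dtwist 1%:M a y J)); first by move=> y _; rewrite dtwist1.
    by apply: smooth_dtwist => // I; exact: saV.
  apply: (smooth_on_eq (f := fun x => (4`!%:R)^-1 * \sum_J extd a x J * D x J)).
    by move=> x Vx; rewrite e1 //; congr (_ * _); apply: eq_bigr => J _; rewrite /D sgE.
  apply: smooth_onM; first exact: smooth_on_cst.
  by apply: smooth_on_sum => J _; apply: smooth_onM.
- have sE J : smooth_on V (fun x => extd Phi x J).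
    apply: (smooth_on_eq (f := fun y => dtwist 1%:M Phi y J)); first by move=> y _; rewrite dtwist1.
    exact: smooth_dtwist.
  apply: (smooth_on_eq (f := fun x => (3`!%:R)^-1 * \sum_J a x J *
     (sg x * ((4`!%:R)^-1 * pairing (extd Phi x) (fun I => eps (fcat I J)))))).
    by move=> x Vx; rewrite e2 //; congr (_ * _); apply: eq_bigr => J _; rewrite sgE.
  apply: smooth_onM; first exact: smooth_on_cst.
  apply: smooth_on_sum => J _; apply: smooth_onM => //; apply: smooth_onM => //.
  apply: smooth_onM; first exact: smooth_on_cst.
  by apply: smooth_on_sum => K _; apply: smooth_onM; [exact: sE | exact: smooth_on_cst].
- move=> x nS; split; [exact: z1 | exact: z2 |] => c.
  by rewrite /u big1 ?mulr0 // => I _; rewrite a0 // mul0r.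
move=> x Vx; rewrite e1 // e2 // sgE //.
have du c : pderiv c (u c) x = (3`!%:R)^-1 * \sum_I (pd c a x I * D x (fcons c I)
    + a x I * pderiv c (fun y => D y (fcons c I)) x).
  rewrite pderivZ; last first.
    by apply: differentiable_sum' => I _; apply: differentiableM'; [exact: da | exact: dD].
  congr (_ * _); rewrite pderiv_sum => [|I _]; last by apply: differentiableM'; [exact: da | exact: dD].
  by apply: eq_bigr => I _; rewrite pderivM //; exact: dD.
rewrite [X in _ = _ + X](eq_bigr _ (fun c _ => du c)).
rewrite -big_distrr -mulrDr /= exchange_big -big_split /=.
transitivity ((4`!%:R)^-1 * pairing (extd a x) (D x)); first by [].
rewrite extdE.
rewrite pairing_suml.
rewrite (eq_bigr (fun c => 4%:R * \sum_K pd c a x K * D x (fcons c K))) => [|c _].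
  rewrite -big_distrr mulrA /= fact43.
  congr (_ * _); rewrite exchange_big; apply: eq_bigr => K _ /=.
  rewrite big_split -big_distrr /= div_D // mulrN addrCA subrr addr0 //.
rewrite pairing_wedge1; last exact: altD.
congr (_ * _); apply: eq_bigr => K _; congr (_ * _).
have -> : (\row_(i < 7) dxi c i : 'rV[R]_7) = delta_mx 0 c.
  by apply/rowP => i; rewrite !mxE /dxi val_eqE.
by rewrite interior_delta.
Qed.

End Codifferential.

(** * Codifferential, closedness and trace of the torsion *)

Lemma diff_smooth_pull {R : realType} m n l k (P : 'M[R]_(m, n)) (a : 'rV[R]_l -> covec R n k) U x I :
  open U -> U x -> (forall I, smooth_on U (fun y => a y I)) ->
  differentiable (fun y => pull P (a y) I) x.
Proof.
move=> oU Ux sa; apply: (smooth_on_diff oU _ Ux); apply: smooth_on_sum => K _.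
by apply: smooth_onM; [exact: sa | exact: smooth_on_cst].
Qed.

Lemma smooth_extd {R : realType} n k (a : 'rV[R]_n -> covec R n k) U : open U ->
  (forall I, smooth_on U (fun y => a y I)) -> forall I, smooth_on U (fun y => extd a y I).
Proof.
move=> oU sa I; apply: (smooth_on_eq (f := fun y => dtwist 1%:M a y I)); first by move=> y _; rewrite dtwist1.
exact: smooth_dtwist.
Qed.

(** All the forms on the product considered below have this shape. *)
Lemma extd_ansatz {R : realType} k (a : 'rV[R]_6 -> covec R 6 k) (b : 'rV[R]_6 -> covec R 6 k.+1)
    (U : set 'rV[R]_6) (c1 c2 : R) (y : 'rV[R]_(1 + 6)) : open U -> U (rsubmx y) ->
  (forall x, U x -> is_alternating (a x)) ->
  (forall I, smooth_on U (fun x => a x I)) -> (forall I, smooth_on U (fun x => b x I)) ->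
  extd (fun z => c1 *: wedge1 (dxi 0) (pull (Emx 1 6) (a (rsubmx z)))
              + c2 *: pull (Emx 1 6) (b (rsubmx z))) y
  = (- c1) *: wedge1 (dxi 0) (pull (Emx 1 6) (extd a (rsubmx y)))
    + c2 *: pull (Emx 1 6) (extd b (rsubmx y)).
Proof.
move=> oU Uy alta sa sb; pose W : set 'rV[R]_(1 + 6) := rsubmx @^-1` U.
have oW : open W by apply: open_comp => // z _; exact: continuous_rsubmx.
have sa' I : smooth_on W (fun z => a (rsubmx z) I) by exact: (smooth_rsubmx (sa I)).
have sb' I : smooth_on W (fun z => b (rsubmx z) I) by exact: (smooth_rsubmx (sb I)).
have da I : differentiable (fun z => pull (Emx 1 6) (a (rsubmx z)) I) y by exact: (diff_smooth_pull _ _ oW).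
have db I : differentiable (fun z => pull (Emx 1 6) (b (rsubmx z)) I) y by exact: (diff_smooth_pull _ _ oW).
have dw I : differentiable (fun z => wedge1 (dxi 0) (pull (Emx 1 6) (a (rsubmx z))) I) y by exact: diff_wedge1.
rewrite extdD => [|I|I]; [|exact: differentiableM'|exact: differentiableM'].
rewrite (extdZ c1) // (extdZ c2) // (extd_wedge1 _ oW) // => [|z Wz]; last by apply: alt_pull; exact: alta.
rewrite !extd_pr2 => [|J|J]; [|exact: (smooth_on_diff oU (sb J))|exact: (smooth_on_diff oU (sa J))].
by rewrite scalerN scaleNr.
Qed.

Lemma ori_neq0 {R : realType} w r s P (kappa : R) : su3 w r s P kappa -> ori7 r s (fid 7) != 0.
Proof.
move=> f; apply/eqP => z; have := pull_ori f; rewrite (top_alt (alt_ori f)) z scale0r pull00.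
move=> /(congr1 (fun a : covec R 7 7 => a (fid 7))); rewrite covecZ eps_fid mulr1 => e.
have {e} e : 0 = - (2 * Num.sqrt 2 * (8 * kappa ^+ 2)) :> R by exact: e.
have [_ _ _ k0 _] := f; have : 0 < 2 * Num.sqrt 2 * (8 * kappa ^+ 2).
  by rewrite mulr_gt0 ?c0_gt0 // mulr_gt0 // exprn_gt0.
by rewrite -[X in _ < X]opprK -e oppr0 ltxx.
Qed.

Section Balanced.
Context {R : realType} (X : atlas R (3 + 3)).
Variables (Omega : diff_form X (complex R) 3).
Hypotheses (cX : complex_manifold X) (hO : holomorphic_volume_form Omega).
Variable w : diff_form X R 2.
Hypothesis hw : hermitian_metric w.
Local Notation J := (@Jmx R 3).
Local Notation E := (@Emx R 1 6).
Local Notation c0 := (2 * Num.sqrt 2 : R).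
Local Notation r := (formRe Omega).
Local Notation s := (formIm Omega).
Local Notation M := (S1_times X).
Local Notation N i x := (normN (w i x) (r i x) (s i x)).
Implicit Types (i j : chart X) (c d : chart M).

Let sX : smooth_manifold X. Proof. by have [] := cX. Qed.
Let oV i : open (chart_img i). Proof. exact: (sm_img_open sX). Qed.
Arguments oV : clear implicits.
Let oM c : open (chart_img c). Proof. exact: open_prod_img. Qed.
Arguments oM : clear implicits.
Let sw i I : smooth_on (chart_img i) (fun x => w i x I).
Proof. by have [h _] := smooth_parts hO hw i. Qed.
Let sr i I : smooth_on (chart_img i) (fun x => r i x I).
Proof. by have [_ [h _]] := smooth_parts hO hw i. Qed.
Let ss i I : smooth_on (chart_img i) (fun x => s i x I).
Proof. by have [_ [_ h]] := smooth_parts hO hw i. Qed.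
Let sN i : smooth_on (chart_img i) (fun x => N i x). Proof. exact: smooth_N. Qed.
Let aw i x : chart_img i x -> is_alternating (w i x).
Proof. by have [[h _ _] _ _] := hw; apply: h. Qed.
Let as_ i x : chart_img i x -> is_alternating (s i x).
Proof. by have [h _ _] := fs hO; apply: h. Qed.
Let dw i x I : chart_img i x -> differentiable (fun x => w i x I) x.
Proof. by move=> hx; apply: (smooth_on_diff (oV i) _ hx); exact: sw. Qed.
Let dr_ i x I : chart_img i x -> differentiable (fun x => r i x I) x.
Proof. by move=> hx; apply: (smooth_on_diff (oV i) _ hx); exact: sr. Qed.

Lemma pull_J_w i x : chart_img i x -> pull J (w i x) = w i x.
Proof. by move=> hx; apply: pull_J_inv; have [_ h _] := hw; exact: h. Qed.

(** Differentiate w /\ Re Omega = 0 in each coordinate direction: the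
    derivatives of Re Omega are again combinations of the standard forms, whose
    product with w vanishes. *)
Lemma dw_wedge_re i x : chart_img i x -> wedge (extd (w i) x) (r i x) = 0.
Proof.
move=> hx; rewrite extdE wedge_suml big1 // => c _; rewrite wedge_wedge1.
have [h [sh si _ _ eO]] := hO.2 i.
have e y (hy : chart_img i y) := (volume_parts (eO y hy)).1.
have dh : differentiable (fun y => complex.Re (h y)) x by exact: (smooth_on_diff (oV i) sh).
have di : differentiable (fun y => complex.Im (h y)) x by exact: (smooth_on_diff (oV i) si).
have z : pd c (fun y => wedge (w i y) (r i y)) x = 0.
  apply: covecP => I; rewrite /pd (@pderiv_eq_on _ _ c _ (fun=> 0) x (chart_img i)) ?pderiv_cst //.
  move=> y hy; rewrite (e y hy); have [w1 w2] := w_rho_iota hO hw hy.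
  by rewrite -scaleNr wedgeDr !wedgeZr w1 w2 !scaler0 addr0.
have z2 : wedge (w i x) (pd c (r i) x) = 0.
  have -> : pd c (r i) x = pderiv c (fun y => complex.Re (h y)) x *: rho0
      + (- pderiv c (fun y => complex.Im (h y)) x) *: iota0.
    apply: covecP => I; rewrite covecD !covecZ /pd.
    rewrite (@pderiv_eq_on _ _ c _ (fun y => rho0 I * complex.Re (h y) + (- iota0 I) * complex.Im (h y)) x (chart_img i)) //.
      by rewrite pderivD ?pderivZ //; [ring | exact: differentiableM' | exact: differentiableM'].
    by move=> y hy; rewrite (e y hy) covecD covecN !covecZ; ring.
  by have [w1 w2] := w_rho_iota hO hw hx; rewrite wedgeDr !wedgeZr w1 w2 !scaler0 addr0.
have : pd c (fun y => wedge (w i y) (r i y)) x = wedge (pd c (w i) x) (r i x) + wedge (w i x) (pd c (r i) x).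
  by apply: pd_wedge => K; [exact: dw | exact: dr_].
rewrite z z2 addr0 => <-; by rewrite -(scale0r (0 : covec R 6 5)) wedge1Zr scale0r.
Qed.

(** Since Re Omega is closed, d phi is a combination of dr /\ dw and d(1/N) /\
    Re Omega, and each of them is orthogonal to psi. *)
Lemma dphi_psi c y : chart_img c y ->
  inner (metric7 w c y) (extd (G2_phi Omega w c) y)
    (psiN (w c.2 (rsubmx y)) (s c.2 (rsubmx y)) (N c.2 (rsubmx y))) = 0.
Proof.
move=> hy; have hx := imgX hy; set x := rsubmx y in hx *; have [P [k f]] := frame_exists hO hw hx.
have sNV : smooth_on (chart_img c.2) (fun x => (N c.2 x)^-1).
  by apply: smooth_onV => // z /(N_gt0 hO hw); exact: lt0r_neq0.
have e : extd (G2_phi Omega w c) y = c0^-1 *: wedge1 (dxi 0) (pull E (extd (w c.2) x))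
   + c0 *: pull E (wedge1 (fun a => pderiv a (fun x => (N c.2 x)^-1) x) (r c.2 x)).
  rewrite (@extd_eq_on _ _ _ _ (fun z => (- c0^-1) *: wedge1 (dxi 0) (pull E (w c.2 (rsubmx z)))
     + c0 *: pull E ((N c.2 (rsubmx z))^-1 *: r c.2 (rsubmx z))) y (chart_img c)) //; last first.
    by move=> z hz; rewrite phiE // /phiN addrC.
  rewrite (@extd_ansatz _ 2 (w c.2) (fun x => (N c.2 x)^-1 *: r c.2 x) (chart_img c.2)) //; last 2 first.
  - exact: aw.
  - by move=> I; apply: smooth_onM.
  rewrite opprK extd_fmul => [||I]; [|exact: (smooth_on_diff (oV _) sNV)|exact: dr_].
  by have [-> _] := parts_closed cX hO hx; rewrite scaler0 addr0.
rewrite e innerDl !innerZl (inner_lam_at f) (inner_beta_at f) ?mulr0 ?addr0 //.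
  by apply: (alt_extd (oV c.2) hx) => // [z hz|I]; [exact: aw | exact: dw].
exact: dw_wedge_re.
Qed.

(** The trace is a quarter of the product of d phi with psi. *)
Lemma torsion_trace (T : tensor2 M) c y :
  is_torsion (metric7 w) (G2_phi Omega w) (G2_psi Omega w) T -> chart_img c y ->
  trace_g (metric7 w) T c y = 0.
Proof.
move=> hT hy; have [P [k f]] := frame_exists hO hw (imgX hy).
have key := trace_at (T := T c y) (nab := nabla (metric7 w c) (G2_phi Omega w c) y) f.
have sym z : chart_img c z -> (metric7 w c z)^T = metric7 w c z.
  by move=> hz; have [P' [k' f']] := frame_exists hO hw (imgX hz); exact: g_sym f'.
rewrite (extd_nabla (oM c) hy sym) in key; last first.
  by rewrite phiE //; exact: alt_phi f.
have : 4 * trace_g (metric7 w) T c y = 0.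
  rewrite -[RHS](dphi_psi hy); apply/esym/key => m I.
  by rewrite (hT c y hy m I) psiE.
by move/eqP; rewrite mulf_eq0 pnatr_eq0 => /eqP.
Qed.

(** When N w^2 is closed, this is the codifferential of e^(-2 f) psi. *)
Definition theta : diff_form X R 3 := fun i x => N i x *: pull J (extd (w i) x).

Let dwJ : diff_form X R 3 := fun i x => pull J (extd (w i) x).

Lemma is_form_theta : is_form theta.
Proof.
have fJ : is_form dwJ.
  split=> [i x hx|i I|i j x o I].
  - apply: alt_pull; apply: (alt_extd (oV i) hx) => // [z hz|L]; [exact: aw | exact: dw].
  - by apply: smooth_pull => L; apply: smooth_extd.
  rewrite -[RHS]/(pull _ (dwJ j _) I) /dwJ; congr (_ I).
  have oi := overlap_img o; have oj := overlap_transition sX o.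
  rewrite -pull_mul (jac_J cX o) pull_mul; congr (pull _ _).
  rewrite -(@extd_pull2 _ _ _ (transition i j) x (overlap i j) (chart_img j) (w j)) //.
  - by apply: (@extd_eq_on R (3 + 3) 2 (w i) (pullback (transition i j) (w j)) x (overlap i j)) => // [|y oy]; [exact: open_overlap|]; exact: (form_pull (fw hw) oy).
  - exact: open_overlap.
  - by move=> l k; exact: Ck_transition.
  - by move=> y; exact: overlap_transition.
  - exact: aw.
  - by move=> I'; exact: dw.
have -> : theta = fmul (fun i x => N i x) dwJ by [].
apply: is_form_fmul fJ => [i|i j x o]; [exact: sN | exact: (inv_N cX hO hw)].
Qed.

Hypothesis bal : forall i x, chart_img i x ->
  extd (fun x => N i x *: wedge (w i x) (w i x)) x = 0.

(** By exp_psiE the form is - dr /\ Im Omega - N w^2 / 2, and Im Omega is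
    closed. *)
Lemma psi_closed c y : chart_img c y ->
  extd (exp_mul (-2) (conf_factor Omega (metric7 w)) (G2_psi Omega w) c) y = 0.
Proof.
move=> hy; have hx := imgX hy.
rewrite (@extd_eq_on _ _ _ _ (fun z => (-1) *: wedge1 (dxi 0) (pull E (s c.2 (rsubmx z)))
   + (- 2^-1) *: pull E (N c.2 (rsubmx z) *: wedge (w c.2 (rsubmx z)) (w c.2 (rsubmx z)))) y (chart_img c)) //; last first.
  by move=> z hz; rewrite exp_psiE.
rewrite (@extd_ansatz _ 3 (s c.2) (fun x => N c.2 x *: wedge (w c.2 x) (w c.2 x)) (chart_img c.2)) //; last 2 first.
- exact: as_.
- by move=> I; apply: smooth_onM => //; exact: smooth_wedge.
have [_ ->] := parts_closed cX hO hx.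
by rewrite bal // !pull00 -(scale0r (0 : covec R 7 4)) wedge1Zr !scale0r !scaler0 addr0.
Qed.

(** The form N phi, in which the factor of Re Omega is constant. *)
Let Phi c (y : 'rV[R]_(1 + 6)) : covec R 7 3 :=
  (- c0^-1) *: wedge1 (dxi 0) (pull E (N c.2 (rsubmx y) *: w c.2 (rsubmx y)))
  + c0 *: pull E (r c.2 (rsubmx y)).

Let PhiE c y : chart_img c y -> Phi c y = N c.2 (rsubmx y) *: phiN (w c.2 (rsubmx y)) (r c.2 (rsubmx y)) (N c.2 (rsubmx y)).
Proof.
move=> hy; have N0 := N_gt0 hO hw (imgX hy).
rewrite /Phi /phiN scalerDr (pullZ (N _ _)^-1) (pullZ (N _ _)) wedge1Zr !scalerA addrC.
by congr (_ *: _ + _ *: _); [rewrite mulrAC divff ?mul1r ?gt_eqF | exact: mulrC].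
Qed.

Let smooth_Nw i I : smooth_on (chart_img i) (fun x => (N i x *: w i x) I).
Proof. exact: smooth_onM. Qed.

(** Since Re Omega is closed, d (N phi) is a multiple of dr /\ d (N w), and the
    balanced condition is the hypothesis of hodge_balanced_at. *)
Lemma star_dPhi c y : chart_img c y ->
  @hodge R 7 4 3 (metric7 w c y) (volcov (metric7 w c y) (ori7 (r c.2 (rsubmx y)) (s c.2 (rsubmx y))))
    (extd (Phi c) y) = pr2_form (A := circle R) theta c y.
Proof.
move=> hy; have hx := imgX hy; set x := rsubmx y in hx *; have [P [k f]] := frame_exists hO hw hx.
pose lam a := pderiv a (fun x => N c.2 x) x.
have dN : differentiable (fun x => N c.2 x) x by apply: (smooth_on_diff (oV c.2) _ hx); exact: sN.
have eN : extd (fun x => N c.2 x *: w c.2 x) x = wedge1 lam (w c.2 x) + N c.2 x *: extd (w c.2) x.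
  by rewrite extd_fmul // => I; exact: dw.
have -> : extd (Phi c) y = c0^-1 *: wedge1 (dxi 0) (pull E (wedge1 lam (w c.2 x) + N c.2 x *: extd (w c.2) x)).
  rewrite (@extd_ansatz _ 2 (fun x => N c.2 x *: w c.2 x) (r c.2) (chart_img c.2)) //; last first.
    by move=> z hz; apply: altZ; exact: aw.
  by have [-> _] := parts_closed cX hO hx; rewrite pull00 scaler0 addr0 opprK eN.
rewrite (hodge_balanced_at f).
- by rewrite pr2E /theta (pullZ (N _ _) J).
- apply: altZ; apply: (alt_extd (oV c.2) hx) => // [z hz|I]; [exact: aw | exact: dw].
have := bal hx; rewrite extd_fmul // => [|I]; last by apply: diff_wedge => K; exact: dw.
rewrite extd_wedge_sq => [|I]; last exact: dw.
move=> h; apply: etrans h; congr (_ + _); rewrite [RHS]scalerA mulrC -scalerA; congr (_ *: _).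
exact: (@wedgeZl R 6 3 2 (N c.2 x) (extd (w c.2) x) (w c.2 x)).
Qed.

(** The form e^(-2 f) psi is the star of N phi, so its codifferential is the
    star of d (N phi). *)
Lemma codifferential :
  is_codiff (metric7 w) (exp_mul (-2) (conf_factor Omega (metric7 w)) (G2_psi Omega w))
    (pr2_form (A := circle R) theta).
Proof.
split; first by apply: is_form_pr2 => //; exact: is_form_theta.
move=> c a alta sa [S [cS SV a0]].
pose o (y : 'rV[R]_7) := ori7 (r c.2 (@rsubmx R 1 1 6 y)) (s c.2 (@rsubmx R 1 1 6 y)) (fid 7).
have nS (x : 'rV[R]_7) : ~ S x -> (forall I, a x I = 0) /\ extd a x = 0.
  move=> nSx; split; first exact: a0.
  rewrite (@extd_eq_on _ _ _ a (fun=> 0) x (~` S)) ?extd_cst //; first exact: open_setC_compact.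
  by move=> y nSy; apply: covecP; exact: a0.
have i0 k (g : 'M[R]_7) (b : covec R 7 k) : inner g 0 b = 0.
  by rewrite -(scale0r (0 : covec R 7 k)) innerZl mul0r.
have frm y (hy : chart_img c y) := frame_exists hO hw (imgX hy).
have detg y : chart_img c y -> 0 < \det (metric7 w c y).
  move=> hy; have [P [k f]] := frm y hy.
  rewrite /metric7 (g_eq f) det_mulmx det_tr -expr2 exprn_even_gt0 //= -unitfE -unitmxE unitmx_inv.
  exact: Q_unit f.
have psiH y : chart_img c y -> exp_mul (-2) (conf_factor Omega (metric7 w)) (G2_psi Omega w) c y =
   @hodge R 7 3 4 (metric7 w c y) (volcov (metric7 w c y) (ori7 (r c.2 (rsubmx y)) (s c.2 (rsubmx y)))) (Phi c y).
  move=> hy; have [P [k f]] := frm y hy.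
  by rewrite expN // psiE // PhiE // hodgeZ (hodge_at f).
apply: (@integral_by_parts R (chart_img c) (oM c) a (Phi c) o S) => //.
- move=> I; apply: smooth_onD; apply: smooth_onM; try exact: smooth_on_cst.
    apply: smooth_wedge1 => L; apply: smooth_pull => K.
    apply: (@smooth_on_sub _ _ _ (@rsubmx R 1 1 (3 + 3) @^-1` chart_img c.2)); first by move=> x /prod_imgE[].
    by apply: (@smooth_rsubmx R 6 _ (fun x => (N c.2 x *: w c.2 x) K)); exact: smooth_Nw.
  apply: smooth_pull => K.
  apply: (@smooth_on_sub _ _ _ (@rsubmx R 1 1 (3 + 3) @^-1` chart_img c.2)); first by move=> x /prod_imgE[].
  by apply: (@smooth_rsubmx R 6 _ (fun x => r c.2 x K)); exact: sr.
- apply: (@smooth_on_sub _ _ _ (@rsubmx R 1 1 (3 + 3) @^-1` chart_img c.2)); first by move=> x /prod_imgE[].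
  apply: smooth_wedge1 => L; apply: smooth_pull => K.
  apply: (@smooth_rsubmx R 6 _ (fun x => iOb (r c.2 x) (s c.2 x) K)).
  apply: (smooth_on_eq (f := fun y => wedge (r c.2 y) (s c.2 y) K + (-1) * wedge (s c.2 y) (r c.2 y) K)).
    by move=> y _; rewrite /iOb mulN1r.
  apply: smooth_onD; first exact: smooth_wedge.
  by apply: smooth_onM; [exact: smooth_on_cst | exact: smooth_wedge].
- by move=> y hy; have [P [k f]] := frm y hy; exact: (ori_neq0 f).
- move=> y hy; have [P [k f]] := frm y hy; move=> t L.
  pose O := ori7 (r c.2 (@rsubmx R 1 1 6 y)) (s c.2 (@rsubmx R 1 1 6 y)).
  have key K := @raise_hodge_density R 3 4 (metric7 w c y) O (Phi c y) K (g_unit f) (g_sym f) (detg y hy).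
  have sg0 : Num.sg (O (fid 7)) != 0 by rewrite sgr_eq0 (ori_neq0 f).
  apply: (mulfI sg0); apply: etrans (esym (key _)) _; rewrite mulrCA.
  apply: etrans (congr1 (fun z => (-1) ^+ t * z) (key L)); rewrite mulrCA; congr (_ * _).
  apply: alt_pull; rewrite -psiH // expN // psiE //; apply: altZ; exact: alt_psi f.
- move=> y hy; have [P [k f]] := frm y hy; rewrite psiH //.
  exact: (@inner_hodge_density R 3 4 (metric7 w c y) _ _ _ (g_unit f) (g_sym f) (detg y hy)).
- move=> y hy; have [P [k f]] := frm y hy; rewrite -star_dPhi //.
  exact: (@inner_hodge_density R 4 3 (metric7 w c y) _ _ _ (g_unit f) (g_sym f) (detg y hy)).
- by move=> y h; rewrite (nS y h).2 i0 mul0r.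
- move=> y hS; have -> : a y = 0 by apply: covecP; exact: a0.
  by rewrite i0 mul0r.
Qed.

End Balanced.

(** * Derivatives in time and the flow *)

Section TimeDerivative.
Context {R : realType} {n : nat}.
Variables (J : set R) (V : set 'rV[R]_n) (oV : open V) (F : R -> 'rV[R]_n -> R).
Hypothesis sF : smooth_on [set v : 'rV[R]_(1 + n) | J (lsubmx v 0 0) /\ V (rsubmx v)]
  (fun v => F (lsubmx v 0 0) (rsubmx v)).
Variables (x : 'rV[R]_n) (Vx : V x) (c : 'I_n).

Lemma rcons1_l (s : R) (y : 'rV[R]_n) : lsubmx (rcons1 s y) 0 0 = s.
Proof. by rewrite row_mxKl mxE. Qed.

Lemma open_slices (U : set 'rV[R]_(1 + n)) s : open U -> U (rcons1 s x) ->
  exists (e : R), 0 < e /\ forall h y, ball s e h -> ball x e y -> U (rcons1 h y).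
Proof.
move=> oU Us; have /nbhs_ballP[e /= e0 he] : nbhs (rcons1 s x) U by apply: open_nbhs_nbhs.
by exists e; split=> // h y bh by_; apply: he; exact: ball_rcons1.
Qed.

(** Near a time in J the function extends smoothly to all times, including
    times outside J, and the spatial derivatives of the extension are those of
    F. *)
Lemma local_extension s0 : J s0 ->
  exists (e : R) (U : set 'rV[R]_(1 + n)) (G : 'rV[R]_(1 + n) -> R), [/\ 0 < e, open U,
    forall k, Ck k U G & [/\ forall h y, ball s0 e h -> ball x e y -> U (rcons1 h y) /\ V y,
     forall h y, ball s0 e h -> ball x e y -> J h -> F h y = G (rcons1 h y) &
     forall h, ball s0 e h -> J h -> pderiv c (F h) x = pderiv (rshift 1 c) G (rcons1 h x)]].
Proof.
move=> Js0; have Ax : [set v : 'rV[R]_(1 + n) | J (lsubmx v 0 0) /\ V (rsubmx v)] (rcons1 s0 x).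
  by rewrite /= rcons1_l row_mxKr.
have [U [G [oU Us CG eG]]] := sF Ax.
have [e1 [e10 h1]] := open_slices oU Us.
have /nbhs_ballP[e2 /= e20 h2] : nbhs x V by apply: open_nbhs_nbhs.
pose e := Num.min e1 e2; have e0 : 0 < e by rewrite lt_min e10.
have b1 (T : pseudoMetricType R) (a b : T) : ball a e b -> ball a e1 b by apply: le_ball; rewrite ge_min lexx.
have b2 (T : pseudoMetricType R) (a b : T) : ball a e b -> ball a e2 b.
  by apply: le_ball; rewrite ge_min lexx orbT.
have hU h y : ball s0 e h -> ball x e y -> U (rcons1 h y) /\ V y.
  by move=> bh by_; split; [apply: h1; exact: b1 | apply: h2; exact: b2].
have hG h y : ball s0 e h -> ball x e y -> J h -> F h y = G (rcons1 h y).
  move=> bh by_ Jh; have [u v] := hU h y bh by_.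
  have := eG (rcons1 h y) u; rewrite /= rcons1_l row_mxKr => -> //.
exists e, U, G; split=> //; split=> // h bh Jh.
rewrite -pderiv_slice; apply: pderiv_near; apply/nbhs_ballP; exists e => // y by_.
exact: hG.
Qed.

Lemma spatial_continuous T : `[0, T]%classic `<=` J ->
  {within `[0, T], continuous (fun s => pderiv c (F s) x)}.
Proof.
move=> TJ; apply/subspace_continuousP => s0 s0T; have Js0 := TJ _ s0T.
have [e [U [G [e0 oU CG [hU hG hp]]]]] := local_extension Js0.
have cH : {for s0, continuous (fun h => pderiv (rshift 1 c) G (rcons1 h x))}.
  have [U0 _] := hU s0 x (ballxx _ e0) (ballxx _ e0).
  have cG : {for rcons1 s0 x, continuous (pderiv (rshift 1 c) G)} by have [_ h] := CG 1%N; exact: h.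
  move=> P nP; have [[/= A1 A2] [n1 n2] h1] := near_rcons1 cG nP.
  by apply: filterS n2 => h Ah; apply: (h1 (x, h)); split=> //=; exact: nbhs_singleton.
rewrite /from_subspace => P /=; rewrite (hp s0 (ballxx _ e0) Js0) => nP.
apply: (@filterS2 _ (nbhs s0) _ _ _ _ _ (cH _ nP) (nbhsx_ballx s0 e e0)) => h Ph bh hT.
by rewrite /= (hp h bh (TJ _ hT)).
Qed.

(** At an interior time the limit within J is the derivative. *)
Lemma dquot_unique (f : R -> R) s0 L b : nbhs s0 J -> is_derive s0 1 f L ->
  (fun h => (h - s0)^-1 * (f h - f s0)) @ within J s0^' --> b -> b = L.
Proof.
move=> nJ [df <-] hb; apply/esym/cvg_lim => // P /hb [/= e1 e10 h1].
have /nbhs_ballP[e2 /= e20 h2] := nJ.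
exists (Num.min e1 e2) => /=; first by rewrite lt_min e10.
move=> r; rewrite /= sub0r normrN lt_min => /andP[r1 r2] r0.
have sb : `|s0 - (r + s0)| = `|r| by rewrite opprD addrCA subrr addr0 normrN.
have := h1 (r + s0); rewrite /= sb -subr_eq0 addrK scaler1 => /(_ r1 r0).
by apply; apply: h2; rewrite /ball /= sb.
Qed.

(** Apply the symmetry of second derivatives to a joint extension in time and
    space. *)
Lemma time_derivative s0 (b : 'rV[R]_n -> R) : nbhs s0 J ->
  (forall y, V y -> (fun h => (h - s0)^-1 * (F h y - F s0 y)) @ within J s0^' --> b y) ->
  is_derive s0 1 (fun h => pderiv c (F h) x) (pderiv c b x).
Proof.
move=> nJ hb; have Js0 := nbhs_singleton nJ.
have [e [U [G [e0 oU CG [hU hG hp]]]]] := local_extension Js0.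
pose l0 := lshift n (ord0 : 'I_1); pose d0 : 'rV[R]_(1 + n) := delta_mx 0 l0.
have lined f y : differentiable f (rcons1 s0 y) ->
    is_derive s0 1 (fun h => f (rcons1 h y)) (pderiv l0 f (rcons1 s0 y)).
  have shift h : rcons1 h y = h *: d0 + rcons1 0 y by rewrite -rcons1_add addr0.
  rewrite /pderiv (shift s0) (_ : (fun h => _) = (fun r => f (r *: d0 + rcons1 0 y))).
    by move=> df; apply: is_derive_line; exact: diff_derivable.
  by apply: funext => h; rewrite shift.
have bG y : ball x e y -> b y = pderiv l0 G (rcons1 s0 y).
  move=> by_; have [Uy Vy] := hU _ _ (ballxx s0 e0) by_.
  have dG : differentiable G (rcons1 s0 y) by have [h _] := CG 1%N; exact: h.
  apply: (dquot_unique nJ) (hb y Vy); have := lined _ _ dG.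
  apply: near_eq_is_derive; have nb := nbhsx_ballx s0 e e0.
  by apply: filterS2 nJ nb => h Jh bh; rewrite hG.
have [U0 _] := hU _ _ (ballxx s0 e0) (ballxx x e0).
have -> : pderiv c b x = pderiv l0 (pderiv (rshift 1 c) G) (rcons1 s0 x).
  rewrite (schwarz _ _ oU (CG 2%N) U0) -pderiv_slice.
  by apply: pderiv_near; apply/nbhs_ballP; exists e => // y; exact: bG.
have dH : differentiable (pderiv (rshift 1 c) G) (rcons1 s0 x).
  by have [_ h] := CG 2%N; have [h1 _] := h (rshift 1 c); exact: h1.
have := lined _ _ dH; apply: near_eq_is_derive.
by apply: filterS2 nJ (nbhsx_ballx s0 e e0) => h Jh bh; rewrite hp.
Qed.

End TimeDerivative.

(** The time derivative of d a is d b = 0 at interior times and d a is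
    continuous up to the ends of the interval, so the mean value theorem
    applies. *)
Lemma extd_conserved {R : realType} n k (J : set R) (V : set 'rV[R]_n) (a b : R -> 'rV[R]_n -> covec R n k) T x :
  open V -> V x -> 0 <= T -> `[0, T]%classic `<=` J ->
  (forall I, smooth_on [set v : 'rV[R]_(1 + n) | J (lsubmx v 0 0) /\ V (rsubmx v)]
    (fun v => a (lsubmx v 0 0) (rsubmx v) I)) ->
  (forall s, `]0, T[%classic s -> forall y, V y -> forall I,
    (fun h => (h - s)^-1 * (a h y I - a s y I)) @ within J s^' --> b s y I) ->
  (forall s, `]0, T[%classic s -> forall I, extd (b s) x I = 0) ->
  forall I, extd (a T) x I = extd (a 0) x I.
Proof.
move=> oV Vx T0 TJ sa hb db I; have [T00|Tn0] := eqVneq T 0; first by rewrite T00.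
have {T0 Tn0} T0 : 0 < T by rewrite lt_neqAle eq_sym Tn0.
have [||s sT e] := @MVT R (fun s => extd (a s) x I) (fun s => extd (b s) x I) 0 T T0.
- move=> s sT; rewrite /extd.
  have nJ : nbhs s J.
    apply: (@filterS _ (nbhs s) _ `]0, T[%classic).
      by move=> h /= hT; apply: TJ; exact: subset_itv_oo_cc.
    by apply: open_nbhs_nbhs; split=> //; exact: itv_open.
  have h j : is_derive s 1 (fun h => pderiv (I j) (fun y => a h y [ffun c => I (lift j c)]) x)
      (pderiv (I j) (fun y => b s y [ffun c => I (lift j c)]) x).
    set K := [ffun c => I (lift j c)].
    have := @time_derivative R n J V oV (fun h y => a h y K) (sa K) x Vx (I j) s (fun y => b s y K) nJ.
    by apply=> y Vy; exact: hb.
  rewrite (_ : (fun s => _) = \sum_(j < k.+1) (fun s => (-1) ^+ j *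
      pderiv (I j) (fun y => a s y [ffun c => I (lift j c)]) x)); last first.
    by apply: funext => r; rewrite fct_sumE.
  by apply: is_derive_sum => j; apply: is_deriveZ.
- rewrite (_ : (fun s => _) = \sum_(j < k.+1) (fun s => (-1) ^+ j *
      pderiv (I j) (fun y => a s y [ffun c => I (lift j c)]) x)); last first.
    by apply: funext => r; rewrite fct_sumE.
  apply: (big_ind (fun f : R -> R => {within `[0, T], continuous f})) => [|f g cf cg|j _].
  + by apply: continuous_subspaceT => r; exact: cst_continuous.
  + by move=> r; apply: continuousD; [exact: cf | exact: cg].
  + set K := [ffun c => I (lift j c)].
    have cp := @spatial_continuous R n J V oV (fun h y => a h y K) (sa K) x Vx (I j) T TJ.
    move=> r; have cc : {for r, continuous (fun=> (-1) ^+ j : R)} by exact: cst_continuous.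
    exact: (continuousM cc (cp r)).
by move: e; rewrite db // mul0r => /eqP; rewrite subr_eq0 => /eqP.
Qed.
Section LinearLimits.
Context {R : realType} {m n k : nat}.

Lemma cvg_pull T (F : set_system T) (P : 'M[R]_(m, n)) (d : T -> covec R n k) b I : Filter F ->
  (forall K, (fun h => d h K) @ F --> b K) -> (fun h => pull P (d h) I) @ F --> pull P b I.
Proof.
move=> FF h; rewrite /pull.
rewrite (_ : (fun h => _) = \sum_J (fun h => d h J * \prod_(c < k) P (I c) (J c))); last first.
  by apply: funext => t; rewrite fct_sumE.
apply: (big_ind2 (fun (f : T -> R) (l : R) => f @ F --> l)) => [|f l g l' hf hg|K _].
- exact: cvg_cst.
- exact: cvgD.
- by apply: cvgM; [exact: h | exact: cvg_cst].
Qed.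

End LinearLimits.

(** dtwist_anti with both matrices equal to 1 says that d d a is its own
    opposite. *)
Lemma extd_extd {R : realType} n k (a : 'rV[R]_n -> covec R n k) U x : open U -> U x ->
  (forall y, U y -> is_alternating (a y)) -> (forall I, smooth_on U (fun y => a y I)) ->
  extd (extd a) x = 0.
Proof.
move=> oU Ux alta sa; have e : extd (extd a) x = dtwist 1%:M (dtwist 1%:M a) x.
  by rewrite dtwist1; apply: (extd_eq_on oU Ux) => y _; rewrite dtwist1.
have := dtwist_anti 1%:M 1%:M oU Ux alta sa; rewrite -e => /eqP.
rewrite -addr_eq0 -mulr2n => /eqP e2; apply: covecP => I.
have := congr1 (fun f : covec R n k.+2 => f I) e2.
rewrite mulr2n covecD => /eqP; rewrite -mulr2n mulrn_eq0 /= => /eqP ->.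
by [].
Qed.

Section Flow.
Context {R : realType} (X : atlas R (3 + 3)).
Variables (Omega : diff_form X (complex R) 3) (J : set R) (w : R -> diff_form X R 2).
Hypotheses (cX : complex_manifold X) (hO : holomorphic_volume_form Omega).
Hypotheses (hw : forall t, J t -> hermitian_metric (w t)) (sfw : smooth_family J w).
Hypothesis flow : anomaly_flow J Omega w.
Local Notation r := (formRe Omega).
Local Notation s := (formIm Omega).
Local Notation E := (@Emx R 1 6).
Local Notation M := (S1_times X).
Local Notation Q t i x := (normN (w t i x) (r i x) (s i x) *: wedge (w t i x) (w t i x)).
Let sX : smooth_manifold X. Proof. by have [] := cX. Qed.
Let oV (i : chart X) : open (chart_img i). Proof. exact: (sm_img_open sX). Qed.
Let sw t i : J t -> forall I, smooth_on (chart_img i) (fun x => w t i x I).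
Proof. by move=> Jt; have [] := smooth_parts hO (hw Jt) i. Qed.
Let aw t i x : J t -> chart_img i x -> is_alternating (w t i x).
Proof. by move=> Jt; have [[+ _ _] _ _] := hw Jt; apply. Qed.
Arguments oV : clear implicits.
Arguments sw : clear implicits.
Arguments aw : clear implicits.

(** The time derivative in the flow is the real part of 4 i del delbar w. *)
Lemma flow_real t i x I : J t -> chart_img i x ->
  (fun h => (h - t)^-1 * (Q h i x I - Q t i x I)) @ within J t^' -->
    -2 * extd (dtwist (@Jmx R 3) (w t i)) x I.
Proof.
move=> Jt hx; have [b [hb eb]] := flow Jt.
rewrite -(ddbar I (oV i) hx (fun y hy => aw t i y Jt hy) (sw t i Jt)).
have := eb i x hx I; rewrite /complexify /fscale => /(congr1 (@complex.Re R)) /= eb'.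
have := hb i x hx I; rewrite {1}eb'.
rewrite (_ : (fun h => _) = (fun h => (h - t)^-1 * (Q h i x I - Q t i x I))) //.
by apply: funext => h; rewrite /fmul !norm_formE.
Qed.

Lemma smooth_flow i I : smooth_on
  [set v : 'rV[R]_(1 + 6) | J (lsubmx v 0 0) /\ chart_img i (rsubmx v)]
  (fun v => Q (lsubmx v 0 0) i (rsubmx v) I).
Proof.
set A := [set v : 'rV[R]_(1 + 6) | _].
have sr K : smooth_on A (fun v => r i (rsubmx v) K).
  apply: (@smooth_on_sub _ _ _ (@rsubmx R 1 1 6 @^-1` chart_img i)); first by move=> v [].
  have [[[_ hr _] _] _] := hO; exact: (smooth_rsubmx (hr i K)).
have ss K : smooth_on A (fun v => s i (rsubmx v) K).
  apply: (@smooth_on_sub _ _ _ (@rsubmx R 1 1 6 @^-1` chart_img i)); first by move=> v [].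
  have [[_ [_ hs _]] _] := hO; exact: (smooth_rsubmx (hs i K)).
have sww K : smooth_on A (fun v => w (lsubmx v 0 0) i (rsubmx v) K) by exact: sfw.
apply: smooth_onM; last by apply: smooth_wedge.
apply: smooth_norm => // v [Jv hv]; exact: (norm_ratio_gt0 hO (hw Jv) hv).
Qed.

(** The time derivative of N w^2 is exact, so d (N w^2) keeps its initial value
    0. *)
Lemma flow_balanced t : 0 <= t -> `[0, t]%classic `<=` J ->
  form_eq (extder (fmul (norm_form Omega (w 0)) (w 0 \wedge w 0))) zero_form ->
  forall i x, chart_img i x -> extd (fun x => Q t i x) x = 0.
Proof.
move=> t0 tJ d0 i x hx; apply: covecP => I.
rewrite (@extd_conserved R 6 4 J (chart_img i) (fun h y => Q h i y)
  (fun h y => -2 *: extd (dtwist (@Jmx R 3) (w h i)) y) t x (oV i) hx t0 tJ (@smooth_flow i)).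
- have e : (fun y => Q 0 i y) = fmul (norm_form Omega (w 0)) (w 0 \wedge w 0) i.
    by apply: funext => y; apply: covecP => K; rewrite /fmul norm_formE.
  by rewrite e; exact: d0.
- move=> h ht y hy K; apply: flow_real => //; apply: tJ; exact: subset_itv_oo_cc ht.
move=> h ht K; have Jh : J h by apply: tJ; exact: subset_itv_oo_cc ht.
have sd := smooth_dtwist (@Jmx R 3) (oV i) (sw h i Jh).
rewrite extdZ => [|L]; last by apply: (smooth_on_diff (oV i) _ hx); exact: smooth_extd.
rewrite (extd_extd (oV i) hx) ?scaler0 // => y hy.
apply: (alt_dtwist _ (oV i) hy) => [z hz|L]; first exact: aw.
exact: (smooth_on_diff (oV i) (sw h i Jh L) hy).
Qed.

(** In e^(-2 f) psi = - dr /\ Im Omega - N w^2 / 2 only the second term depends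
    on time. *)
Lemma flow_psi t c y I : J t -> chart_img c y ->
  (fun h => (h - t)^-1 *
    (exp_mul (-2) (conf_factor Omega (metric7 (w h))) (G2_psi Omega (w h)) c y I
     - exp_mul (-2) (conf_factor Omega (metric7 (w t))) (G2_psi Omega (w t)) c y I)) @ within J t^' -->
  pull E (extd (dtwist (@Jmx R 3) (w t c.2)) (rsubmx y)) I.
Proof.
move=> Jt hy; have hx := imgX hy; set x := rsubmx y in hx *.
set L := extd _ x.
pose d h := (h - t)^-1 *: (Q h c.2 x - Q t c.2 x).
have cd K : (fun h => d h K) @ within J t^' --> (-2 *: L) K by exact: flow_real.
have cp : (fun h => - 2^-1 * pull E (d h) I) @ within J t^' --> - 2^-1 * pull E (-2 *: L) I.
  by apply: cvgM; [exact: cvg_cst | exact: cvg_pull].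
move: cp; rewrite (_ : - 2^-1 * pull E (-2 *: L) I = pull E L I); last first.
  by rewrite (pullZ (-2)) covecZ mulrA mulrNN mulVf ?mul1r // pnatr_eq0.
apply: cvg_trans; apply: near_eq_cvg; apply: filterS (withinT _ _) => h Jh.
rewrite /= (exp_psiE hO (hw Jh) hy) (exp_psiE hO (hw Jt) hy) -/x.
rewrite /d (pullZ (h - t)^-1) -(scaleN1r (Q t c.2 x)) pullD (pullZ (-1)).
rewrite !(covecZ, covecD); move: (wedge1 _ _ I) (pull E (Q h _ _) I) (pull E (Q t _ _) I) => a1 a2 a3.
ring.
Qed.

(** Since w is J-invariant, e^(2 f) theta = J dw equals i (del - delbar) w. *)
Lemma extd_dual t c y : J t -> chart_img c y ->
  extd (exp_mul 2 (conf_factor Omega (metric7 (w t))) (pr2_form (A := circle R) (theta Omega (w t))) c) y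
  = pull E (extd (dtwist (@Jmx R 3) (w t c.2)) (rsubmx y)).
Proof.
move=> Jt hy; have oM : open (chart_img c) by exact: open_prod_img.
rewrite (@extd_eq_on _ _ _ _ (fun z => pull E (dtwist (@Jmx R 3) (w t c.2) (rsubmx z))) y (chart_img c)) //.
  rewrite extd_pr2 // => K.
  have sd := smooth_dtwist (@Jmx R 3) (oV c.2) (sw t c.2 Jt) K.
  exact: (smooth_on_diff (oV c.2) sd (imgX hy)).
move=> z hz; have hx := imgX hz.
rewrite (expNV hO (hw Jt) hz) pr2E /theta (pullZ (normN _ _ _)) scalerA mulVf ?scale1r; last first.
  by rewrite gt_eqF // (N_gt0 hO (hw Jt)).
congr pull; apply: (dtwist_pull (oV c.2)) => //; first exact: sw.
by move=> y' hy'; apply: (pull_J_w (hw Jt)).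
Qed.

End Flow.

Theorem mainTheorem5 (R : realType) (X : atlas R (3 + 3))
  (Omega : diff_form X R[i] 3) (tau : \bar R) (w : R -> diff_form X R 2)
  (C : R) :
  let J := [set t : R | 0 <= t /\ (t%:E < tau)%E] in
  complex_manifold X ->
  compact [set: carrier X] ->
  holomorphic_volume_form Omega ->
  (0 < tau)%E ->
  (forall t, J t -> hermitian_metric (w t)) ->
  smooth_family J w ->
  form_eq (extder (fmul (norm_form Omega (w 0)) (w 0 \wedge w 0))) zero_form ->
  anomaly_flow J Omega w ->
  let psi := fun t => G2_psi Omega (w t) in
  let phi := fun t => G2_phi Omega (w t) in
  exists (g : R -> tensor2 (S1_times X))
      (dstar : R -> diff_form (S1_times X) R 3),
    let f := fun t => conf_factor Omega (g t) in
    forall t, J t ->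
      [/\ G2_structure (orientation Omega) (phi t) (g t) (psi t),
          is_codiff (g t) (exp_mul (-2) (f t) (psi t)) (dstar t),
          forall T : tensor2 (S1_times X),
            is_torsion (g t) (phi t) (psi t) T ->
            has_dt J (fun s => exp_mul (-2) (f s) (psi s)) t
              (fadd (extder (exp_mul 2 (f t) (dstar t)))
                    (fscale (C - 2) (extder (fmul (trace_g (g t) T) (phi t)))))
        & form_eq (extder (exp_mul (-2) (f t) (psi t))) zero_form].
Proof.
move=> J cX _ hO tau0 hw sfw d0 flow psi phi.
have J0 t : J t -> 0 <= t /\ `[0, t]%classic `<=` J.
  move=> [t0 tt]; split=> // h; rewrite /= in_itv /= => /andP[h0 ht]; split=> //.
  by apply: le_lt_trans tt; rewrite lee_fin.
exists (fun t => metric7 (w t)), (fun t => pr2_form (A := circle R) (theta Omega (w t))) => f t Jt.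
have [t0 tJ] := J0 t Jt; have bal := flow_balanced cX hO hw sfw flow t0 tJ d0.
split.
- exact: (G2_structureP cX hO (hw t Jt)).
- exact: (codifferential cX hO (hw t Jt) bal).
- move=> T hT c y hy I.
  have oM : open (chart_img c) by apply: open_prod_img; have [] := cX.
  (* The right-hand side of the evolution equation is d (J dw); its last term
     vanishes with the trace. *)
  have -> : fadd (extder (exp_mul 2 (f t) (pr2_form (A := circle R) (theta Omega (w t)))))
      (fscale (C - 2) (extder (fmul (trace_g (metric7 (w t)) T) (phi t)))) c y I
    = pull (@Emx R 1 6) (extd (dtwist (@Jmx R 3) (w t c.2)) (rsubmx y)) I.
    rewrite /fadd /fscale /extder (extd_dual cX hO hw Jt hy).
    rewrite (@extd_eq_on _ _ _ (fmul (trace_g (metric7 (w t)) T) (phi t) c) (fun _ => 0) y (chart_img c)) //.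
      by rewrite extd_cst mulr0 addr0.
    move=> z hz; apply: covecP => K.
    by rewrite /fmul (torsion_trace cX hO (hw t Jt) hT hz) mul0r.
  exact: (flow_psi cX hO hw flow).
- by move=> c y hy I; rewrite /extder (psi_closed cX hO (hw t Jt) bal hy).
Qed.
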